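(* Let $\psi\in\mathcal N$ and $\phi(u)=\psi(u)/u$. Then for any $t\ge0$ the intertwining identity $$P_t\,\mathcal I_\phi f=\mathcal I_\phi\,Q_tf$$ holds for all $f\in L^2(\varepsilon)$. Moreover: (1) $\mathcal I_\phi$ is a bounded operator from $L^2(\varepsilon)$ to $L^2(\nu)$ and a bounded operator from $C_0([0,\infty))$ to itself. (2) The range of $\mathcal I_\phi:L^2(\varepsilon)\to L^2(\nu)$ is dense in $L^2(\nu)$. However, there exists $C>0$ such that $\|\mathcal I_\phi f\|_\nu\ge C\|f\|_\varepsilon$ for all $f\in L^2(\varepsilon)$ if and only if $\psi(u)=\sigma^2u^2$ with $\sigma^2>0$. (3) $\mathcal I_\phi$ is a Markov operator determined by its integer moments, and, for any $z\in\mathbb C$ with $\Re z>-1$ and $x>0$, writing $p_z(x)=x^z$, $$\mathcal I_\phi p_z(x)=\frac{\Gamma(z+1)}{W_\phi(z+1)}\,p_z(x).$$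
   Context: $\mathcal N$ is the set of functions $\psi(z)=\sigma^2z^2+mz+\int_0^\infty(e^{-zy}-1+zy)\Pi(dy)$ (for $z\in i\mathbb R$, extended to $\Re z\ge0$), with $\sigma\ge0$, $m\ge0$ and $\Pi$ a $\sigma$-finite positive measure on $(0,\infty)$ with $\int_0^\infty(y^2\wedge y)\Pi(dy)<\infty$, $(\sigma,\Pi)\ne(0,0)$. $\overline\Pi(y)=\int_y^\infty\Pi(dr)$; $\phi(z)=\psi(z)/z=m+\sigma^2z+\int_0^\infty(1-e^{-zy})\overline\Pi(y)dy$ is a Bernstein function; $\mathfrak r=\phi(\infty)$. For $\Re z>0$, $W_\phi(z)=\frac{e^{-\gamma_\phi z}}{\phi(z)}\prod_{k=1}^\infty\frac{\phi(k)}{\phi(k+z)}e^{\frac{\phi'(k)}{\phi(k)}z}$, $\gamma_\phi=\lim_{n\to\infty}\big(\sum_{k=1}^n\frac{\phi'(k)}{\phi(k)}-\ln\phi(n)\big)$; it satisfies $W_\phi(1)=1$, $W_\phi(z+1)=\phi(z)W_\phi(z)$, so $W_\phi(n+1)=\prod_{k=1}^n\phi(k)$. $P=(P_t)_{t\ge0}$ is the generalized Laguerre semigroup associated with $\psi$: the Feller semigroup on $C_0([0,\infty))$ characterized by its generator, given at least for $f$ with $x\mapsto f(e^x)$ in $C^2([-\infty,\infty])$ ($C^2$ with finite limits at $\pm\infty$ of the function and its first two derivatives) by $\mathbf Gf(x)=\sigma^2xf''(x)+(m+\sigma^2-x)f'(x)+\int_0^\infty(f(e^{-y}x)-f(x)+yxf'(x))\frac{\Pi(dy)}x$.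 It has a unique invariant measure, a probability measure with density $\nu$ on $(0,\mathfrak r)$, determined by its moments $\int x^n\nu(x)dx=W_\phi(n+1)$. $P$ also denotes its contraction extension to $L^2(\nu)=L^2((0,\mathfrak r),\nu(x)dx)$. $Q=(Q_t)_{t\ge0}$ is the classical Laguerre semigroup of order $0$ (the case $\psi(u)=u^2$), with generator $xf''(x)+(1-x)f'(x)$, self-adjoint in $L^2(\varepsilon)$, $\varepsilon(x)=e^{-x}$, $x>0$. $\mathcal I_\phi f(x)=\mathbb E[f(xI_\phi)]$ with $I_\phi=\int_0^\infty e^{-\eta_t}dt$, where $\eta$ is a (possibly killed, at rate $\phi(0)$, with $\eta=\infty$ after killing) subordinator with $\ln\mathbb E[e^{-u\eta_1}]=-\phi(u)$. ''Determined by its integer moments'' means that the law of $I_\phi$ is moment-determinate. $C_0([0,\infty))$ is the space of continuous functions vanishing at infinity with uniform norm. *)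

(* Defs.v *)
From HB Require Import structures.
From mathcomp Require Import all_boot all_order all_algebra.
From mathcomp Require Import all_classical all_reals all_analysis.
From mathcomp Require Import measurable_realfun.
From mathcomp Require Export complex.
Set Implicit Arguments.
Unset Strict Implicit.
Unset Printing Implicit Defensive.
Import Order.TTheory GRing.Theory Num.Theory.
Import numFieldNormedType.Exports.
Local Open Scope classical_set_scope.
Local Open Scope ring_scope.
Local Open Scope complex_scope.

Section complex_analysis.
Context {R : realType}.

Definition expC (z : R[i]) : R[i] :=
  (expR (complex.Re z) * cos (complex.Im z)) +i*
  (expR (complex.Re z) * sin (complex.Im z)).

(* Only meaningful for 0 < x. *)
Definition cpow (x : R) (z : R[i]) : R[i] := expC (z * (ln x)%:C).

Definition integrableC d (T : measurableType d) (mu : {measure set T -> \bar R})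
    (D : set T) (f : T -> R[i]) : Prop :=
  mu.-integrable D (fun x => (complex.Re (f x))%:E) /\
  mu.-integrable D (fun x => (complex.Im (f x))%:E).

Definition integralC d (T : measurableType d) (mu : {measure set T -> \bar R})
    (D : set T) (f : T -> R[i]) : R[i] :=
  (\int[mu]_(x in D) complex.Re (f x)) +i* (\int[mu]_(x in D) complex.Im (f x)).

Definition limC (u : nat -> R[i]) : R[i] :=
  lim (complex.Re (u n) @[n --> \oo]) +i* lim (complex.Im (u n) @[n --> \oo]).

(* Euler's integral, for 0 < Re z. *)
Definition GammaC (z : R[i]) : R[i] :=
  integralC lebesgue_measure `]0, +oo[
    (fun x => cpow x (z - 1) * (expR (- x))%:C).

End complex_analysis.

(* The characteristics (sigma, m, Pi) of psi; only the restriction of Pi to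
   ]0, +oo[ is ever used. *)
Record triplet (R : realType) := Triplet {
  sigma : R;
  drift : R;
  levy : {measure set (measurableTypeR R) -> \bar R}
}.

Section exponents.
Context {R : realType}.
Implicit Type c : triplet R.

Definition in_N c : Prop :=
  [/\ 0 <= sigma c, 0 <= drift c,
      sigma_finite (`]0%R, +oo[%classic : set (measurableTypeR R)) (levy c),
      (\int[levy c]_(y in `]0%R, +oo[) (Num.min (y ^+ 2) y)%:E < +oo)%E
    & ~ (sigma c = 0 /\ levy c `]0%R, +oo[%classic = 0%E)].

Definition psi c (z : R[i]) : R[i] :=
  (sigma c ^+ 2)%:C * z ^+ 2 + (drift c)%:C * z +
  integralC (levy c) `]0, +oo[
    (fun y => expC (- (z * y%:C)) - 1 + z * y%:C).

(* psi(z)/z extended by continuity at 0, where its value is psi'(0) = m. *)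
Definition phi c (z : R[i]) : R[i] :=
  if z == 0 then (drift c)%:C else psi c z / z.

Definition phiR c (u : R) : R := complex.Re (phi c u%:C).

Definition phi_inf c : \bar R := lim ((phiR c u)%:E @[u --> +oo]).

Definition dlog_phi c (k : nat) : R := derive1 (phiR c) k%:R / phiR c k%:R.

Definition gamma_phi c : R :=
  lim ((\sum_(1 <= k < n.+1) dlog_phi c k - ln (phiR c n%:R)) @[n --> \oo]).

Definition W_phi c (z : R[i]) : R[i] :=
  expC (- ((gamma_phi c)%:C * z)) / phi c z *
  limC (fun n => \prod_(1 <= k < n.+1)
    (phi c k%:R / phi c (k%:R + z) * expC ((dlog_phi c k)%:C * z))).

End exponents.

(* Functions on [0, +oo[ are represented by functions on R whose values on the
   negative half-line are irrelevant. *)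
Section semigroups.
Context {R : realType}.
Implicit Types (f g : R -> R) (c : triplet R) (P : R -> (R -> R) -> (R -> R)).

Definition C0 f : Prop :=
  {within `[0, +oo[, continuous f} /\ f x @[x --> +oo] --> (0 : R).

Definition C0norm f : R := sup [set `|f x| | x in `[0, +oo[].

Definition C0_bounded_operator (T : (R -> R) -> (R -> R)) : Prop :=
  [/\ forall f, C0 f -> C0 (T f),
      forall (a : R) f g, C0 f -> C0 g -> forall x, 0 <= x ->
        T (fun y => a * f y + g y) x = a * T f x + T g x
    & exists C : R, forall f, C0 f -> C0norm (T f) <= C * C0norm f].

Definition feller_semigroup P : Prop :=
  [/\ forall t, 0 <= t -> C0_bounded_operator (P t),
      forall t f, 0 <= t -> C0 f -> (forall x, 0 <= x -> 0 <= f x <= 1) ->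
        forall x, 0 <= x -> 0 <= P t f x <= 1,
      forall f x, C0 f -> 0 <= x -> P 0 f x = f x,
      forall s t f x, 0 <= s -> 0 <= t -> C0 f -> 0 <= x ->
        P (s + t) f x = P s (P t f) x
    & forall f, C0 f -> C0norm (P t f - f) @[t --> 0^'+] --> (0 : R)].

(* f is in the domain of the generator of P, which maps f to g. *)
Definition generator_maps P f g : Prop :=
  [/\ C0 f, C0 g
    & C0norm (fun x => t^-1 * (P t f x - f x) - g x) @[t --> 0^'+] --> (0 : R)].

(* x |-> f(e^x) is in C^2([-oo, +oo]) *)
Definition C2_log f : Prop :=
  [/\ forall k u, (k < 2)%N -> derivable (derive1n k (f \o expR)) u 1,
      continuous (derive1n 2 (f \o expR))
    & forall k, (k <= 2)%N ->
        cvg (derive1n k (f \o expR) u @[u --> +oo]) /\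
        cvg (derive1n k (f \o expR) u @[u --> -oo])].

Definition laguerre_generator c f (x : R) : R :=
  sigma c ^+ 2 * x * derive1n 2 f x +
  (drift c + sigma c ^+ 2 - x) * derive1 f x +
  \int[levy c]_(y in `]0, +oo[)
    ((f (expR (- y) * x) - f x + y * x * derive1 f x) / x).

(* C^2([-oo, +oo]) only controls f and G f up to a factor x near 0, so G f need
   not be continuous at 0: f is in the domain as soon as both f and G f (extended
   to [0, +oo[) belong to C0. *)
Definition generalized_laguerre c P : Prop :=
  feller_semigroup P /\
  forall f g, C0 f -> C2_log f -> C0 g ->
    (forall x, 0 < x -> g x = laguerre_generator c f x) ->
    generator_maps P f g.

Definition classical_triplet : triplet R := Triplet 1 0 mzero.

Definition L2 (mu : {measure set (measurableTypeR R) -> \bar R}) : {pred R -> R} := Lfun mu 2%:E.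

Definition L2norm (mu : {measure set (measurableTypeR R) -> \bar R}) f : \bar R :=
  'N[mu]_2%:E[EFin \o f]%E.

(* T acts on functions; it induces a bounded operator between the spaces of
   classes modulo almost everywhere equality. *)
Definition L2_operator (mu nu : {measure set (measurableTypeR R) -> \bar R})
    (T : (R -> R) -> (R -> R)) : Prop :=
  [/\ forall f, f \in L2 mu -> T f \in L2 nu,
      forall f g, f \in L2 mu -> g \in L2 mu ->
        f = g %[ae mu] -> T f = T g %[ae nu]
    & forall (a : R) f g, f \in L2 mu -> g \in L2 mu ->
        T (fun y => a * f y + g y) = (fun y => a * T f y + T g y) %[ae nu]].

Definition L2_bounded_operator (mu nu : {measure set (measurableTypeR R) -> \bar R})
    (T : (R -> R) -> (R -> R)) : Prop :=
  L2_operator mu nu T /\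
  exists C : R, forall f, f \in L2 mu ->
    (L2norm nu (T f) <= C%:E * L2norm mu f)%E.

Definition L2_contraction_extension (mu : {measure set (measurableTypeR R) -> \bar R})
    (P P2 : R -> (R -> R) -> (R -> R)) : Prop :=
  forall t, 0 <= t ->
  [/\ L2_operator mu mu (P2 t),
      forall f, f \in L2 mu -> (L2norm mu (P2 t f) <= L2norm mu f)%E
    & forall f, C0 f -> measurable_fun setT f -> P2 t f = P t f %[ae mu]].

(* nu has density w on D, and gives no mass to the complement of D. *)
Definition has_density (nu : {measure set (measurableTypeR R) -> \bar R}) (D : set R) (w : R -> R) :
    Prop :=
  [/\ measurable_fun D w, forall x, D x -> 0 <= w x
    & forall A, measurable A ->
        nu A = (\int[lebesgue_measure]_(x in A `&` D) (w x)%:E)%E].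

Definition invariant_measure (nu : {measure set (measurableTypeR R) -> \bar R}) P : Prop :=
  forall t f, 0 <= t -> C0 f ->
    \int[nu]_(x in `[0, +oo[) P t f x = \int[nu]_(x in `[0, +oo[) f x.

Definition invariant_law c P (nu : probability (measurableTypeR R) R) : Prop :=
  [/\ exists w, has_density nu [set x | 0 < x /\ (x%:E < phi_inf c)%E] w,
      invariant_measure nu P
    & forall n : nat,
        nu.-integrable setT (fun x => (x ^+ n)%:E) /\
        (\int[nu]_x x ^+ n)%:C = W_phi c n.+1%:R].

End semigroups.

(* e^{-x} dx on ]0, +oo[ *)
Definition epsilon_law (R : realType) : probability (measurableTypeR R) R :=
  exponential_distribution_exponential_prob__canonical__probability_measure_Probability
    (@ltr01 R).

Section exponential_functional.
Context {R : realType} d (Omega : measurableType d) (Pr : probability Omega R).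
Implicit Types (xi : R -> Omega -> R) (zeta : Omega -> \bar R).

Definition subordinator xi : Prop :=
  [/\ forall t, 0 <= t -> measurable_fun setT (xi t),
      forall w, [/\ xi 0 w = 0,
        forall s t, 0 <= s -> s <= t -> xi s w <= xi t w
        & forall t, 0 <= t -> xi s w @[s --> t^'+] --> xi t w],
      forall s t B, 0 <= s -> 0 <= t -> measurable B ->
        Pr [set w | B (xi (s + t) w - xi s w)] = Pr [set w | B (xi t w)]
    & forall (n : nat) (t : nat -> R) (B : nat -> set R),
        0 <= t 0%N -> (forall i, t i <= t i.+1) ->
        (forall i, measurable (B i)) ->
        Pr (\bigcap_(i in `I_n) [set w | B i (xi (t i.+1) w - xi (t i) w)]) =
        (\prod_(i < n) Pr [set w | B i (xi (t i.+1) w - xi (t i) w)%R])%E].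

(* Exponential of rate q, and +oo almost surely if q = 0. *)
Definition exponential_time (q : R) zeta : Prop :=
  measurable_fun [set: Omega] zeta /\
  forall t, 0 <= t -> Pr [set w | (t%:E < zeta w)%E] = (expR (- (q * t)))%:E.

Definition independent_of_process xi zeta : Prop :=
  forall (A : set (\bar R)) (n : nat) (t : nat -> R) (B : nat -> set R),
    measurable A -> (forall i, 0 <= t i) -> (forall i, measurable (B i)) ->
    Pr ([set w | A (zeta w)] `&` \bigcap_(i in `I_n) [set w | B i (xi (t i) w)]) =
    (Pr [set w | A (zeta w)] *
     Pr (\bigcap_(i in `I_n) [set w | B i (xi (t i) w)]))%E.

Definition killed xi zeta (t : R) (w : Omega) : \bar R :=
  if (t%:E < zeta w)%E then (xi t w)%:E else +oo%E.

(* eta is a subordinator killed at rate q = f 0, with Laplace exponent f. *)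
Definition killed_subordinator (f : R -> R) (eta : R -> Omega -> \bar R) : Prop :=
  (exists xi zeta,
    [/\ subordinator xi, exponential_time (f 0) zeta,
        independent_of_process xi zeta
      & forall t w, 0 <= t -> eta t w = killed xi zeta t w]) /\
  forall u : R, 0 < u ->
    ln (fine (\int[Pr]_w expeR (- (u%:E * eta 1%R w)))%E) = - f u.

Definition exp_functional (eta : R -> Omega -> \bar R) (w : Omega) : \bar R :=
  (\int[lebesgue_measure]_(t in `[0%R, +oo[) expeR (- eta t w))%E.

(* f |-> (x |-> E[f(x X)]) for a random variable X with values in [0, +oo],
   almost surely finite. *)
Definition mult_op (X : Omega -> \bar R) (f : R -> R) (x : R) : R :=
  \int[Pr]_w f (x * fine (X w)).

Definition mult_opC (X : Omega -> \bar R) (f : R -> R[i]) (x : R) : R[i] :=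
  integralC Pr setT (fun w => f (x * fine (X w))).

(* There is no other law on the real line with the same finite moments. *)
Definition moment_determinate (X : Omega -> \bar R) : Prop :=
  [/\ measurable_fun [set: Omega] X, forall w, (0 <= X w)%E,
      forall n : nat, (\int[Pr]_w (X w ^+ n) < +oo)%E
    & forall mu : probability (measurableTypeR R) R,
        (forall n : nat,
          mu.-integrable setT (fun x => (x ^+ n)%:E) /\
          (\int[mu]_x (x ^+ n)%:E = \int[Pr]_w (X w ^+ n))%E) ->
        forall A : set R, measurable A -> mu A = Pr [set w | A (fine (X w))]].

End exponential_functional.

Section markov.
Context {R : realType}.

Definition bounded_borel (f : R -> R) : Prop :=
  measurable_fun setT f /\ exists M : R, forall x, `|f x| <= M.

(* On bounded Borel functions, evaluated at points of [0, +oo[. *)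
Definition markov_operator (T : (R -> R) -> (R -> R)) : Prop :=
  [/\ forall f, bounded_borel f -> bounded_borel (T f),
      forall (a : R) f g, bounded_borel f -> bounded_borel g ->
        forall x, 0 <= x -> T (fun y => a * f y + g y) x = a * T f x + T g x,
      forall f, bounded_borel f -> (forall x, 0 <= x -> 0 <= f x) ->
        forall x, 0 <= x -> 0 <= T f x
    & forall x, 0 <= x -> T (fun=> 1) x = 1].

End markov.

(* Main.v *)
(* Let mu be the law of X = I_phi. Expanding the powers of X over ordered times gives
   E X^n = n! / (phi(1) ... phi(n)), and these moments determine mu. The moments of nu are
   phi(1) ... phi(n), so the product of independent variables with laws nu and mu has the moments n! of the
   exponential law: the integral of f against eps is that of I f against nu. Jensen's inequality then makes I
   a contraction from L^2(eps) to L^2(nu).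

   The recurrence of the integer moments extends to an identity E g(X) = E (A g)(X), valid for powers with
   exponents of real part > -1: it gives the functional equation of the Mellin transform M of mu, and
   M(n + w) ~ M(n) (n / phi(n))^w turns it into the Weierstrass product of Gamma / W_phi.

   The same identity shows that the generator maps x |-> E e^(-l x X) = I(e^(-l .))(x) to an explicit
   combination of such functions, so that P moves l exactly as Q moves the parameter of e^(-l x). Intertwining
   on exponentials extends to L^2(eps) because they, or the monomials, span a dense subspace. The range
   contains the monomials, hence is dense in L^2(nu); testing a lower bound on x^n forces psi(u) = sigma^2 u^2. *)
Require Import Defs.
From HB Require Import structures.
From mathcomp Require Import all_boot all_order all_algebra.
From mathcomp Require Import all_classical all_reals all_analysis.
From mathcomp Require Import measurable_realfun.
From mathcomp Require Import ring lra.
Set Implicit Arguments.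
Unset Strict Implicit.
Unset Printing Implicit Defensive.
Import Order.TTheory GRing.Theory Num.Theory.
Import numFieldNormedType.Exports.
Local Open Scope classical_set_scope.
Local Open Scope ring_scope.

(** Two special cases serve as tools, which is why results are stated for [admissible] triplets
    rather than for [in_N]. For phi = 1 (a pure drift) the moments of X are n!, so X is exponential:
    Gamma becomes a Mellin transform of the same theory, with its product formula. For phi(u) = u
    the law mu is the unit mass at 1, so the evolution theorem for P also covers Q.

    Since phi is nondecreasing, E X^n <= n! / phi(1)^n; since phi(u) / u is nonincreasing, the
    moments of nu are at most n! phi(1)^n. Both laws thus have exponential moments, and identities
    checked on polynomials pass to bounded functions through dominated limits. Powers with exponent
    in ]-1, 0[ are out of reach of polynomials; they are integrable because the truncated identity
    bounds them by its other side, which only involves x^(p + 1).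

    The identity rests on phi(z) / z = sigma^2 + int_0^oo kap(y) e^(-zy) dy, where kap is m plus the
    twice integrated tail of Pi. On exponentials the semigroup follows an explicit curve, so that no
    core of the generator is needed. *)

Section exponential_series.
Context {R : realType}.
Implicit Types (x y : R) (n : nat).

Lemma series_exp_coeff_le x n : 0 <= x -> series (exp_coeff x) n <= expR x.
Proof.
move=> x0; apply: nondecreasing_cvgn_le; last exact: is_cvg_series_exp_coeff.
by apply: nondecreasing_series => i _ _; exact: exp_coeff_ge0.
Qed.

Lemma expr_le_expR x n : 0 <= x -> x ^+ n <= n`!%:R * expR x.
Proof.
move=> x0; rewrite mulrC -ler_pdivrMr ?ltr0n ?fact_gt0//.
case: n => [|n]; first by rewrite expr0 fact0 divr1 -expR0 ler_expR.
by apply: le_trans (expR_ge1Dxn n x0); rewrite lerDr.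
Qed.

(** Used throughout to absorb a polynomial factor into part of an exponential weight. *)
Lemma expr_le_expRM (a x : R) n : 0 < a -> 0 <= x ->
  x ^+ n <= n`!%:R / a ^+ n * expR (a * x).
Proof.
move=> a0 x0.
have := expr_le_expR n (mulr_ge0 (ltW a0) x0).
rewrite exprMn => h; rewrite mulrAC ler_pdivlMr ?exprn_gt0// mulrC.
exact: h.
Qed.

Lemma cos_coeff_le x n : `|cos_coeff x n| <= exp_coeff `|x| n.
Proof.
rewrite /cos_coeff /exp_coeff /= !normrM normfV !normrX normrN1 expr1n mulr1 !normr_nat.
rewrite ler_wpM2r ?invr_ge0 ?ler0n//.
rewrite -[leRHS]mul1r ler_wpM2r ?exprn_ge0//.
by case: odd.
Qed.

Lemma sin_coeff_le x n : `|sin_coeff x n| <= exp_coeff `|x| n.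
Proof.
rewrite /sin_coeff /exp_coeff /= !normrM normfV !normrX normrN1 expr1n mulr1 !normr_nat.
rewrite ler_wpM2r ?invr_ge0 ?ler0n//.
rewrite -[leRHS]mul1r ler_wpM2r ?exprn_ge0//.
by case: odd.
Qed.

Lemma series_cos_coeff_le x n : `|series (cos_coeff x) n| <= expR `|x|.
Proof.
apply: le_trans (series_exp_coeff_le n (normr_ge0 x)).
apply: (le_trans (ler_norm_sum _ _ _)).
by apply: ler_sum => i _; exact: cos_coeff_le.
Qed.

Lemma series_sin_coeff_le x n : `|series (sin_coeff x) n| <= expR `|x|.
Proof.
apply: le_trans (series_exp_coeff_le n (normr_ge0 x)).
apply: (le_trans (ler_norm_sum _ _ _)).
by apply: ler_sum => i _; exact: sin_coeff_le.
Qed.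

Lemma cvg_series_cos_coeff x : series (cos_coeff x) n @[n --> \oo] --> cos x.
Proof. by rewrite unlock; exact: is_cvg_series_cos_coeff. Qed.

Lemma cvg_series_sin_coeff x : series (sin_coeff x) n @[n --> \oo] --> sin x.
Proof. by rewrite unlock; exact: is_cvg_series_sin_coeff. Qed.

End exponential_series.

(** * Polynomial approximation under an exponential weight *)

Section step_sequence.
Context {R : realType}.
Implicit Types (y z u : R).

Lemma squeeze_cvgn (f g h : nat -> R) (l : R) : (forall n, f n <= g n <= h n) ->
  f n @[n --> \oo] --> l -> h n @[n --> \oo] --> l -> g n @[n --> \oo] --> l.
Proof. by move=> fgh; apply: squeeze_cvgr; exact: nearW. Qed.

Lemma bernoulli_ineq u m : 0 <= u <= 1 -> 1 - m%:R * u <= (1 - u) ^+ m.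
Proof.
move=> /andP[u0 u1]; elim: m => [|m ih]; first by rewrite mul0r subr0 expr0.
rewrite exprS -natr1; apply: le_trans (ler_wpM2l _ ih); last by rewrite subr_ge0.
have : 0 <= m%:R * u * u :> R by rewrite !mulr_ge0.
by nra.
Qed.

(** With y the square root of z, n y^n stays below 1 / (1 - y), and the other factor y^n tends to
    0. *)
Lemma cvg_natr_expr z : 0 <= z < 1 -> n%:R * z ^+ n @[n --> \oo] --> (0 : R).
Proof.
move=> /andP[z0 z1].
pose y := Num.sqrt z.
have y0 : 0 <= y by exact: sqrtr_ge0.
have zy : z = y * y by rewrite -expr2 sqr_sqrtr.
have y1 : y < 1 by rewrite -sqrtr1 ltr_sqrt.
have le n : n%:R * y ^+ n <= (1 - y)^-1.
  rewrite -div1r ler_pdivlMr ?subr_gt0//.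
  have [->|yn0] := eqVneq y 0.
    by case: n => [|n]; rewrite ?mul0r ?ler01// expr0n/= mulr0 mul0r ler01.
  have yp : 0 < y by rewrite lt_def yn0.
  elim: n => [|n ih]; first by rewrite mul0r mul0r ler01.
  have h := bernoulli_ineq n.+1 (_ : 0 <= 1 - y <= 1).
  have : 0 <= 1 - y <= 1 by apply/andP; split; lra.
  move=> /h; rewrite subKr => {}h.
  (* Each term of 1 + y + ... + y^n is at least y^(n+1), and the sum times 1 - y is 1 - y^(n+1). *)
  suff : n.+1%:R * y ^+ n.+1 * (1 - y) <= 1 - y ^+ n.+1.
    by have := exprn_ge0 n.+1 y0; lra.
  clear h; elim: n {ih} => [|n ih]; first by rewrite mul1r !expr1; nra.
  rewrite -natr1 [y ^+ n.+2]exprS.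
  have h0 := exprn_ge0 n.+1 y0.
  have h1 : y ^+ n.+1 <= 1 by exact: exprn_ile1 (ltW y1).
  have h2 : y * (n.+1%:R * y ^+ n.+1 * (1 - y)) <= y * (1 - y ^+ n.+1) by exact: ler_wpM2l.
  have h3 : 0 <= (1 - y * y ^+ n.+1) * (1 - y).
    by rewrite mulr_ge0 ?subr_ge0 ?(ltW y1)// mulr_ile1 ?(ltW y1).
  move: h2 h3; move: (y ^+ n.+1) (n.+1%:R : R) => Y N h2 h3; nra.
have cy : (1 - y)^-1 * y ^+ n @[n --> \oo] --> (0 : R).
  by rewrite -[X in _ --> X](mulr0 (1 - y)^-1); apply: cvgM; [exact: cvg_cst|apply: cvg_expr; rewrite ger0_norm].
apply: (@squeeze_cvgn (cst 0) _ _ _ _ (cvg_cst (0 : R)) cy) => n /=.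
rewrite mulr_ge0 ?exprn_ge0//= zy exprMn mulrA.
by rewrite ler_wpM2r ?exprn_ge0.
Qed.

(** For y < 1/2, Bernoulli's inequality bounds the power below by 1 - n (2y)^n. For y >= 1/2, the
    bound 1 - u <= e^(-u) gives at most e^(-n (2y)^n) <= e^(-n). The factor n in the exponent is
    what makes the limit 0 at y = 1/2 as well. *)
Lemma cvg_step y : 0 <= y <= 1 ->
  (1 - y ^+ n) ^+ (n * 2 ^ n)%N @[n --> \oo] --> ((y < 2^-1)%R%:R : R).
Proof.
move=> /andP[y0 y1].
have ya n : 0 <= 1 - y ^+ n <= 1.
  by rewrite subr_ge0 exprn_ile1//= gerBl exprn_ge0.
have [yl|yg] := ltP y 2^-1.
- rewrite (_ : true%:R = 1)//; have c1 : 1 - n%:R * (2 * y) ^+ n @[n --> \oo] --> (1 : R).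
    rewrite -[X in _ --> X]subr0; apply: cvgB; first exact: cvg_cst.
    by apply: cvg_natr_expr; apply/andP; split; lra.
  apply: (@squeeze_cvgn _ _ (cst 1) _ _ c1 (cvg_cst (1 : R))) => n /=.
  have /andP[h0 h1] := ya n.
  rewrite exprn_ile1// andbT.
  have := @bernoulli_ineq (y ^+ n) (n * 2 ^ n)%N _.
  rewrite exprMn natrM natrX mulrA; apply.
  by rewrite exprn_ge0//= exprn_ile1.
- rewrite (_ : false%:R = 0)//; have c1 : expR (- n%:R) @[n --> \oo] --> (0 : R) by exact: cvgn_expR.
  apply: (@squeeze_cvgn (cst 0) _ _ _ _ (cvg_cst (0 : R)) c1) => n /=.
  have /andP[h0 h1] := ya n.
  rewrite exprn_ge0//=.
  have h2 : 1 - y ^+ n <= expR (- y ^+ n) by exact: expR_ge1Dx.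
  apply: (@le_trans _ _ (expR (- y ^+ n) ^+ (n * 2 ^ n)%N)).
    by rewrite lerXn2r ?nnegrE ?expR_ge0.
  rewrite -expRM_natl ler_expR mulrN lerN2 natrM natrX -mulrA ler_peMr//.
  rewrite -exprMn exprn_ege1//; lra.
Qed.

End step_sequence.

(* Closed under the limits that dominated convergence allows for a law integrating e^(2a|x|). *)
Definition closed_class (R : realType) (a : R) (V : (R -> R) -> Prop) : Prop :=
  (forall k f g, V f -> V g -> V (fun x => k * f x + g x)) /\
  (forall (f_ : nat -> R -> R) f C, (forall n, V (f_ n)) ->
    (forall n x, `|f_ n x| <= C * expR (a * `|x|)) ->
    (forall x, f_ n x @[n --> \oo] --> f x) -> V f).

(* Steps of length at most a/2 in t lead from the monomials to all waves x^k cos(tx + th). With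
   u = (1 + cos)/2, the polynomials (1 - u^n)^(n 2^n) turn waves into indicators of {cos < 0}, and
   slow waves have half-lines as limits of such sets. *)
Section closed_class_theory.
Import HBNNSimple.
Context {R : realType} (a : R) (V : (R -> R) -> Prop).
Hypotheses (a0 : 0 < a) (clV : closed_class a V).
Hypothesis V_monomial : forall n, V (fun x => x ^+ n).

Let V_lin : forall k f g, V f -> V g -> V (fun x => k * f x + g x).
Proof. by case: clV. Qed.

Let V_lim (f_ : nat -> R -> R) f C : (forall n, V (f_ n)) ->
    (forall n x, `|f_ n x| <= C * expR (a * `|x|)) ->
    (forall x, f_ n x @[n --> \oo] --> f x) -> V f.
Proof. by case: clV => _; apply. Qed.

Let V0 : V (fun=> 0).
Proof.
have := V_lin (-1) (V_monomial 0) (V_monomial 0).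
by congr V; apply/funext => x; rewrite expr0 mulr1 addNr.
Qed.

Let VZ k f : V f -> V (fun x => k * f x).
Proof.
by move=> Vf; have := V_lin k Vf V0; congr V; apply/funext => x; rewrite addr0.
Qed.

Let VD f g : V f -> V g -> V (fun x => f x + g x).
Proof.
by move=> Vf Vg; have := V_lin 1 Vf Vg; congr V; apply/funext => x; rewrite mul1r.
Qed.

Let V_sum n (F : nat -> R -> R) : (forall i, V (F i)) ->
  V (fun x => \sum_(0 <= i < n) F i x).
Proof.
move=> VF; elim: n => [|n ih].
  by have := V0; congr V; apply/funext => x; rewrite big_nil.
have := VD ih (VF n).
by congr V; apply/funext => x; rewrite big_nat_recr.
Qed.

Let V_wave (t : R) := forall k th, V (fun x => x ^+ k * cos (t * x + th)).

Let sin_cos (u : R) : sin u = cos (u - pi / 2).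
Proof. by rewrite cosB cos_pihalf sin_pihalf mulr0 add0r mulr1. Qed.

(** Expand cos(hx) and sin(hx) in the addition formula. The partial sums are at most e^|hx| <=
    e^(a|x|/2), and the other half of the weight absorbs x^k; hence steps of length a/2. *)
Let V_wave_step t h : V_wave t -> `|h| <= a / 2 -> V_wave (t + h).
Proof.
move=> Wt ha k th.
pose f_ n x := x ^+ k * (series (cos_coeff (h * x)) n * cos (t * x + th) -
  series (sin_coeff (h * x)) n * sin (t * x + th)).
have a20 : 0 < a / 2 by rewrite divr_gt0.
apply: (@V_lim f_ _ (2 * (k`!%:R / (a / 2) ^+ k))).
- move=> n; rewrite /f_.
  (* Coefficients of the cosine and sine series at hx with the powers of x split off; these powers
     raise the degree k of the wave. *)
  pose c i : R := (~~ odd i)%:R * (-1) ^+ i./2 * h ^+ i / i`!%:R.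
  pose s i : R := (odd i)%:R * (-1) ^+ i.-1./2 * h ^+ i / i`!%:R.
  pose F i x := c i * (x ^+ (k + i) * cos (t * x + th)) +
    - s i * (x ^+ (k + i) * cos (t * x + (th - pi / 2))).
  have VF i : V (F i) by apply: V_lin; [exact: Wt|apply: VZ; exact: Wt].
  have := V_sum n VF; congr V; apply/funext => x.
  rewrite /series /= !mulr_suml -sumrB mulr_sumr; apply: eq_bigr => i _.
  rewrite /F sin_cos addrA /cos_coeff /sin_coeff /c /s /= !exprMn exprD.
  by rewrite -?exprnP; ring.
- move=> n x; rewrite /f_ normrM normrX.
  have e1 : `|h * x| <= a / 2 * `|x| by rewrite normrM ler_wpM2r.
  have e2 : expR `|h * x| <= expR (a / 2 * `|x|) by rewrite ler_expR.
  have H : `|series (cos_coeff (h * x)) n * cos (t * x + th) -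
    series (sin_coeff (h * x)) n * sin (t * x + th)| <= 2 * expR (a / 2 * `|x|).
    rewrite (le_trans (ler_normB _ _))// !normrM mulr_natl mulr2n lerD//.
      rewrite -[leRHS]mulr1 ler_pM// ?cos_max//.
      exact: le_trans (series_cos_coeff_le _ _) e2.
    rewrite -[leRHS]mulr1 ler_pM// ?sin_max//.
    exact: le_trans (series_sin_coeff_le _ _) e2.
  have -> : a * `|x| = a / 2 * `|x| + a / 2 * `|x| by field.
  have e3 := expr_le_expRM k a20 (normr_ge0 x).
  apply: (le_trans (ler_pM _ _ e3 H)); rewrite ?exprn_ge0//.
  by rewrite expRD le_eqVlt; apply/orP; left; apply/eqP; ring.
- move=> x; rewrite mulrDl addrAC [_ + h * x]addrC cosD.
  apply: cvgM; first exact: cvg_cst.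
  apply: cvgB; apply: cvgM; try exact: cvg_cst.
    exact: cvg_series_cos_coeff.
  exact: cvg_series_sin_coeff.
Qed.

Let V_waveT t : V_wave t.
Proof.
have [N hN] : exists N : nat, `|t| / (N.+1)%:R <= a / 2.
  have /archi_boundP := divr_ge0 (normr_ge0 t) (ltW (divr_gt0 a0 (ltr0n R 2))).
  set N := Num.bound _ => hN; exists N.
  rewrite ler_pdivrMr ?ltr0n// mulrC -ler_pdivrMr ?divr_gt0//.
  by rewrite ltW// (lt_le_trans hN)// ler_nat.
have H (n : nat) : V_wave (n%:R * (t / N.+1%:R)).
  elim: n => [|n ih].
    move=> k th; have := VZ (cos th) (V_monomial k); congr V.
    by apply/funext => x; rewrite !mul0r add0r mulrC.
  rewrite -natr1 mulrDl mul1r; apply: V_wave_step => //.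
  by rewrite normrM normfV normr_nat.
by have := H N.+1; rewrite mulrCA divff ?mulr1// pnatr_eq0.
Qed.

(** The product formula for cosines turns powers of a cosine into combinations of waves with other
    frequencies and phases. *)
Let V_poly_wave (p : {poly R}) t th : V (fun x => p.[cos (t * x + th)]).
Proof.
have Vpow (i : nat) : forall t' th',
    V (fun x => cos (t' * x + th') * cos (t * x + th) ^+ i).
  elim: i => [|i ih] t' th'.
    by have := V_waveT t' 0 th'; congr V; apply/funext => x; rewrite mulrC.
  have := VD (VZ 2^-1 (ih (t' + t) (th' + th))) (VZ 2^-1 (ih (t' - t) (th' - th))).
  congr V; apply/funext => x.
  have -> : (t' + t) * x + (th' + th) = (t' * x + th') + (t * x + th) by ring.
  have -> : (t' - t) * x + (th' - th) = (t' * x + th') - (t * x + th) by ring.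
  by rewrite cosB cosD exprS; field.
have Vp j : V (fun x => p`_j * cos (t * x + th) ^+ j).
  by apply: VZ; have := Vpow j 0 0; congr V; apply/funext => x;
    rewrite mul0r addr0 cos0 mul1r.
have := V_sum (size p) Vp; congr V; apply/funext => x.
by rewrite horner_coef big_mkord.
Qed.

Let V_half_wave t th : V (fun x => (cos (t * x + th) < 0)%R%:R).
Proof.
pose q n : {poly R} := (1 - (2^-1 *: (1 + 'X)) ^+ n) ^+ (n * 2 ^ n)%N.
have qE n s : (q n).[s] = (1 - (2^-1 * (1 + s)) ^+ n) ^+ (n * 2 ^ n)%N.
  by rewrite /q !hornerE.
have sb x : 0 <= 2^-1 * (1 + cos (t * x + th)) <= 1.
  have := cos_geN1 (t * x + th); have := cos_le1 (t * x + th).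
  by move=> *; apply/andP; split; lra.
apply: (@V_lim (fun n x => (q n).[cos (t * x + th)]) _ 1).
- by move=> n; exact: V_poly_wave.
- move=> n x; rewrite qE mul1r.
  apply: (@le_trans _ _ 1); last by rewrite -expR0 ler_expR mulr_ge0// ltW.
  have /andP[h0 h1] := sb x.
  have h2 := exprn_ge0 n h0; have h3 := exprn_ile1 n h0 h1.
  by rewrite normrX exprn_ile1// ger0_norm; lra.
- move=> x; under eq_fun do rewrite qE.
  have -> : (cos (t * x + th) < 0) = (2^-1 * (1 + cos (t * x + th)) < 2^-1).
    by apply/idP/idP => ?; lra.
  exact: cvg_step.
Qed.

(** sin((b - x)/(n + 1)) has the sign of b - x as soon as |b - x| < (n + 1) pi, so the half-wave
    sets converge to the ray. *)
Let V_ray b : V (fun x => (b < x)%R%:R).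
Proof.
apply: (@V_lim (fun n x => (sin (n.+1%:R^-1 * (b - x)) < 0)%R%:R) _ 1).
- move=> n; have := V_half_wave (- n.+1%:R^-1) (n.+1%:R^-1 * b - pi / 2).
  congr V; apply/funext => x; rewrite sin_cos; congr ((cos _ < 0)%R%:R); ring.
- move=> n x; rewrite mul1r ger0_norm ?ler0n//.
  apply: (@le_trans _ _ 1); first by case: (_ < _); rewrite ?ler01.
  by rewrite -expR0 ler_expR mulr_ge0// ltW.
- move=> x.
  suff H : \forall n \near \oo, (sin (n.+1%:R^-1 * (b - x)) < 0)%R%:R = (b < x)%R%:R :> R.
    by apply: cvg_near_cst.
  near=> n.
  have n1 : n.+1%:R^-1 * `|b - x| < pi.
    apply: (@lt_le_trans _ _ 1); last by apply: le_trans (pi_ge2 R); rewrite ler1n.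
    rewrite mulrC ltr_pdivrMr ?ltr0n// mul1r.
    near: n; exists (Num.bound `|b - x|) => // n /= hn.
    by rewrite (lt_le_trans (archi_boundP (normr_ge0 _)))// ler_nat (leq_trans hn).
  have n0 : 0 < n.+1%:R^-1 :> R by rewrite invr_gt0 ltr0n.
  congr ((nat_of_bool _)%:R); case: (ltP b x) => bx.
    apply: (introT idP); have -> : b - x = - (x - b) by ring.
    rewrite mulrN sinN oppr_lt0 sin_gt0_pi// mulr_gt0 ?subr_gt0//=.
    by rewrite -(gtr0_norm (_ : 0 < x - b)) ?subr_gt0// distrC.
  apply/negbTE; rewrite -leNgt sin_ge0_pi// mulr_ge0 ?subr_ge0 ?(ltW n0)//=.
  by rewrite -[b - x]ger0_norm ?subr_ge0// ltW.
Unshelve. all: by end_near.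
Qed.

Let V_indic (A : set (measurableTypeR R)) : measurable A -> V (\1_A : R -> R).
Proof.
have E : @measurable _ (measurableTypeR R) = <<s @RGenOInfty.G R >>.
  exact: RGenOInfty.measurableE.
move=> mA; have : <<s @RGenOInfty.G R >> A by rewrite -E.
clear mA; move: A.
have V1 : V (fun=> 1) by have := V_monomial 0; congr V; apply/funext => x; rewrite expr0.
apply: (@dynkin_induction _ (measurableTypeR R) (@RGenOInfty.G R)
   (fun A => V (\1_A : R -> R))).
- exact: E.
- move=> A B [x ->] [y ->]; exists (Num.max x y).
  by apply/seteqP; split=> z /=; rewrite !in_itv/= !andbT gt_max => /andP.
- by have := V1; congr V; apply/funext => x; rewrite indicT.
- move=> A [b ->]; have := V_ray b; congr V; apply/funext => x.
  by rewrite indicE mem_setE in_itv/= andbT.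
- move=> A mA VA; have := V_lin (-1) VA V1; congr V; apply/funext => x.
  by rewrite !indicE in_setC; case: (x \in A) => /=; rewrite ?mulr1 ?mulr0 ?addNr ?add0r.
- move=> F mF tF VF.
  have sumE n x : (\sum_(0 <= i < n) \1_(F i) x : R) = \1_(\bigcup_(i in `I_n) F i) x.
    elim: n => [|n ih]; first by rewrite big_nil II0 bigcup_set0 indic0.
    rewrite big_nat_recr//= ih IIS bigcup_setU bigcup_set1.
    rewrite !indicE in_setU; case: (boolP (x \in F n)) => [xn|_]; last by rewrite orbF addr0.
    case: (boolP (x \in _)) => //=; last by rewrite add0r.
    rewrite inE => -[k /= kn Fk].
    have := tF k n I I; rewrite inE in xn.
    by move=> /(_ (ex_intro _ x (conj Fk xn))) kE; rewrite kE ltnn in kn.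
  apply: (@V_lim (fun n x => \sum_(0 <= i < n) \1_(F i) x) _ 1).
  + by move=> n; exact: V_sum.
  + move=> n x; rewrite mul1r sumE indicE ger0_norm ?ler0n//.
    apply: (@le_trans _ _ 1); first by case: (_ \in _); rewrite ?ler01.
    by rewrite -expR0 ler_expR mulr_ge0// ltW.
  + move=> x; apply: cvg_near_cst; rewrite indicE.
    case: (boolP (x \in \bigcup_k F k)).
      rewrite inE => -[k _ Fk]; exists k.+1 => // n /= kn.
      by rewrite sumE indicE mem_set//; exists k.
    move=> xF; exists 0%N => // n _ /=; rewrite sumE indicE memNset// => -[k _ Fk].
    by move/negP: xF; apply; rewrite inE; exists k.
Qed.

Lemma closed_class_bounded (f : R -> R) : bounded_borel f -> V f.
Proof.
move=> [mf [M fM]].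
have M0 : 0 <= M by apply: le_trans (fM 0).
have V1 : V (fun=> 1) by have := V_monomial 0; congr V; apply/funext => x; rewrite expr0.
(* Adding the bound M reduces to a nonnegative function, which is an increasing limit of simple
   functions. *)
suff H (g : R -> R) : measurable_fun setT g -> (forall x, 0 <= g x <= 2 * M) -> V g.
  have : V (fun x => f x + M).
    apply: H; first by apply: measurable_funD.
    by move=> x; have /ler_normlP[] := fM x => *; apply/andP; split; lra.
  move=> Vg; have := V_lin (- M) V1 Vg; congr V; apply/funext => x.
  by rewrite mulr1 addrC addrK.
move=> mg g0.
have mg' : measurable_fun setT (EFin \o (g : measurableTypeR R -> R)) by apply/measurable_EFinP.
pose s := nnsfun_approx measurableT mg'.
have cs x : s n x @[n --> \oo] --> g x.
  have h : forall y : measurableTypeR R, setT y -> (0 <= (EFin \o g) y)%E.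
    by move=> y _; rewrite lee_fin; have /andP[] := g0 y.
  by have /fine_cvgP[] := @cvg_nnsfun_approx _ _ _ _ measurableT _ mg' h x I.
have sle n x : 0 <= s n x <= g x.
  apply/andP; split; first exact: fun_ge0.
  rewrite -(cvg_lim _ (cs x))//.
  apply: (nondecreasing_cvgn_le _ (cvgP _ (cs x)) n).
  by move=> m k mk; have /lefP := nd_nnsfun_approx measurableT mg' mk; apply.
have Vs n : V (s n).
  have VS (l : seq R) : V (fun x => \sum_(y <- l) y * \1_(s n @^-1` [set y]) x).
    elim: l => [|y l ih]; first by have := V0; congr V; apply/funext => x; rewrite big_nil.
    have mA : measurable (s n @^-1` [set y]) by exact: measurable_funPTI.
    have := V_lin y (V_indic mA) ih.
    by congr V; apply/funext => x; rewrite big_cons.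
  have := VS (finmap.enum_fset (fset_set (range (s n)))); congr V; apply/funext => x.
  by rewrite fimfunE fsbig_finite.
apply: (@V_lim (fun n => s n) g (2 * M)) => //.
move=> n x; have /andP[h0 h1] := sle n x; have /andP[h2 h3] := g0 x.
rewrite ger0_norm// (le_trans h1)// (le_trans h3)// ler_peMr ?mulr_ge0//.
by rewrite -expR0 ler_expR mulr_ge0// ltW.
Qed.

End closed_class_theory.

(** * Dominated convergence and exponential moments *)

Section Rintegral_limits.
Context d (T : measurableType d) (R : realType) (mu : {measure set T -> \bar R}).
Variable D : set T.
Hypothesis mD : measurable D.

Lemma integrable_dominated (f g : T -> R) : measurable_fun D f ->
  mu.-integrable D (EFin \o g) -> (forall x, D x -> `|f x| <= g x) ->
  mu.-integrable D (EFin \o f).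
Proof.
move=> mf ig fg; apply: le_integrable ig => //; first exact/measurable_EFinP.
move=> x Dx /=; rewrite lee_fin (le_trans (fg _ Dx))//.
by rewrite ler_norm.
Qed.

Lemma integrable_scale (k : R) (f : T -> R) : mu.-integrable D (EFin \o f) ->
  mu.-integrable D (EFin \o (fun x => k * f x)).
Proof.
by move=> i; rewrite (_ : _ \o _ = (fun x => k%:E * (EFin \o f) x)%E)//; exact: integrableZl.
Qed.

Lemma integrable_add (f g : T -> R) : mu.-integrable D (EFin \o f) ->
  mu.-integrable D (EFin \o g) -> mu.-integrable D (EFin \o (fun x => f x + g x)).
Proof.
by move=> i j; rewrite (_ : _ \o _ = (EFin \o f) \+ (EFin \o g))%E//; exact: integrableD.
Qed.

Lemma Rintegral_dominated_cvg (f_ : nat -> T -> R) (f g : T -> R) :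
  (forall n, measurable_fun D (f_ n)) -> mu.-integrable D (EFin \o g) ->
  (forall n x, D x -> `|f_ n x| <= g x) ->
  (forall x, D x -> f_ n x @[n --> \oo] --> f x) ->
  mu.-integrable D (EFin \o f) /\
  \int[mu]_(x in D) f_ n x @[n --> \oo] --> \int[mu]_(x in D) f x.
Proof.
move=> mf ig fg cf.
have mF : measurable_fun D f.
  exact: (measurable_fun_cvg mf cf).
have If : mu.-integrable D (EFin \o f).
  apply: (integrable_dominated mF ig) => x Dx.
  have cn : `|f_ n x| @[n --> \oo] --> `|f x| by apply: cvg_norm; exact: cf.
  rewrite -(cvg_lim _ cn)//; apply: limr_le; first exact: cvgP cn.
  by apply: nearW => n; exact: fg.
split=> //; apply: fine_cvg; rewrite fineK; last exact: integrable_fin_num.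
apply: (@dominated_cvg _ _ _ _ D mD (fun n => EFin \o f_ n) (EFin \o f) (EFin \o g)) => //.
- by move=> n; exact/measurable_EFinP.
- by move=> x Dx; apply: cvg_EFin; [exact: nearW|exact: cf].
Qed.

End Rintegral_limits.

Section moments.
Context {R : realType}.
Implicit Types mu : probability (measurableTypeR R) R.

(* exp |y| <= exp y + exp (-y), whose Taylor series only has even terms. *)
Lemma exp_moment mu (a K C : R) : 0 <= a -> 0 <= K -> a * K < 1 ->
  (forall n, ~~ odd n -> (\int[mu]_x (x ^+ n)%:E <= (C * n`!%:R * K ^+ n)%:E)%E) ->
  mu.-integrable setT (fun x => (expR (a * `|x|))%:E).
Proof.
move=> a0 K0 aK hm.
pose S n (x : measurableTypeR R) : R := \sum_(0 <= i < n) (exp_coeff (a * x) i + exp_coeff (- (a * x)) i).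
have SE x i : exp_coeff (a * x) i + exp_coeff (- (a * x)) i =
    if odd i then 0 else 2 * a ^+ i / i`!%:R * x ^+ i.
  rewrite /exp_coeff /= exprNn -signr_odd !exprMn.
  by case: (odd i); rewrite ?expr1 ?expr0; ring.
have term0 x i : 0 <= exp_coeff (a * x) i + exp_coeff (- (a * x)) i.
  rewrite SE; case: ifPn => // oi.
  by rewrite mulr_ge0 ?exprn_even_ge0// !mulr_ge0 ?invr_ge0 ?exprn_ge0.
have mS n : measurable_fun setT (S n).
  apply: measurable_sum => i; under eq_fun do rewrite SE.
  by case: (odd i); [exact: measurable_cst|apply: measurable_funM => //; exact: measurable_funX].
have cS x : S n x @[n --> \oo] --> expR (a * x) + expR (- (a * x)).
  have -> : (fun n => S n x) = (fun n => series (exp_coeff (a * x)) n + series (exp_coeff (- (a * x))) n).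
    by apply/funext => n; rewrite /S big_split.
  by apply: cvgD; exact: is_cvg_series_exp_coeff.
(* The i-th term integrates to at most 2 |C| (aK)^i, and B sums this geometric series. The absolute
   value covers a C of unknown sign. *)
pose B := 2 * `|C| / (1 - a * K).
have bS n : (\int[mu]_x (S n x)%:E <= B%:E)%E.
  have -> : (\int[mu]_x (S n x)%:E = \sum_(0 <= i < n) \int[mu]_x (exp_coeff (a * x) i + exp_coeff (- (a * x)) i)%:E)%E.
    rewrite -ge0_integral_sum//.
    - by apply: eq_integral => x _; rewrite /S sumEFin.
    - move=> i; apply/measurable_EFinP; under eq_fun do rewrite SE.
      by case: (odd i); [exact: measurable_cst|apply: measurable_funM => //; exact: measurable_funX].
    - by move=> i x _; rewrite lee_fin.
  have tb i : (\int[mu]_x (exp_coeff (a * x) i + exp_coeff (- (a * x)) i)%:E <= (2 * `|C| * (a * K) ^+ i)%:E)%E.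
    have [oi|oi] := boolP (odd i).
      under eq_integral do rewrite SE oi.
      by rewrite integral0 lee_fin !mulr_ge0 ?exprn_ge0 ?mulr_ge0.
    under eq_integral do rewrite SE (negbTE oi).
    have e0 : 0 <= 2 * a ^+ i / i`!%:R by rewrite !mulr_ge0 ?invr_ge0 ?exprn_ge0.
    under eq_integral do rewrite EFinM.
    rewrite ge0_integralZl_EFin//; last first.
    - by apply/measurable_EFinP; exact: measurable_funX.
    - by move=> x _; rewrite lee_fin exprn_even_ge0.
    apply: (@le_trans _ _ ((2 * a ^+ i / i`!%:R)%:E * (`|C| * i`!%:R * K ^+ i)%:E)%E).
      apply: lee_wpmul2l; first by rewrite lee_fin.
      apply: (le_trans (hm _ oi)); rewrite lee_fin -!mulrA ler_wpM2r ?ler_norm//.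
      by rewrite mulr_ge0 ?exprn_ge0.
    rewrite -EFinM lee_fin exprMn.
    have f0 : i`!%:R != 0 :> R by rewrite pnatr_eq0 -lt0n fact_gt0.
    by rewrite le_eqVlt; apply/orP; left; apply/eqP; field.
  apply: (@le_trans _ _ (\sum_(0 <= i < n) (2 * `|C| * (a * K) ^+ i)%:E)%E).
    by apply: lee_sum => i _; exact: tb.
  rewrite sumEFin lee_fin.
  rewrite -mulr_sumr /B -!mulrA ler_wpM2l// ler_wpM2l//.
  have aK0 : 0 <= a * K by exact: mulr_ge0.
  have p0 : 0 < 1 - a * K by rewrite subr_gt0.
  have gE : \sum_(0 <= i < n) (a * K) ^+ i = (1 - (a * K) ^+ n) / (1 - a * K).
    elim: n => [|n ih]; first by rewrite big_nil expr0 subrr mul0r.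
    by rewrite big_nat_recr//= ih exprS; field; rewrite gt_eqF.
  rewrite gE ler_pdivrMr// mulVf ?gt_eqF//.
  by rewrite gerBl exprn_ge0.
have le1 x : expR (a * `|x|) <= expR (a * x) + expR (- (a * x)).
  have [x0|x0] := leP 0 x; first by rewrite ger0_norm// lerDl expR_ge0.
  by rewrite ltr0_norm// mulrN lerDr expR_ge0.
have mcosh : measurable_fun setT (fun x : measurableTypeR R => expR (a * x) + expR (- (a * x))).
  by apply: (measurable_fun_cvg mS) => x _; exact: cS.
have mexp : measurable_fun setT (fun x : measurableTypeR R => expR (a * `|x|)).
  by apply: measurableT_comp => //; apply: measurable_funM.
apply/integrableP; split; first exact/measurable_EFinP.
apply: (@le_lt_trans _ _ (\int[mu]_x (expR (a * x) + expR (- (a * x)))%:E)%E).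
  apply: ge0_le_integral => //.
  - by apply/measurable_EFinP; apply: measurableT_comp.
  - by apply/measurable_EFinP.
  - by move=> x _; rewrite /= lee_fin ger0_norm ?expR_ge0.
apply: (@le_lt_trans _ _ B%:E); last exact: ltry.
have := @cvg_monotone_convergence _ _ _ mu setT measurableT (fun n x => (S n x)%:E) _ _ _.
have -> : (\int[mu]_x (expR (a * x) + expR (- (a * x)))%:E = \int[mu]_x limn (fun n => (S n x)%:E))%E.
  apply: eq_integral => x _; apply/esym/cvg_lim => //.
  by apply: cvg_EFin; [exact: nearW|exact: cS].
move=> h; rewrite -(cvg_lim _ (h _ _ _))//.
- apply: lime_le; last by apply: nearW.
  apply: cvgP (h _ _ _).
  + by move=> n; exact/measurable_EFinP.
  + by move=> n x _; rewrite lee_fin sumr_ge0.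
  + by move=> x _ m n mn; rewrite lee_fin /S (big_cat_nat (leq0n m) mn)//= lerDl sumr_ge0.
- by move=> n; exact/measurable_EFinP.
- by move=> n x _; rewrite lee_fin sumr_ge0.
- by move=> x _ m n mn; rewrite lee_fin /S (big_cat_nat (leq0n m) mn)//= lerDl sumr_ge0.
Qed.

End moments.

(** * Square-integrable functions *)

Section L2_basics.
Context {R : realType}.
Implicit Types (mu nu : {measure set (measurableTypeR R) -> \bar R}) (f g : R -> R).

(** Comparisons of norms are reduced below to comparisons of integrals of squares, squaring being
    monotone on [0, +oo]. *)
Lemma L2norm_sqr mu f : (L2norm mu f `^ 2 = \int[mu]_x (f x ^+ 2)%:E)%E.
Proof.
rewrite /L2norm poweR_Lnorm//; apply: eq_integral => x _ /=.
by rewrite powR_mulrn// real_normK ?num_real.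
Qed.

Lemma L2P mu f : f \in L2 mu <->
  measurable_fun setT f /\ mu.-integrable setT (fun x => (f x ^+ 2)%:E).
Proof.
split.
  move=> fL; split; last exact: Lfun2_integrable_sqr.
  by have := sub_Lfun_mfun fL; rewrite inE.
move=> [mf /integrableP[_ i2]]; rewrite inE; apply/andP; split; rewrite inE//=.
rewrite /finite_norm.
have : (L2norm mu f `^ 2 < +oo)%E.
  rewrite L2norm_sqr; apply: le_lt_trans i2; apply: ge0_le_integral => //.
  - by move=> x _; rewrite lee_fin sqr_ge0.
  - by apply/measurable_EFinP; exact: measurable_funX.
  - by do 2 apply: measurableT_comp => //; exact: measurable_funX.
  - by move=> x _; rewrite /= lee_fin ler_norm.
by apply: lty_poweRy.
Qed.

Lemma L2_measurable mu f : f \in L2 mu -> measurable_fun setT f.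
Proof. by move=> /L2P[]. Qed.

Lemma L2_sqr_integrable mu f : f \in L2 mu -> mu.-integrable setT (fun x => (f x ^+ 2)%:E).
Proof. by move=> /L2P[]. Qed.

Lemma L2norm_ge0 mu f : (0 <= L2norm mu f)%E.
Proof. exact: Lnorm_ge0. Qed.

Lemma sqre_le (x y : \bar R) : (0 <= x)%E -> (0 <= y)%E -> (x <= y)%E = (x `^ 2 <= y `^ 2)%E.
Proof.
move=> x0 y0; apply/idP/idP.
  by move=> xy; apply: gt0_ler_poweR; rewrite ?in_itv/= ?x0 ?y0 ?leey.
have sqrtK (z : \bar R) : (0 <= z)%E -> ((z `^ 2) `^ (2^-1) = z)%E.
  by move=> z0; rewrite -poweRrM divff// poweRe1.
move=> xy; rewrite -[leLHS]sqrtK// -[leRHS]sqrtK//.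
by apply: gt0_ler_poweR; rewrite ?in_itv/= ?leey ?poweR_ge0.
Qed.

Lemma L2norm_le mu nu f g :
  (L2norm mu f <= L2norm nu g)%E =
  (\int[mu]_x (f x ^+ 2)%:E <= \int[nu]_x (g x ^+ 2)%:E)%E.
Proof. by rewrite sqre_le ?L2norm_ge0// !L2norm_sqr. Qed.

Lemma L2norm_lt mu f (e : R) : 0 < e ->
  (L2norm mu f < e%:E)%E = (\int[mu]_x (f x ^+ 2)%:E < (e ^+ 2)%:E)%E.
Proof.
move=> e0; have e0' : (0 <= e%:E)%E by rewrite lee_fin ltW.
rewrite !ltNge (sqre_le e0' (L2norm_ge0 _ _)) L2norm_sqr poweR_EFin.
by rewrite powR_mulrn// ltW.
Qed.

Lemma L2norm_scale mu (k : R) f : (0 <= k) -> measurable_fun setT f ->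
  (L2norm mu (fun x => (k * f x)%R) = k%:E * L2norm mu f)%E.
Proof.
move=> k0 mf; have k0' : (0 <= k%:E)%E by rewrite lee_fin.
have kf0 := mule_ge0 k0' (L2norm_ge0 mu f).
have E : (L2norm mu (fun x => (k * f x)%R) `^ 2 = (k%:E * L2norm mu f) `^ 2)%E.
  rewrite poweRM ?L2norm_ge0// !L2norm_sqr poweR_EFin powR_mulrn//.
  rewrite -ge0_integralZl_EFin ?sqr_ge0//.
  - by apply: eq_integral => x _; rewrite -EFinM exprMn.
  - by move=> x _; rewrite lee_fin sqr_ge0.
  - by apply/measurable_EFinP; exact: measurable_funX.
by apply/eqP; rewrite eq_le (sqre_le (L2norm_ge0 _ _) kf0) (sqre_le kf0 (L2norm_ge0 _ _)) E lexx.
Qed.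

Lemma L2_lin mu (k : R) f g : f \in L2 mu -> g \in L2 mu ->
  (fun x => k * f x + g x) \in L2 mu.
Proof.
move=> /L2P[mf i_f] /L2P[mg ig]; apply/L2P; split.
  by apply: measurable_funD => //; exact: measurable_funM.
have h : mu.-integrable setT (EFin \o (fun x => 2 * k ^+ 2 * f x ^+ 2 + 2 * g x ^+ 2)).
  rewrite (_ : _ \o _ = (fun x => ((2 * k ^+ 2)%:E * (f x ^+ 2)%:E) + (2%:E * (g x ^+ 2)%:E))%E).
    by apply: integrableD => //; exact: integrableZl.
  by apply/funext => x /=; rewrite EFinD !EFinM.
apply: (integrable_dominated _ _ h) => //.
  by apply: measurable_funX; apply: measurable_funD => //; exact: measurable_funM.
move=> x _; rewrite ger0_norm ?sqr_ge0//.
have := sqr_ge0 (k * f x - g x); nra.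
Qed.

Lemma L2norm_add_le mu f g : measurable_fun setT f -> measurable_fun setT g ->
  (L2norm mu (fun x => f x + g x)%R <= L2norm mu f + L2norm mu g)%E.
Proof. by move=> mf mg; apply: minkowski_EFin => //; rewrite ler1n. Qed.

Lemma L2norm_eq0 mu f : measurable_fun setT f -> L2norm mu f = 0%E ->
  {ae mu, forall x, f x = 0}.
Proof.
move=> mf h.
have mf' : measurable_fun (setT : set (measurableTypeR R)) (EFin \o f) by exact/measurable_EFinP.
have [] := @Lnorm_eq0_eq0 _ (measurableTypeR R) R mu (EFin \o f) 2%:E mf' _ h.
  by rewrite lte_fin.
move=> N [mN N0 NP]; exists N; split => // x; move=> hx; apply: NP => /= fx.
by apply: hx; have [] := fx I.
Qed.

End L2_basics.

(** * From decaying exponentials to monomials *)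

Section laplace_class.
Context {R : realType} (a : R) (V : (R -> R) -> Prop).
Hypotheses (a0 : 0 < a) (clV : closed_class a V).
Hypothesis V_exp : forall l, 0 < l -> V (fun x => expR (- (l * `|x|))).

Let pow_bound k (x : R) : `|x| ^+ k <= k`!%:R / a ^+ k * expR (a * `|x|).
Proof. exact: expr_le_expRM. Qed.

(** Differentiation in the rate: the quotients (e^(-l|x|) - e^(-(l+h)|x|))/h stay in the class, and
    after division by e^(-l|x|) they lie between |x| - h |x|^2 and |x|. One more factor |x| appears
    in the limit. *)
Let V_pow_exp k l : 0 < l -> V (fun x => `|x| ^+ k * expR (- (l * `|x|))).
Proof.
elim: k l => [|k ih] l l0.
  by have := V_exp l0; congr V; apply/funext => x; rewrite expr0 mul1r.
pose h n : R := n.+1%:R^-1.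
have h0 n : 0 < h n by rewrite invr_gt0 ltr0n.
pose f_ n (x : R) := `|x| ^+ k * expR (- (l * `|x|)) * ((1 - expR (- (h n * `|x|))) / h n).
have quot n (x : R) : `|x| - `|x| ^+ 2 * h n <= (1 - expR (- (h n * `|x|))) / h n <= `|x|.
  have u0 := normr_ge0 x; have e1 := expR_ge1Dx (- (h n * `|x|)).
  have v0 : 0 <= h n * `|x| by rewrite mulr_ge0// ltW.
  apply/andP; split; last by rewrite ler_pdivrMr//; lra.
  rewrite ler_pdivlMr//.
  have e2 := expR_ge1Dx (h n * `|x|); rewrite expRN.
  have E0 := expR_gt0 (h n * `|x|).
  have : (expR (h n * `|x|))^-1 <= (1 + h n * `|x|)^-1 by rewrite lef_pV2// posrE; lra.
  move=> e3; suff : (1 + h n * `|x|)^-1 <= 1 - h n * `|x| + (h n * `|x|) ^+ 2 by lra.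
  rewrite -[leLHS]mul1r ler_pdivrMr; last by lra.
  by have := exprn_ge0 3 v0; rewrite !exprS expr0; nra.
have [clin clim] := clV.
apply: (clim f_ _ (k.+1`!%:R / a ^+ k.+1)).
- move=> n; have l1 : 0 < l + h n by rewrite addr_gt0.
  have := clin (- (h n)^-1) _ _ (ih _ l1) (clin (h n)^-1 _ _ (ih _ l0) (clin (-1) _ _ (ih _ l0) (ih _ l0))).
  congr V; apply/funext => x; rewrite /f_ mulrDl opprD expRD; ring.
- move=> n x; have /andP[_ q1] := quot n x.
  have q0 : 0 <= (1 - expR (- (h n * `|x|))) / h n.
    apply: divr_ge0; last exact: ltW.
    by rewrite subr_ge0 -expR0 ler_expR oppr_le0 mulr_ge0// ltW.
  have e0 : 0 <= `|x| ^+ k * expR (- (l * `|x|)) by rewrite mulr_ge0 ?exprn_ge0 ?expR_ge0.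
  rewrite /f_ ger0_norm; last exact: mulr_ge0.
  apply: le_trans (pow_bound _ _); rewrite exprSr.
  apply: ler_pM => //.
  by rewrite ler_piMr ?exprn_ge0// -expR0 ler_expR oppr_le0 mulr_ge0// ltW.
- move=> x; rewrite exprSr mulrAC; apply: cvgM; first exact: cvg_cst.
  have c1 : `|x| - `|x| ^+ 2 * h n @[n --> \oo] --> `|x|.
    rewrite -[X in _ --> X]subr0 -[X in _ --> _ - X](mulr0 (`|x| ^+ 2)).
    apply: cvgB; first exact: cvg_cst.
    by apply: cvgM; [exact: cvg_cst|exact: cvg_harmonic].
  by apply: (squeeze_cvgn _ c1 (cvg_cst `|x|)) => n; exact: quot.
Qed.

(** Let the rate l = 1/(n + 1) tend to 0 under the fixed bound |x|^k <= (k!/a^k) e^(a|x|). *)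
Lemma closed_class_abs_monomial k : V (fun x => `|x| ^+ k).
Proof.
have [clin clim] := clV.
apply: (clim (fun n x => `|x| ^+ k * expR (- (n.+1%:R^-1 * `|x|))) _ (k`!%:R / a ^+ k)).
- by move=> n; apply: V_pow_exp; rewrite invr_gt0 ltr0n.
- move=> n x; apply: le_trans (pow_bound _ _).
  rewrite ger0_norm ?mulr_ge0 ?exprn_ge0 ?expR_ge0//.
  by rewrite ler_piMr ?exprn_ge0// -expR0 ler_expR oppr_le0 mulr_ge0.
- move=> x; rewrite -[X in _ --> X]mulr1; apply: cvgM; first exact: cvg_cst.
  rewrite -[X in _ --> X]expR0; apply: continuous_cvg; first exact: continuous_expR.
  rewrite -[X in _ --> X]oppr0; apply: cvgN; rewrite -[X in _ --> X](mul0r `|x|).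
  by apply: cvgM; [exact: cvg_harmonic|exact: cvg_cst].
Qed.

End laplace_class.

(** * Determinacy by moments and density of polynomials *)

Section determinacy.
Context {R : realType}.
Implicit Types mu : probability (measurableTypeR R) R.

Lemma monomial_integrable mu (a : R) n : 0 < a ->
  mu.-integrable setT (fun x => (expR (a * `|x|))%:E) ->
  mu.-integrable setT (fun x => (x ^+ n)%:E).
Proof.
move=> a0 ie.
have ig : mu.-integrable setT (EFin \o (fun x => n`!%:R / a ^+ n * expR (a * `|x|))).
  by apply: integrable_scale.
apply: (integrable_dominated _ _ ig) => //.
by move=> x _; rewrite normrX; exact: expr_le_expRM.
Qed.

(** The functions integrable under both laws with equal integrals form a closed class containing the
    monomials, so [closed_class_bounded] applies. *)
Lemma moments_determine_integrals mu1 mu2 (a : R) : 0 < a ->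
  mu1.-integrable setT (fun x => (expR (a * `|x|))%:E) ->
  mu2.-integrable setT (fun x => (expR (a * `|x|))%:E) ->
  (forall n, \int[mu1]_x (x ^+ n) = \int[mu2]_x (x ^+ n)) ->
  forall f, bounded_borel f -> \int[mu1]_x f x = \int[mu2]_x f x.
Proof.
move=> a0 i1 i2 mom f bf.
pose V (f : R -> R) := [/\ measurable_fun (setT : set (measurableTypeR R)) f,
  mu1.-integrable setT (EFin \o f), mu2.-integrable setT (EFin \o f)
  & \int[mu1]_x f x = \int[mu2]_x f x].
suff : V f by case.
apply: (@closed_class_bounded R a V a0 _ _ f bf).
- split.
  + move=> k g h [mg i1g i2g eg] [mh i1h i2h eh].
    have i1' mu (ig : mu.-integrable setT (EFin \o g)) : mu.-integrable setT (EFin \o (fun x => k * g x)).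
      exact: integrable_scale.
    split.
    * by apply: measurable_funD => //; exact: measurable_funM.
    * exact: (integrable_add measurableT (i1' _ i1g) i1h).
    * exact: (integrable_add measurableT (i1' _ i2g) i2h).
    * rewrite !RintegralD//; try exact: i1'.
      by rewrite !RintegralZl// eg eh.
  + move=> f_ g C Vf fC cf.
    have mg n : measurable_fun (setT : set (measurableTypeR R)) (f_ n) by have [] := Vf n.
    have iC mu : mu.-integrable setT (fun x => (expR (a * `|x|))%:E) ->
        mu.-integrable setT (EFin \o (fun x => C * expR (a * `|x|))).
      by move=> i; exact: integrable_scale.
    have [I1 c1] := Rintegral_dominated_cvg measurableT mg (iC _ i1)
      (fun n x _ => fC n x) (fun x _ => cf x).
    have [I2 c2] := Rintegral_dominated_cvg measurableT mg (iC _ i2)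
      (fun n x _ => fC n x) (fun x _ => cf x).
    split => //; first by apply: (measurable_fun_cvg mg) => x _; exact: cf.
    have E : (fun n => \int[mu1]_x f_ n x) = (fun n => \int[mu2]_x f_ n x).
      by apply/funext => n; have [] := Vf n.
    by rewrite -(cvg_lim _ c1)// -(cvg_lim _ c2)// E.
- move=> n; split => //.
  + exact: monomial_integrable i1.
  + exact: monomial_integrable i2.
Qed.

Lemma moments_determine mu1 mu2 (a : R) : 0 < a ->
  mu1.-integrable setT (fun x => (expR (a * `|x|))%:E) ->
  mu2.-integrable setT (fun x => (expR (a * `|x|))%:E) ->
  (forall n, \int[mu1]_x (x ^+ n) = \int[mu2]_x (x ^+ n)) ->
  forall A, measurable A -> mu1 A = mu2 A.
Proof.
move=> a0 i1 i2 mom A mA.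
have bA : bounded_borel (\1_A : R -> R).
  split; first exact: measurable_indic.
  by exists 1 => x; rewrite indicE ger0_norm//; case: (_ \in _).
have := moments_determine_integrals a0 i1 i2 mom bA.
rewrite /Rintegral !integral_indic// !setIT => h.
by rewrite -[LHS]fineK ?fin_num_measure// h fineK ?fin_num_measure.
Qed.

End determinacy.

Section L2_density.
Context {R : realType} (mu : probability (measurableTypeR R) R).
Variable V : (R -> R) -> Prop.
Hypothesis V_lin : forall k f g, V f -> V g -> V (fun x => k * f x + g x).
Hypothesis V_closed : forall f, f \in L2 mu ->
  (forall e, 0 < e -> exists g, [/\ V g, g \in L2 mu & (L2norm mu (fun x => f x - g x)%R < e%:E)%E]) ->
  V f.

(** Since (f - f_n)^2 <= 4 G^2, dominated pointwise convergence is convergence in L^2. This puts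
    closedness in L^2 into the form required by [closed_class]. *)
Lemma L2_dominated_closed (f_ : nat -> R -> R) (f G : R -> R) :
  (forall n, V (f_ n)) -> (forall n, f_ n \in L2 mu) -> G \in L2 mu ->
  (forall n x, `|f_ n x| <= G x) -> (forall x, f_ n x @[n --> \oo] --> f x) ->
  V f /\ f \in L2 mu.
Proof.
move=> Vf Lf LG fG cf.
have mf n := L2_measurable (Lf n).
have mF : measurable_fun (setT : set (measurableTypeR R)) f.
  by apply: (measurable_fun_cvg mf) => x _; exact: cf.
have iG := L2_sqr_integrable LG.
have fG' x : `|f x| <= G x.
  have cn : `|f_ n x| @[n --> \oo] --> `|f x| by apply: cvg_norm; exact: cf.
  rewrite -(cvg_lim _ cn)//; apply: limr_le; first exact: cvgP cn.
  by apply: nearW => n; exact: fG.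
have fL : f \in L2 mu.
  apply/L2P; split => //; apply: (integrable_dominated _ _ iG) => //.
    exact: measurable_funX.
  move=> x _; rewrite ger0_norm ?sqr_ge0//.
  by have := fG' x; rewrite ler_norml => /andP[? ?]; nra.
split => //; apply: V_closed => // e e0.
have i4 : mu.-integrable setT (EFin \o (fun x => 4 * G x ^+ 2)) by exact: integrable_scale.
have b4 n (x : measurableTypeR R) : setT x -> `|(f x - f_ n x) ^+ 2| <= 4 * G x ^+ 2.
  move=> _; rewrite ger0_norm ?sqr_ge0//; have := fG n x; have := fG' x.
  by rewrite !ler_norml => /andP[? ?] /andP[? ?]; nra.
have c4 (x : measurableTypeR R) : setT x -> (f x - f_ n x) ^+ 2 @[n --> \oo] --> (0 : R).
  move=> _; rewrite -[X in _ --> X](_ : (f x - f x) ^+ 2 = 0); last by rewrite subrr expr0n.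
  rewrite expr2; under eq_fun do rewrite expr2.
  by apply: cvgM; apply: cvgB => //; exact: cvg_cst.
have [_] := @Rintegral_dominated_cvg _ _ _ mu setT measurableT
  (fun n x => (f x - f_ n x) ^+ 2) (cst 0) (fun x => 4 * G x ^+ 2)
  (fun n => measurable_funX 2 (measurable_funB mF (mf n))) i4 b4 c4.
rewrite Rintegral_cst// mul0r => c.
have /cvgrPdist_lt/(_ _ (exprn_gt0 2 e0)) [N _ /(_ N (leqnn N))] := c.
rewrite /= sub0r normrN => hN.
exists (f_ N); split => //; rewrite L2norm_lt//.
have iN : mu.-integrable setT (fun x => ((f x - f_ N x) ^+ 2)%:E).
  have := L2_lin (-1) (Lf N) fL => /L2_sqr_integrable.
  by congr (integrable _ _ _); apply/funext => x; congr (_ %:E); ring.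
rewrite -[X in (X < _)%E]fineK; last exact: integrable_fin_num.
by rewrite lte_fin (le_lt_trans _ hN)// ler_norm.
Qed.

(** e^(a|x|/2) is square integrable, so the closed class argument runs with rate a/2 and yields all
    bounded functions. The truncations of f to |f| <= n then converge to f, dominated by |f|. *)
Lemma L2_closed_class_full (a : R) : 0 < a ->
  mu.-integrable setT (fun x => (expR (a * `|x|))%:E) ->
  (forall n, V (fun x => x ^+ n)) ->
  forall f, f \in L2 mu -> V f.
Proof.
move=> a0 ie Vmono f fL.
have a20 : 0 < a / 2 by rewrite divr_gt0.
have exp2L (C : R) : (fun x => C * expR (a / 2 * `|x|)) \in L2 mu.
  have me : measurable_fun (setT : set (measurableTypeR R)) (fun x : R => C * expR (a / 2 * `|x|)).
    by apply: measurable_funM => //; apply: measurableT_comp => //; exact: measurable_funM.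
  apply/L2P; split => //.
  rewrite (_ : (fun _ => _) = (EFin \o (fun x => C ^+ 2 * expR (a * `|x|)))); first exact: integrable_scale.
  apply/funext => x /=; congr (_%:E); rewrite exprMn expr2 -expRM_natl; congr (_ * expR _).
  by field.
pose V' f := V f /\ f \in L2 mu.
have bV g : bounded_borel g -> V' g.
  apply: (@closed_class_bounded R (a / 2) V' a20).
    split.
      by move=> k g1 g2 [V1 L1] [V2 L2']; split; [exact: V_lin|exact: L2_lin].
    move=> f_ h C V'f fC cf; apply: (L2_dominated_closed _ _ (exp2L C) fC cf) => n.
      by have [] := V'f n.
    by have [] := V'f n.
  move=> n; split; first exact: Vmono.
  apply/L2P; split; first exact: measurable_funX.
  have := monomial_integrable (n * 2) a0 ie.
  by congr (integrable _ _ _); apply/funext => x; rewrite exprM.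
have mf := L2_measurable fL.
pose f_ n (x : R) := f x * (`|f x| <= n%:R)%R%:R.
have bf n : bounded_borel (f_ n).
  split.
    apply: measurable_funM => //.
    have mA : measurable [set x : measurableTypeR R | `|f x| <= n%:R].
      rewrite -[X in measurable X]setTI.
      by apply: measurable_fun_le => //; exact: measurableT_comp.
    rewrite (_ : (fun x => _) = \1_[set x : measurableTypeR R | `|f x| <= n%:R]).
      exact: measurable_indic.
    by apply/funext => x; rewrite indicE mem_setE.
  exists n%:R => x; rewrite /f_ normrM normr_nat; case: (boolP (`|f x| <= n%:R)) => h.
    by rewrite mulr1.
  by rewrite mulr0.
have absL : (fun x => `|f x|) \in L2 mu.
  apply/L2P; split; first exact: measurableT_comp.
  have := L2_sqr_integrable fL; congr (integrable _ _ _); apply/funext => x.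
  by rewrite real_normK ?num_real.
suff [] : V f /\ f \in L2 mu by [].
apply: (L2_dominated_closed (f_ := f_) _ _ absL) => [n|n|n x|x].
- by have [] := bV _ (bf n).
- by have [] := bV _ (bf n).
- by rewrite /f_ normrM normr_nat ler_piMr// lern1 leq_b1.
- apply: cvg_near_cst; exists (Num.bound `|f x|) => // n /= hn.
  rewrite /f_ (_ : `|f x| <= n%:R) ?mulr1//.
  by rewrite (le_trans (ltW (archi_boundP (normr_ge0 _))))// ler_nat.
Qed.

End L2_density.

(** * The Laplace exponent *)

Section real_derivatives.
Context {R : realType}.
Implicit Types (f g : R -> R) (x df dg k : R).

Lemma is_derive_add f g x df dg : is_derive x 1 f df -> is_derive x 1 g dg ->
  is_derive x 1 (fun y => f y + g y) (df + dg).
Proof. by move=> *; exact: is_deriveD. Qed.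

Lemma is_derive_sub f g x df dg : is_derive x 1 f df -> is_derive x 1 g dg ->
  is_derive x 1 (fun y => f y - g y) (df - dg).
Proof. by move=> *; exact: is_deriveB. Qed.

Lemma is_derive_opp f x df : is_derive x 1 f df -> is_derive x 1 (fun y => - f y) (- df).
Proof. by move=> *; exact: is_deriveN. Qed.

Lemma is_derive_mul f g x df dg : is_derive x 1 f df -> is_derive x 1 g dg ->
  is_derive x 1 (fun y => f y * g y) (df * g x + f x * dg).
Proof.
move=> hf hg; have h := is_deriveM hf hg.
suff <- : f x *: dg + g x *: df = df * g x + f x * dg by exact: h.
by rewrite /GRing.scale/= addrC [df * _]mulrC.
Qed.

Lemma is_derive_const x k : is_derive x 1 (fun=> k) 0.
Proof. exact: is_derive_cst. Qed.

Lemma is_derive_var x : is_derive x 1 (fun y => y) 1.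
Proof. exact: is_derive_id. Qed.

Lemma is_derive_chain f g x df dg : is_derive x 1 g dg -> is_derive (g x) 1 f df ->
  is_derive x 1 (fun y => f (g y)) (df * dg).
Proof.
move=> hg hf; exact: (is_derive1_comp hf hg).
Qed.

Lemma is_derive_exp g x dg : is_derive x 1 g dg ->
  is_derive x 1 (fun y => expR (g y)) (expR (g x) * dg).
Proof. by move=> hg; exact: is_derive_chain. Qed.

Lemma is_derive_cosf g x dg : is_derive x 1 g dg ->
  is_derive x 1 (fun y => cos (g y)) (- sin (g x) * dg).
Proof. by move=> hg; exact: is_derive_chain. Qed.

Lemma is_derive_sinf g x dg : is_derive x 1 g dg ->
  is_derive x 1 (fun y => sin (g y)) (cos (g x) * dg).
Proof. by move=> hg; exact: is_derive_chain. Qed.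

End real_derivatives.

(** Differentiates along the structure of the function, using derivatives found in the context, and
    leaves the equality of the computed and the stated values. *)
Ltac deriv := eapply is_derive_eq;
  [repeat first
    [ eassumption
    | apply: is_derive_const | apply: is_derive_var
    | apply: is_derive_exp | apply: is_derive_cosf | apply: is_derive_sinf
    | apply: is_derive_sub | apply: is_derive_add
    | apply: is_derive_opp | apply: is_derive_mul ] | rewrite ?/GRing.scale/=; cbv beta ].

(** * Inequalities for the integrand of the exponent *)

Section derivative_inequalities.
Context {R : realType}.
Implicit Types (f g df dg : R -> R) (x y u v : R).

Lemma is_derive_continuous f x d : is_derive x 1 f d -> {for x, continuous f}.
Proof. by move=> [h _]; apply: differentiable_continuous; exact/derivable1_diffP. Qed.

(** The mean value theorem for g - f. The comparisons of integrands below use it in the variable y,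
    from equality at y = 0. *)
Lemma le_of_derive f g df dg y : 0 <= y -> f 0 <= g 0 ->
  (forall x, 0 <= x -> is_derive x 1 f (df x)) ->
  (forall x, 0 <= x -> is_derive x 1 g (dg x)) ->
  (forall x, 0 < x -> df x <= dg x) -> f y <= g y.
Proof.
move=> y0 fg0 hf hg hd.
have [->|yn0] := eqVneq y 0; first by [].
have yp : 0 < y by rewrite lt_def yn0.
pose h x := g x - f x.
have dh x : 0 <= x -> is_derive x 1 h (dg x - df x).
  by move=> x0; apply: is_derive_sub; [exact: hg|exact: hf].
have ch : {within `[0, y], continuous h}.
  apply: derivable_within_continuous => x; rewrite in_itv/= => /andP[x0 _].
  by have [] := dh _ x0.
have dh' x : x \in `]0, y[ -> is_derive x 1 h (dg x - df x).
  by rewrite in_itv/= => /andP[x0 _]; apply: dh; exact: ltW.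
have [x xy E] := MVT yp dh' ch.
move: xy; rewrite in_itv/= => /andP[x0 xy].
have := hd _ x0; rewrite -subr_ge0 => hx.
have : 0 <= h y - h 0 by rewrite E subr0 mulr_ge0// ltW.
by rewrite /h; lra.
Qed.

Lemma sin_le_id y : 0 <= y -> `|sin y| <= y.
Proof.
move=> y0; rewrite ler_norml; apply/andP; split.
  apply: (@le_of_derive (fun y => - y) sin (fun=> - 1) cos) => //.
  - by rewrite sin0 oppr0.
  - by move=> x _; exact: cos_geN1.
apply: (@le_of_derive sin (fun y => y) cos (fun=> 1)) => //.
- by rewrite sin0.
Qed.

Lemma sin_norm_le y : `|sin y| <= `|y|.
Proof.
have [y0|y0] := leP 0 y; first by rewrite [leRHS]ger0_norm// sin_le_id.
by rewrite -normrN -sinN [leRHS]ltr0_norm// sin_le_id// oppr_ge0 ltW.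
Qed.

Lemma oneBcos_le y : 1 - cos y <= y ^+ 2.
Proof.
have h x : 0 <= x -> 1 - cos x <= x ^+ 2.
  move=> x0.
  apply: (@le_of_derive (fun y => 1 - cos y) (fun y => y * y) sin (fun y => y + y)) => //.
  - by rewrite cos0 mulr0 subrr.
  - by move=> z _; deriv; ring.
  - by move=> z _; deriv; ring.
  - by move=> z z0; have := sin_le_id (ltW z0); rewrite ler_norml => /andP[_]; lra.
by rewrite -cos_norm -real_normK ?num_real// h.
Qed.

Lemma subr_sin_le y : `|y - sin y| <= y ^+ 2.
Proof.
have h x : 0 <= x -> `|x - sin x| <= x ^+ 2.
  move=> x0; rewrite ler_norml; apply/andP; split.
    have := sin_le_id x0; rewrite ler_norml => /andP[_ ?].
    by have := sqr_ge0 x; lra.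
  apply: (@le_of_derive (fun y => y - sin y) (fun y => y * y) (fun y => 1 - cos y) (fun y => y + y)) => //.
  - by rewrite sin0 mulr0 subrr.
  - by move=> z _; deriv; ring.
  - move=> z z0; have := oneBcos_le z; have := cos_geN1 z.
    by case: (leP z 1) => ?; nra.
have [y0|y0] := leP 0 y; first exact: h.
by rewrite -normrN opprD -sinN -sqrrN h// oppr_ge0 ltW.
Qed.

(** The integrand of [psi] at a real argument; divided by u it is that of [phi], and divided by u^2
    that of phi(u)/u. *)
Definition expc2 u y : R := expR (- (u * y)) - 1 + u * y.

Lemma expc2_ge0 u y : 0 <= expc2 u y.
Proof. by rewrite /expc2; have := expR_ge1Dx (- (u * y)); lra. Qed.

Lemma expc2_le_id u y : 0 <= u -> 0 <= y -> expc2 u y <= u * y.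
Proof.
move=> u0 y0; have : expR (- (u * y)) <= 1.
  by rewrite -expR0 ler_expR oppr_le0 mulr_ge0.
by rewrite /expc2; lra.
Qed.

Lemma expRN_le x : 0 <= x -> expR (- x) <= 1 - x + x ^+ 2.
Proof.
move=> x0; rewrite expRN.
have h := expR_ge1Dx x.
have : (expR x)^-1 <= (1 + x)^-1 by rewrite lef_pV2// posrE ?expR_gt0; lra.
move=> /le_trans; apply; rewrite -[leLHS]mul1r ler_pdivrMr; last by lra.
by have := exprn_ge0 3 x0; rewrite !exprS expr0; nra.
Qed.

Lemma expc2_le_sqr u y : 0 <= u -> 0 <= y -> expc2 u y <= (u * y) ^+ 2.
Proof.
by move=> u0 y0; have := expRN_le (mulr_ge0 u0 y0); rewrite /expc2; lra.
Qed.

Lemma le_min_sqr_id (A B K t y : R) : 0 <= y -> 0 <= A -> 0 <= B -> A <= K -> B <= K ->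
  t <= A * y ^+ 2 -> t <= B * y -> t <= K * Num.min (y ^+ 2) y.
Proof.
move=> y0 A0 B0 AK BK h1 h2; rewrite /Num.min; case: ifP => _.
  by rewrite (le_trans h1)// ler_wpM2r// sqr_ge0.
by rewrite (le_trans h2)// ler_wpM2r.
Qed.

Lemma expc2_le_min u y : 0 <= u -> 0 <= y ->
  expc2 u y <= (u ^+ 2 + u) * Num.min (y ^+ 2) y.
Proof.
move=> u0 y0; apply: (@le_min_sqr_id (u ^+ 2) u) => //.
- exact: sqr_ge0.
- by rewrite lerDl.
- by rewrite lerDr sqr_ge0.
- by rewrite -exprMn expc2_le_sqr.
- exact: expc2_le_id.
Qed.

Lemma is_derive_expc2 u y : is_derive y 1 (expc2 u) (u * (1 - expR (- (u * y)))).
Proof. by rewrite /expc2; deriv; ring. Qed.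

Lemma expc20 u : expc2 u 0 = 0.
Proof. by rewrite /expc2 mulr0 oppr0 expR0; ring. Qed.

(** Both sides vanish at y = 0 and their y-derivatives 1 - e^(-uy) increase with u. Integrated, this
    makes phi nondecreasing. *)
Lemma expc2_div_homo u v y : 0 < u -> u <= v -> 0 <= y ->
  expc2 u y / u <= expc2 v y / v.
Proof.
move=> u0 uv y0; have v0 := lt_le_trans u0 uv.
apply: (@le_of_derive (fun y => expc2 u y / u) (fun y => expc2 v y / v)
  (fun y => 1 - expR (- (u * y))) (fun y => 1 - expR (- (v * y)))) => //.
- by rewrite !expc20 !mul0r.
- by move=> x _; have h := is_derive_expc2 u x; deriv; field; rewrite gt_eqF.
- by move=> x _; have h := is_derive_expc2 v x; deriv; field; rewrite gt_eqF.
- by move=> x x0; rewrite lerD2l lerN2 ler_expR lerN2 ler_wpM2r// ltW.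
Qed.

(** Two successive comparisons of y-derivatives reduce to e^(-vy) <= e^(-uy). Integrated, this makes
    phi(u)/u nonincreasing. *)
Lemma expc2_div2_homo u v y : 0 < u -> u <= v -> 0 <= y ->
  expc2 v y / v ^+ 2 <= expc2 u y / u ^+ 2.
Proof.
move=> u0 uv y0; have v0 := lt_le_trans u0 uv.
apply: (@le_of_derive (fun y => expc2 v y / v ^+ 2) (fun y => expc2 u y / u ^+ 2)
  (fun y => (1 - expR (- (v * y))) / v) (fun y => (1 - expR (- (u * y))) / u)) => //.
- by rewrite !expc20 !mul0r.
- by move=> x _; have h := is_derive_expc2 v x; deriv; field; rewrite gt_eqF.
- by move=> x _; have h := is_derive_expc2 u x; deriv; field; rewrite gt_eqF.
- move=> x x0.
  apply: (@le_of_derive (fun y => (1 - expR (- (v * y))) / v) (fun y => (1 - expR (- (u * y))) / u)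
    (fun y => expR (- (v * y))) (fun y => expR (- (u * y)))) => //.
  + exact: ltW.
  + by rewrite !mulr0 oppr0 expR0 subrr !mul0r.
  + by move=> z _; deriv; field; rewrite gt_eqF.
  + by move=> z _; deriv; field; rewrite gt_eqF.
  + by move=> z z0; rewrite ler_expR lerN2 ler_wpM2r// ltW.
Qed.

(** The derivative in u of [expc2 u y / u], hence the Levy part of the integrand of phi'. *)
Definition dexpc2 u y : R := (1 - expR (- (u * y)) * (1 + u * y)) / u ^+ 2.

Lemma is_derive_dexpc2 u y : 0 < u -> is_derive y 1 (dexpc2 u) (y * expR (- (u * y))).
Proof. by move=> u0; rewrite /dexpc2; deriv; field; rewrite gt_eqF. Qed.

Lemma is_derive_expc2_div u y : 0 < u ->
  is_derive u 1 (fun u => expc2 u y / u) (dexpc2 u y).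
Proof.
move=> u0; have hV : is_derive u 1 (fun u => u^-1) (- (u ^- 2)).
  apply: is_derive_eq; first by apply: is_deriveV; rewrite gt_eqF.
  by rewrite scaler1.
rewrite /expc2 /dexpc2; deriv; field; rewrite gt_eqF//.
Qed.

Lemma dexpc20 u : dexpc2 u 0 = 0.
Proof. by rewrite /dexpc2 mulr0 oppr0 expR0 addr0 mulr1 subrr mul0r. Qed.

(** Concavity of phi at the level of integrands: with the next lemma it leads to phi(u + 1) - phi(u)
    <= phi'(u) <= phi(u) - phi(u - 1). Here the y-derivatives compare as e^(-uy) (1 - e^(-y)) <= y
    e^(-uy). *)
Lemma dexpc2_ge_diff u y : 0 < u -> 0 <= y ->
  expc2 (u + 1) y / (u + 1) - expc2 u y / u <= dexpc2 u y.
Proof.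
move=> u0 y0; have v0 : 0 < u + 1 by lra.
apply: (@le_of_derive (fun y => expc2 (u + 1) y / (u + 1) - expc2 u y / u) (dexpc2 u)
  (fun y => expR (- (u * y)) - expR (- ((u + 1) * y))) (fun y => y * expR (- (u * y)))) => //.
- by rewrite !expc20 dexpc20 !mul0r subrr.
- move=> x _; have h1 := is_derive_expc2 u x; have h2 := is_derive_expc2 (u + 1) x.
  by deriv; field; rewrite !gt_eqF.
- by move=> x _; exact: is_derive_dexpc2.
- move=> x x0; have -> : - ((u + 1) * x) = - (u * x) + - x by ring.
  by rewrite expRD; have := expR_ge1Dx (- x); have := expR_gt0 (- (u * x)); nra.
Qed.

Lemma dexpc2_le_diff u y : 1 < u -> 0 <= y ->
  dexpc2 u y <= expc2 u y / u - expc2 (u - 1) y / (u - 1).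
Proof.
move=> u1 y0; have u0 : 0 < u by lra. have v0 : 0 < u - 1 by lra.
apply: (@le_of_derive (dexpc2 u) (fun y => expc2 u y / u - expc2 (u - 1) y / (u - 1))
  (fun y => y * expR (- (u * y))) (fun y => expR (- ((u - 1) * y)) - expR (- (u * y)))) => //.
- by rewrite !expc20 dexpc20 !mul0r subrr.
- by move=> x _; exact: is_derive_dexpc2.
- move=> x _; have h1 := is_derive_expc2 u x; have h2 := is_derive_expc2 (u - 1) x.
  by deriv; field; rewrite !gt_eqF.
- move=> x x0; have -> : - ((u - 1) * x) = - (u * x) + x by ring.
  by rewrite expRD; have := expR_ge1Dx x; have := expR_gt0 (- (u * x)); nra.
Qed.

(** The domination for differentiating phi under the integral near any u >= 1. The constant 4 is 2/u
    at u = 1/2. *)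
Lemma dexpc2_bound u y : 2^-1 <= u -> 0 <= y -> 0 <= dexpc2 u y <= 4 * Num.min (y ^+ 2) y.
Proof.
move=> u2 y0; have u0 : 0 < u by lra.
have x0 : 0 <= u * y by rewrite mulr_ge0// ltW.
have e0 := expR_gt0 (- (u * y)).
have e1 := expR_ge1Dx (- (u * y)).
have e2 : expR (- (u * y)) * (1 + u * y) <= 1.
  rewrite expRN mulrC ler_pdivrMr ?expR_gt0// mul1r.
  exact: expR_ge1Dx.
apply/andP; split; first by rewrite divr_ge0 ?subr_ge0// sqr_ge0.
apply: (@le_min_sqr_id 1 4) => //; rewrite ?ler1n//; rewrite /dexpc2 ler_pdivrMr ?exprn_gt0//; first by nra.
have : 1 - expR (- (u * y)) * (1 + u * y) <= 2 * (u * y).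
  by nra.
have : 2 * (u * y) <= 4 * y * u ^+ 2 by nra.
lra.
Qed.

End derivative_inequalities.

(** * The exponent: integrability, positivity, concavity, absence of zeros *)

Section characteristic_exponent.
Context {R : realType} (c : triplet R).
Local Open Scope complex_scope.

(** Unlike in [in_N], a drift alone is allowed; [gamma_triplet] is of this kind. *)
Definition admissible : Prop :=
  [/\ 0 <= sigma c, 0 <= drift c,
      sigma_finite (`]0%R, +oo[%classic : set (measurableTypeR R)) (levy c),
      (\int[levy c]_(y in `]0%R, +oo[) (Num.min (y ^+ 2) y)%:E < +oo)%E
    & ~ [/\ sigma c = 0, drift c = 0 & levy c `]0%R, +oo[%classic = 0%E]].

Hypothesis adm : admissible.

Local Notation D := (`]0%R, +oo[%classic : set (measurableTypeR R)).

Lemma pos_half_lineP (y : R) : D y <-> 0 < y.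
Proof. by rewrite /= in_itv/= andbT. Qed.

Let mD : measurable D. Proof. exact: measurable_itv. Qed.

Lemma levy_min_integrable : (levy c).-integrable D (EFin \o (fun y : R => Num.min (y ^+ 2) y)).
Proof.
have [_ _ _ h _] := adm; apply/integrableP; split.
  by apply/measurable_EFinP; apply: measurable_minr => //; exact: measurable_funX.
apply: le_lt_trans h; apply: ge0_le_integral => //.
- by apply/measurable_EFinP; apply: measurableT_comp => //; apply: measurable_minr => //; exact: measurable_funX.
- by apply/measurable_EFinP; apply: measurable_minr => //; exact: measurable_funX.
- move=> y /pos_half_lineP y0 /=; rewrite lee_fin ger0_norm//.
  by rewrite /Num.min; case: ifP => _; [rewrite sqr_ge0|exact: ltW].
Qed.

Lemma levy_integrable (f : R -> R) (K : R) : measurable_fun setT (f : measurableTypeR R -> R) ->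
  (forall y, 0 < y -> `|f y| <= K * Num.min (y ^+ 2) y) ->
  (levy c).-integrable D (EFin \o f).
Proof.
move=> mf fK.
apply: (integrable_dominated mD _ (integrable_scale mD K levy_min_integrable)).
  exact: measurable_funTS.
by move=> y /pos_half_lineP y0; exact: fK.
Qed.

Definition re_expc2 (a b y : R) := expR (- (a * y)) * cos (b * y) - 1 + a * y.
Definition im_expc2 (a b y : R) := b * y - expR (- (a * y)) * sin (b * y).

Lemma re_expc2_bound a b y : 0 <= a -> 0 <= y ->
  `|re_expc2 a b y| <= (a ^+ 2 + a + (b ^+ 2 + 2)) * Num.min (y ^+ 2) y.
Proof.
move=> a0 y0; have -> : re_expc2 a b y = expc2 a y - expR (- (a * y)) * (1 - cos (b * y)).
  by rewrite /re_expc2 /expc2; ring.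
rewrite (le_trans (ler_normB _ _))// mulrDl lerD//.
  by rewrite ger0_norm ?expc2_ge0// expc2_le_min.
have e0 := expR_ge0 (- (a * y)).
have e1 : expR (- (a * y)) <= 1 by rewrite -expR0 ler_expR oppr_le0 mulr_ge0.
have c0 := cos_le1 (b * y); have c1 := cos_geN1 (b * y).
have c2 := oneBcos_le (b * y).
rewrite ger0_norm ?mulr_ge0 ?subr_ge0//.
apply: (@le_trans _ _ (1 - cos (b * y))).
  by rewrite ler_piMl// subr_ge0.
have b0 := sqr_ge0 b; have y20 := sqr_ge0 y.
rewrite /Num.min; case: ifPn => h.
  by rewrite exprMn in c2; nra.
rewrite exprMn in c2.
by case: (leP y 1) => y1; nra.
Qed.

Lemma im_expc2_bound a b y : 0 <= a -> 0 <= y ->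
  `|im_expc2 a b y| <= (b ^+ 2 + `|b| * a + 2 * `|b|) * Num.min (y ^+ 2) y.
Proof.
move=> a0 y0.
have e0 := expR_ge0 (- (a * y)).
have e1 : expR (- (a * y)) <= 1 by rewrite -expR0 ler_expR oppr_le0 mulr_ge0.
have e2 : 1 - a * y <= expR (- (a * y)) := expR_ge1Dx _.
have b0 := normr_ge0 b.
have s1 : `|sin (b * y)| <= `|b| * y by rewrite (le_trans (sin_norm_le _))// normrM (ger0_norm y0).
have h : `|im_expc2 a b y| <= `|b * y - sin (b * y)| + (1 - expR (- (a * y))) * `|sin (b * y)|.
  have -> : im_expc2 a b y = (b * y - sin (b * y)) + (1 - expR (- (a * y))) * sin (b * y).
    by rewrite /im_expc2; ring.
  by rewrite (le_trans (ler_normD _ _))// normrM [X in _ + X * _]ger0_norm ?subr_ge0.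
have s0 := normr_ge0 (sin (b * y)).
have ay0 : 0 <= a * y by exact: mulr_ge0.
have ba : 0 <= `|b| * a by exact: mulr_ge0.
apply: (@le_min_sqr_id _ (b ^+ 2 + `|b| * a) (2 * `|b|)).
- exact: y0.
- by rewrite addr_ge0 ?sqr_ge0.
- exact: mulr_ge0.
- by rewrite lerDl mulr_ge0.
- by rewrite lerDr addr_ge0 ?sqr_ge0.
- apply: (le_trans h); rewrite [leRHS]mulrDl lerD//.
    by rewrite -exprMn subr_sin_le.
  apply: (@le_trans _ _ (a * y * (`|b| * y))); last by rewrite le_eqVlt; apply/orP; left; apply/eqP; ring.
  by apply: ler_pM => //; lra.
- rewrite /im_expc2; apply: (le_trans (ler_normB _ _)).
  rewrite (_ : 2 * `|b| * y = `|b| * y + `|b| * y); last by ring.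
  rewrite lerD//; first by rewrite normrM (ger0_norm y0).
  by rewrite normrM (ger0_norm e0) (le_trans _ s1)// ler_piMl.
Qed.

Lemma measurable_expRN (a : R) : measurable_fun setT (fun y : measurableTypeR R => expR (- (a * y))).
Proof. by apply: measurableT_comp => //; apply: measurableT_comp => //; exact: measurable_funM. Qed.

Lemma measurable_cosM (b : R) : measurable_fun setT (fun y : measurableTypeR R => cos (b * y)).
Proof.
apply: measurableT_comp; last exact: measurable_funM.
by apply: continuous_measurable_fun; exact: continuous_cos.
Qed.

Lemma measurable_sinM (b : R) : measurable_fun setT (fun y : measurableTypeR R => sin (b * y)).
Proof.
apply: measurableT_comp; last exact: measurable_funM.
by apply: continuous_measurable_fun; exact: continuous_sin.
Qed.

Lemma measurable_re_expc2 a b : measurable_fun setT (re_expc2 a b : measurableTypeR R -> R).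
Proof.
apply: measurable_funD; last exact: measurable_funM.
apply: measurable_funB => //; apply: measurable_funM; first exact: measurable_expRN.
exact: measurable_cosM.
Qed.

Lemma measurable_im_expc2 a b : measurable_fun setT (im_expc2 a b : measurableTypeR R -> R).
Proof.
apply: measurable_funB; first exact: measurable_funM.
apply: measurable_funM; first exact: measurable_expRN.
exact: measurable_sinM.
Qed.

Lemma measurable_expc2 u : measurable_fun setT (expc2 u : measurableTypeR R -> R).
Proof.
apply: measurable_funD; last exact: measurable_funM.
by apply: measurable_funB => //; exact: measurable_expRN.
Qed.

Lemma re_expc2_integrable a b : 0 <= a -> (levy c).-integrable D (EFin \o re_expc2 a b).
Proof.
move=> a0; apply: levy_integrable; first exact: measurable_re_expc2.
by move=> y y0; exact: re_expc2_bound a0 (ltW y0).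
Qed.

Lemma im_expc2_integrable a b : 0 <= a -> (levy c).-integrable D (EFin \o im_expc2 a b).
Proof.
move=> a0; apply: levy_integrable; first exact: measurable_im_expc2.
by move=> y y0; exact: im_expc2_bound a0 (ltW y0).
Qed.

Lemma expc2_integrable u : 0 <= u -> (levy c).-integrable D (EFin \o expc2 u).
Proof.
move=> u0; apply: levy_integrable; first exact: measurable_expc2.
by move=> y y0; rewrite ger0_norm ?expc2_ge0//; exact: expc2_le_min u0 (ltW y0).
Qed.

Lemma re_psi_integrand (a b y : R) :
  complex.Re (expC (- ((a +i* b) * y%:C)) - 1 + (a +i* b) * y%:C) = re_expc2 a b y.
Proof.
rewrite /expC /re_expc2 /=; have -> : a * y - b * 0 = a * y by ring.
have -> : a * 0 + b * y = b * y by ring.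
by rewrite cosN.
Qed.

Lemma im_psi_integrand (a b y : R) :
  complex.Im (expC (- ((a +i* b) * y%:C)) - 1 + (a +i* b) * y%:C) = im_expc2 a b y.
Proof.
rewrite /expC /im_expc2 /=; have -> : a * y - b * 0 = a * y by ring.
have -> : a * 0 + b * y = b * y by ring.
by rewrite sinN; ring.
Qed.

Lemma psiE a b : psi c (a +i* b) =
  (sigma c ^+ 2 * (a ^+ 2 - b ^+ 2) + drift c * a + \int[levy c]_(y in D) re_expc2 a b y) +i*
  (sigma c ^+ 2 * (2 * (a * b)) + drift c * b + \int[levy c]_(y in D) im_expc2 a b y).
Proof.
rewrite /psi /integralC.
have -> : \int[levy c]_(y in D) complex.Re (expC (- ((a +i* b) * y%:C)) - 1 + (a +i* b) * y%:C) =
  \int[levy c]_(y in D) re_expc2 a b y.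
  by apply: eq_Rintegral => y _; exact: re_psi_integrand.
have -> : \int[levy c]_(y in D) complex.Im (expC (- ((a +i* b) * y%:C)) - 1 + (a +i* b) * y%:C) =
  \int[levy c]_(y in D) im_expc2 a b y.
  by apply: eq_Rintegral => y _; exact: im_psi_integrand.
rewrite expr2; simpc; congr (_ +i* _); ring.
Qed.

Definition psiR u : R := sigma c ^+ 2 * u ^+ 2 + drift c * u + \int[levy c]_(y in D) expc2 u y.

Lemma psi_real u : psi c u%:C = (psiR u)%:C.
Proof.
have -> : u%:C = u +i* 0 by [].
rewrite psiE /psiR; congr (_ +i* _).
  rewrite expr0n subr0; congr (_ + _); apply: eq_Rintegral => y _.
  by rewrite /re_expc2 /expc2 mul0r cos0 mulr1.
rewrite mulr0 mulr0 mulr0 mulr0 addr0 add0r.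
rewrite (_ : (fun y => im_expc2 u 0 y) = cst 0).
  by rewrite Rintegral_cst// mul0r.
by apply/funext => y; rewrite /im_expc2 !mul0r sin0 mulr0 subrr.
Qed.

Lemma phi_real u : u != 0 -> phi c u%:C = (psiR u / u)%:C.
Proof.
move=> u0; rewrite /phi.
have /negbTE -> : u%:C != 0 by rewrite (fmorph_eq0 (real_complex R)).
by rewrite psi_real rmorphM/= fmorphV.
Qed.

Lemma phiRE u : u != 0 -> phiR c u = psiR u / u.
Proof. by move=> u0; rewrite /phiR phi_real. Qed.

Lemma phi_phiR u : u != 0 -> phi c u%:C = (phiR c u)%:C.
Proof. by move=> u0; rewrite phi_real// phiRE. Qed.

(** The integrand is positive at every y > 0, so a vanishing integral leaves no mass there. *)
Lemma levy_null u : 0 < u -> \int[levy c]_(y in D) expc2 u y = 0 -> levy c D = 0%E.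
Proof.
move=> u0 Z.
have Ze : (\int[levy c]_(y in D) `|(expc2 u y)%:E| = 0)%E.
  under eq_integral do rewrite gee0_abs ?lee_fin ?expc2_ge0//.
  rewrite -[LHS]fineK; last exact/integrable_fin_num/expc2_integrable/ltW.
  by congr (_%:E); exact: Z.
have me : measurable_fun D (EFin \o (expc2 u : measurableTypeR R -> R)).
  by apply/measurable_EFinP; apply: measurable_funTS; exact: measurable_expc2.
have [N [mN N0 NP]] := proj1 (@ae_eq_integral_abs _ _ _ (levy c) D mD _ me) Ze.
apply/eqP; rewrite -measure_le0 -N0; apply: le_measure; rewrite ?inE//.
move=> y /pos_half_lineP y0; apply: NP => /= h.
have : (0 < expc2 u y)%R.
  rewrite /expc2; have := @expR_gt1Dx R (- (u * y)).
  by rewrite oppr_eq0 mulf_eq0 !gt_eqF// => /(_ isT); lra.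
by have [->] := h (proj2 (pos_half_lineP y) y0); rewrite ltxx.
Qed.

Lemma psiR_gt0 u : 0 < u -> 0 < psiR u.
Proof.
move=> u0; have [s0 d0 _ _ nz] := adm.
have i0 : 0 <= \int[levy c]_(y in D) expc2 u y.
  by apply: Rintegral_ge0 => y _; exact: expc2_ge0.
have t1 : 0 <= sigma c ^+ 2 * u ^+ 2 by rewrite mulr_ge0 ?sqr_ge0.
have t2 : 0 <= drift c * u by rewrite mulr_ge0// ltW.
rewrite lt_neqAle !addr_ge0// andbT; apply/negP => /eqP E.
apply: nz; split.
- have : sigma c ^+ 2 * u ^+ 2 = 0 by move: E; rewrite /psiR; lra.
  by move/eqP; rewrite mulf_eq0 !sqrf_eq0 (gt_eqF u0) orbF => /eqP.
- have : drift c * u = 0 by move: E; rewrite /psiR; lra.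
  by move/eqP; rewrite mulf_eq0 (gt_eqF u0) orbF => /eqP.
- by apply: (levy_null u0); move: E; rewrite /psiR; lra.
Qed.

Lemma phiR_gt0 u : 0 < u -> 0 < phiR c u.
Proof. by move=> u0; rewrite phiRE ?gt_eqF// divr_gt0// psiR_gt0. Qed.

Let int_div u k : 0 < u -> (\int[levy c]_(y in D) expc2 u y) / k = \int[levy c]_(y in D) (expc2 u y / k).
Proof. by move=> u0; rewrite RintegralZr//; exact/expc2_integrable/ltW. Qed.

Let div_integrable u k : 0 < u -> (levy c).-integrable D (EFin \o (fun y => expc2 u y / k)).
Proof.
move=> u0; have := integrable_scale mD k^-1 (expc2_integrable (ltW u0)).
by congr (integrable _ _ (EFin \o _)); apply/funext => y; rewrite mulrC.
Qed.

Lemma phiR_integral u : 0 < u ->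
  phiR c u = sigma c ^+ 2 * u + drift c + \int[levy c]_(y in D) (expc2 u y / u).
Proof.
move=> u0; rewrite -int_div// phiRE ?gt_eqF// /psiR; field; rewrite gt_eqF//.
Qed.

Lemma phiR_homo u v : 0 < u -> u <= v -> phiR c u <= phiR c v.
Proof.
move=> u0 uv; have v0 := lt_le_trans u0 uv.
rewrite !phiR_integral// lerD//; first by rewrite lerD2r ler_wpM2l// sqr_ge0.
apply: le_Rintegral => //; try exact: div_integrable.
by move=> y /pos_half_lineP y0; apply: expc2_div_homo => //; exact: ltW.
Qed.

Lemma phiR_div_integral u : 0 < u ->
  phiR c u / u = sigma c ^+ 2 + drift c / u + \int[levy c]_(y in D) (expc2 u y / u ^+ 2).
Proof.
by move=> u0; rewrite -int_div// phiRE ?gt_eqF// /psiR; field; rewrite gt_eqF.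
Qed.

Lemma phiR_div_homo u v : 0 < u -> u <= v -> phiR c v / v <= phiR c u / u.
Proof.
move=> u0 uv; have v0 := lt_le_trans u0 uv; have [_ d0 _ _ _] := adm.
rewrite !phiR_div_integral// lerD//; first by rewrite lerD2l ler_wpM2l// lef_pV2.
apply: le_Rintegral => //; try exact: div_integrable.
by move=> y /pos_half_lineP y0; apply: expc2_div2_homo => //; exact: ltW.
Qed.

Let dexpc2_integrable u : 2^-1 <= u -> (levy c).-integrable D (EFin \o dexpc2 u).
Proof.
move=> u2; apply: (@levy_integrable _ 4).
  apply: measurable_funM => //; apply: measurable_funB => //; apply: measurable_funM.
    exact: measurable_expRN.
  by apply: measurable_funD => //; exact: measurable_funM.
by move=> y y0; have /andP[h1 h2] := dexpc2_bound u2 (ltW y0); rewrite ger0_norm.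
Qed.

Lemma is_derive_phiR (u : R) : 1 <= u ->
  is_derive u 1 (phiR c) (sigma c ^+ 2 + \int[levy c]_(y in D) dexpc2 u y).
Proof.
move=> u1; pose f (x y : R) := expc2 x y / x.
have u0 : 0 < u by lra.
have dF (x y : R) : 0 < x -> is_derive x 1 (f ^~ y) (dexpc2 x y) by exact: is_derive_expc2_div.
have Iu : (`]2^-1, u + 1[%classic : set R) u by rewrite /= in_itv/=; apply/andP; split; lra.
have Ipos x : (`]2^-1, u + 1[%classic : set R) x -> 2^-1 <= x /\ 0 < x.
  by rewrite /= in_itv/= => /andP[h _]; split; lra.
have If x : (`]2^-1, u + 1[%classic : set R) x -> (levy c).-integrable D (EFin \o f x).
  by move=> /Ipos[_ x0]; exact: div_integrable.
have df x y : (`]2^-1, u + 1[%classic : set R) x -> D y -> derivable (f ^~ y) x 1.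
  by move=> /Ipos[_ x0] _; have [] := dF x y x0.
have G0 (y : measurableTypeR R) : 0 <= 4 * `|Num.min (y ^+ 2) y| by rewrite mulr_ge0.
have iG : (levy c).-integrable D (EFin \o (fun y : R => 4 * `|Num.min (y ^+ 2) y|)).
  by apply: integrable_scale => //; have := integrable_abse levy_min_integrable.
have pE (x y : R) : 0 < x -> partial1of2 f x y = dexpc2 x y.
  by move=> x0; rewrite partial1of2E; have [_ ->] := dF x y x0.
have Gub x y : (`]2^-1, u + 1[%classic : set R) x -> D y -> `|partial1of2 f x y| <= 4 * `|Num.min (y ^+ 2) y|.
  move=> /Ipos[x2 x0] /pos_half_lineP y0; rewrite pE//.
  have /andP[h1 h2] := dexpc2_bound x2 (ltW y0).
  by rewrite ger0_norm// (le_trans h2)// ler_wpM2l// ler_norm.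
have d1 := derivable_under_integral mD Iu If df G0 iG Gub.
have d2 := differentiation_under_integral mD Iu If df G0 iG Gub.
have dI : is_derive u 1 (fun x => \int[levy c]_(y in D) f x y) (\int[levy c]_(y in D) dexpc2 u y).
  apply: DeriveDef => //; rewrite -derive1E d2.
  by apply: eq_Rintegral => y _; rewrite pE.
have : is_derive u 1 (fun x => sigma c ^+ 2 * x + drift c + \int[levy c]_(y in D) f x y)
   (sigma c ^+ 2 + \int[levy c]_(y in D) dexpc2 u y).
  by deriv; ring.
apply: near_eq_is_derive => //.
near=> x; rewrite phiR_integral//; near: x; exact: lt_nbhsr.
Unshelve. all: by end_near.
Qed.

Lemma phiR_derive1_ge u : 1 <= u -> phiR c (u + 1) - phiR c u <= derive1 (phiR c) u.
Proof.
move=> u1; have [_ E] := is_derive_phiR u1; rewrite derive1E E.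
have u0 : 0 < u by lra. have v0 : 0 < u + 1 by lra.
rewrite !phiR_integral//.
have := @le_Rintegral _ _ _ (levy c) D (fun y => expc2 (u + 1) y / (u + 1) - expc2 u y / u) (dexpc2 u) mD.
rewrite RintegralB//; try exact: div_integrable.
move=> h; suff : \int[levy c]_(x in D) (expc2 (u + 1) x / (u + 1)) -
  \int[levy c]_(x in D) (expc2 u x / u) <= \int[levy c]_(x in D) dexpc2 u x by lra.
apply: h.
- have i1 := div_integrable (u + 1) v0.
  have i2 := integrable_scale mD (-1) (div_integrable u u0).
  by have := integrable_add mD i1 i2; congr (integrable _ _ (EFin \o _)); apply/funext => y; ring.
- by apply: dexpc2_integrable; lra.
- by move=> y /pos_half_lineP y0; apply: dexpc2_ge_diff => //; exact: ltW.
Qed.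

Lemma phiR_derive1_le u : 1 < u -> derive1 (phiR c) u <= phiR c u - phiR c (u - 1).
Proof.
move=> u1; have [_ E] := is_derive_phiR (ltW u1); rewrite derive1E E.
have u0 : 0 < u by lra. have v0 : 0 < u - 1 by lra.
rewrite !phiR_integral//.
have := @le_Rintegral _ _ _ (levy c) D (dexpc2 u) (fun y => expc2 u y / u - expc2 (u - 1) y / (u - 1)) mD.
rewrite RintegralB//; try exact: div_integrable.
move=> h; suff : \int[levy c]_(x in D) dexpc2 u x <= \int[levy c]_(x in D) (expc2 u x / u) -
  \int[levy c]_(x in D) (expc2 (u - 1) x / (u - 1)) by lra.
apply: h.
- by apply: dexpc2_integrable; lra.
- have i1 := div_integrable u u0.
  have i2 := integrable_scale mD (-1) (div_integrable (u - 1) v0).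
  by have := integrable_add mD i1 i2; congr (integrable _ _ (EFin \o _)); apply/funext => y; ring.
- by move=> y /pos_half_lineP y0; apply: dexpc2_le_diff => //; exact: ltW.
Qed.

(* [Re (psi z * conj z) >= |z|^2 psi(Re z) / Re z], since the y-derivatives of the integrands
   compare as [1 - e^{-ay} cos(by) >= 1 - e^{-ay}]. *)
Lemma psi_neq0 z : 0 < complex.Re z -> psi c z != 0.
Proof.
case: z => a b /= a0; have [s0 d0 _ _ _] := adm.
have N0 : 0 < a ^+ 2 + b ^+ 2 by rewrite ltr_pwDl ?exprn_gt0 ?sqr_ge0.
have I1 := re_expc2_integrable b (ltW a0); have I2 := im_expc2_integrable b (ltW a0).
have J : (a ^+ 2 + b ^+ 2) / a * \int[levy c]_(y in D) expc2 a y <=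
   a * \int[levy c]_(y in D) re_expc2 a b y + b * \int[levy c]_(y in D) im_expc2 a b y.
  rewrite -!RintegralZl//; last exact/expc2_integrable/ltW.
  rewrite -RintegralD//; try exact: integrable_scale.
  apply: le_Rintegral => //.
  - by apply: integrable_scale => //; exact/expc2_integrable/ltW.
  - by apply: integrable_add => //; exact: integrable_scale.
  - move=> y /pos_half_lineP y0.
    apply: (@le_of_derive _ (fun y => (a ^+ 2 + b ^+ 2) / a * expc2 a y)
      (fun y => a * re_expc2 a b y + b * im_expc2 a b y)
      (fun y => (a ^+ 2 + b ^+ 2) * (1 - expR (- (a * y))))
      (fun y => (a ^+ 2 + b ^+ 2) * (1 - expR (- (a * y)) * cos (b * y)))).
    + exact: ltW.
    + by rewrite expc20 /re_expc2 /im_expc2 !mulr0 oppr0 expR0 cos0 sin0; lra.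
    + move=> x _; have h := is_derive_expc2 a x; deriv; field; rewrite gt_eqF//.
    + by move=> x _; rewrite /re_expc2 /im_expc2; deriv; ring.
    + move=> x x0; rewrite (ler_wpM2l (ltW N0))// lerD2l lerN2.
      by rewrite ler_piMr ?expR_ge0// cos_le1.
apply/negP => /eqP; rewrite psiE => -[E1 E2].
have P := psiR_gt0 a0.
have : 0 < (a ^+ 2 + b ^+ 2) / a * psiR a by rewrite mulr_gt0// divr_gt0.
have -> : (a ^+ 2 + b ^+ 2) / a * psiR a = (a ^+ 2 + b ^+ 2) * (sigma c ^+ 2 * a + drift c) +
   (a ^+ 2 + b ^+ 2) / a * \int[levy c]_(y in D) expc2 a y.
  by rewrite /psiR; field; rewrite gt_eqF.
set X := \int[levy c]_(y in D) re_expc2 a b y in J E1.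
set Y := \int[levy c]_(y in D) im_expc2 a b y in J E2.
have : a * (sigma c ^+ 2 * (a ^+ 2 - b ^+ 2) + drift c * a + X) +
   b * (sigma c ^+ 2 * (2 * (a * b)) + drift c * b + Y) = 0.
  by rewrite E1 E2 !mulr0 addr0.
have -> : a * (sigma c ^+ 2 * (a ^+ 2 - b ^+ 2) + drift c * a + X) +
   b * (sigma c ^+ 2 * (2 * (a * b)) + drift c * b + Y) =
   (a ^+ 2 + b ^+ 2) * (sigma c ^+ 2 * a + drift c) + (a * X + b * Y) by ring.
lra.
Qed.

Lemma phi_neq0 z : 0 < complex.Re z -> phi c z != 0.
Proof.
move=> z0; rewrite /phi; have zn : z != 0 by apply: contraTneq z0 => ->; rewrite ltxx.
by rewrite (negbTE zn) mulf_neq0 ?psi_neq0// invr_neq0.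
Qed.

End characteristic_exponent.

Lemma in_N_admissible (R : realType) (c : triplet R) : in_N c -> admissible c.
Proof.
move=> [s0 d0 sf i nz]; split => //.
by move=> [? _ ?]; apply: nz.
Qed.

(** * Moments of the exponential functional *)

Section lifting.
Context d (T1 : measurableType d) d' (T2 : measurableType d') (R : realType).
Context (m1 : {measure set T1 -> \bar R}) (m2 : {measure set T2 -> \bar R}).
Import HBNNSimple.

(** Simple functions, then monotone convergence. The weights F and G carry the remaining factors of
    a product, so that functions of several variables can be treated one variable at a time. *)
Lemma weighted_integral_lift (F : T1 -> R) (G : T2 -> R)
    (U : T1 -> measurableTypeR R) (V : T2 -> measurableTypeR R) (f : R -> R) :
  measurable_fun setT F -> (forall w, 0 <= F w) ->
  measurable_fun setT G -> (forall w, 0 <= G w) ->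
  measurable_fun setT U -> measurable_fun setT V ->
  (forall B : set (measurableTypeR R), measurable B ->
    (\int[m1]_w (F w * \1_B (U w))%:E = \int[m2]_w (G w * \1_B (V w))%:E)%E) ->
  measurable_fun setT (f : measurableTypeR R -> R) -> (forall x, 0 <= f x) ->
  (\int[m1]_w (F w * f (U w))%:E = \int[m2]_w (G w * f (V w))%:E)%E.
Proof.
move=> mF F0 mG G0 mU mV FG mf f0.
have mf' : measurable_fun setT (EFin \o (f : measurableTypeR R -> R)) by exact/measurable_EFinP.
pose s := nnsfun_approx measurableT mf'.
have cs x : s n x @[n --> \oo] --> f x.
  have h : forall y : measurableTypeR R, setT y -> (0 <= (EFin \o f) y)%E.
    by move=> y _; rewrite lee_fin.
  by have /fine_cvgP[] := @cvg_nnsfun_approx _ _ _ _ measurableT _ mf' h x I.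
have ms d0 (T : measurableType d0) (W : T -> measurableTypeR R) n :
    measurable_fun setT W -> measurable_fun setT (fun w => s n (W w)).
  by move=> mW; apply: measurableT_comp => //; exact: measurable_funPT.
have mono d0 (T : measurableType d0) (m : {measure set T -> \bar R}) (H : T -> R) (W : T -> measurableTypeR R) :
    measurable_fun setT H -> (forall w, 0 <= H w) -> measurable_fun setT W ->
    (\int[m]_w (H w * f (W w))%:E = limn (fun n => \int[m]_w (H w * s n (W w))%:E))%E.
  move=> mH H0 mW.
  rewrite -monotone_convergence//.
  - apply: eq_integral => w _; apply/esym/cvg_lim => //; apply: cvg_EFin; first exact: nearW.
    by apply: cvgM; [exact: cvg_cst|exact: cs].
  - by move=> n; apply/measurable_EFinP; apply: measurable_funM => //; exact: ms.
  - by move=> n w _; rewrite lee_fin mulr_ge0// fun_ge0.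
  - move=> w _ k n kn; rewrite lee_fin ler_wpM2l//.
    by have /lefP := nd_nnsfun_approx measurableT mf' kn; apply.
rewrite !mono//; congr (limn _); apply/funext => n.
have S d0 (T : measurableType d0) (m : {measure set T -> \bar R}) (H : T -> R) (W : T -> measurableTypeR R) :
    measurable_fun setT H -> (forall w, 0 <= H w) -> measurable_fun setT W ->
    (\int[m]_w (H w * s n (W w))%:E =
     \sum_(y <- finmap.enum_fset (fset_set (range (s n)))) (`|y|%:E * \int[m]_w (H w * \1_(s n @^-1` [set y]) (W w))%:E))%E.
  move=> mH H0 mW.
  under eq_bigr => y _.
    rewrite -ge0_integralZl_EFin//; last 2 first.
    - by move=> w _; rewrite lee_fin mulr_ge0// indicE ler0n.
    - apply/measurable_EFinP; apply: measurable_funM => //.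
      by apply: measurableT_comp => //; apply: measurable_indic; exact: measurable_funPTI.
    over.
  rewrite -ge0_integral_sum//.
  - apply: eq_integral => w _; rewrite fimfunE fsbig_finite//= mulr_sumr sumEFin.
    rewrite big_seq [in RHS]big_seq; congr (_%:E); apply: eq_bigr => y.
    rewrite in_fset_set// inE => -[x _ <-].
    by rewrite ger0_norm ?fun_ge0// mulrCA.
  - move=> y; apply: measurable_funeM; apply/measurable_EFinP; apply: measurable_funM => //.
    by apply: measurableT_comp => //; apply: measurable_indic; exact: measurable_funPTI.
  - by move=> y w _; rewrite mule_ge0 ?lee_fin// mulr_ge0// indicE ler0n.
rewrite !S//; apply: eq_bigr => y _; congr (_ * _)%E; apply: FG.
exact: measurable_funPTI.
Qed.

End lifting.

Section family_induction.
Context {R : realType}.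
Implicit Types (h : nat -> R -> R) (B : nat -> set (measurableTypeR R)).

Definition nonneg_family h := forall i,
  measurable_fun setT (h i : measurableTypeR R -> R) /\ forall x, 0 <= h i x.

Definition update h k (f : R -> R) i := if i == k then f else h i.

(** Passes from families of indicators to families of nonnegative functions, by induction on the
    number k of indices at which the family need not consist of indicators. *)
Lemma nonneg_family_induction (n : nat) (Q : (nat -> R -> R) -> Prop) :
  (forall h h', (forall i, (i < n)%N -> h i = h' i) -> Q h -> Q h') ->
  (forall B, (forall i, measurable (B i)) -> Q (fun i => \1_(B i))) ->
  (forall k h, (k < n)%N -> nonneg_family h ->
    (forall A : set (measurableTypeR R), measurable A -> Q (update h k \1_A)) -> Q h) ->
  forall h, nonneg_family h -> Q h.
Proof.
move=> Qext Q1 Qstep.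
have key k : (k <= n)%N -> forall h B, nonneg_family h -> (forall i, measurable (B i)) ->
    (forall i, (k <= i)%N -> h i = \1_(B i)) -> Q h.
  elim: k => [|k ih] kn h B hh mB hB.
    by apply: (Qext (fun i => \1_(B i))); [move=> i _; rewrite hB|exact: Q1].
  apply: (Qstep k) => // A mA.
  apply: (ih (ltnW kn) _ (fun i => if i == k then A else B i)).
  - move=> i; rewrite /update; case: ifP => _; last exact: hh.
    by split; [exact: measurable_indic|move=> x; rewrite indicE].
  - by move=> i; case: ifP.
  - move=> i ki; rewrite /update; case: eqVneq => [//|ik].
    by apply: hB; rewrite ltn_neqAle eq_sym ik.
move=> h hh.
(* [Q] only sees the indices below n, so the other functions may be taken to be indicators. *)
pose h' i : R -> R := if (i < n)%N then h i else \1_([set: R]).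
apply: (Qext h'); first by move=> i ni; rewrite /h' ni.
apply: (key n _ h' (fun=> setT)) => //.
- move=> i; rewrite /h'; case: ifP => _; first exact: hh.
  by split; [exact: measurable_indic|move=> x; rewrite indicE].
- by move=> i ni; rewrite /h' ltnNge ni.
Qed.

End family_induction.

(** * Expectations of products *)

Section independence.
Context d (Omega : measurableType d) (R : realType) (Pr : probability Omega R).
Variables (n : nat) (U : nat -> Omega -> measurableTypeR R).
Hypothesis mU : forall i, (i < n)%N -> measurable_fun setT (U i).

Let prod_measurable (h : nat -> R -> R) (r : seq nat) (P : pred nat) :
  nonneg_family h -> (forall i, i \in r -> (i < n)%N) ->
  measurable_fun setT (fun w => \prod_(i <- r | P i) h i (U i w)).
Proof.
move=> hh rn; rewrite (_ : (fun w => _) = (fun w => \prod_(i <- [seq i <- r | P i]) h i (U i w))); last first.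
  by apply/funext => w; rewrite big_filter.
have : forall i, i \in [seq i <- r | P i] -> (i < n)%N by move=> i; rewrite mem_filter => /andP[_ /rn].
elim: [seq i <- r | P i] => [|i l ih] ln.
  by under eq_fun do rewrite big_nil; exact: measurable_cst.
under eq_fun do rewrite big_cons; apply: measurable_funM.
  by apply: measurableT_comp; [have [] := hh i|apply: mU; apply: ln; rewrite mem_head].
by apply: ih => j jl; apply: ln; rewrite inE jl orbT.
Qed.

Let prod_split (h : nat -> R -> R) k w : (k < n)%N ->
  \prod_(0 <= i < n) h i (U i w) = (\prod_(0 <= i < n | i != k) h i (U i w)) * h k (U k w).
Proof.
move=> kn; rewrite (bigD1_seq k)/= ?iota_uniq ?mem_index_iota// mulrC.
by [].
Qed.

Let prod_update (h : nat -> R -> R) k f w : (k < n)%N ->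
  \prod_(0 <= i < n) update h k f i (U i w) = (\prod_(0 <= i < n | i != k) h i (U i w)) * f (U k w).
Proof.
move=> kn; rewrite (prod_split _ _ kn) /update eqxx; congr (_ * _).
by apply: eq_bigr => i /negbTE ->.
Qed.

Lemma prod_indic (B : nat -> set R) w :
  \prod_(0 <= i < n) \1_(B i) (U i w) = \1_(\bigcap_(i in `I_n) [set w | B i (U i w)]) w :> R.
Proof.
elim: n => [|m ih]; first by rewrite big_nil II0 bigcap_set0 indicT.
rewrite big_nat_recr//= ih IIS bigcap_setU bigcap_set1 indicI /=.
by congr (_ * _); rewrite !indicE /=; congr (_%:R); apply/idP/idP; rewrite !inE.
Qed.

(** Meant for the survival indicator F of the event s < zeta, with k its probability: independence
    on events becomes independence on products of nonnegative functions. *)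
Lemma weighted_family_lift (F : Omega -> R) (k : R) :
  measurable_fun setT F -> (forall w, 0 <= F w) -> 0 <= k ->
  (forall B, (forall i, measurable (B i : set (measurableTypeR R))) ->
    (\int[Pr]_w (F w * \prod_(0 <= i < n) \1_(B i) (U i w))%:E =
     k%:E * \int[Pr]_w (\prod_(0 <= i < n) \1_(B i) (U i w))%:E)%E) ->
  forall h, nonneg_family h ->
    (\int[Pr]_w (F w * \prod_(0 <= i < n) h i (U i w))%:E =
     k%:E * \int[Pr]_w (\prod_(0 <= i < n) h i (U i w))%:E)%E.
Proof.
move=> mF F0 k0 FB.
have kE h : nonneg_family h -> (k%:E * \int[Pr]_w (\prod_(0 <= i < n) h i (U i w))%:E =
   \int[Pr]_w (k * \prod_(0 <= i < n) h i (U i w))%:E)%E.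
  move=> hh; rewrite -ge0_integralZl_EFin//.
  - by move=> w _; rewrite lee_fin prodr_ge0// => i _; have [_] := hh i; apply.
  - by apply/measurable_EFinP; apply: prod_measurable => // i; rewrite mem_index_iota.
apply: nonneg_family_induction (n) _ _ FB _.
- move=> h h' hh'.
  have E w : \prod_(0 <= i < n) h i (U i w) = \prod_(0 <= i < n) h' i (U i w).
    by apply: eq_big_nat => i /andP[_ ni]; rewrite hh'.
  by under eq_integral do rewrite E; under [in X in _ = X -> _]eq_integral do rewrite E.
- move=> j h jn hh hA.
  have hu A : measurable (A : set (measurableTypeR R)) -> nonneg_family (update h j \1_A).
    move=> mA i; rewrite /update; case: ifP => _; last exact: hh.
    by split; [exact: measurable_indic|move=> x; rewrite indicE].
  rewrite kE//.
  under eq_integral do rewrite (prod_split h _ jn) mulrA.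
  under [RHS]eq_integral do rewrite (prod_split h _ jn) mulrA.
  have mp : measurable_fun setT (fun w => \prod_(0 <= i < n | i != j) h i (U i w)).
    by apply: prod_measurable => // i; rewrite mem_index_iota.
  have p0 w : 0 <= \prod_(0 <= i < n | i != j) h i (U i w).
    by apply: prodr_ge0 => i _; have [_] := hh i; apply.
  apply: weighted_integral_lift.
  + exact: measurable_funM.
  + by move=> w; rewrite mulr_ge0.
  + exact: measurable_funM.
  + by move=> w; rewrite mulr_ge0.
  + exact: mU.
  + exact: mU.
  + move=> B mB; have := hA B mB; rewrite kE; last exact: hu.
    move=> E; transitivity (\int[Pr]_w (F w * \prod_(0 <= i < n) update h j \1_B i (U i w))%:E)%E.
      by apply: eq_integral => w _; rewrite (prod_update _ _ _ jn) mulrA.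
    by rewrite E; apply: eq_integral => w _; rewrite (prod_update _ _ _ jn) mulrA.
  + by have [] := hh j.
  + by have [] := hh j.
Qed.

(** The same coordinatewise lift. Values in [0, 1] keep every expectation finite, so that
    real-valued integrals may be multiplied. *)
Lemma independent_prod_expectation :
  (forall B, (forall i, measurable (B i : set (measurableTypeR R))) ->
    Pr (\bigcap_(i in `I_n) [set w | B i (U i w)]) = (\prod_(0 <= i < n) Pr [set w | B i (U i w)])%E) ->
  forall h, nonneg_family h -> (forall i x, h i x <= 1) ->
    \int[Pr]_w (\prod_(0 <= i < n) h i (U i w)) = \prod_(0 <= i < n) \int[Pr]_w h i (U i w).
Proof.
move=> indep.
pose Q (h : nat -> R -> R) := (forall i x, (i < n)%N -> h i x <= 1) ->
  (\int[Pr]_w (\prod_(0 <= i < n) h i (U i w))%:E = (\prod_(0 <= i < n) \int[Pr]_w h i (U i w))%:E)%E.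
have int1 (f : R -> R) i : (i < n)%N -> measurable_fun setT (f : measurableTypeR R -> R) -> (forall x, 0 <= f x) -> (forall x, f x <= 1) ->
    Pr.-integrable setT (EFin \o (fun w => f (U i w))).
  move=> ni mf f0 f1.
  apply: (integrable_dominated _ _ (finite_measure_integrable_cst Pr 1 measurableT)) => //.
    by apply: measurableT_comp => //; exact: mU.
  by move=> w _ /=; rewrite ger0_norm.
suff H h : nonneg_family h -> Q h.
  by move=> h hh h1; rewrite /Rintegral H// => i x _; exact: h1.
move: h; apply: (nonneg_family_induction (n := n)).
- move=> h h' hh' Qh h1.
  have E2 w : \prod_(0 <= i < n) h' i (U i w) = \prod_(0 <= i < n) h i (U i w).
    by apply: eq_big_nat => i /andP[_ ni]; rewrite hh'.
  under eq_integral do rewrite E2.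
  rewrite Qh; last by move=> i x ni; rewrite hh'// h1.
  by congr (_%:E); apply: eq_big_nat => i /andP[_ ni]; rewrite hh'.
- move=> B mB _.
  have mUB i : (i < n)%N -> measurable [set w | B i (U i w)].
    by move=> ni; rewrite -[X in measurable X]setTI; apply: (mU ni).
  under eq_integral do rewrite prod_indic.
  rewrite integral_indic//; last by apply: fin_bigcap_measurable => // i /= ni; exact: mUB.
  rewrite setIT. etransitivity; first exact: (indep B mB).
  rewrite (big_morph EFin (@EFinM R) erefl); apply: eq_big_nat => i /andP[_ ni].
  rewrite /Rintegral (_ : (fun w => (\1_(B i) (U i w))%:E) = (fun w => (\1_[set w | B i (U i w)] w)%:E)).
    by rewrite integral_indic ?setIT ?fineK ?fin_num_measure//; exact: mUB.
  by apply/funext => w; rewrite !indicE; congr (_%:R%:E); apply/idP/idP; rewrite !inE.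
- move=> j h jn hh hA h1.
  have mp : measurable_fun setT (fun w => \prod_(0 <= i < n | i != j) h i (U i w)).
    by apply: prod_measurable => // i; rewrite mem_index_iota.
  have p0 w : 0 <= \prod_(0 <= i < n | i != j) h i (U i w).
    by apply: prodr_ge0 => i _; have [_] := hh i; apply.
  pose k := \prod_(0 <= i < n | i != j) \int[Pr]_w h i (U i w).
  have k0 : 0 <= k.
    by apply: prodr_ge0 => i _; apply: Rintegral_ge0 => w _; have [_] := hh i; apply.
  have [mhj hj0] := hh j.
  have KE (f : R -> R) : measurable_fun setT (f : measurableTypeR R -> R) -> (forall x, 0 <= f x) -> (forall x, f x <= 1) ->
      (\int[Pr]_w (k * f (U j w))%:E = (k * \int[Pr]_w f (U j w))%:E)%E.
    move=> mf f0 f1; rewrite -RintegralZl//; last exact: int1.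
    rewrite /Rintegral fineK//; apply: integrable_fin_num => //.
    by apply: integrable_scale => //; exact: int1.
  rewrite (bigD1_seq j)/= ?iota_uniq ?mem_index_iota// mulrC -/k -KE//; last by move=> x; exact: h1.
  under eq_integral do rewrite (prod_split h _ jn).
  apply: weighted_integral_lift => //; try exact: mU.
  move=> B mB; have := hA B mB; rewrite /Q => /(_ _).
  have b1 i x : (i < n)%N -> update h j \1_B i x <= 1.
    move=> ni; rewrite /update; case: ifP => _; last exact: h1.
    by rewrite indicE lern1 leq_b1.
  move=> /(_ b1) E.
  transitivity (\int[Pr]_w (\prod_(0 <= i < n) update h j \1_B i (U i w))%:E)%E.
    by apply: eq_integral => w _; rewrite (prod_update _ _ _ jn).
  rewrite E KE//.
  rewrite (bigD1_seq j)/= ?iota_uniq ?mem_index_iota// mulrC; congr (_ * _)%:E.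
    by apply: eq_bigr => i /negbTE ij; rewrite /update ij.
  by rewrite /update eqxx.
Qed.

End independence.

(** * Powers of an integral over a ray *)

Section tail_powers.
Context {R : realType}.
Local Open Scope ereal_scope.
Variable z : measurableTypeR R -> \bar R.
Hypotheses (mz : measurable_fun setT z) (z0 : forall t, 0 <= z t).
Local Notation leb := (@lebesgue_measure R).

Definition tail (s : R) : \bar R := \int[leb]_(t in `[s, +oo[) z t.

Let ind (s t : R) : \bar R := (s <= t)%R%:R%:E.

Let ind_ge0 s t : 0 <= ind s t. Proof. by rewrite lee_fin ler0n. Qed.

Lemma integral_ray (s : R) (f : measurableTypeR R -> \bar R) :
  \int[leb]_(t in `[s, +oo[) f t = \int[leb]_t (ind s t * f t).
Proof.
rewrite integral_mkcond; apply: eq_integral => t _.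
rewrite /patch mem_setE in_itv/= andbT /ind.
by case: (s <= t)%R; rewrite ?mul1e ?mul0e.
Qed.

Let measurable_ind2 : measurable_fun setT (fun p : measurableTypeR R * measurableTypeR R => ind p.1 p.2).
Proof.
apply/measurable_EFinP.
have mA : measurable [set p : measurableTypeR R * measurableTypeR R | (p.1 <= p.2)%R].
  rewrite -[X in measurable X]setTI; exact: measurable_fun_le.
rewrite (_ : (fun p => _) = \1_[set p : measurableTypeR R * measurableTypeR R | (p.1 <= p.2)%R]).
  exact: measurable_indic.
by apply/funext => p; rewrite indicE mem_setE.
Qed.

Lemma tail_ge0 s : 0 <= tail s. Proof. by apply: integral_ge0. Qed.

Lemma measurable_tail : measurable_fun setT (tail : measurableTypeR R -> \bar R).
Proof.
rewrite (_ : tail = (fun s => \int[leb]_t (ind s t * z t))); last first.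
  by apply/funext => s; exact: integral_ray.
apply: (@measurable_fun_fubini_tonelli_F _ _ _ _ _ leb (fun p : measurableTypeR R * measurableTypeR R => ind p.1 p.2 * z p.2)).
  by apply: emeasurable_funM => //; exact: measurableT_comp.
by move=> p; rewrite mule_ge0.
Qed.

(** Formally d(T^(j+1)) = -(j + 1) z T^j dt, but T may be infinite, so Tonelli replaces
    differentiation. In T(s) times the integral of z T^j over [s, +oo[, write T(s) = T(t) + B(t)
    with B(t) the integral of z over [s, t[; exchanging the order of integration in the B-term
    recovers the induction hypothesis and adds 1 to the coefficient. *)
Lemma tail_power j s : tail s ^+ j.+1 =
  j.+1%:R%:E * \int[leb]_(t in `[s, +oo[) (z t * tail t ^+ j).
Proof.
have mT := measurable_tail.
have T0 := tail_ge0.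
have mTj k : measurable_fun setT (fun t : measurableTypeR R => tail t ^+ k).
  elim: k => [|k ih]; first by under eq_fun do rewrite expe0; exact: measurable_cst.
  by under eq_fun do rewrite expeS; exact: emeasurable_funM.
have Tj0 k t : 0 <= tail t ^+ k by exact: expe_ge0.
(* Strict, so that [s, t[ and [t, +oo[ split the ray without overlap. *)
pose ind' (u t : R) : \bar R := (u < t)%R%:R%:E.
have ind'_ge0 u t : 0 <= ind' u t by rewrite lee_fin ler0n.
have mi (a : R) : measurable_fun setT (ind a : measurableTypeR R -> \bar R).
  exact: (measurableT_comp measurable_ind2 (pair1_measurable (a : measurableTypeR R))).
have mi' : measurable_fun setT (fun p : measurableTypeR R * measurableTypeR R => ind' p.1 p.2).
  rewrite (_ : (fun p => _) = (fun p => 1 - ind p.2 p.1)).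
    apply: emeasurable_funB => //.
    exact: (measurableT_comp measurable_ind2 (@measurable_swap _ _ (measurableTypeR R) (measurableTypeR R))).
  apply/funext => p; rewrite /ind' /ind ltNge -EFinB; congr (_%:E).
  by case: (_ <= _)%R; rewrite /= ?subrr ?subr0.
have mi'l (t : R) : measurable_fun setT (fun u : measurableTypeR R => ind' u t).
  exact: (measurableT_comp mi' (pair2_measurable (t : measurableTypeR R))).
have mi'r (u : R) : measurable_fun setT (fun t : measurableTypeR R => ind' u t).
  exact: (measurableT_comp mi' (pair1_measurable (u : measurableTypeR R))).
have open_ray (u : R) (f : measurableTypeR R -> \bar R) : measurable_fun setT f ->
    \int[leb]_t (ind' u t * f t) = \int[leb]_(t in `[u, +oo[) f t.
  move=> mf; rewrite -integral_itv_obnd_cbnd; last exact: measurable_funTS.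
  rewrite [RHS]integral_mkcond; apply: eq_integral => t _.
  rewrite /patch mem_setE in_itv/= andbT /ind'.
  by case: (u < t)%R; rewrite ?mul1e ?mul0e.
elim: j s => [|j ih] s.
  by rewrite mul1e expeS expe0 mule1; apply: eq_integral => t _; rewrite expe0 mule1.
pose g t := z t * tail t ^+ j.
have mg : measurable_fun setT (g : measurableTypeR R -> \bar R) by exact: emeasurable_funM.
have g0 t : 0 <= g t by exact: mule_ge0.
pose B t := \int[leb]_u (ind s u * ind' u t * z u).
have mB : measurable_fun setT (B : measurableTypeR R -> \bar R).
  apply: (@measurable_fun_fubini_tonelli_F _ _ _ _ _ leb (fun p : measurableTypeR R * measurableTypeR R => ind s p.2 * ind' p.2 p.1 * z p.2)).
    apply: emeasurable_funM; last exact: measurableT_comp.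
    apply: emeasurable_funM; first exact: (measurableT_comp (mi s)).
    exact: (measurableT_comp mi' (@measurable_swap _ _ (measurableTypeR R) (measurableTypeR R))).
  by move=> p; rewrite !mule_ge0.
have B0 t : 0 <= B t by apply: integral_ge0 => u _; rewrite !mule_ge0.
have splitT t : (s <= t)%R -> tail s = tail t + B t.
  move=> st; rewrite /tail !integral_ray -ge0_integralD//; last 4 first.
  - by move=> u _; rewrite mule_ge0.
  - exact: emeasurable_funM.
  - by move=> u _; rewrite !mule_ge0.
  - by do 2 apply: emeasurable_funM => //.
  apply: eq_integral => u _; rewrite /ind /ind'.
  have [tu|ut] := leP t u; first by rewrite (le_trans st tu) mul1e mule0 mul0e adde0.
  by rewrite mul0e add0e mule1.
have E1 : tail s * \int[leb]_(t in `[s, +oo[) g t =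
    \int[leb]_(t in `[s, +oo[) (z t * tail t ^+ j.+1) + \int[leb]_t (ind s t * g t * B t).
  rewrite !integral_ray -ge0_integralZl//; last 2 first.
  - exact: emeasurable_funM.
  - by move=> t _; rewrite mule_ge0.
  rewrite -ge0_integralD//; last 4 first.
  - by move=> t _; rewrite !mule_ge0.
  - by do 2 apply: emeasurable_funM => //.
  - by move=> t _; rewrite !mule_ge0.
  - by do 2 apply: emeasurable_funM => //.
  apply: eq_integral => t _; rewrite /ind.
  have [st|ts] := leP s t; last by rewrite !mul0e mule0 adde0.
  rewrite !mul1e (splitT _ st) ge0_muleDl// /g expeS; congr (_ + _).
    by rewrite muleCA.
  by rewrite muleC.
have E2 : \int[leb]_t (ind s t * g t * B t) = \int[leb]_u (ind s u * (z u * \int[leb]_(t in `[u, +oo[) g t)).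
  pose k (p : measurableTypeR R * measurableTypeR R) := ind s p.1 * g p.1 * (ind s p.2 * ind' p.2 p.1 * z p.2).
  have mk : measurable_fun setT k.
    apply: emeasurable_funM; first by apply: emeasurable_funM; [exact: (measurableT_comp (mi s))|exact: (measurableT_comp mg)].
    apply: emeasurable_funM; last exact: measurableT_comp.
    apply: emeasurable_funM; first exact: (measurableT_comp (mi s)).
    exact: (measurableT_comp mi' (@measurable_swap _ _ (measurableTypeR R) (measurableTypeR R))).
  have k0 p : 0 <= k p by rewrite /k !mule_ge0.
  transitivity (\int[leb]_t \int[leb]_u k (t, u)).
    apply: eq_integral => t _; rewrite /k/= ge0_integralZl//.
    - by do 2 apply: emeasurable_funM => //.
    - by move=> u _; rewrite !mule_ge0.
    - by rewrite mule_ge0.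
  rewrite (@fubini_tonelli _ _ _ _ R leb leb k mk k0); apply: eq_integral => u _.
  rewrite -open_ray// -ge0_integralZl//; last 2 first.
  - exact: emeasurable_funM.
  - by move=> t _; rewrite mule_ge0.
  rewrite -ge0_integralZl//; last 2 first.
  - by apply: measurable_funeM; exact: emeasurable_funM.
  - by move=> t _; rewrite !mule_ge0.
  apply: eq_integral => t _; rewrite /k /=.
  have [su|us] := leP s u; last by rewrite {2 3}/ind leNgt us !mul0e !mule0.
  have [ut|tu] := ltP u t; last by rewrite /ind' ltNge tu /= !(mul0e, mule0).
  by rewrite /ind (le_trans su (ltW ut)) su /ind' ut !mul1e muleC.
have mG : measurable_fun setT (fun u : measurableTypeR R => \int[leb]_(t in `[u, +oo[) g t).
  rewrite (_ : (fun u => _) = (fun u => \int[leb]_t (ind u t * g t))); last first.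
    by apply/funext => u; exact: integral_ray.
  apply: (@measurable_fun_fubini_tonelli_F _ _ _ _ _ leb (fun p : measurableTypeR R * measurableTypeR R => ind p.1 p.2 * g p.2)).
    by apply: emeasurable_funM => //; exact: measurableT_comp.
  by move=> p; rewrite mule_ge0.
have G0 u : 0 <= \int[leb]_(t in `[u, +oo[) g t by exact: integral_ge0.
rewrite expeS ih muleCA E1 E2 ge0_muleDr//; last 2 first.
- by apply: integral_ge0 => t _; rewrite mule_ge0.
- by apply: integral_ge0 => t _; rewrite !mule_ge0.
rewrite -[X in _ + X]ge0_integralZl//; last 2 first.
- by apply: emeasurable_funM; [exact: mi|exact: emeasurable_funM].
- by move=> t _; rewrite !mule_ge0.
under [X in _ + X]eq_integral do rewrite muleCA (muleCA j.+1%:R%:E) -ih.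
rewrite -integral_ray -[X in _ + X]mul1e -ge0_muleDl ?lee_fin//.
by rewrite -EFinD natr1.
Qed.

End tail_powers.

(** * Exponential integrals and monotone multiplicative functions *)

Section exponential_rays.
Context {R : realType}.

Lemma integral_exp_ray (l s : R) : 0 < l ->
  (\int[lebesgue_measure]_(t in `[s, +oo[) (expR (- (l * (t - s))))%:E = (l^-1)%:E)%E.
Proof.
move=> l0.
have dF (x : R) : is_derive x 1 (fun t => - (expR (- (l * (t - s))) / l)) (expR (- (l * (x - s)))).
  by deriv; field; rewrite gt_eqF.
rewrite (@ge0_continuous_FTC2y _ _ (fun t => - (expR (- (l * (t - s))) / l)) s 0).
- by rewrite subrr mulr0 oppr0 expR0 sub0e -EFinN opprK mul1r.
- by move=> x _; exact: expR_ge0.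
- apply: continuous_subspaceT => x; apply: is_derive_continuous; deriv; reflexivity.
- rewrite -[X in _ --> X](oppr0) -[X in _ --> - X](mul0r l^-1).
  apply: cvgN; apply: cvgM; last exact: cvg_cst.
  suff h : l * (t - s) @[t --> +oo] --> +oo.
    have := cvg_comp _ _ h (@cvgr_expR R).
    by apply: cvg_trans; apply: near_eq_cvg; apply: nearW => t /=; rewrite /comp.
  apply/cvgryPge => A; near=> t.
  rewrite mulrC -ler_pdivrMr// lerBrDr; near: t.
  by apply: nbhs_pinfty_ge; exact: num_real.
- by move=> x _; have [] := dF x.
- by apply: cvg_at_right_filter; apply: is_derive_continuous; exact: dF.
- by move=> x _; rewrite derive1E; have [_ ->] := dF x.
Unshelve. all: by end_near.
Qed.

(** g is known at the integers. Comparing (n + 1) t with its integer part, monotonicity gives |ln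
    g(t) + l t| <= 2 l/(n + 1) for every n. *)
Lemma monotone_multiplicative (g : R -> R) (l : R) :
  (forall s t, 0 <= s -> 0 <= t -> g (s + t) = g s * g t) ->
  (forall s t, 0 <= s -> s <= t -> g t <= g s) ->
  g 1 = expR (- l) -> forall t, 0 <= t -> g t = expR (- (l * t)).
Proof.
move=> gD gmono g1.
have gM n t : 0 <= t -> g (n.+1%:R * t) = g t ^+ n.+1.
  move=> t0; elim: n => [|n ih]; first by rewrite mul1r expr1.
  by rewrite -natr1 mulrDl mul1r gD ?mulr_ge0// ih [RHS]exprSr.
have gn n : g n.+1%:R = expR (- l * n.+1%:R).
  by rewrite -[n.+1%:R]mulr1 gM// g1 mulr1 expRM_natr.
have g0 t : 0 <= t -> 0 < g t.
  move=> t0; apply: (@lt_le_trans _ _ (g (Num.bound t).+1%:R)).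
    by rewrite gn expR_gt0.
  apply: gmono => //; rewrite ltW// (lt_trans (archi_boundP t0))// ltr_nat//.
have l0 : 0 <= l.
  have h : g 2 <= g 1 by apply: gmono => //; rewrite ler1n.
  by move: h; rewrite (gn 1%N) g1 ler_expR; lra.
move=> t t0.
have key n : `|ln (g t) + l * t| * n.+1%:R <= 2 * l.
  have nt0 : 0 <= n.+1%:R * t by rewrite mulr_ge0.
  have /andP[k1 k2] := truncn_itv nt0.
  set k := Num.truncn (n.+1%:R * t) in k1 k2.
  have E : ln (g (n.+1%:R * t)) = n.+1%:R * ln (g t).
    by rewrite gM// lnXn ?g0// mulr_natl.
  have u1 : ln (g (n.+1%:R * t)) <= - l * k%:R.
    move: k1; clear k2; case: k => [|k] k1.
      rewrite mulr0 -ln1 ler_ln ?posrE ?g0//.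
      have : g 0 <= 1.
        have := gD 0 0 (lexx _) (lexx _); rewrite addr0 => e.
        have := g0 0 (lexx _) => p; rewrite le_eqVlt; apply/orP; left; apply/eqP.
        by apply: (mulfI (lt0r_neq0 p)); rewrite mulr1.
      by move=> h; apply: le_trans h; exact: gmono.
    by rewrite -ler_expR lnK ?posrE ?g0// -gn; exact: gmono.
  have u2 : - l * k.+1%:R <= ln (g (n.+1%:R * t)).
    by rewrite -ler_expR lnK ?posrE ?g0// -gn; apply: gmono => //; exact: ltW.
  rewrite -[X in _ * X <= _](ger0_norm (ler0n R _)) -normrM mulrDl [ln (g t) * _]mulrC -E.
  have kE : k.+1%:R = k%:R + 1 :> R by rewrite natr1.
  have v1 := ler_wpM2l l0 k1; have v2 := ler_wpM2l l0 (ltW k2).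
  by rewrite kE in v2 u2; rewrite ler_norml; apply/andP; split; lra.
suff : ln (g t) + l * t = 0.
  by move=> h; rewrite -[LHS]lnK ?posrE ?g0//; congr expR; lra.
apply/eqP; rewrite -normr_le0 leNgt; apply/negP => p.
set e := `|_| in p key.
have := archi_boundP (divr_ge0 (mulr_ge0 (ler0n R 2) l0) (ltW p)).
set N := Num.bound _; rewrite ltr_pdivrMr// => h.
have := key N; rewrite leNgt => /negP; apply; apply: (lt_le_trans h).
by rewrite mulrC ler_wpM2l ?ler_nat// ltW.
Qed.

End exponential_rays.

(** * Moments of the integral of the killed exponential process *)

Section subordinator_moments.
Context {R : realType} d (Omega : measurableType d) (Pr : probability Omega R).
Context (c : triplet R) (xi : R -> Omega -> R) (zeta : Omega -> \bar R).
Hypotheses (adm : admissible c) (hsub : subordinator Pr xi)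
  (hzeta : exponential_time Pr (phiR c 0) zeta)
  (hind : independent_of_process Pr xi zeta).
Hypothesis hlap : forall n, (0 < n)%N ->
  \int[Pr]_w expR (- (n%:R * xi 1 w)) = expR (- (phiR c n%:R - phiR c 0)).

Let mxi t : 0 <= t -> measurable_fun setT (xi t : Omega -> measurableTypeR R).
Proof. by case: hsub => h _ _ _; exact: h. Qed.

Let xi0 w : xi 0 w = 0. Proof. by case: hsub => _ /(_ w)[]. Qed.

Let xi_homo w s t : 0 <= s -> s <= t -> xi s w <= xi t w.
Proof. by case: hsub => _ /(_ w)[_ h _] _ _; exact: h. Qed.

Let xi_ge0 w t : 0 <= t -> 0 <= xi t w.
Proof. by move=> t0; rewrite -(xi0 w) xi_homo. Qed.

Let lap (a t : R) := \int[Pr]_w expR (- (a * xi t w)).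

Let incr_law (a s t : R) : 0 <= s -> 0 <= t ->
  \int[Pr]_w expR (- (a * (xi (s + t) w - xi s w))) = lap a t.
Proof.
move=> s0 t0; have st0 : 0 <= s + t by exact: addr_ge0.
have mf : measurable_fun setT (fun x : measurableTypeR R => (expR (- (a * x)))%:E).
  by apply/measurable_EFinP; exact: measurable_expRN.
pose V w : measurableTypeR R := xi (s + t) w - xi s w.
have mV : measurable_fun setT V by apply: measurable_funB; exact: mxi.
rewrite /lap /Rintegral; congr fine.
transitivity (\int[pushforward Pr V]_x (expR (- (a * x)))%:E)%E.
  by rewrite ge0_integral_pushforward// => x _; rewrite lee_fin expR_ge0.
pose W : Omega -> measurableTypeR R := xi t.
have mW : measurable_fun setT W by exact: mxi.
transitivity (\int[pushforward Pr W]_x (expR (- (a * x)))%:E)%E; last first.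
  by rewrite ge0_integral_pushforward// => x _; rewrite lee_fin expR_ge0.
apply: eq_measure_integral => A mA _.
by case: hsub => _ _ h _; exact: h.
Qed.

Let increments_expectation (n : nat) (a s : nat -> R) : (forall i, 0 <= a i) -> 0 <= s 0%N ->
  (forall i, s i <= s i.+1) ->
  \int[Pr]_w (\prod_(0 <= i < n) expR (- (a i * (xi (s i.+1) w - xi (s i) w)))) =
  \prod_(0 <= i < n) lap (a i) (s i.+1 - s i).
Proof.
move=> a0 s0 sS.
have si i : 0 <= s i by elim: i => // i ih; exact: le_trans (sS i).
pose h i (x : R) := if 0 <= x then expR (- (a i * x)) else 0.
have hE i w : h i (xi (s i.+1) w - xi (s i) w) = expR (- (a i * (xi (s i.+1) w - xi (s i) w))).
  by rewrite /h subr_ge0 xi_homo.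
have := @independent_prod_expectation _ Omega R Pr n (fun i w => xi (s i.+1) w - xi (s i) w : measurableTypeR R).
move=> /(_ _ _ h) H.
transitivity (\int[Pr]_w (\prod_(0 <= i < n) h i (xi (s i.+1) w - xi (s i) w))).
  by apply: eq_Rintegral => w _; apply: eq_bigr => i _; rewrite hE.
rewrite H.
- apply: eq_bigr => i _; rewrite (eq_Rintegral _ (fun w _ => hE i w)).
  by have := @incr_law (a i) (s i) (s i.+1 - s i) (si i); rewrite subr_ge0 => /(_ (sS i)) <-; rewrite subrKC.
- by move=> i _; apply: measurable_funB; apply: mxi.
- move=> B mB; case: hsub => _ _ _ hh.
  by rewrite big_mkord; exact: hh.
- move=> i; split; last by move=> x; rewrite /h; case: ifP => // _; exact: expR_ge0.
  apply: measurable_fun_ifT => //; last exact: measurable_expRN.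
  by apply: measurable_fun_ler.
- by move=> i x; rewrite /h; case: ifPn => // x0; rewrite -expR0 ler_expR oppr_le0 mulr_ge0.
Qed.

Let lapD a s t : 0 <= a -> 0 <= s -> 0 <= t -> lap a (s + t) = lap a s * lap a t.
Proof.
move=> a0 s0 t0.
pose u i := if i == 0%N then 0 else if i == 1%N then s else s + t.
have uS i : u i <= u i.+1.
  by case: i => [|[|i]]; rewrite /u//= ?lerDl.
have := @increments_expectation 2 (fun=> a) u (fun=> a0) (lexx _) uS.
rewrite !big_nat_recr//= big_nil mul1r /u /= subr0 addrAC subrr add0r => <-.
apply: eq_Rintegral => w _; rewrite !big_nat_recr//= big_nil mul1r -expRD; congr expR.
by rewrite xi0; ring.
Qed.

Let lapE n t : (0 < n)%N -> 0 <= t -> lap n%:R t = expR (- ((phiR c n%:R - phiR c 0) * t)).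
Proof.
move=> n0; apply: monotone_multiplicative.
- by move=> s u s0 u0; apply: lapD.
- move=> s u s0 su; have u0 := le_trans s0 su.
  have i v : 0 <= v -> Pr.-integrable setT (EFin \o (fun w => expR (- (n%:R * xi v w)))).
    move=> v0; apply: (integrable_dominated _ _ (finite_measure_integrable_cst Pr 1 measurableT)) => //.
      apply: (measurableT_comp (measurable_expRN n%:R)); exact: mxi.
    move=> w _ /=; rewrite ger0_norm ?expR_ge0//.
    by rewrite -expR0 ler_expR oppr_le0 mulr_ge0// xi_ge0.
  apply: le_Rintegral => //; [exact: i|exact: i|move=> w _].
  by rewrite ler_expR lerN2 ler_wpM2l// xi_homo.
- exact: hlap.
Qed.

(** e^(-eta_t) for the killed process; the value 0 at negative times lets t range over the whole
    line. *)
Definition killed_exp (p : measurableTypeR R * Omega) : R :=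
  if (0 <= p.1) && (p.1%:E < zeta p.2)%E then expR (- xi p.1 p.2) else 0.

Lemma killed_exp_ge0 p : 0 <= killed_exp p.
Proof. by rewrite /killed_exp; case: ifP => // _; exact: expR_ge0. Qed.

Let mzeta : measurable_fun setT zeta. Proof. by case: hzeta. Qed.

Let mev t : measurable [set w | (t%:E < zeta w)%E].
Proof.
rewrite -[X in measurable X]setTI.
by apply: emeasurable_fun_o_infty => //.
Qed.

(** Summation by parts: each increment is counted once for every later time. The multiplicities n -
    i become the arguments of phi. *)
Let xi_sum (s : nat -> R) n w : s 0%N = 0 ->
  \sum_(0 <= i < n) xi (s i.+1) w = \sum_(0 <= i < n) (n - i)%:R * (xi (s i.+1) w - xi (s i) w).
Proof.
move=> s0; elim: n => [|n ih]; first by rewrite !big_nil.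
have tel m : \sum_(0 <= i < m) (xi (s i.+1) w - xi (s i) w) = xi (s m) w.
  by rewrite telescope_sumr// s0 xi0 subr0.
transitivity (\sum_(0 <= i < n.+1) ((n - i)%:R * (xi (s i.+1) w - xi (s i) w) + (xi (s i.+1) w - xi (s i) w))).
  by rewrite big_split/= tel big_nat_recr//= ih big_nat_recr//= subnn mul0r addr0.
apply: eq_big_nat => i /andP[_ ni]; rewrite subSn//.
by rewrite -natr1 mulrDl mul1r.
Qed.

(* q = phi 0 is the killing rate, so that killing turns phi(k) - q into phi(k). *)
Lemma killed_exp_expectation n (s : nat -> R) : s 0%N = 0 -> (forall i, s i <= s i.+1) ->
  (\int[Pr]_w (\prod_(0 <= i < n) killed_exp (s i.+1, w))%:E =
   (\prod_(0 <= i < n) expR (- (phiR c (n - i)%:R * (s i.+1 - s i))))%:E)%E.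
Proof.
move=> s0 sS.
have si i : 0 <= s i by elim: i => [|i ih]; [rewrite s0|exact: le_trans (sS i)].
have sh i j : (i <= j)%N -> s i <= s j.
  by move=> /subnK <-; elim: (j - i)%N => // k ih; apply: (le_trans ih); rewrite addSn.
case: n => [|n].
  under eq_integral do rewrite big_nil.
  by rewrite big_nil integral_cst// mul1e; exact: probability_setT.
pose F w : R := \1_[set w | ((s n.+1)%:E < zeta w)%E] w.
have E w : \prod_(0 <= i < n.+1) killed_exp (s i.+1, w) =
   F w * \prod_(0 <= i < n.+1) expR (- (xi (s i.+1) w)).
  have [zw|zw] := boolP ((s n.+1)%:E < zeta w)%E.
    rewrite /F indicE mem_set//= mul1r; apply: eq_big_nat => i /andP[_ ni].
    by rewrite /killed_exp /= si (le_lt_trans _ zw) ?lee_fin ?sh.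
  rewrite /F indicE memNset/=; last exact/negP.
  by rewrite mul0r big_nat_recr//= {2}/killed_exp /= (negbTE zw) andbF mulr0.
have hh : nonneg_family (fun=> (fun x : R => expR (- x))).
  by move=> i; split; [have := measurable_expRN (1 : R); under eq_fun do rewrite mul1r|move=> x; exact: expR_ge0].
under eq_integral do rewrite E.
have := @weighted_family_lift _ Omega R Pr n.+1 (fun i => xi (s i.+1)) _ F (expR (- (phiR c 0 * s n.+1))) _ _ _ _ (fun=> (fun x : R => expR (- x))) hh.
move=> ->.
- have E2 : (\int[Pr]_w (\prod_(0 <= i < n.+1) expR (- xi (s i.+1) w))%:E)%E =
    (\prod_(0 <= i < n.+1) expR (- ((phiR c (n.+1 - i)%:R - phiR c 0) * (s i.+1 - s i))))%:E.
    have := @increments_expectation n.+1 (fun i => (n.+1 - i)%:R) s (fun=> ler0n _ _) (si _) sS.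
    rewrite (_ : \prod_(0 <= i < n.+1) lap _ _ = \prod_(0 <= i < n.+1) expR (- ((phiR c (n.+1 - i)%:R - phiR c 0) * (s i.+1 - s i)))); last first.
      apply: eq_big_nat => i /andP[_ ni]; apply: lapE; first by rewrite subn_gt0.
      by rewrite subr_ge0.
    move=> <-; rewrite /Rintegral fineK.
      apply: eq_integral => w _; congr (_%:E).
      rewrite -!(big_morph expR (@expRD R) (@expR0 R)) !sumrN; congr expR; congr (- _).
      exact: xi_sum.
    apply: integrable_fin_num => //.
    apply: (integrable_dominated _ _ (finite_measure_integrable_cst Pr 1 measurableT)) => //.
      apply: measurable_prod => i _; apply: (measurableT_comp (measurable_expRN _)).
      by apply: measurable_funB; exact: mxi.
    move=> w _ /=; rewrite ger0_norm; last by apply: prodr_ge0 => i _; exact: expR_ge0.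
    apply: prodr_ile1 => i _; rewrite expR_ge0/= -expR0 ler_expR oppr_le0 mulr_ge0//.
    by rewrite subr_ge0 xi_homo.
  rewrite E2 -EFinM; congr (_%:E).
  have -> : s n.+1 = \sum_(0 <= i < n.+1) (s i.+1 - s i) by rewrite telescope_sumr// s0 subr0.
  rewrite mulr_sumr -sumrN (big_morph expR (@expRD R) (@expR0 R)) -big_split/=.
  by apply: eq_bigr => i _; rewrite -expRD; congr expR; ring.
- by move=> i _; exact: mxi.
- exact: measurable_indic.
- by move=> w; rewrite /F indicE.
- exact: expR_ge0.
- move=> B mB.
  have mUB i : measurable [set w | B i (xi (s i.+1) w)].
    by rewrite -[X in measurable X]setTI; apply: (mxi (si i.+1)).
  have mcap : measurable (\bigcap_(i in `I_n.+1) [set w | B i (xi (s i.+1) w)]).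
    by apply: fin_bigcap_measurable => // i _.
  have PI w : \prod_(0 <= i < n.+1) \1_(B i) (xi (s i.+1) w) = \1_(\bigcap_(i in `I_n.+1) [set w | B i (xi (s i.+1) w)]) w :> R.
    exact: (@prod_indic _ _ _ n.+1 (fun i => xi (s i.+1)) B w).
  under [in RHS]eq_integral do rewrite PI.
  transitivity (\int[Pr]_w (\1_([set w | ((s n.+1)%:E < zeta w)%E] `&` \bigcap_(i in `I_n.+1) [set w | B i (xi (s i.+1) w)]) w : R)%:E)%E.
    by apply: eq_integral => w _; rewrite PI /F indicI.
  rewrite !integral_indic//; last exact: measurableI.
  rewrite !setIT; have [_ <-] := hzeta; last exact: si.
  have mA : measurable [set x : \bar R | ((s n.+1)%:E < x)%E].
    rewrite (_ : [set x | _] = [set` `](s n.+1)%:E, +oo%E]]); first exact: emeasurable_itv.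
    by apply/seteqP; split => x /=; rewrite in_itv/= leey andbT.
  exact: (@hind _ n.+1 (fun i => s i.+1) B mA (fun i => si i.+1) mB).
Qed.

(** Joint measurability in time and chance. For a >= 0, a value above a at time t persists up to
    some rational q > t by right continuity, and a value above a at q holds at all earlier times
    since xi is nondecreasing. The superlevel set is thus a countable union of rectangles. *)
Lemma measurable_killed_exp : measurable_fun setT killed_exp.
Proof.
have xi_right w t : 0 <= t -> xi u w @[u --> t^'+] --> xi t w.
  by case: hsub => _ /(_ w)[_ _ h] _ _; exact: h.
apply: (measurability (@RGenOInfty.G R) (RGenOInfty.measurableE R)) => _ [_ [a ->] <-].
rewrite setTI.
have [a0|a0] := ltP a 0.
  rewrite (_ : _ @^-1` _ = setT); first exact: measurableT.
  apply/seteqP; split => // p _ /=; rewrite in_itv/= andbT.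
  exact: lt_le_trans (killed_exp_ge0 p).
pose E (q : rat) : set (measurableTypeR R * Omega) :=
  (`[0, ratr q[%classic : set (measurableTypeR R)) `*`
  (if 0 <= ratr q :> R then [set w | ((ratr q)%:E < zeta w)%E] `&` [set w | a < expR (- xi (ratr q) w)] else set0).
rewrite (_ : _ @^-1` _ = \bigcup_q E q).
  apply: bigcupT_measurable_rat => q; apply: measurableX; first exact: measurable_itv.
  case: ifPn => q0; last exact: measurable0.
  apply: measurableI; first exact: mev.
  rewrite -[X in measurable X]setTI.
  have m1 : measurable_fun setT (fun w => expR (- xi (ratr q) w)).
    by apply: measurableT_comp => //; apply: measurableT_comp => //; exact: mxi.
  have := m1 measurableT `]a, +oo[%classic (measurable_itv _).
  by congr (measurable (_ `&` _)); apply/seteqP; split => w /=; rewrite in_itv/= andbT.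
apply/seteqP; split => [[t w]|[t w] [q _]] /=; rewrite in_itv/= andbT /killed_exp /=.
  case: ifPn => [/andP[t0 tz] ae|_]; last by rewrite ltNge a0.
  have [r [tr rz]] : exists r : R, t < r /\ forall u, t < u -> u < r -> (u%:E < zeta w)%E /\ a < expR (- xi u w).
    have [r1 [tr1 h1]] : exists r : R, t < r /\ forall u, t < u -> u < r -> (u%:E < zeta w)%E.
      case: (zeta w) tz => [z||//]; last by exists (t + 1); split; [lra|move=> *; exact: ltry].
      by rewrite lte_fin => tz; exists z; split => // u _; rewrite lte_fin.
    have c1 : expR (- xi u w) @[u --> t^'+] --> expR (- xi t w).
      by apply: continuous_cvg; [exact: continuous_expR|apply: cvgN; exact: xi_right].
    have := cvgr_gt _ c1 _ ae; rewrite near_withinE => -[e /= e0 he].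
    exists (Num.min r1 (t + e)); split; first by rewrite lt_min tr1 ltrDl.
    move=> u tu; rewrite lt_min => /andP[u1 u2]; split; first exact: h1.
    by apply: he => //=; rewrite ltr0_norm ?subr_lt0//; lra.
  have [q /andP[tq qr]] : exists q : rat, (t < ratr q) && (ratr q < r).
    by have [q] := @rat_in_itvoo R t r tr; rewrite in_itv/=; exists q.
  have [h1 h2] := rz _ tq qr.
  exists q => //; split => /=; first by rewrite in_itv/= t0.
  by rewrite ifT// ltW// (le_lt_trans t0).
move=> [/=]; rewrite in_itv/= => /andP[t0 tq].
have q0 : 0 <= ratr q :> R by rewrite ltW// (le_lt_trans t0).
rewrite q0 => -[/= zq aq].
rewrite t0 (lt_trans _ zq) ?lte_fin//=.
by apply: (lt_le_trans aq); rewrite ler_expR lerN2 xi_homo// ltW.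
Qed.

Definition killed_tail (w : Omega) (s : R) : \bar R := tail (fun t => (killed_exp (t, w))%:E) s.

Let mslice w : measurable_fun setT (fun t : measurableTypeR R => (killed_exp (t, w))%:E).
Proof. by apply/measurable_EFinP; exact: (measurableT_comp measurable_killed_exp (pair2_measurable w)). Qed.

Lemma measurable_killed_tail : measurable_fun setT (fun p : measurableTypeR R * Omega => killed_tail p.2 p.1).
Proof.
rewrite (_ : (fun p => _) = (fun p : measurableTypeR R * Omega =>
   \int[lebesgue_measure]_u ((p.1 <= u)%R%:R%:E * (killed_exp (u, p.2))%:E))%E); last first.
  by apply/funext => p; rewrite /killed_tail /tail integral_ray.
apply: (@measurable_fun_fubini_tonelli_F _ _ (measurableTypeR R * Omega)%type _ _ lebesgue_measure
  (fun r : (measurableTypeR R * Omega) * measurableTypeR R => ((r.1.1 <= r.2)%R%:R%:E * (killed_exp (r.2, r.1.2))%:E)%E)).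
  apply: emeasurable_funM.
    apply/measurable_EFinP.
    have mA : measurable [set r : (measurableTypeR R * Omega) * measurableTypeR R | (r.1.1 <= r.2)%R].
      rewrite -[X in measurable X]setTI; apply: measurable_fun_le => //.
      exact: (measurableT_comp measurable_fst measurable_fst).
    rewrite (_ : (fun r => _) = \1_[set r : (measurableTypeR R * Omega) * measurableTypeR R | (r.1.1 <= r.2)%R]).
      exact: measurable_indic.
    by apply/funext => r; rewrite indicE mem_setE.
  apply/measurable_EFinP; apply: (measurableT_comp measurable_killed_exp).
  by apply: measurable_fun_pair => //; exact: (measurableT_comp measurable_snd measurable_fst).
by move=> r; rewrite mule_ge0 ?lee_fin ?ler0n ?killed_exp_ge0.
Qed.

Lemma killed_tail_ge0 w s : (0 <= killed_tail w s)%E.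
Proof. by apply: tail_ge0 => t; rewrite lee_fin killed_exp_ge0. Qed.

(** Let T(s) be the integral of e^(-eta_t) over [s, +oo[. [tail_power] writes T(s_k)^(j+1) as an
    integral over a new last time t; the induction hypothesis for k + 1 times brings the factor
    e^(-phi(j + 1)(t - s_k)), whose integral is 1/phi(j + 1). This is why a product over earlier
    times is carried along. *)
Lemma killed_tail_expectation j k (s : nat -> R) : s 0%N = 0 -> (forall i, s i <= s i.+1) ->
  (\int[Pr]_w ((\prod_(0 <= i < k) killed_exp (s i.+1, w))%:E * killed_tail w (s k) ^+ j) =
   (j`!%:R / \prod_(1 <= i < j.+1) phiR c i%:R *
    \prod_(0 <= i < k) expR (- (phiR c (k + j - i)%:R * (s i.+1 - s i))))%:E)%E.
Proof.
elim: j k s => [|j ih] k s s0 sS.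
  rewrite big_geq// divr1 mul1r addn0 -killed_exp_expectation//.
  by apply: eq_integral => w _; rewrite expe0 mule1.
pose P w := \prod_(0 <= i < k) killed_exp (s i.+1, w).
have P0 w : 0 <= P w by apply: prodr_ge0 => i _; exact: killed_exp_ge0.
have mP : measurable_fun setT P.
  apply: measurable_prod => i _.
  exact: (measurableT_comp measurable_killed_exp (pair1_measurable _)).
pose z t w := (killed_exp (t, w))%:E.
have z0 t w : (0 <= z t w)%E by rewrite lee_fin killed_exp_ge0.
have T0 := killed_tail_ge0.
have Tj0 t w : (0 <= killed_tail w t ^+ j)%E by exact: expe_ge0.
pose ind (t : R) : \bar R := (s k <= t)%R%:R%:E.
have ind0 t : (0 <= ind t)%E by rewrite lee_fin ler0n.
have mind : measurable_fun setT (ind : measurableTypeR R -> \bar R).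
  apply/measurable_EFinP.
  rewrite (_ : (fun t => _) = \1_(`[s k, +oo[%classic : set (measurableTypeR R))).
    exact: measurable_indic.
  by apply/funext => t; rewrite indicE mem_setE in_itv/= andbT.
have mTj : measurable_fun setT (fun p : Omega * measurableTypeR R => (killed_tail p.1 p.2 ^+ j)%E).
  have m1 : measurable_fun setT (fun p : Omega * measurableTypeR R => killed_tail p.1 p.2).
    exact: (measurableT_comp measurable_killed_tail (@measurable_swap _ _ Omega (measurableTypeR R))).
  elim: (j) => [|m mm]; first by under eq_fun do rewrite expe0; exact: measurable_cst.
  by under eq_fun do rewrite expeS; exact: emeasurable_funM.
have mz : measurable_fun setT (fun p : Omega * measurableTypeR R => z p.2 p.1).
  apply/measurable_EFinP.
  exact: (measurableT_comp measurable_killed_exp (@measurable_swap _ _ Omega (measurableTypeR R))).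
pose K (p : Omega * measurableTypeR R) : \bar R :=
  (ind p.2 * ((P p.1)%:E * z p.2 p.1 * killed_tail p.1 p.2 ^+ j))%E.
have mK : measurable_fun setT K.
  apply: emeasurable_funM; first exact: (measurableT_comp mind measurable_snd).
  apply: emeasurable_funM => //; apply: emeasurable_funM => //.
  by apply/measurable_EFinP; exact: (measurableT_comp mP measurable_fst).
have K0 p : (0 <= K p)%E by rewrite /K mule_ge0// mule_ge0// mule_ge0// lee_fin.
have mKw w : measurable_fun setT (fun t : measurableTypeR R => K (w, t)).
  exact: (measurableT_comp mK (pair1_measurable w)).
have phi0 i : 0 < phiR c i.+1%:R by apply: phiR_gt0 => //; rewrite ltr0n.
transitivity (j.+1%:R%:E * \int[Pr]_w \int[lebesgue_measure]_t K (w, t))%E.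
  rewrite -ge0_integralZl//; last 2 first.
  - exact: measurable_fun_fubini_tonelli_F.
  - by move=> w _; apply: integral_ge0 => t _.
  apply: eq_integral => w _; rewrite /killed_tail tail_power//; last by move=> t; rewrite lee_fin killed_exp_ge0.
  rewrite muleCA; congr (_ * _)%E; rewrite integral_ray -ge0_integralZl//; last 3 first.
  - apply: emeasurable_funM; first exact: mind.
    apply: emeasurable_funM; first exact: mslice.
    exact: (measurableT_comp mTj (pair1_measurable w)).
  - by move=> t _; rewrite mule_ge0 ?ind0// mule_ge0 ?z0//; exact: Tj0.
  - by rewrite lee_fin; exact: P0.
  by apply: eq_integral => t _; rewrite /K /= muleCA -!muleA.
rewrite (@fubini_tonelli _ _ _ _ R Pr lebesgue_measure K mK K0).
pose C := j`!%:R / \prod_(1 <= i < j.+1) phiR c i%:R *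
    \prod_(0 <= i < k) expR (- (phiR c (k + j.+1 - i)%:R * (s i.+1 - s i))).
have C0 : 0 <= C.
  apply: mulr_ge0; last by apply: prodr_ge0 => i _; exact: expR_ge0.
  apply: divr_ge0; first exact: ler0n.
  by rewrite big_add1; apply: prodr_ge0 => i _; exact: ltW.
have inner t : (\int[Pr]_w K (w, t) = ind t * (C * expR (- (phiR c j.+1%:R * (t - s k))))%:E)%E.
  rewrite /K /=; rewrite ge0_integralZl//; last 2 first.
  - apply: emeasurable_funM; last exact: (measurableT_comp mTj (pair2_measurable t)).
    apply: emeasurable_funM; first exact/measurable_EFinP.
    exact: (measurableT_comp mz (pair2_measurable t)).
  - by move=> w _; rewrite mule_ge0// mule_ge0// lee_fin.
  rewrite /ind; have [skt|_] := leP (s k) t; last by rewrite !mul0e.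
  congr (_ * _)%E.
  (* t becomes the time of index k + 1 and is repeated afterwards, which keeps the sequence
     nondecreasing. *)
  pose s' i := if (i <= k)%N then s i else t.
  have s'k : s' k.+1 = t by rewrite /s' ltnn.
  have s'E i : (i <= k)%N -> s' i = s i by rewrite /s' => ->.
  have s'S i : s' i <= s' i.+1.
    rewrite /s'; have [ik|ki|->] := ltngtP i k.
    - exact: sS.
    - by [].
    - by rewrite ?ltnn.
  have := ih k.+1 s' _ s'S; rewrite (s'E 0%N)// => /(_ s0).
  rewrite s'k [\prod_(0 <= i < k.+1) expR _]big_nat_recr//= s'k (s'E k)// addSn subSn ?leq_addr// addKn.
  have -> : \prod_(0 <= i < k) expR (- (phiR c ((k + j).+1 - i)%:R * (s' i.+1 - s' i))) =
     \prod_(0 <= i < k) expR (- (phiR c (k + j.+1 - i)%:R * (s i.+1 - s i))).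
    by apply: eq_big_nat => i /andP[_ ik]; rewrite addnS !s'E// ltnW.
  rewrite mulrA -/C => <-; apply: eq_integral => w _; congr (_ * _)%E.
  rewrite big_nat_recr//= s'k EFinM; congr (_%:E * _)%E.
  by apply: eq_big_nat => i /andP[_ ik]; rewrite s'E.
under eq_integral do rewrite inner EFinM muleCA.
rewrite ge0_integralZl//; last 2 first.
- apply: emeasurable_funM => //; apply/measurable_EFinP.
  apply: measurableT_comp => //; apply: measurableT_comp => //; apply: measurable_funM => //.
  exact: measurable_funB.
- by move=> t _; rewrite mule_ge0// lee_fin expR_ge0.
rewrite -integral_ray integral_exp_ray// -!EFinM; congr (_%:E).
rewrite /C factS natrM [\prod_(1 <= i < j.+2) _]big_nat_recr//=.
have : \prod_(1 <= i < j.+1) phiR c i%:R != 0.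
  rewrite prodf_seq_neq0; apply/allP => i.
  by rewrite mem_index_iota; case: i => // i _; rewrite gt_eqF.
set A := \prod_(0 <= i < k) _; set B := \prod_(1 <= i < j.+1) _ => B0.
by move: (phiR c j.+1%:R) (phi0 j) => p p0; field; rewrite B0 gt_eqF.
Qed.

Lemma killed_tail_moment n :
  (\int[Pr]_w killed_tail w 0 ^+ n = (n`!%:R / \prod_(1 <= i < n.+1) phiR c i%:R)%:E)%E.
Proof.
have := @killed_tail_expectation n 0 (fun=> 0) erefl (fun=> lexx _).
rewrite big_nil mulr1 => <-; apply: eq_integral => w _.
by rewrite big_nil mul1e.
Qed.

End subordinator_moments.

(** * Image laws and the law of the exponential functional *)

Section image_laws.
Context d (T : measurableType d) (R : realType) (P : probability T R).

Lemma image_law (f : T -> measurableTypeR R) : measurable_fun setT f ->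
  exists mu : probability (measurableTypeR R) R, forall A, mu A = P (f @^-1` A).
Proof.
move=> mf.
pose F := mfun_Sub (mem_set mf : f \in mfun).
exists (distribution P F) => A; rewrite /distribution /pushforward.
by [].
Qed.

Lemma ge0_integral_image_law (mu : probability (measurableTypeR R) R) (f : T -> measurableTypeR R)
    (g : R -> \bar R) : measurable_fun setT f -> (forall A, mu A = P (f @^-1` A)) ->
  measurable_fun setT (g : measurableTypeR R -> \bar R) -> (forall x, (0 <= g x)%E) ->
  (\int[mu]_x g x = \int[P]_w g (f w))%E.
Proof.
move=> mf muE mg g0.
transitivity (\int[pushforward P f]_x g x)%E.
  by apply: eq_measure_integral => A mA _; exact: muE.
by rewrite ge0_integral_pushforward.
Qed.

Lemma Rintegral_image_law (mu : probability (measurableTypeR R) R) (f : T -> measurableTypeR R)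
    (g : R -> R) : measurable_fun setT f -> (forall A, mu A = P (f @^-1` A)) ->
  measurable_fun setT (g : measurableTypeR R -> R) ->
  \int[mu]_x g x = \int[P]_w g (f w).
Proof.
move=> mf muE mg.
have mg' : measurable_fun setT (EFin \o (g : measurableTypeR R -> R)) by exact/measurable_EFinP.
rewrite /Rintegral integralE [in RHS]integralE; congr (fine (_ - _)).
- rewrite (ge0_integral_image_law mf muE (measurable_funepos mg') (funepos_ge0 _)).
  by apply: eq_integral => w _; rewrite !funeposE.
- rewrite (ge0_integral_image_law mf muE (measurable_funeneg mg') (funeneg_ge0 _)).
  by apply: eq_integral => w _; rewrite !funenegE.
Qed.

Lemma integrable_image_law (mu : probability (measurableTypeR R) R) (f : T -> measurableTypeR R)
    (g : R -> R) : measurable_fun setT f -> (forall A, mu A = P (f @^-1` A)) ->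
  measurable_fun setT (g : measurableTypeR R -> R) ->
  mu.-integrable setT (EFin \o g) <-> P.-integrable setT (EFin \o (fun w => g (f w))).
Proof.
move=> mf muE mg.
have mg' : measurable_fun setT (EFin \o (g : measurableTypeR R -> R)) by exact/measurable_EFinP.
have mgf : measurable_fun setT (EFin \o (fun w => g (f w))) by exact/measurable_EFinP/measurableT_comp.
have E : (\int[mu]_x `|(EFin \o g) x| = \int[P]_w `|(EFin \o (fun w => g (f w))) w|)%E.
  by rewrite (ge0_integral_image_law mf muE)//; exact: measurableT_comp.
by split => /integrableP[_ h]; apply/integrableP; split => //; [rewrite -E|rewrite E].
Qed.

End image_laws.

Section exponential_functional.
Context {R : realType} d (Omega : measurableType d) (Pr : probability Omega R).
Context (c : triplet R) (adm : admissible c) (eta : R -> Omega -> \bar R).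
Hypothesis heta : killed_subordinator Pr (phiR c) eta.
Local Notation X := (exp_functional eta).

(** The exponent is prescribed for the killed process at time 1; independence of the killing time
    takes out the survival probability e^(-phi(0)). *)
Lemma killed_laplace xi zeta : subordinator Pr xi -> exponential_time Pr (phiR c 0) zeta ->
  independent_of_process Pr xi zeta -> (forall t w, 0 <= t -> eta t w = killed xi zeta t w) ->
  forall n, (0 < n)%N ->
  \int[Pr]_w expR (- (n%:R * xi 1 w)) = expR (- (phiR c n%:R - phiR c 0)).
Proof.
move=> hsub hz hind etaE n n0.
have phin : 0 < phiR c n%:R by apply: phiR_gt0 => //; rewrite ltr0n.
have [_ /(_ n%:R)] := heta; rewrite ltr0n => /(_ n0) H.
have m1 : measurable_fun setT (xi 1 : Omega -> measurableTypeR R) by case: hsub => h _ _ _; exact: h.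
have mz : measurable_fun setT zeta by case: hz.
pose F w : R := \1_[set w | (1%:E < zeta w)%E] w.
have mev : measurable [set w | (1%:E < zeta w)%E].
  by rewrite -[X in measurable X]setTI; apply: emeasurable_fun_o_infty.
have x0 w : 0 <= xi 1 w.
  by have [_ /(_ w)[e mo _] _ _] := hsub; rewrite -e mo.
have E : (\int[Pr]_w expeR (- (n%:R%:E * eta 1 w)) =
   \int[Pr]_w (F w * \prod_(0 <= i < 1) expR (- (n%:R * xi 1 w)))%:E)%E.
  apply: eq_integral => w _; rewrite big_nat1 etaE// /killed.
  have [zw|zw] := boolP (1%:E < zeta w)%E.
    by rewrite /F indicE mem_set//= mul1r.
  by rewrite /F indicE memNset ?mul0r /=; [rewrite gt0_muley ?lte_fin ?ltr0n|exact/negP].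
have hh : nonneg_family (fun=> (fun x : R => expR (- (n%:R * x)))).
  by move=> i; split; [exact: measurable_expRN|move=> x; exact: expR_ge0].
have := @weighted_family_lift _ Omega R Pr 1 (fun=> xi 1) _ F (expR (- (phiR c 0 * 1))) _ _ _ _ (fun=> (fun x : R => expR (- (n%:R * x)))) hh.
rewrite -E => /(_ _ _ _ _ _) W.
have {}W : (\int[Pr]_w expeR (- (n%:R%:E * eta 1 w)) = (expR (- phiR c 0) * \int[Pr]_w expR (- (n%:R * xi 1 w)))%:E)%E.
  rewrite W.
  - have i1 : Pr.-integrable setT (EFin \o (fun w => expR (- (n%:R * xi 1 w)))).
      apply: (integrable_dominated _ _ (finite_measure_integrable_cst Pr 1 measurableT)) => //.
        exact: (measurableT_comp (measurable_expRN n%:R)).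
      move=> w _ /=; rewrite ger0_norm ?expR_ge0//.
      by rewrite -[leRHS]expR0 ler_expR oppr_le0 mulr_ge0.
    rewrite EFinM mulr1; congr (_ * _)%E.
    rewrite /Rintegral fineK; last exact: integrable_fin_num.
    by apply: eq_integral => w _; rewrite big_nat1.
  - by move=> i _.
  - exact: measurable_indic.
  - by move=> w; rewrite /F indicE.
  - exact: expR_ge0.
  - move=> B mB.
    have mB0 : measurable [set w | B 0%N (xi 1 w)].
      by rewrite -[X in measurable X]setTI; apply: m1.
    have PI w : \prod_(0 <= i < 1) \1_(B i) (xi 1 w) = \1_[set w | B 0%N (xi 1 w)] w :> R.
      by rewrite big_nat1 !indicE; congr (_%:R); apply/idP/idP; rewrite !inE.
    under [in RHS]eq_integral do rewrite PI.
    transitivity (\int[Pr]_w (\1_([set w | (1%:E < zeta w)%E] `&` [set w | B 0%N (xi 1 w)]) w : R)%:E)%E.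
      by apply: eq_integral => w _; rewrite PI /F indicI.
    rewrite !integral_indic//; last exact: measurableI.
    rewrite !setIT; have [_ <-] := hz; last exact: ler01.
    have mA : measurable [set x : \bar R | (1%:E < x)%E].
      rewrite (_ : [set x | _] = [set` `]1%:E, +oo%E]]); first exact: emeasurable_itv.
      by apply/seteqP; split => x /=; rewrite in_itv/= leey andbT.
    have := @hind _ 1 (fun=> 1) B mA (fun=> ler01) mB.
    rewrite (_ : \bigcap_(i in `I_1) _ = [set w | B 0%N (xi 1 w)])//.
    by rewrite IIS II0 set0U bigcap_set1.
move: H; rewrite W /= => H.
set L := \int[Pr]_w _ in H *.
have L0 : 0 <= L by apply: Rintegral_ge0 => w _; exact: expR_ge0.
(* [ln] is 0 at 0, so a vanishing expectation would give phi(n) = 0. *)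
have P0 : 0 < expR (- phiR c 0) * L.
  rewrite lt_def mulr_ge0 ?expR_ge0// andbT; apply/negP => /eqP e.
  by move: H; rewrite e ln0//; lra.
have := congr1 expR H; rewrite lnK ?posrE// => e.
by rewrite opprB expRD -e mulrA -expRD subrr expR0 mul1r.
Qed.

(** X is almost surely finite since its mean is. It is positive where zeta > 0, an almost sure
    event, being at least t e^(-xi_t) for every t in ]0, zeta[. *)
Lemma exp_functional_facts :
  [/\ measurable_fun setT X, forall w, (0 <= X w)%E,
      forall n, (\int[Pr]_w (X w ^+ n) = (n`!%:R / \prod_(1 <= i < n.+1) phiR c i%:R)%:E)%E
    & {ae Pr, forall w, (0 < X w < +oo)%E}].
Proof.
have [[xi [zeta [hsub hz hind etaE]]] _] := heta.
have hl := killed_laplace hsub hz hind etaE.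
have XE w : X w = killed_tail xi zeta w 0.
  apply: eq_integral => t; rewrite inE/= in_itv/= andbT => t0.
  rewrite etaE// /killed /killed_exp /= t0/=.
  by case: ifPn.
have X0 w : (0 <= X w)%E by rewrite XE; exact: killed_tail_ge0.
have mX : measurable_fun setT X.
  rewrite (_ : X = (fun w => killed_tail xi zeta w 0)); last by apply/funext.
  have := measurableT_comp (measurable_killed_tail hsub hz) (pair1_measurable (0 : measurableTypeR R)).
  exact.
have mom n : (\int[Pr]_w (X w ^+ n) = (n`!%:R / \prod_(1 <= i < n.+1) phiR c i%:R)%:E)%E.
  by under eq_integral do rewrite XE; exact: (killed_tail_moment adm hsub hz hind hl).
split => //.
have fin : {ae Pr, forall w, (X w < +oo)%E}.
  have iX : Pr.-integrable setT X.
    apply/integrableP; split => //; under eq_integral do rewrite gee0_abs//.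
    have -> : (\int[Pr]_w X w = \int[Pr]_w (X w ^+ 1))%E.
      by apply: eq_integral => w _; rewrite expeS expe0 mule1.
    by rewrite mom; exact: ltry.
  have := integrable_ae measurableT iX; apply: filterS => w /(_ I).
  by rewrite fin_numE => /andP[_ h]; rewrite lt_neqAle h leey.
have pos : {ae Pr, forall w, (0 < X w)%E}.
  have mz : measurable_fun setT zeta by case: hz.
  have mev : measurable [set w | (0%:E < zeta w)%E].
    by rewrite -[X in measurable X]setTI; apply: emeasurable_fun_o_infty.
  exists (~` [set w | (0%:E < zeta w)%E]); split.
  - exact: measurableC.
  - rewrite probability_setC//; have [_ ->] := hz; last exact: lexx.
    by rewrite mulr0 oppr0 expR0 subee.
  - move=> w; apply: contra_not => /= zw.
    have [t [t0 tz]] : exists t : R, 0 < t /\ (t%:E < zeta w)%E.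
      case: (zeta w) zw => [z| _|//]; [|by exists 1; rewrite ltry; split].
      by rewrite lte_fin => z0; exists (z / 2); rewrite lte_fin; split; lra.
    have [_ /(_ w)[_ homo _] _ _] := hsub.
    apply: (@lt_le_trans _ _ (\int[lebesgue_measure]_(u in `[0%R, t]) (expR (- xi t w))%:E)%E).
      rewrite integral_cst//= lebesgue_measure_itv/= lte_fin t0 -EFinB -EFinM lte_fin.
      by rewrite subr0 mulr_gt0// expR_gt0.
    have mk : measurable_fun setT (fun u : measurableTypeR R => (killed_exp xi zeta (u, w))%:E).
      by apply/measurable_EFinP; exact: (measurableT_comp (measurable_killed_exp hsub hz) (pair2_measurable w)).
    rewrite XE; apply: (@le_trans _ _ (\int[lebesgue_measure]_(u in `[0%R, t]) (killed_exp xi zeta (u, w))%:E)%E).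
      apply: ge0_le_integral => //.
      - exact: measurable_funTS.
      - move=> u; rewrite /= in_itv/= => /andP[u0 ut].
        by rewrite /killed_exp /= u0 (le_lt_trans _ tz) ?lee_fin//= ler_expR lerN2 homo.
    apply: ge0_subset_integral => //.
    - exact: measurable_funTS.
    - by move=> u _; rewrite lee_fin killed_exp_ge0.
    - by move=> u; rewrite /= !in_itv/= andbT => /andP[].
by apply: filterS2 fin pos => w -> ->.
Qed.

(** [fine] sends +oo to 0, which concerns a null event only. *)
Lemma exp_functional_law : exists mu : probability (measurableTypeR R) R,
  [/\ forall A, mu A = Pr ((fun w => fine (X w)) @^-1` A),
      mu `]0%R, +oo[%classic = 1%E
    & forall n, (\int[mu]_x (`|x| ^+ n)%:E = (n`!%:R / \prod_(1 <= i < n.+1) phiR c i%:R)%:E)%E].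
Proof.
have [mX X0 mom fin] := exp_functional_facts.
have mfX : measurable_fun setT (fun w => fine (X w) : measurableTypeR R).
  by apply: measurableT_comp => //; exact: measurable_fine.
have [mu muE] := image_law Pr mfX.
exists mu; split => //.
- have mpos : measurable ((fun w => fine (X w)) @^-1` `]0%R, +oo[%classic).
    by rewrite -[X in measurable X]setTI; apply: mfX => //; exact: measurable_itv.
  rewrite muE; apply/eqP; rewrite eq_le probability_le1//=.
  rewrite -(@probability_setT _ _ _ Pr).
  have [N [mN N0 NP]] := fin.
  have := @probability_setC _ _ _ Pr _ mN; rewrite N0 sube0 => e.
  rewrite probability_setT -e; apply: le_measure; rewrite ?inE//; first exact: measurableC.
  move=> w /= Nw; rewrite in_itv/= andbT.
  have /contrapT : ~ ~ (0 < X w < +oo)%E by move=> h; apply: Nw; exact: NP.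
  by case: (X w) => [r||] //= /andP[].
- move=> n; rewrite (ge0_integral_image_law mfX muE); last 2 first.
  - by apply/measurable_EFinP; apply: measurable_funX; exact: normr_measurable.
  - by move=> x; rewrite lee_fin exprn_ge0.
  rewrite -mom; apply: ae_eq_integral => //.
  - by apply/measurable_EFinP; apply: measurable_funX; apply: measurableT_comp.
  - elim: n => [|n ih]; first by under eq_fun do rewrite expe0; exact: measurable_cst.
    by under eq_fun do rewrite expeS; exact: emeasurable_funM.
  - apply: filterS fin => w /andP[h1 h2] _.
    have fw : X w \is a fin_num by rewrite fin_numElt h2 (lt_trans _ h1).
    by rewrite -{2}(fineK fw) -EFin_expe ger0_norm// fine_ge0.
Qed.

End exponential_functional.

(** Tonelli's theorem is applied with a sigma-finite measure on the whole line, while the Levy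
    measure is sigma-finite on ]0, +oo[; the mass elsewhere is removed. *)
Lemma sigma_finite_restriction d (T : measurableType d) (R : realType)
    (m : {measure set T -> \bar R}) (D : set T) : measurable D -> sigma_finite D m ->
  exists p : {sigma_finite_measure set T -> \bar R}, forall A, p A = m (A `&` D).
Proof.
move=> mD [F DF FF].
pose r : {measure set T -> \bar R} := mrestr m mD.
have sf : sigma_finite setT r.
  exists (fun n => if n is k.+1 then F k else ~` D).
    apply/esym/seteqP; split => // x _; have [Dx|nDx] := pselect (D x).
      by move: (Dx); rewrite DF => -[k _ Fk]; exists k.+1.
    by exists 0%N.
  case=> [|k]; first by split; [exact: measurableC|rewrite /r/= /mrestr setICl measure0].
  have [mF Fy] := FF k; split => //; apply: le_lt_trans Fy; rewrite /r/= /mrestr.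
  by apply: le_measure; rewrite ?inE//; exact: measurableI.
pose H := Measure_isSigmaFinite.Build _ _ _ r sf.
pose p : {sigma_finite_measure set T -> \bar R} := HB.pack_for (SigmaFiniteMeasure.type T R) (Measure.sort r) H.
by exists p.
Qed.

(** * Mellin transforms *)

Section Rfubini.
Context d1 d2 (T1 : measurableType d1) (T2 : measurableType d2) (R : realType).
Variables (m1 : {sigma_finite_measure set T1 -> \bar R}) (m2 : {sigma_finite_measure set T2 -> \bar R}).
Variable f : T1 * T2 -> R.
Hypotheses (mf : measurable_fun setT f)
  (f1 : forall x, m2.-integrable setT (fun y => (f (x, y))%:E))
  (f2 : forall y, m1.-integrable setT (fun x => (f (x, y))%:E))
  (f12 : (\int[m2]_y \int[m1]_x (`|f (x, y)|)%:E < +oo)%E).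

Lemma Rfubini : [/\ m1.-integrable setT (fun x => (\int[m2]_y f (x, y))%:E),
  m2.-integrable setT (fun y => (\int[m1]_x f (x, y))%:E)
  & \int[m1]_x \int[m2]_y f (x, y) = \int[m2]_y \int[m1]_x f (x, y)].
Proof.
have i12 : (m1 \x m2)%E.-integrable setT (EFin \o f).
  by apply/integrable21ltyP => //; exact/measurable_EFinP.
have E1 : (fun x => (\int[m2]_y f (x, y))%:E) = (fun x => \int[m2]_y (f (x, y))%:E)%E.
  by apply/funext => x; rewrite /Rintegral fineK//; exact: integrable_fin_num.
have E2 : (fun y => (\int[m1]_x f (x, y))%:E) = (fun y => \int[m1]_x (f (x, y))%:E)%E.
  by apply/funext => x; rewrite /Rintegral fineK//; exact: integrable_fin_num.
split; first by rewrite E1; exact: (integrable_fubini_F i12).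
  rewrite E2; apply/integrableP; split; first exact: (measurable_fubini_G i12).
  apply: le_lt_trans f12; apply: ge0_le_integral => //.
  - by apply: measurableT_comp => //; exact: (measurable_fubini_G i12).
  - apply: (measurable_fun_fubini_tonelli_G (fun z => (`|f z|)%:E)) => //.
    by apply/measurable_EFinP; exact: measurableT_comp.
  - move=> y _; apply: (le_trans (le_abse_integral _ _ _)) => //.
    by have /integrableP[] := f2 y.
by rewrite /Rintegral; congr fine; have := Fubini i12; rewrite E1 E2.
Qed.
End Rfubini.

(** * The exponent as the Laplace transform of an integrated tail *)

Section hinge.
Context {R : realType} (c : triplet R) (adm : admissible c).
Local Notation leb := (@lebesgue_measure R).
Local Notation D := (`]0%R, +oo[%classic : set (measurableTypeR R)).
Implicit Types (H h q : R -> R) (r s y : R).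

Let mD : measurable D. Proof. exact: measurable_itv. Qed.

Definition hinge r y : R := Num.max (r - y) 0.

Lemma hinge_ge0 r y : 0 <= hinge r y.
Proof. by rewrite /hinge le_max lexx orbT. Qed.

(** The integral remainder of Taylor's formula on [0, r]. The weight vanishes beyond r, so that the
    domain is the same half-line for all r. *)
Lemma taylor_hinge H h q r : 0 < r ->
  (forall s, is_derive s 1 H (h s)) -> (forall s, is_derive s 1 h (q s)) -> continuous q ->
  leb.-integrable D (fun y => (hinge r y * q y)%:E) /\
  \int[leb]_(y in D) (hinge r y * q y) = H r - H 0 - r * h 0.
Proof.
move=> r0 dH dh cq.
pose F y := (r - y) * h y + H y.
have dF y : is_derive y 1 F ((r - y) * q y).
  by rewrite /F; have := dH y; have := dh y => ? ?; deriv; ring.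
have cf : continuous (fun y => (r - y) * q y).
  by move=> y; apply: cvgM (cq y); apply: cvgB; [exact: cvg_cst|exact: cvg_id].
have cf' : {within `[0, r], continuous (fun y => (r - y) * q y)}.
  exact: continuous_subspaceT.
have cF y : {for y, continuous F} by exact: is_derive_continuous (dF y).
have FTC := @continuous_FTC2 R (fun y => (r - y) * q y) F 0 r r0 cf'.
have {}FTC : (\int[leb]_(x in `[0%R, r]) ((r - x) * q x)%:E = (F r)%:E - (F 0)%:E)%E.
  apply: FTC.
    split; first by move=> y _; have [] := dF y.
    - by apply: cvg_at_right_filter; exact: cF.
    - by apply: cvg_at_left_filter; exact: cF.
  by move=> y _; have [_ e] := dF y; rewrite derive1E e.
have ic : leb.-integrable `[0%R, r] (fun y => ((r - y) * q y)%:E).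
  by apply: continuous_compact_integrable => //; exact: segment_compact.
have E : (fun y => (hinge r y * q y)%:E) \_ D = (fun y => ((r - y) * q y)%:E) \_ (`]0%R, r]%classic : set R).
  apply/funext => y; rewrite !patchE; case: ifPn => [|/negP]; rewrite inE/= in_itv/= andbT => y0.
    case: ifPn => [|/negP]; rewrite inE/= in_itv/= y0/= => k.
      by rewrite /hinge max_l// subr_ge0.
    by rewrite /hinge max_r ?mul0r// subr_le0 ltW// ltNge; apply/negP.
  by case: ifPn => //; rewrite inE/= in_itv/= => /andP[/y0].
have ioc : leb.-integrable `]0%R, r] (fun y => ((r - y) * q y)%:E).
  by apply: integrableS ic => //; exact: subset_itv_oc_cc.
split.
  by apply/integrable_mkcond => //; rewrite E; apply/(integrable_mkcond _ _).1.
rewrite /Rintegral integral_mkcond E -integral_mkcond integral_itv_obnd_cbnd; last first.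
  exact: measurable_int ioc.
by rewrite FTC/= /F subrr mul0r; ring.
Qed.

(** The twice integrated tail of the Levy measure: the integral over r > y of the mass of ]r,
    +oo[. *)
Definition rho y : R := \int[levy c]_(r in D) hinge r y.

Lemma measurable_hinge2 : measurable_fun setT (fun z : measurableTypeR R * measurableTypeR R => hinge z.2 z.1).
Proof. by apply: measurable_maxr => //; exact: measurable_funB. Qed.

Lemma hinge_le r y : 0 < y -> 0 < r -> `|hinge r y| <= (y^-1 + 1) * Num.min (r ^+ 2) r.
Proof.
move=> y0 r0; rewrite ger0_norm ?hinge_ge0//; have yi : 0 < y^-1 by rewrite invr_gt0.
apply: (@le_min_sqr_id _ y^-1 1) => //; [exact: ltW|exact: ltW|lra|lra| |].
- rewrite /hinge ge_max; apply/andP; split; last by rewrite mulr_ge0 ?sqr_ge0 ?ltW.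
  rewrite -(ler_pM2l y0) mulrA divff ?gt_eqF// mul1r; by have := sqr_ge0 (r - y); have := sqr_ge0 r; nra.
- by rewrite /hinge ge_max; apply/andP; split; lra.
Qed.

(* Taylor's formula with integral remainder, and Tonelli. *)
Lemma hinge_transform H h q a C : 0 < a ->
  (forall s, is_derive s 1 H (h s)) -> (forall s, is_derive s 1 h (q s)) -> continuous q ->
  (forall s, 0 < s -> `|q s| <= C * expR (- (a * s))) ->
  [/\ (levy c).-integrable D (fun r => (H r - H 0 - r * h 0)%:E),
     leb.-integrable D (fun y => (rho y * q y)%:E)
   & \int[leb]_(y in D) (rho y * q y) = \int[levy c]_(r in D) (H r - H 0 - r * h 0)].
Proof.
move=> a0 dH dh cq qC; have [_ _ sf _ _] := adm.
have [p pE] := sigma_finite_restriction mD sf.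
have pE' (f : R -> \bar R) : (forall r, ~ D r -> f r = 0%E) -> (\int[p]_r f r = \int[levy c]_(r in D) f r)%E.
  move=> f0; transitivity (\int[p]_(r in D) f r)%E.
    rewrite [RHS]integral_mkcond; apply: eq_integral => r _; rewrite patchE.
    by case: ifPn => //; rewrite notin_setE => /f0.
  by apply: eq_measure_integral => A mA AD; apply: (etrans (pE A)); congr (levy c _); exact/setIidPl.
have pI (f : R -> R) : measurable_fun setT (f : measurableTypeR R -> R) -> (forall r, ~ D r -> f r = 0) ->
   (levy c).-integrable D (EFin \o f) -> p.-integrable setT (EFin \o f).
  move=> mf f0 /integrableP[_ i]; apply/integrableP; split; first exact/measurable_EFinP.
  rewrite (pE' (fun x => `|(f x)%:E|)%E)// => r /f0 ->; exact: abse0.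
have pR (f : R -> R) : (forall r, ~ D r -> f r = 0) ->
  \int[p]_r f r = \int[levy c]_(r in D) f r.
  by move=> f0; rewrite /Rintegral (pE' (EFin \o f))// => r /f0 /= ->.
pose f (z : measurableTypeR R * measurableTypeR R) : R := \1_D z.1 * (hinge z.2 z.1 * q z.1).
have mq : measurable_fun setT (q : measurableTypeR R -> R) by exact: continuous_measurable_fun.
have mf : measurable_fun setT f.
  apply: measurable_funM; first by apply: measurableT_comp => //; exact: measurable_indic.
  by apply: measurable_funM; [exact: measurable_hinge2|exact: measurableT_comp].
have fD y r : ~ D r -> f (y, r) = 0.
  move=> /pos_half_lineP/negP; rewrite -leNgt => r0; rewrite /f/= indicE.
  have [|_] := boolP (y \in D); last by rewrite mul0r.
  rewrite inE => /pos_half_lineP y0; rewrite /hinge max_r ?mul0r ?mulr0//; lra.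
have fDN y r : ~ D y -> f (y, r) = 0.
  by move=> Dy; rewrite /f/= indicE memNset// mul0r.
have ih y : 0 < y -> (levy c).-integrable D (EFin \o (hinge^~ y)).
  move=> y0; apply: (levy_integrable adm (K := y^-1 + 1)); last by move=> r; exact: hinge_le.
  by apply: measurable_maxr => //; exact: measurable_funB.
have f1 y : p.-integrable setT (fun r => (f (y, r))%:E).
  apply: pI; [exact: (measurableT_comp mf (pair1_measurable y))|exact: fD|].
  have [|/negP] := boolP (0 < y); last first.
    move=> /pos_half_lineP ny; rewrite (_ : _ \o _ = cst 0%E); first exact: integrable0.
    by apply/funext => r /=; rewrite fDN.
  move=> y0; rewrite (_ : _ \o _ = EFin \o (fun r => q y * hinge r y)).
    by apply: integrable_scale => //; exact: ih.
  by apply/funext => r /=; rewrite /f/= indicE mem_set ?mul1r 1?mulrC//; exact/pos_half_lineP.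
have R1 y : \int[p]_r f (y, r) = \1_D y * (rho y * q y).
  rewrite pR; last by move=> r; exact: fD.
  rewrite indicE; have [|/negP] := boolP (y \in D); last first.
    rewrite inE => ny; rewrite mul0r (_ : (fun r => _) = cst 0) ?Rintegral_cst ?mul0r//.
    by apply/funext => r; rewrite fDN.
  rewrite inE mul1r => Dy; have /pos_half_lineP y0 := Dy.
  rewrite /rho mulrC -RintegralZl//; last exact: ih.
  by apply: eq_Rintegral => r _; rewrite /f/= indicE mem_set ?mul1r 1?mulrC.
have indD (g : R -> R) : (fun y => (\1_D y * g y)%:E) = (fun y => (g y)%:E) \_ D.
  by apply/funext => y; rewrite patchE indicE; case: ifPn => _; rewrite ?mul1r ?mul0r.
pose G r := \1_D r * (H r - H 0 - r * h 0).
have f2 r : leb.-integrable setT (fun y => (f (y, r))%:E).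
  have [|/negP] := boolP (0 < r); last first.
    move=> /pos_half_lineP ny; rewrite (_ : (fun y => _) = cst 0%E); first exact: integrable0.
    by apply/funext => y /=; rewrite fD.
  by move=> r0; rewrite indD; apply/(integrable_mkcond _ _).1 => //; case: (taylor_hinge r0 dH dh cq).
have R2 r : \int[leb]_y f (y, r) = G r.
  rewrite /G indicE; have [|/negP] := boolP (r \in D); last first.
    rewrite inE => ny; rewrite mul0r (_ : (fun y => _) = cst 0) ?Rintegral_cst ?mul0r//.
    by apply/funext => y; rewrite fD.
  rewrite inE mul1r => /pos_half_lineP r0; have [_ <-] := taylor_hinge r0 dH dh cq.
  by rewrite /Rintegral indD -integral_mkcond.
have f12 : (\int[p]_r \int[leb]_y (`|f (y, r)|)%:E < +oo)%E.
  apply: (@le_lt_trans _ _ (\int[p]_r (\1_D r * (C / a ^+ 2 * expc2 a r))%:E)%E).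
    apply: ge0_le_integral => //.
    - by move=> r _; exact: integral_ge0.
    - apply: (measurable_fun_fubini_tonelli_G (fun z => (`|f z|)%:E)) => //.
      by apply/measurable_EFinP; exact: measurableT_comp.
    - apply/measurable_EFinP; apply: measurable_funM; first exact: measurable_indic.
      by apply: measurable_funM => //; exact: measurable_expc2.
    - move=> r _; rewrite indicE; have [|/negP] := boolP (r \in D); last first.
        rewrite inE => ny; rewrite mul0r.
        by under eq_integral do rewrite fD// normr0; rewrite integral0.
      rewrite inE mul1r => /pos_half_lineP r0.
      (* C e^(-as) is C times the second derivative of e^(-as)/a^2, so Taylor's formula evaluates
         the dominating integral as (C/a^2) [expc2 a r], which is Levy integrable. *)
      pose Ha s := expR (- (a * s)) / a ^+ 2; pose ha s := - (expR (- (a * s)) / a).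
      have dHa s : is_derive s 1 Ha (ha s) by rewrite /Ha /ha; deriv; field; rewrite gt_eqF.
      have dha s : is_derive s 1 ha (expR (- (a * s))) by rewrite /ha; deriv; field; rewrite gt_eqF.
      have ca : continuous (fun s : R => expR (- (a * s))).
        move=> s; apply: (@is_derive_continuous _ _ _ (- a * expR (- (a * s)))).
        by deriv; ring.
      have [ia Ia] := taylor_hinge r0 dHa dha ca.
      have -> : C / a ^+ 2 * expc2 a r = \int[leb]_(y in D) (C * (hinge r y * expR (- (a * y)))).
        rewrite RintegralZl// Ia /Ha /ha /expc2 mulr0 oppr0 expR0; field; rewrite gt_eqF//.
      have iCa := integrable_scale mD C ia.
      rewrite /Rintegral fineK; last exact: integrable_fin_num iCa.
      rewrite integral_mkcond; apply: ge0_le_integral => //.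
      - by apply/measurable_EFinP; apply: measurableT_comp => //; exact: (measurableT_comp mf (pair2_measurable (r : measurableTypeR R))).
      - by apply/(measurable_restrictT _ _).1 => //; exact: measurable_int iCa.
      - move=> y _; rewrite patchE; case: ifPn => [|/negP]; rewrite inE => Dy; last by rewrite fDN// normr0.
        rewrite lee_fin /f/= indicE mem_set// mul1r normrM ger0_norm ?hinge_ge0// mulrCA.
        by rewrite ler_wpM2l ?hinge_ge0// qC//; exact/pos_half_lineP.
  rewrite (pE' (fun r => (\1_D r * (C / a ^+ 2 * expc2 a r))%:E)%E); last first.
    by move=> r Dr; rewrite indicE memNset// mul0r.
  have iC := integrable_scale mD (C / a ^+ 2) (expc2_integrable adm (ltW a0)).
  under eq_integral => r Dr do rewrite indicE Dr mul1r.
  by have := integrable_fin_num mD iC; rewrite fin_numElt => /andP[].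
have [i1 i2 E12] := Rfubini mf f1 f2 f12.
have i1' : leb.-integrable D (fun y => (rho y * q y)%:E).
  by apply/(integrable_mkcond _ mD); rewrite -indD; move: i1; under eq_fun do rewrite R1.
split => //.
- have i3 : (p : {measure set _ -> \bar R}).-integrable setT (EFin \o G) by move: i2; under eq_fun do rewrite R2.
  apply/integrableP; have /integrableP[mG iG] := i3.
  have GE r : D r -> (EFin \o G) r = (H r - H 0 - r * h 0)%:E.
    by move=> Dr; rewrite /G/= indicE mem_set// mul1r.
  split.
    apply: (eq_measurable_fun (EFin \o G)); first by move=> r; rewrite inE => /GE.
    exact: measurable_funTS.
  move: iG; rewrite (pE' (fun r => `|(EFin \o G) r|)%E); last first.
    by move=> r Dr; rewrite /G/= indicE memNset// mul0r normr0.
  rewrite (_ : (\int[levy c]_(r in D) `|(EFin \o G) r|)%E =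
    (\int[levy c]_(r in D) `|(H r - H 0 - r * h 0)%:E|)%E)//.
  by apply: eq_integral => r; rewrite inE => /GE ->.
- move: E12; under eq_Rintegral do rewrite R1.
  under [in RHS]eq_Rintegral do rewrite R2.
  rewrite pR; last by move=> r Dr; rewrite /G indicE memNset// mul0r.
  rewrite [X in X = _ -> _]/Rintegral indD -integral_mkcond -/(Rintegral _ _ _) => ->.
  by apply: eq_Rintegral => r Dr; rewrite /G indicE Dr mul1r.
Qed.

End hinge.

(** * The density [kap] *)

Section levy_kernel.
Context {R : realType} (c : triplet R) (adm : admissible c).
Local Notation leb := (@lebesgue_measure R).
Local Notation D := (`]0%R, +oo[%classic : set (measurableTypeR R)).
Implicit Types (H h q : R -> R) (r s y a b : R).

Let mD : measurable D. Proof. exact: measurable_itv. Qed.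

(** The density for which psi(z) = z^2 (sigma^2 + int_0^oo kap(y) e^(-zy) dy). *)
Definition kap y : R := drift c + rho c y.

Lemma kap_ge0 y : 0 <= kap y.
Proof.
by have [_ d0 _ _ _] := adm; rewrite addr_ge0//; apply: Rintegral_ge0 => r _; exact: hinge_ge0.
Qed.

Lemma expRN_integrable a : 0 < a -> leb.-integrable D (fun y => (expR (- (a * y)))%:E).
Proof.
move=> a0; apply/integrableP; split.
  by apply/measurable_EFinP; apply: measurable_funTS; exact: measurable_expRN.
rewrite integral_itv_obnd_cbnd; last first.
  apply: measurable_funTS; apply: measurableT_comp => //.
  by apply/measurable_EFinP; exact: measurable_expRN.
under eq_integral do rewrite gee0_abs ?lee_fin ?expR_ge0//.
rewrite (_ : (\int[_]_(_ in _) _)%E = (a^-1)%:E) ?ltry//.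
by rewrite -(integral_exp_ray 0 a0); apply: eq_integral => t _; rewrite subr0.
Qed.

Lemma integral_pos_half_line h q a C : 0 < a ->
  (forall s, is_derive s 1 h (q s)) -> continuous q ->
  (forall s, 0 < s -> `|q s| <= C * expR (- (a * s))) ->
  h n%:R @[n --> \oo] --> 0 ->
  leb.-integrable D (fun y => (q y)%:E) /\ \int[leb]_(y in D) q y = - h 0.
Proof.
move=> a0 dh cq qC h0.
have mq : measurable_fun setT (q : measurableTypeR R -> R) by exact: continuous_measurable_fun.
pose f_ n y := q y * \1_(`]-oo, n.+1%:R]%classic) y.
have ig := integrable_scale mD C (expRN_integrable a0).
have mf n : measurable_fun D (f_ n).
  apply: measurable_funTS; apply: measurable_funM => //; exact: measurable_indic.
have fb n y : D y -> `|f_ n y| <= C * expR (- (a * y)).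
  move=> /pos_half_lineP y0; rewrite /f_ indicE; case: (_ \in _); rewrite ?mulr1 ?qC//.
  by rewrite mulr0 normr0 (le_trans _ (qC _ y0)).
have fc y : D y -> f_ n y @[n --> \oo] --> q y.
  move=> _; apply: cvg_near_cst.
  near=> n; rewrite /f_ indicE mem_set ?mulr1//= in_itv/=.
  by rewrite (@le_trans _ _ n%:R) ?ler_nat//; near: n; exact: nbhs_infty_ger.
have [i cv] := Rintegral_dominated_cvg mD mf ig fb fc.
split => //; suff cv2 : \int[leb]_(x in D) f_ n x @[n --> \oo] --> 0 - h 0.
  by rewrite -sub0r; exact: cvg_unique cv cv2.
rewrite (_ : (fun n => _) = (fun n => h n.+1%:R - h 0)); last first.
  apply/funext => n.
  have n0 : 0 < n.+1%:R :> R by rewrite ltr0n.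
  have FTC : (\int[leb]_(x in `[0%R, n.+1%:R]) (q x)%:E = (h n.+1%:R)%:E - (h 0)%:E)%E.
    apply: continuous_FTC2 => //; first exact: continuous_subspaceT.
      split; first by move=> y _; have [] := dh y.
      - by apply: cvg_at_right_filter; exact: is_derive_continuous (dh _).
      - by apply: cvg_at_left_filter; exact: is_derive_continuous (dh _).
    by move=> y _; have [_ e] := dh y; rewrite derive1E e.
  rewrite /Rintegral -[RHS]/(fine ((h n.+1%:R)%:E - (h 0)%:E)%E) -FTC; congr fine.
  rewrite -integral_itv_obnd_cbnd; last by apply: measurable_funTS; exact/measurable_EFinP.
  rewrite [LHS]integral_mkcond [RHS]integral_mkcond; apply: eq_integral => y _.
  rewrite !patchE /f_ indicE.
  have -> : (y \in (`]-oo, n.+1%:R]%classic : set R)) = (y <= n.+1%:R).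
    by apply/idP/idP; rewrite inE/= in_itv.
  have -> : (y \in D) = (0 < y) by apply/idP/idP; rewrite inE/= in_itv/= andbT.
  have -> : (y \in (`]0%R, n.+1%:R]%classic : set R)) = (0 < y <= n.+1%:R).
    by apply/idP/idP; rewrite inE/= in_itv.
  by case: (0 < y) => //=; case: (y <= _); rewrite ?mulr1 ?mulr0.
have h0' : h n.+1%:R @[n --> \oo] --> 0 by move: h0; rewrite -(cvg_shiftS (fun n => h n%:R)).
exact: (cvgB h0' (cvg_cst _)).
Unshelve. all: by end_near.
Qed.

Lemma kap_transform H h q a C : 0 < a ->
  (forall s, is_derive s 1 H (h s)) -> (forall s, is_derive s 1 h (q s)) -> continuous q ->
  (forall s, 0 < s -> `|q s| <= C * expR (- (a * s))) ->
  h n%:R @[n --> \oo] --> 0 ->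
  leb.-integrable D (fun y => (kap y * q y)%:E) /\
  \int[leb]_(y in D) (kap y * q y) = - (drift c * h 0) + \int[levy c]_(r in D) (H r - H 0 - r * h 0).
Proof.
move=> a0 dH dh cq qC h0.
have [_ i1 E1] := hinge_transform adm a0 dH dh cq qC.
have [i2 E2] := integral_pos_half_line a0 dh cq qC h0.
have i3 := integrable_scale mD (drift c) i2.
have kE : (fun y => (kap y * q y)%:E) = (fun y => (drift c * q y + rho c y * q y)%:E).
  by apply/funext => y; rewrite /kap mulrDl.
split; first by rewrite kE; exact: integrable_add.
rewrite -E1; transitivity (\int[leb]_(y in D) (drift c * q y + rho c y * q y)).
  by apply: eq_Rintegral => y _; rewrite /kap mulrDl.
by rewrite RintegralD// RintegralZl// E2 mulrN.
Qed.

Let Cf a b y : R := expR (- (a * y)) * cos (b * y).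
Let Sf a b y : R := expR (- (a * y)) * sin (b * y).

Let dC a b y : is_derive y 1 (Cf a b) (- a * Cf a b y - b * Sf a b y).
Proof. by rewrite /Cf /Sf; deriv; ring. Qed.

Let dS a b y : is_derive y 1 (Sf a b) (- a * Sf a b y + b * Cf a b y).
Proof. by rewrite /Cf /Sf; deriv; ring. Qed.

Let C_le a b y : `|Cf a b y| <= expR (- (a * y)).
Proof.
rewrite /Cf normrM ger0_norm ?expR_ge0// -[leRHS]mulr1 ler_wpM2l ?expR_ge0//.
by rewrite ler_norml cos_geN1 cos_le1.
Qed.

Let S_le a b y : `|Sf a b y| <= expR (- (a * y)).
Proof.
rewrite /Sf normrM ger0_norm ?expR_ge0// -[leRHS]mulr1 ler_wpM2l ?expR_ge0//.
by rewrite ler_norml sin_geN1 sin_le1.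
Qed.

Let comb_le a b k l y : `|k * Cf a b y + l * Sf a b y| <= (`|k| + `|l|) * expR (- (a * y)).
Proof.
rewrite (le_trans (ler_normD _ _))// (normrM k) (normrM l) mulrDl lerD//; apply: ler_wpM2l => //.
Qed.

Let exp0 a : 0 < a -> expR (- (a * n%:R)) @[n --> \oo] --> (0 : R).
Proof.
move=> a0; have h : (expR (- a) ^+ n : R) @[n --> \oo] --> 0.
  by apply: cvg_expr; rewrite ger0_norm ?expR_ge0// -[ltRHS]expR0 ltr_expR oppr_lt0.
by rewrite (_ : (fun n => _) = (fun n => expR (- a) ^+ n))//; apply/funext => n; rewrite -expRM_natl mulrN mulrC.
Qed.

Let comb0 a b k l : 0 < a -> (k * Cf a b n%:R + l * Sf a b n%:R) @[n --> \oo] --> (0 : R).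
Proof.
move=> a0; apply: (@squeeze_cvgn _ (fun n => - ((`|k| + `|l|) * expR (- (a * n%:R)))) _ (fun n => (`|k| + `|l|) * expR (- (a * n%:R)))).
- by move=> n; rewrite -ler_norml; exact: comb_le.
- rewrite -[X in _ --> X]oppr0 -[X in _ --> - X](mulr0 (`|k| + `|l|)).
  by apply: cvgN; apply: cvgM; [exact: cvg_cst|exact: exp0].
- rewrite -[X in _ --> X](mulr0 (`|k| + `|l|)).
  by apply: cvgM; [exact: cvg_cst|exact: exp0].
Qed.

Let contC a b : continuous (Cf a b).
Proof. by move=> y; exact: is_derive_continuous (dC a b y). Qed.

Let contS a b : continuous (Sf a b).
Proof. by move=> y; exact: is_derive_continuous (dS a b y). Qed.

(** [kap_transform] applied to e^(-ay) makes kap(y) e^(-ay) integrable; dividing by the exponential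
    gives the measurability of kap, and the rest is domination. *)
Lemma measurable_kap_integrable a b (f : R -> R) : 0 < a ->
  measurable_fun D (f : measurableTypeR R -> R) -> (forall y, 0 < y -> `|f y| <= expR (- (a * y))) ->
  leb.-integrable D (fun y => (kap y * f y)%:E).
Proof.
move=> a0 mf fb.
pose h y := - (a * expR (- (a * y))); pose q y := a ^+ 2 * expR (- (a * y)).
have dH s : is_derive s 1 (fun y => expR (- (a * y))) (h s) by rewrite /h; deriv; ring.
have dh s : is_derive s 1 h (q s) by rewrite /h /q; deriv; rewrite /h; ring.
have cq : continuous q.
  move=> y; apply: (@is_derive_continuous _ _ _ (- a * (a ^+ 2 * expR (- (a * y))))).
  by rewrite /q; deriv; rewrite /h; ring.
have qb s : 0 < s -> `|q s| <= a ^+ 2 * expR (- (a * s)).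
  by move=> _; rewrite ger0_norm// /q mulr_ge0 ?expR_ge0// sqr_ge0.
have h0 : h n%:R @[n --> \oo] --> 0.
  rewrite /h -[X in _ --> X]oppr0 -[X in _ --> - X](mulr0 a).
  by apply: cvgN; apply: cvgM; [exact: cvg_cst|exact: exp0].
have [i _] := kap_transform a0 dH dh cq qb h0.
have mk : measurable_fun D (kap : measurableTypeR R -> R).
  rewrite (_ : kap = (fun y => (kap y * q y) * (a ^- 2 * expR (a * y)))); last first.
    apply/funext => y; have e : expR (- (a * y)) * expR (a * y) = 1 by rewrite -expRD addNr expR0.
    rewrite -[LHS]mulr1 -e /q; move: (kap y) (expR _) (expR _) => k u v.
    by field; rewrite gt_eqF.
  apply: measurable_funM; first exact/measurable_EFinP/measurable_int/i.
  apply: measurable_funTS; apply: measurable_funM => //.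
  by apply: measurableT_comp => //; exact: measurable_funM.
apply: (integrable_dominated mD _ (integrable_scale mD (a ^- 2) i)) => //.
- by apply: measurable_funM.
- move=> y /pos_half_lineP y0; rewrite normrM ger0_norm ?kap_ge0// /q.
  rewrite mulrCA [a ^- 2 * _]mulrA mulVf ?mul1r ?ler_wpM2l ?kap_ge0 ?fb//.
  by rewrite expf_neq0// gt_eqF.
Qed.

Local Open Scope complex_scope.

(** Apply [kap_transform] to the real and imaginary parts of e^(-zy), whose second derivatives are
    the parts of z^2 e^(-zy). *)
Lemma kap_exp a b : 0 < a ->
  let A := \int[leb]_(y in D) (kap y * (expR (- (a * y)) * cos (b * y))) in
  let B := \int[leb]_(y in D) (kap y * (expR (- (a * y)) * sin (b * y))) in
  psi c (a +i* b) = (a +i* b) ^+ 2 * ((sigma c ^+ 2 + A) +i* (- B)).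
Proof.
move=> a0 A B.
have mC : measurable_fun D (Cf a b : measurableTypeR R -> R).
  by apply: measurable_funTS; exact: continuous_measurable_fun.
have mS : measurable_fun D (Sf a b : measurableTypeR R -> R).
  by apply: measurable_funTS; exact: continuous_measurable_fun.
have iC := measurable_kap_integrable b a0 mC (fun y _ => C_le a b y).
have iS := measurable_kap_integrable b a0 mS (fun y _ => S_le a b y).
have lin k l : \int[leb]_(y in D) (kap y * (k * Cf a b y + l * Sf a b y)) = k * A + l * B.
  have -> : (fun y => kap y * (k * Cf a b y + l * Sf a b y)) =
      (fun y => k * (kap y * Cf a b y) + l * (kap y * Sf a b y)) by apply/funext => y; ring.
  by rewrite RintegralD ?RintegralZl//; exact: integrable_scale.
have dC' y : is_derive y 1 (Cf a b) (- a * Cf a b y + (- b) * Sf a b y).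
  by rewrite [- b * _]mulNr; exact: dC.
have dS' y : is_derive y 1 (Sf a b) (b * Cf a b y + (- a) * Sf a b y).
  by rewrite addrC; exact: dS.
have d2 k l y : is_derive y 1 (fun y => k * Cf a b y + l * Sf a b y)
   ((l * b - k * a) * Cf a b y + (- (k * b) - l * a) * Sf a b y).
  by have := dC a b y; have := dS a b y => ? ?; deriv; ring.
have cc k l : continuous (fun y => k * Cf a b y + l * Sf a b y).
  by move=> y; exact: is_derive_continuous (d2 k l y).
have [_] := kap_transform a0 dC' (d2 _ _) (cc _ _) (fun y _ => comb_le a b _ _ y) (comb0 _ _ _ a0).
rewrite lin => E1.
have [_] := kap_transform a0 dS' (d2 _ _) (cc _ _) (fun y _ => comb_le a b _ _ y) (comb0 _ _ _ a0).
rewrite lin => E2.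
have C0 : Cf a b 0 = 1 by rewrite /Cf !mulr0 oppr0 expR0 cos0 mulr1.
have S0 : Sf a b 0 = 0 by rewrite /Sf !mulr0 sin0 mulr0.
rewrite psiE expr2; simpc; congr (_ +i* _).
  have -> : \int[levy c]_(y in D) re_expc2 a b y =
    \int[levy c]_(r in D) (Cf a b r - Cf a b 0 - r * (- a * Cf a b 0 + - b * Sf a b 0)).
    by apply: eq_Rintegral => y _; rewrite C0 S0 /re_expc2 /Cf; ring.
  by move: E1; rewrite C0 S0; lra.
have -> : \int[levy c]_(y in D) im_expc2 a b y =
   - \int[levy c]_(r in D) (Sf a b r - Sf a b 0 - r * (b * Cf a b 0 + - a * Sf a b 0)).
  rewrite -mulN1r -RintegralZl//; last first.
    by have [i _ _] := hinge_transform adm a0 dS' (d2 _ _) (cc _ _) (fun y _ => comb_le a b _ _ y).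
  by apply: eq_Rintegral => y _; rewrite C0 S0 /im_expc2 /Sf; ring.
by move: E2; rewrite C0 S0; lra.
Qed.

End levy_kernel.

Section product_integral.
Context d1 d2 (T1 : measurableType d1) (T2 : measurableType d2) (R : realType).
Variables (m1 : {sigma_finite_measure set T1 -> \bar R}) (m2 : {sigma_finite_measure set T2 -> \bar R}).

Lemma product_integral (u : T1 -> R) (v : T2 -> R) :
  m1.-integrable setT (EFin \o u) -> m2.-integrable setT (EFin \o v) ->
  (m1 \x m2)%E.-integrable setT (EFin \o (fun z => u z.1 * v z.2)) /\
  \int[(m1 \x m2)%E]_z (u z.1 * v z.2) = (\int[m1]_x u x) * (\int[m2]_y v y).
Proof.
move=> iu iv.
have mu : measurable_fun setT u by exact/measurable_EFinP/(measurable_int _ iu).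
have mv : measurable_fun setT v by exact/measurable_EFinP/(measurable_int _ iv).
have mf : measurable_fun setT (EFin \o (fun z : T1 * T2 => u z.1 * v z.2)).
  by apply/measurable_EFinP; apply: measurable_funM; exact: measurableT_comp.
have iau : m1.-integrable setT (EFin \o (fun x => `|u x|)) by exact: integrable_norm iu.
have iav : m2.-integrable setT (EFin \o (fun x => `|v x|)) by exact: integrable_norm iv.
have inner (w : T2 -> R) k : m2.-integrable setT (EFin \o w) ->
    (\int[m2]_y (k * w y)%:E = (k * \int[m2]_y w y)%:E)%E.
  move=> iw; rewrite -RintegralZl// /Rintegral fineK//.
  by apply: integrable_fin_num => //; exact: integrable_scale.
have i : (m1 \x m2)%E.-integrable setT (EFin \o (fun z => u z.1 * v z.2)).
  apply/integrable12ltyP => //.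
  rewrite (_ : (\int[m1]_x _)%E = (\int[m1]_x ((\int[m2]_y `|v y|) * `|u x|)%:E)%E).
    have := integrable_scale measurableT (\int[m2]_y `|v y|) iau.
    by move/(integrable_fin_num measurableT); rewrite fin_numElt => /andP[].
  apply: eq_integral => x _; rewrite -[in RHS]mulrC -inner//.
  by apply: eq_integral => y _ /=; rewrite normrM.
split => //; rewrite {1}/Rintegral -integral12_prod_meas1// /fubini_F/=.
rewrite (_ : (fun x => _) = (fun x => ((\int[m2]_y v y) * u x)%:E)).
  by rewrite mulrC -RintegralZl.
by apply/funext => x; rewrite inner// mulrC.
Qed.

End product_integral.

(** * The moment identity and its extension to complex powers *)

Section moment_identity.
Context {R : realType} (c : triplet R) (adm : admissible c).
Context (mu : probability (measurableTypeR R) R).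
Local Notation leb := (@lebesgue_measure R).
Local Notation D := (`]0%R, +oo[%classic : set (measurableTypeR R)).
Implicit Types (g : R -> R) (p : R).

Hypothesis mu_pos : mu D = 1%E.
Hypothesis mu_mom : forall n,
  (\int[mu]_x (`|x| ^+ n)%:E = (n`!%:R / \prod_(1 <= i < n.+1) phiR c i%:R)%:E)%E.

Let mD : measurable D. Proof. exact: measurable_itv. Qed.

Lemma positive_ae : {ae mu, forall x, 0 < x}.
Proof.
exists (~` D); split; first exact: measurableC.
  by rewrite probability_setC// mu_pos subee.
by move=> x /=; apply: contra_not => /pos_half_lineP.
Qed.

Lemma positive_ext (f g : R -> R) : measurable_fun setT (f : measurableTypeR R -> R) ->
  measurable_fun setT (g : measurableTypeR R -> R) -> (forall x, 0 < x -> f x = g x) ->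
  \int[mu]_x f x = \int[mu]_x g x.
Proof.
move=> mf mg fg; rewrite /Rintegral; congr fine; apply: ae_eq_integral => //.
- exact/measurable_EFinP.
- exact/measurable_EFinP.
- by apply: (@filterS _ _ (ae_filter_ringOfSetsType mu) _ _ _ positive_ae) => x /fg /= ->.
Qed.

Let prod_ge n : phiR c 1 ^+ n <= \prod_(1 <= i < n.+1) phiR c i%:R.
Proof.
elim: n => [|n ih]; first by rewrite big_geq.
rewrite big_nat_recr//= exprSr; apply: ler_pM => //.
- by rewrite exprn_ge0// ltW// phiR_gt0.
- by rewrite ltW// phiR_gt0.
- by apply: phiR_homo => //; rewrite ler1n.
Qed.

Let prod_gt0 n : 0 < \prod_(1 <= i < n.+1) phiR c i%:R :> R.
Proof. by rewrite (lt_le_trans _ (prod_ge n))// exprn_gt0// phiR_gt0. Qed.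

Local Notation a := (phiR c 1 / 2).

Let a0 : 0 < a. Proof. by rewrite divr_gt0// phiR_gt0. Qed.

(** For an arbitrary law on the line, of which only moments are known, as determinacy requires. The
    bound n!/phi(1)^n allows any rate below phi(1); half of it is taken. *)
Lemma exp_integrable_even (m : probability (measurableTypeR R) R) : (forall n, ~~ odd n ->
    (\int[m]_x (x ^+ n)%:E = (n`!%:R / \prod_(1 <= i < n.+1) phiR c i%:R)%:E)%E) ->
  m.-integrable setT (EFin \o (fun x => expR (a * `|x|))).
Proof.
move=> m_mom; have p1 : 0 < phiR c 1 by apply: phiR_gt0.
apply: (@exp_moment _ m a (phiR c 1)^-1 1); first exact: ltW.
- by rewrite invr_ge0 ltW.
- rewrite mulrAC divff ?gt_eqF// mul1r; lra.
- move=> n en; rewrite m_mom// lee_fin mul1r exprVn ler_wpM2l// lef_pV2 ?posrE ?prod_ge//.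
  by rewrite exprn_gt0.
Qed.

Lemma exp_integrable : mu.-integrable setT (EFin \o (fun x => expR (a * `|x|))).
Proof.
apply: exp_integrable_even => n en; rewrite -mu_mom; apply: eq_integral => x _.
by rewrite -normrX ger0_norm// exprn_even_ge0.
Qed.

Let pos (x : R) : R := Num.max x 0.
Let kker g (z : measurableTypeR R * measurableTypeR R) : R :=
  \1_D z.1 * (kap c z.1 * expR (- z.1)) * (pos z.2 * g (expR (- z.1) * z.2)).
Let Lk := (leb \x mu)%E.

(** The expectation of x (sigma^2 g(x) + int_0^oo kap(y) e^(-y) g(e^(-y) x) dy), with the second
    part written as an integral over pairs (y, x). *)
Let A g := sigma c ^+ 2 * (\int[mu]_x (pos x * g x)) + \int[Lk]_z kker g z.

Let good g := [/\ measurable_fun setT (g : measurableTypeR R -> R), mu.-integrable setT (EFin \o g),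
  mu.-integrable setT (EFin \o (fun x => pos x * g x)) & Lk.-integrable setT (EFin \o kker g)].

Let KI g := good g /\ \int[mu]_x g x = A g.

Let pos_ge0 x : 0 <= pos x. Proof. by rewrite /pos le_max lexx orbT. Qed.

Let posE x : 0 < x -> pos x = x. Proof. by move=> x0; rewrite /pos max_l// ltW. Qed.

Let pos_le x : pos x <= `|x|. Proof. by rewrite /pos ge_max ler_norm normr_ge0. Qed.

Let mpos : measurable_fun setT (pos : measurableTypeR R -> R).
Proof. exact: measurable_maxr. Qed.

Let kap_int b : 0 < b ->
  leb.-integrable setT (EFin \o (fun y => \1_D y * (kap c y * expR (- (b * y))))).
Proof.
move=> b0.
have i : leb.-integrable D (fun y => (kap c y * expR (- (b * y)))%:E).
  apply: (measurable_kap_integrable adm 0 b0); first by apply: measurable_funTS; exact: measurable_expRN.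
  by move=> y _; rewrite ger0_norm ?expR_ge0.
move/(integrable_mkcond _ mD) : i; congr (integrable _ _ _); apply/funext => y.
by rewrite patchE /= indicE; case: ifPn => _; rewrite ?mul1r ?mul0r.
Qed.

Let kker_le g G z : (forall x, `|g x| <= G x) -> `|kker g z| <= kker G z.
Proof.
move=> gG; rewrite /kker normrM ger0_norm; last first.
  by rewrite mulr_ge0 ?mulr_ge0 ?kap_ge0 ?expR_ge0// indicE.
rewrite ler_wpM2l//; first by rewrite mulr_ge0 ?mulr_ge0 ?kap_ge0 ?expR_ge0// indicE.
by rewrite normrM ger0_norm// ler_wpM2l.
Qed.

Let mkker g : measurable_fun setT (g : measurableTypeR R -> R) -> measurable_fun setT (kker g).
Proof.
move=> mg; apply: measurable_funM.
  have /measurable_int/measurable_EFinP m := kap_int ltr01.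
  rewrite (_ : (fun z => _) = (fun y : measurableTypeR R => \1_D y * (kap c y * expR (- (1 * y)))) \o fst).
    exact: measurableT_comp.
  by apply/funext => z /=; rewrite mul1r.
apply: measurable_funM; first exact: measurableT_comp.
apply: measurableT_comp => //; apply: measurable_funM => //.
by apply: measurableT_comp => //; apply: measurableT_comp.
Qed.

Let good_dominated g G : measurable_fun setT (g : measurableTypeR R -> R) -> good G ->
  (forall x, `|g x| <= G x) -> good g.
Proof.
move=> mg [mG i1 i2 i3] gG; split => //.
- exact: (integrable_dominated measurableT mg i1).
- apply: (integrable_dominated measurableT _ i2); first exact: measurable_funM.
  by move=> x _; rewrite normrM ger0_norm// ler_wpM2l.
- apply: (integrable_dominated measurableT _ i3); first exact: mkker.
  by move=> z _; exact: kker_le.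
Qed.

Let KI_dominated (f_ : nat -> R -> R) (f G : R -> R) : (forall n, KI (f_ n)) -> good G ->
  (forall n x, `|f_ n x| <= G x) -> (forall x, f_ n x @[n --> \oo] --> f x) -> KI f.
Proof.
move=> KF gG fG fc; have [mG i1 i2 i3] := gG.
have mf n : measurable_fun setT (f_ n : measurableTypeR R -> R) by case: (KF n) => -[].
have [j1 c1] := Rintegral_dominated_cvg measurableT mf i1 (fun n x _ => fG n x) (fun x _ => fc x).
have mf2 n : measurable_fun setT (fun x : measurableTypeR R => pos x * f_ n x) by exact: measurable_funM.
have fG2 n (x : measurableTypeR R) : setT x -> `|pos x * f_ n x| <= pos x * G x.
  by move=> _; rewrite normrM ger0_norm// ler_wpM2l.
have fc2 (x : measurableTypeR R) : setT x -> pos x * f_ n x @[n --> \oo] --> pos x * f x.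
  by move=> _; apply: cvgM; [exact: cvg_cst|exact: fc].
have [j2 c2] := Rintegral_dominated_cvg measurableT mf2 i2 fG2 fc2.
have mf3 n : measurable_fun setT (kker (f_ n)) by exact: mkker.
have fG3 n z : setT z -> `|kker (f_ n) z| <= kker G z by move=> _; exact: kker_le.
have fc3 z : setT z -> kker (f_ n) z @[n --> \oo] --> kker f z.
  move=> _; apply: cvgM; first exact: cvg_cst.
  by apply: cvgM; [exact: cvg_cst|exact: fc].
have [j3 c3] := Rintegral_dominated_cvg measurableT mf3 i3 fG3 fc3.
split; first split => //.
  exact: (measurable_fun_cvg mf (fun x _ => fc x)).
have {}c1 : A (f_ n) @[n --> \oo] --> \int[mu]_x f x.
  by rewrite (_ : (fun n => A (f_ n)) = (fun n => \int[mu]_x f_ n x))//; apply/funext => n; have [] := KF n.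
apply: cvg_unique c1 _ => //; apply: cvgD => //.
by apply: cvgM; [exact: cvg_cst|exact: c2].
Qed.

Let KI_lin k f g : KI f -> KI g -> KI (fun x => k * f x + g x).
Proof.
move=> [[mf f1 f2 f3] Ef] [[mg g1 g2 g3] Eg].
have p2E : (fun x => pos x * (k * f x + g x)) = (fun x => k * (pos x * f x) + pos x * g x).
  by apply/funext => x; ring.
have p3E : kker (fun x => k * f x + g x) = (fun z => k * kker f z + kker g z).
  by apply/funext => z; rewrite /kker; ring.
split; first split.
- by apply: measurable_funD => //; exact: measurable_funM.
- by apply: integrable_add => //; exact: integrable_scale.
- by rewrite p2E; apply: integrable_add => //; exact: integrable_scale.
- by rewrite p3E; apply: integrable_add => //; exact: integrable_scale.
rewrite /A p2E p3E !RintegralD ?RintegralZl//; try exact: integrable_scale.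
by rewrite Ef Eg /A; ring.
Qed.

Let b0 : 0 < a / 2. Proof. by rewrite divr_gt0. Qed.

(** The factor x of the identity costs half of the exponent: |x| e^(a|x|/2) <= (2/a) e^(a|x|). Hence
    a closed class with rate a/2. *)
Let good_exp C : 0 <= C -> good (fun x => C * expR (a / 2 * `|x|)).
Proof.
move=> C0; have me : measurable_fun setT (fun x : measurableTypeR R => C * expR (a / 2 * `|x|)).
  apply: measurable_funM => //; apply: measurableT_comp => //.
  by apply: measurable_funM => //; exact: measurableT_comp.
have h1 (x : R) : expR (a / 2 * `|x|) <= expR (a * `|x|).
  by rewrite ler_expR ler_wpM2r//; have := a0; lra.
have h2 (x : R) : `|x| * expR (a / 2 * `|x|) <= (a / 2)^-1 * expR (a * `|x|).
  have := expr_le_expRM 1 b0 (normr_ge0 x); rewrite !expr1 mul1r => h.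
  apply: (@le_trans _ _ ((a / 2)^-1 * expR (a / 2 * `|x|) * expR (a / 2 * `|x|))).
    by rewrite ler_wpM2r ?expR_ge0.
  by rewrite -mulrA -expRD -mulrDl -splitr.
split => //.
- apply: (integrable_dominated measurableT me (integrable_scale measurableT C exp_integrable)).
  by move=> x _; rewrite ger0_norm ?mulr_ge0 ?expR_ge0// ler_wpM2l.
- apply: (integrable_dominated measurableT _ (integrable_scale measurableT (C * (a / 2)^-1) exp_integrable)).
    exact: measurable_funM.
  move=> x _; rewrite ger0_norm ?mulr_ge0 ?expR_ge0//.
  rewrite mulrCA -(mulrA C); apply: ler_wpM2l => //.
  exact: (le_trans (ler_wpM2r (expR_ge0 _) (pos_le x)) (h2 x)).
have [i _] := product_integral (kap_int ltr01) (integrable_scale measurableT (C * (a / 2)^-1) exp_integrable).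
apply: (integrable_dominated measurableT (mkker me) i) => z _.
rewrite ger0_norm; last first.
  by rewrite /kker !mulr_ge0 ?kap_ge0 ?expR_ge0// indicE.
rewrite /kker mul1r; have [|/negP] := boolP (z.1 \in D); last first.
  by move=> h; rewrite indicE (negbTE (introN idP h)) !mul0r.
rewrite inE => /pos_half_lineP y0.
apply: ler_wpM2l; first by rewrite !mulr_ge0 ?kap_ge0 ?expR_ge0// indicE.
rewrite mulrCA -(mulrA C); apply: ler_wpM2l => //; apply: (le_trans _ (h2 z.2)).
apply: ler_pM; [exact: pos_ge0|exact: expR_ge0|exact: pos_le|].
rewrite ler_expR; apply: ler_wpM2l; first exact: ltW.
rewrite normrM (ger0_norm (expR_ge0 _)) ler_piMl//.
by rewrite -[leRHS]expR0 ler_expR oppr_le0 ltW.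
Qed.

Let KI_closed : closed_class (a / 2) KI.
Proof.
split; first exact: KI_lin.
move=> f_ f C Kf fC fc; apply: (KI_dominated (G := fun x => `|C| * expR (a / 2 * `|x|)) Kf _ _ fc).
  exact: good_exp.
by move=> n x; apply: le_trans (fC n x) _; rewrite ler_wpM2r ?expR_ge0// ler_norm.
Qed.

Lemma abs_moment n : \int[mu]_x (`|x| ^+ n) = n`!%:R / \prod_(1 <= i < n.+1) phiR c i%:R.
Proof. by rewrite /Rintegral mu_mom. Qed.

(** The y-integral is the Laplace transform of [kap] at n + 1, equal to phi(n + 1)/(n + 1) - sigma^2
    by [kap_exp]. *)
Let KI_monomial n : KI (fun x => x ^+ n).
Proof.
have mX : measurable_fun setT (fun x : measurableTypeR R => x ^+ n) by exact: measurable_funX.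
have gX : good (fun x => x ^+ n).
  apply: (good_dominated mX (good_exp (C := n`!%:R / (a / 2) ^+ n) _)).
    by rewrite divr_ge0 ?exprn_ge0// ltW.
  by move=> x; rewrite normrX; exact: expr_le_expRM.
split => //.
have mabs k : measurable_fun setT (fun x : measurableTypeR R => `|x| ^+ k).
  by apply: measurable_funX; exact: normr_measurable.
have -> : \int[mu]_x (x ^+ n) = \int[mu]_x (`|x| ^+ n).
  by apply: positive_ext => // x x0; rewrite gtr0_norm.
have i2 : mu.-integrable setT (EFin \o (fun x => pos x * x ^+ n)) by case: gX.
have e2 : \int[mu]_x (pos x * x ^+ n) = \int[mu]_x (`|x| ^+ n.+1).
  by apply: positive_ext => //; [exact: measurable_funM|move=> x x0; rewrite posE// gtr0_norm// exprS].
have n1 : 0 < n.+1%:R :> R by rewrite ltr0n.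
have kE : kker (fun x => x ^+ n) =
    (fun z => \1_D z.1 * (kap c z.1 * expR (- (n.+1%:R * z.1))) * (pos z.2 * z.2 ^+ n)).
  apply/funext => z; rewrite /kker exprMn -expRM_natl.
  have -> : expR (- (n.+1%:R * z.1)) = expR (- z.1) * expR (n%:R * - z.1).
    by rewrite -expRD; congr expR; rewrite -addn1 natrD; ring.
  by ring.
rewrite /A e2 kE; have [_ ->] := product_integral (kap_int n1) i2.
rewrite e2 !abs_moment.
have -> : \int[leb]_x (\1_D x * (kap c x * expR (- (n.+1%:R * x)))) =
   \int[leb]_(y in D) (kap c y * (expR (- (n.+1%:R * y)) * cos (0 * y))).
  rewrite /Rintegral [in RHS]integral_mkcond; congr fine; apply: eq_integral => y _.
  by rewrite patchE indicE mul0r cos0 mulr1; case: ifPn => _; rewrite ?mul1r ?mul0r.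
have := kap_exp adm 0 n1; rewrite /=.
set B := \int[leb]_(y in D) (kap c y * (expR (- (n.+1%:R * y)) * cos (0 * y))).
have -> : \int[leb]_(y in D) (kap c y * (expR (- (n.+1%:R * y)) * sin (0 * y))) = 0.
  rewrite (_ : (fun y => _) = cst 0) ?Rintegral_cst ?mul0r//.
  by apply/funext => y; rewrite mul0r sin0 !mulr0.
rewrite -[(_ +i* 0)%C]/((n.+1%:R)%:C)%C psi_real => /(congr1 (@complex.Re R)) /=.
rewrite oppr0 !mulr0 !subr0 => E.
rewrite [in RHS]big_nat_recr//= phiRE ?gt_eqF// E factS natrM.
have := prod_gt0 n; set Q := \prod_(_ <= _ < _) _ => Q0.
rewrite -mulrDl.
have S0 : 0 < sigma c ^+ 2 + B.
  have := psiR_gt0 adm n1; rewrite E pmulr_rgt0//; exact: mulr_gt0.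
by field; rewrite !gt_eqF.
Qed.

Let KI_bounded f : bounded_borel f -> KI f.
Proof. exact: (closed_class_bounded b0 KI_closed KI_monomial). Qed.

Let Ep p (x : R) : R := expR (p * ln x).

Let mEp p : measurable_fun setT (Ep p : measurableTypeR R -> R).
Proof. by apply: measurableT_comp => //; apply: measurable_funM => //; exact: measurable_ln. Qed.

(** Every power is bounded on this set: [Ep p] is 1 on the nonpositive half-line, as [ln] vanishes
    there. *)
Let Tr (N : nat) : set (measurableTypeR R) := `]-oo, 0%R] `|` `[N.+1%:R^-1, N.+1%:R].

Let mTr N : measurable (Tr N).
Proof. by apply: measurableU; exact: measurable_itv. Qed.

Let TrP N x : Tr N x <-> x <= 0 \/ (N.+1%:R^-1 <= x /\ x <= N.+1%:R).
Proof.
rewrite /Tr/=; split.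
  by case; rewrite /= in_itv/=; [left|move=> /andP[]; right].
by move=> [h|[h1 h2]]; [left|right]; rewrite /= in_itv/= ?h ?h1.
Qed.

Let Tr_homo m n : (m <= n)%N -> Tr m `<=` Tr n.
Proof.
move=> mn x /TrP h; apply/TrP; case: h => [|[h1 h2]]; [by left|right; split].
- by apply: le_trans h1; rewrite lef_pV2 ?posrE ?ltr0n// ler_nat.
- by apply: (le_trans h2); rewrite ler_nat.
Qed.

Let Tr_cvg x : \forall n \near \oo, \1_(Tr n) x = 1 :> R.
Proof.
have [x0|x0] := leP x 0.
  by apply: nearW => n; rewrite indicE mem_set//; apply/TrP; left.
near=> n; rewrite indicE mem_set//; apply/TrP; right; split.
- rewrite -(invrK x) lef_pV2 ?posrE ?invr_gt0 ?ltr0n//.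
  by rewrite (@le_trans _ _ n%:R) ?ler_nat//; near: n; exact: nbhs_infty_ger.
- by rewrite (@le_trans _ _ n%:R) ?ler_nat//; near: n; exact: nbhs_infty_ger.
Unshelve. all: by end_near.
Qed.

Let Ep_trunc p N x : Tr N x -> Ep p x <= expR (`|p| * ln N.+1%:R).
Proof.
move=> /TrP h; rewrite /Ep ler_expR.
have N1 : 1 <= N.+1%:R :> R by rewrite ler1n.
have L0 : 0 <= ln (N.+1%:R : R) by exact: ln_ge0.
case: h => [x0|[h1 h2]]; first by rewrite ln0// mulr0 mulr_ge0.
have x0 : 0 < x by rewrite (lt_le_trans _ h1)// invr_gt0 ltr0n.
rewrite (le_trans (ler_norm _))// normrM ler_wpM2l// ler_norml; apply/andP; split.
  by rewrite -lnV ?posrE ?ltr0n// ler_ln// posrE// invr_gt0 ltr0n.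
by rewrite ler_ln// posrE// ltr0n.
Qed.

Let pos_pow_int p : -1 < p -> mu.-integrable setT (EFin \o (fun x => pos x * Ep p x)).
Proof.
move=> p1; have [m pm] : exists m : nat, p + 1 <= m%:R.
  by exists (Num.truncn `|p + 1|).+1; rewrite (le_trans (ler_norm _))// ltW// truncnS_gt.
have gX k : mu.-integrable setT (EFin \o (fun x : R => `|x| ^+ k)).
  apply/integrableP; split.
    by apply/measurable_EFinP; apply: measurable_funX; exact: normr_measurable.
  by under eq_integral do rewrite gee0_abs ?lee_fin ?exprn_ge0//; rewrite mu_mom ltry.
apply: (integrable_dominated measurableT _ (integrable_add measurableT (gX 0%N) (gX m))).
  by apply: measurable_funM.
move=> x _; rewrite ger0_norm ?mulr_ge0 ?expR_ge0// expr0.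
have [x0|x0] := leP x 0; first by rewrite /pos max_r// mul0r addr_ge0// exprn_ge0.
rewrite posE// gtr0_norm// /Ep -{1}(lnK (x := x)) ?posrE// -expRD.
have [l0|l0] := leP (ln x) 0.
  rewrite (@le_trans _ _ 1)//; last by rewrite lerDl exprn_ge0// ltW.
  by rewrite -[leRHS]expR0 ler_expR; nra.
rewrite (@le_trans _ _ (x ^+ m))//; last by rewrite lerDr.
have -> : x ^+ m = expR (m%:R * ln x) by rewrite expRM_natl lnK ?posrE.
rewrite ler_expR -[X in X + _]mul1r -mulrDl.
by apply: ler_wpM2r; [exact: ltW|lra].
Qed.

Let kker_pow p (z : measurableTypeR R * measurableTypeR R) : kker (Ep p) z =
  \1_D z.1 * (kap c z.1 * expR (- ((p + 1) * z.1))) * (pos z.2 * Ep p z.2).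
Proof.
rewrite /kker; have [x0|x0] := leP z.2 0; first by rewrite /pos max_r// !mul0r !mulr0.
have -> : expR (- ((p + 1) * z.1)) = expR (- z.1) * expR (- (p * z.1)).
  by rewrite -expRD; congr expR; ring.
have -> : Ep p (expR (- z.1) * z.2) = expR (- (p * z.1)) * Ep p z.2.
  rewrite /Ep lnM ?posrE ?expR_gt0// expRK mulrDr expRD; congr (expR _ * _); ring.
by ring.
Qed.

Let kker_pow_int p : -1 < p -> Lk.-integrable setT (EFin \o kker (Ep p)).
Proof.
move=> p1; have p0 : 0 < p + 1 by lra.
have [i _] := product_integral (kap_int p0) (pos_pow_int p1).
by move: i; congr (integrable _ _ (EFin \o _)); apply/funext => z; rewrite kker_pow.
Qed.

Let KI_trunc p g N : measurable_fun setT (g : measurableTypeR R -> R) ->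
  (forall x, `|g x| <= Ep p x) -> KI (fun x => g x * \1_(Tr N) x).
Proof.
move=> mg gp; apply: KI_bounded; split.
  by apply: measurable_funM => //; apply: measurable_indic; exact: mTr.
exists (expR (`|p| * ln N.+1%:R)) => x; rewrite indicE.
have [|] := boolP (x \in Tr N); last by rewrite mulr0 normr0 expR_ge0.
by rewrite inE mulr1 => /(Ep_trunc p); exact: le_trans.
Qed.

Let trunc_le p g N x : `|g x| <= Ep p x -> `|g x * \1_(Tr N) x| <= Ep p x.
Proof.
move=> h; rewrite indicE; case: (_ \in _); rewrite ?mulr1// mulr0 normr0.
exact: expR_ge0.
Qed.

(** For -1 < p < 0 the moments say nothing. On truncations of x^p the identity is known, and its
    right side is bounded uniformly by the one for x^p, which is finite: it only involves x^(p+1)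
    and the Laplace transform of [kap] at p + 1 > 0. Monotone convergence removes the truncation. *)
Let pow_int p : -1 < p -> mu.-integrable setT (EFin \o Ep p).
Proof.
move=> p1; have i2 := pos_pow_int p1; have i3 := kker_pow_int p1.
pose f N (x : measurableTypeR R) := (Ep p x * \1_(Tr N) x)%:E.
have Ep_n x : `|Ep p x| <= Ep p x by rewrite ger0_norm ?expR_ge0.
have mf N : measurable_fun setT (f N).
  by apply/measurable_EFinP; apply: measurable_funM => //; apply: measurable_indic; exact: mTr.
have f0 N x : setT x -> (0 <= f N x)%E.
  by move=> _; rewrite lee_fin mulr_ge0 ?expR_ge0// indicE.
have fh x : setT x -> {homo f ^~ x : m n / (m <= n)%N >-> (m <= n)%E}.
  move=> _ m n mn; rewrite lee_fin ler_wpM2l ?expR_ge0// !indicE ler_nat.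
  case: (boolP (x \in Tr m)) => //; rewrite inE => /(Tr_homo mn) h.
  by rewrite mem_set.
have fc x : f n x @[n --> \oo] --> (Ep p x)%:E.
  apply: cvg_near_cst; near=> n; rewrite /f (_ : \1_(Tr n) x = 1) ?mulr1//.
  near: n; exact: Tr_cvg.
have cv := @cvg_monotone_convergence _ _ R mu setT measurableT f mf f0 fh.
apply/integrableP; split; first exact/measurable_EFinP.
under eq_integral do rewrite gee0_abs ?lee_fin ?expR_ge0//.
pose B := sigma c ^+ 2 * (\int[mu]_x (pos x * Ep p x)) + \int[Lk]_z kker (Ep p) z.
apply: (@le_lt_trans _ _ B%:E); last exact: ltry.
rewrite (_ : (\int[mu]_x (Ep p x)%:E)%E = (\int[mu]_x limn (f ^~ x))%E); last first.
  by apply: eq_integral => x _; apply/esym/cvg_lim.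
rewrite -(cvg_lim _ cv)//; apply: lime_le; first exact: cvgP cv.
apply: nearW => N; have [[_ k1 k2 k3] kE] := KI_trunc N (mEp p) Ep_n.
rewrite /f -(fineK (integrable_fin_num measurableT k1)) lee_fin -/(Rintegral _ _ _) kE.
have tl (x : R) : `|Ep p x * \1_(Tr N) x| <= Ep p x by exact: trunc_le.
rewrite /A lerD//.
  rewrite ler_wpM2l ?sqr_ge0//; apply: le_Rintegral => // x _.
  by rewrite ler_wpM2l// (le_trans (ler_norm _)).
apply: le_Rintegral => // z _; exact: (le_trans (ler_norm _) (kker_le _ tl)).
Unshelve. all: by end_near.
Qed.

Let KI_pow p g : -1 < p -> measurable_fun setT (g : measurableTypeR R -> R) ->
  (forall x, `|g x| <= Ep p x) -> KI g.
Proof.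
move=> p1 mg gp; have gE : good (Ep p).
  by split => //; [exact: pow_int|exact: pos_pow_int|exact: kker_pow_int].
apply: (KI_dominated (f_ := fun N x => g x * \1_(Tr N) x) _ gE).
- by move=> N; exact: (KI_trunc (p := p)).
- by move=> N x; exact: trunc_le.
- move=> x; apply: cvg_near_cst; near=> n; rewrite (_ : \1_(Tr n) x = 1) ?mulr1//.
  near: n; exact: Tr_cvg.
Unshelve. all: by end_near.
Qed.

Lemma pow_integrable p : -1 < p -> mu.-integrable setT (EFin \o (fun x => expR (p * ln x))).
Proof. exact: pow_int. Qed.

(* For g = x^n this is E X^n = E X^(n+1) phi(n + 1)/(n + 1), by the formula of [kap_exp]; both sides are
   stable under dominated limits. *)
Lemma moment_identity g : bounded_borel g ->
  \int[mu]_x g x = sigma c ^+ 2 * (\int[mu]_x (Num.max x 0 * g x)) +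
    \int[leb]_(y in D) (kap c y * (expR (- y) * \int[mu]_x (Num.max x 0 * g (expR (- y) * x)))).
Proof.
move=> gb; have [[mg i1 i2 i3] E] := KI_bounded gb; rewrite E /A; congr (_ + _).
have [_ [M gM]] := gb.
have pi y : mu.-integrable setT (EFin \o (fun x => pos x * g (expR (- y) * x))).
  have i0 := pos_pow_int (ltrN10 R).
  apply: (integrable_dominated measurableT _ (integrable_scale measurableT M i0)).
    by apply: measurable_funM => //; apply: measurableT_comp => //; exact: measurable_funM.
  move=> x _; rewrite normrM ger0_norm// /Ep mul0r expR0 mulr1 mulrC.
  by rewrite ler_wpM2r.
rewrite {1}/Rintegral -(integral12_prod_meas1 i3) /fubini_F/=.
rewrite /Rintegral [in RHS]integral_mkcond; congr fine; apply: eq_integral => y _.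
rewrite patchE /kker/=; case: ifPn => [yD|yD].
  rewrite indicE yD mul1r -RintegralZl// -RintegralZl//; last exact: integrable_scale.
  rewrite /Rintegral fineK.
    by apply: eq_integral => x _; congr EFin; rewrite mulrA.
  by apply: integrable_fin_num => //; apply: integrable_scale => //; exact: integrable_scale.
by under eq_integral do rewrite indicE (negbTE yD) !mul0r; rewrite integral0.
Qed.

Local Open Scope complex_scope.

(** The exponent is z rather than z - 1, so that the value at n is the n-th moment. On x <= 0 the
    integrand is 1, and the laws to which this is applied do not charge that set. *)
Definition mellin (m : {measure set (measurableTypeR R) -> \bar R}) (z : R[i]) : R[i] :=
  integralC m setT (cpow ^~ z).

Let cpowE x p b : cpow x (p +i* b) = (Ep p x * cos (b * ln x)) +i* (Ep p x * sin (b * ln x)).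
Proof. by rewrite /cpow /expC /Ep /= !mulr0 subr0 add0r. Qed.

Let re_le p b x : `|Ep p x * cos (b * ln x)| <= Ep p x.
Proof.
rewrite normrM ger0_norm ?expR_ge0// -[leRHS]mulr1 ler_wpM2l ?expR_ge0//.
by rewrite ler_norml cos_geN1 cos_le1.
Qed.

Let im_le p b x : `|Ep p x * sin (b * ln x)| <= Ep p x.
Proof.
rewrite normrM ger0_norm ?expR_ge0// -[leRHS]mulr1 ler_wpM2l ?expR_ge0//.
by rewrite ler_norml sin_geN1 sin_le1.
Qed.

Let mre p b : measurable_fun setT (fun x : measurableTypeR R => Ep p x * cos (b * ln x)).
Proof.
apply: measurable_funM => //.
by apply: (measurableT_comp (measurable_cosM b)); exact: measurable_ln.
Qed.

Let mim p b : measurable_fun setT (fun x : measurableTypeR R => Ep p x * sin (b * ln x)).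
Proof.
apply: measurable_funM => //.
by apply: (measurableT_comp (measurable_sinM b)); exact: measurable_ln.
Qed.

Lemma mellin_integrable z : -1 < complex.Re z -> integrableC mu setT (cpow ^~ z).
Proof.
case: z => p b /= p1; split.
  have [[_ i _ _] _] := KI_pow p1 (mre p b) (re_le p b).
  by move: i; congr (integrable _ _ (EFin \o _)); apply/funext => x; rewrite cpowE.
have [[_ i _ _] _] := KI_pow p1 (mim p b) (im_le p b).
by move: i; congr (integrable _ _ (EFin \o _)); apply/funext => x; rewrite cpowE.
Qed.

(** The identity for the real and imaginary parts of x^z. Since (e^(-y) x)^z splits, the double
    integral is a product, and the y-integral is the Laplace transform of [kap] at z + 1. *)
Lemma mellin_recurrence z : -1 < complex.Re z ->
  (z + 1) * mellin mu z = phi c (z + 1) * mellin mu (z + 1).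
Proof.
case: z => p b /= p1; have w0 : 0 < p + 1 by lra.
have -> : (p +i* b)%C + 1 = (p + 1) +i* b by simpc.
have melE q : mellin mu (q +i* b) =
    (\int[mu]_x (Ep q x * cos (b * ln x))) +i* (\int[mu]_x (Ep q x * sin (b * ln x))).
  by rewrite /mellin /integralC; congr (_ +i* _); apply: eq_Rintegral => x _; rewrite cpowE.
have [[_ i1 i2 _] E1] := KI_pow p1 (mre p b) (re_le p b).
have [[_ j1 j2 _] E2] := KI_pow p1 (mim p b) (im_le p b).
have posEp (f : R -> R) : measurable_fun setT (f : measurableTypeR R -> R) ->
    \int[mu]_x (pos x * (Ep p x * f x)) = \int[mu]_x (Ep (p + 1) x * f x).
  move=> mf; apply: positive_ext; [|exact: measurable_funM|].
    by apply: measurable_funM => //; exact: measurable_funM.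
  move=> x x0; rewrite posE// mulrA -{1}(lnK (x := x)) ?posrE// -expRD.
  by congr (expR _ * _); ring.
have mc : measurable_fun setT (fun x : measurableTypeR R => cos (b * ln x)).
  by apply: (measurableT_comp (measurable_cosM b)); exact: measurable_ln.
have ms : measurable_fun setT (fun x : measurableTypeR R => sin (b * ln x)).
  by apply: (measurableT_comp (measurable_sinM b)); exact: measurable_ln.
have E1' := posEp _ mc; have E2' := posEp _ ms.
pose u1 (y : R) := \1_D y * (kap c y * (expR (- ((p + 1) * y)) * cos (b * y))).
pose u2 (y : R) := \1_D y * (kap c y * (expR (- ((p + 1) * y)) * sin (b * y))).
have indE (f : R -> R) : (fun y => (\1_D y * f y)%:E) = (fun y => (f y)%:E) \_ D.
  by apply/funext => y; rewrite patchE indicE; case: ifPn => _; rewrite ?mul1r ?mul0r.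
have trig_int (f : R -> R) : measurable_fun setT (f : measurableTypeR R -> R) ->
   (forall y, `|f y| <= 1) ->
   leb.-integrable setT (EFin \o (fun y => \1_D y * (kap c y * (expR (- ((p + 1) * y)) * f y)))).
  move=> mf f1; rewrite (_ : EFin \o _ = (fun y => (kap c y * (expR (- ((p + 1) * y)) * f y))%:E) \_ D).
    apply/(integrable_mkcond _ mD).1; apply: (measurable_kap_integrable adm 0 w0).
      by apply: measurable_funTS; apply: measurable_funM => //; exact: measurable_expRN.
    move=> y _; rewrite normrM ger0_norm ?expR_ge0// -[leRHS]mulr1.
    by rewrite ler_wpM2l ?expR_ge0.
  exact: indE.
have iu1 : leb.-integrable setT (EFin \o u1).
  by apply: trig_int; [exact: measurable_cosM|move=> y; rewrite ler_norml cos_geN1 cos_le1].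
have iu2 : leb.-integrable setT (EFin \o u2).
  by apply: trig_int; [exact: measurable_sinM|move=> y; rewrite ler_norml sin_geN1 sin_le1].
have lnE (z : measurableTypeR R * measurableTypeR R) : 0 < z.2 ->
    b * ln (expR (- z.1) * z.2) = b * ln z.2 - b * z.1.
  by move=> x0; rewrite lnM ?posrE ?expR_gt0// expRK; ring.
have kpE (z : measurableTypeR R * measurableTypeR R) (f : R -> R) :
   kker (fun x => Ep p x * f x) z = kker (Ep p) z * f (expR (- z.1) * z.2).
  by rewrite /kker; ring.
have k1 : kker (fun x => Ep p x * cos (b * ln x)) = (fun z =>
    u1 z.1 * (pos z.2 * (Ep p z.2 * cos (b * ln z.2))) + u2 z.1 * (pos z.2 * (Ep p z.2 * sin (b * ln z.2)))).
  apply/funext => z; rewrite (kpE z (fun x => cos (b * ln x))) kker_pow /u1 /u2.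
  have [x0|x0] := leP z.2 0; first by rewrite /pos max_r// !(mul0r, mulr0) addr0.
  by rewrite lnE// cosB; ring.
have k2 : kker (fun x => Ep p x * sin (b * ln x)) = (fun z =>
    u1 z.1 * (pos z.2 * (Ep p z.2 * sin (b * ln z.2))) - u2 z.1 * (pos z.2 * (Ep p z.2 * cos (b * ln z.2)))).
  apply/funext => z; rewrite (kpE z (fun x => sin (b * ln x))) kker_pow /u1 /u2.
  have [x0|x0] := leP z.2 0; first by rewrite /pos max_r// !(mul0r, mulr0) subrr.
  by rewrite lnE// sinB; ring.
have [p11 q11] := product_integral iu1 i2; have [p12 q12] := product_integral iu1 j2.
have [p21 q21] := product_integral iu2 i2; have [p22 q22] := product_integral iu2 j2.
move: E1 E2; rewrite /A k1 k2 RintegralD// RintegralB// q11 q12 q21 q22 E1' E2'.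
have U1 : \int[leb]_y u1 y = \int[leb]_(y in D) (kap c y * (expR (- ((p + 1) * y)) * cos (b * y))).
  by rewrite /Rintegral /u1 indE -integral_mkcond.
have U2 : \int[leb]_y u2 y = \int[leb]_(y in D) (kap c y * (expR (- ((p + 1) * y)) * sin (b * y))).
  by rewrite /Rintegral /u2 indE -integral_mkcond.
have wn : (p + 1) +i* b != 0 by rewrite eq_complex/= negb_and gt_eqF.
rewrite /phi (negbTE wn) (kap_exp adm b w0)/= -U1 -U2 !melE => -> ->.
move: (\int[leb]_y u1 y) (\int[leb]_y u2 y) => X Y.
move: (\int[mu]_x _) (\int[mu]_x (_ * sin _)) => C S.
have -> : (sigma c ^+ 2 * C + (X * C + Y * S)) +i* (sigma c ^+ 2 * S + (X * S - Y * C)) =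
    ((sigma c ^+ 2 + X) +i* (- Y)) * (C +i* S).
  by simpc; congr (_ +i* _); ring.
move: ((p + 1) +i* b) wn (C +i* S) ((sigma c ^+ 2 + X) +i* - Y) => w wn k m; field.
by rewrite wn.
Qed.

End moment_identity.

(** * The exponential law as the case phi = 1 *)

Section exponential_law.
Context {R : realType}.
Local Notation leb := (@lebesgue_measure R).
Local Notation D := (`]0%R, +oo[%classic : set (measurableTypeR R)).
Local Notation eps := (epsilon_law R).

Let mD : measurable D. Proof. exact: measurable_itv. Qed.

Let pdfE (f : R -> R) :
  (fun x => (exponential_pdf 1 x * f x)%:E) = (fun x => (f x * expR (- x))%:E) \_ (`[0%R, +oo[%classic : set R).
Proof.
apply/funext => x; rewrite patchE; case: ifPn => [|/negP]; rewrite inE/= in_itv/= andbT.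
  by move=> x0; rewrite exponential_pdfE// mul1r mulNr mul1r mulrC.
by move=> /negP; rewrite -ltNge => x0; rewrite lt0_exponential_pdf// mul0r.
Qed.

Let mexpN : measurable_fun setT (fun x : measurableTypeR R => expR (- x)).
Proof. by apply: measurableT_comp => //; exact: measurable_oppr. Qed.

Lemma ge0_integral_epsilon (f : R -> R) : measurable_fun setT (f : measurableTypeR R -> R) ->
  (forall x, 0 <= f x) ->
  (\int[eps]_x (f x)%:E = \int[leb]_(x in D) (f x * expR (- x))%:E)%E.
Proof.
move=> mf f0.
have mpdf : measurable_fun setT (exponential_pdf (1 : R) : measurableTypeR R -> R).
  exact: measurable_exponential_pdf.
have pdf0 (x : measurableTypeR R) : 0 <= exponential_pdf (1 : R) x.
  by apply: exponential_pdf_ge0.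
have := @weighted_integral_lift _ (measurableTypeR R) _ (measurableTypeR R) R leb eps (exponential_pdf 1)
  (fun=> 1) id id f mpdf pdf0 (measurable_cst _) (fun=> ler01) (@measurable_id _ _ _) (@measurable_id _ _ _) _ mf f0.
rewrite (_ : (fun w => (1 * f w)%:E) = (EFin \o f)); last by apply/funext => x; rewrite mul1r.
move=> <-.
  by rewrite pdfE -integral_mkcond -integral_itv_obnd_cbnd//; apply: measurable_funTS; apply/measurable_EFinP; exact: measurable_funM.
move=> B mB; rewrite (_ : (fun w => (1 * \1_B w)%:E) = (EFin \o \1_B)); last by apply/funext => x; rewrite mul1r.
rewrite [RHS](integral_indic _ measurableT)// setIT /= /exponential_prob [RHS]integral_mkcond.
apply: eq_integral => x _; rewrite patchE indicE.
by case: (x \in B); rewrite ?mulr1 ?mulr0.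
Qed.

Lemma Rintegral_epsilon (f : R -> R) : measurable_fun setT (f : measurableTypeR R -> R) ->
  \int[eps]_x f x = \int[leb]_(x in D) (f x * expR (- x)).
Proof.
move=> mf; rewrite /Rintegral integralE [in RHS]integralE; congr (fine (_ - _)).
- rewrite (_ : (EFin \o f)^\+%E = EFin \o (f^\+)); last by apply/funext => x; rewrite /= funeposE /funrpos/= -EFin_max.
  rewrite (ge0_integral_epsilon (measurable_funrpos mf)); last by move=> x; exact: funrpos_ge0.
  apply: eq_integral => x _; rewrite funeposE /funrpos -EFin_max; congr EFin.
  by rewrite maxr_pMl ?expR_ge0// mul0r.
- rewrite (_ : (EFin \o f)^\-%E = EFin \o (f^\-)); last by apply/funext => x; rewrite /= funenegE /funrneg/= -EFin_max.
  rewrite (ge0_integral_epsilon (measurable_funrneg mf)); last by move=> x; exact: funrneg_ge0.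
  apply: eq_integral => x _; rewrite funenegE /funrneg -EFin_max; congr EFin.
  by rewrite maxr_pMl ?expR_ge0// mul0r mulNr.
Qed.

Lemma epsilon_pos : eps D = 1%E.
Proof.
rewrite -(@probability_setT _ _ _ eps) /= /exponential_prob.
have mpdf : measurable_fun setT (exponential_pdf (1 : R) : measurableTypeR R -> R).
  exact: measurable_exponential_pdf.
have E : (fun x => (exponential_pdf (1 : R) x)%:E) =
    (fun x => (exponential_pdf (1 : R) x)%:E) \_ (`[0%R, +oo[%classic : set R).
  apply/funext => x; rewrite patchE; case: ifPn => // /negP; rewrite inE/= in_itv/= andbT.
  by move=> /negP; rewrite -ltNge => x0; rewrite lt0_exponential_pdf.
rewrite integral_itv_obnd_cbnd; last by apply: measurable_funTS; exact/measurable_EFinP.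
rewrite [LHS]integral_mkcond; apply: eq_integral => x _.
exact: (esym (congr1 (fun f : R -> \bar R => f x) E)).
Qed.

Let pow_le n (x : R) : 0 <= x -> x ^+ n * expR (- x) <= n`!%:R / 2^-1 ^+ n * expR (- (2^-1 * x)).
Proof.
move=> x0; have h : 0 < 2^-1 :> R by rewrite invr_gt0.
have := expr_le_expRM n h x0 => /(ler_wpM2r (expR_ge0 (- x))) => /le_trans; apply.
rewrite -[leLHS]mulrA -expRD (_ : 2^-1 * x - x = - (2^-1 * x))//; lra.
Qed.

Lemma epsilon_moment n : (\int[eps]_x (`|x| ^+ n)%:E = (n`!%:R)%:E)%E.
Proof.
have h2 : 0 < 2^-1 :> R by rewrite invr_gt0.
have mX k : measurable_fun setT (fun x : measurableTypeR R => x ^+ k * expR (- x)).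
  by apply: measurable_funM => //; exact: measurable_funX.
have iX k : leb.-integrable D (EFin \o (fun x : R => x ^+ k * expR (- x))).
  apply: (integrable_dominated mD _ (integrable_scale mD (k`!%:R / 2^-1 ^+ k) (expRN_integrable h2))).
    exact: measurable_funTS.
  by move=> x /pos_half_lineP x0; have x0' := ltW x0; rewrite ger0_norm ?mulr_ge0 ?expR_ge0 ?exprn_ge0//; exact: pow_le.
suff E k : \int[leb]_(x in D) (x ^+ k * expR (- x)) = k`!%:R.
  rewrite ge0_integral_epsilon.
  - rewrite -E /Rintegral fineK; last by apply: integrable_fin_num => //; exact: iX.
    by apply: eq_integral => x; rewrite inE => /pos_half_lineP x0; rewrite gtr0_norm.
  - by apply: measurable_funX; exact: normr_measurable.
  - by move=> x; rewrite exprn_ge0.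
elim: k => [|k ih].
  have dh (s : R) : is_derive s 1 (fun y => - expR (- y)) (expR (- s)) by deriv; ring.
  have cq : continuous (fun y : R => expR (- y)).
    by move=> y; apply: (@is_derive_continuous _ _ _ (- expR (- y))); deriv; ring.
  have qb (s : R) : 0 < s -> `|expR (- s)| <= 1 * expR (- (1 * s)).
    by move=> _; rewrite ger0_norm ?expR_ge0// !mul1r.
  have h0 : - expR (- n%:R) @[n --> \oo] --> (0 : R).
    rewrite -[X in _ --> X]oppr0; apply: cvgN.
    rewrite (_ : (fun n => _) = (fun n => expR (- 1) ^+ n)).
      by apply: cvg_expr; rewrite ger0_norm ?expR_ge0// -[ltRHS]expR0 ltr_expR oppr_lt0.
    by apply/funext => m; rewrite -expRM_natl mulrN1.
  have [_] := integral_pos_half_line ltr01 dh cq qb h0.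
  rewrite oppr0 expR0 opprK fact0 => <-; apply: eq_Rintegral => x _.
  by rewrite expr0 mul1r.
(* h has derivative q and h(0) = 0, so q integrates to 0: this is the recurrence between consecutive
   moments. *)
pose h (s : R) := - (s ^+ k.+1 * expR (- s)).
pose q (s : R) := s ^+ k.+1 * expR (- s) - k.+1%:R * (s ^+ k * expR (- s)).
have dX m (s : R) : is_derive s 1 (fun y : R => y ^+ m.+1) (m.+1%:R * s ^+ m).
  elim: m => [|m im]; first by under eq_fun do rewrite expr1; apply: is_derive_eq (is_derive_var s) _; rewrite expr0 mulr1.
  under eq_fun do rewrite exprS.
  by deriv; rewrite !exprS -[in RHS]addn1 natrD; ring.
have dh (s : R) : is_derive s 1 h (q s).
  by rewrite /h /q; have := dX k s => ?; deriv; ring.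
have cX m : continuous (fun s : R => s ^+ m * expR (- s)).
  move=> s; case: m => [|m].
    by apply: (@is_derive_continuous _ _ _ (- (s ^+ 0 * expR (- s)))); under eq_fun do rewrite expr0; deriv; rewrite expr0; ring.
  by apply: (@is_derive_continuous _ _ _ (m.+1%:R * s ^+ m * expR (- s) - s ^+ m.+1 * expR (- s))); have := dX m s => ?; deriv; ring.
have cq : continuous q.
  by move=> s; apply: cvgB (cX _ s) _; apply: cvgM; [exact: cvg_cst|exact: cX].
pose C : R := k.+1`!%:R / 2^-1 ^+ k.+1 + k.+1%:R * (k`!%:R / 2^-1 ^+ k).
have qb (s : R) : 0 < s -> `|q s| <= C * expR (- (2^-1 * s)).
  move=> /ltW s0; rewrite /q /C mulrDl (le_trans (ler_normB _ _))// lerD//.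
    by rewrite ger0_norm ?mulr_ge0 ?expR_ge0 ?exprn_ge0// pow_le.
  rewrite ger0_norm ?mulr_ge0 ?expR_ge0 ?exprn_ge0// -mulrA ler_wpM2l//.
  exact: pow_le.
have h0 : h n%:R @[n --> \oo] --> 0.
  have e0 : (expR (- (2^-1 * n%:R)) : R) @[n --> \oo] --> 0.
    rewrite (_ : (fun n => _) = (fun n => expR (- 2^-1) ^+ n)).
      by apply: cvg_expr; rewrite ger0_norm ?expR_ge0// -[ltRHS]expR0 ltr_expR oppr_lt0.
    by apply/funext => m; rewrite -expRM_natl mulrN mulrC.
  rewrite -[X in _ --> X]oppr0; apply: cvgN.
  apply: (@squeeze_cvgn _ (fun=> 0) _ (fun n => k.+1`!%:R / 2^-1 ^+ k.+1 * expR (- (2^-1 * n%:R)))).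
  - by move=> m; rewrite mulr_ge0 ?expR_ge0 ?exprn_ge0//= pow_le.
  - exact: cvg_cst.
  - by rewrite -[X in _ --> X](mulr0 (k.+1`!%:R / 2^-1 ^+ k.+1)); apply: cvgM => //; exact: cvg_cst.
have [_] := integral_pos_half_line h2 dh cq qb h0.
rewrite /q RintegralB//; last exact: integrable_scale.
rewrite RintegralZl// ih /h expr0n /= mul0r oppr0 oppr0 => /eqP; rewrite subr_eq0 => /eqP ->.
by rewrite factS natrM.
Qed.

Local Open Scope complex_scope.

(** Here psi(z) = z, so the products of phi are 1 and the results about [mu] apply to [eps], whose
    Mellin transform is Gamma(z + 1). *)
Definition gamma_triplet : triplet R := Triplet 0 1 mzero.

Lemma gamma_admissible : admissible gamma_triplet.
Proof.
split => //=.
- exists (fun=> `]0%R, +oo[%classic); first by rewrite bigcup_const//; exists 0%N.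
  by move=> n; split; [exact: measurable_itv|rewrite /mzero ltry].
- by rewrite integral_measure_zero.
- by move=> [_ /eqP]; rewrite oner_eq0.
Qed.

Lemma gamma_phi_eq1 (z : R[i]) : z != 0 -> phi gamma_triplet z = 1.
Proof.
move=> z0; rewrite /phi (negbTE z0) /psi/=.
have -> : integralC mzero (`]0%R, +oo[%classic : set (measurableTypeR R))
   (fun y => expC (- (z * y%:C)) - 1 + z * y%:C) = 0.
  by rewrite /integralC /Rintegral !integral_measure_zero.
by rewrite expr0n/= !mul0r add0r mul1r addr0 divff.
Qed.

Lemma gamma_phiR_eq1 (u : R) : u != 0 -> phiR gamma_triplet u = 1.
Proof.
move=> u0; rewrite /phiR gamma_phi_eq1//.
by rewrite (fmorph_eq0 (real_complex R)).
Qed.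

Lemma gamma_prod n : \prod_(1 <= i < n.+1) phiR gamma_triplet i%:R = 1.
Proof.
rewrite big_nat big1// => i /andP[i1 _].
by rewrite gamma_phiR_eq1// pnatr_eq0 -lt0n.
Qed.

Lemma mellin_epsilon (z : R[i]) : -1 < complex.Re z -> mellin eps z = GammaC (z + 1).
Proof.
move=> z1; have m : forall n, (\int[eps]_x (`|x| ^+ n)%:E = (n`!%:R / \prod_(1 <= i < n.+1) phiR gamma_triplet i%:R)%:E)%E.
  by move=> n; rewrite gamma_prod divr1 epsilon_moment.
have [i1 i2] := mellin_integrable gamma_admissible epsilon_pos m z1.
rewrite /mellin /GammaC /integralC addrK; congr (_ +i* _).
  rewrite Rintegral_epsilon; last exact/measurable_EFinP/measurable_int/i1.
  by apply: eq_Rintegral => x _ /=; rewrite mulr0 subr0.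
rewrite Rintegral_epsilon; last exact/measurable_EFinP/measurable_int/i2.
by apply: eq_Rintegral => x _ /=; rewrite mulr0 add0r.
Qed.

End exponential_law.

(** * Complex powers and limits *)

Section complex_limits.
Context {R : realType}.
Local Open Scope complex_scope.
Implicit Types (u v : nat -> R[i]) (k l z w : R[i]).

Lemma expCD z w : expC (z + w) = expC z * expC w :> R[i].
Proof.
case: z => a b; case: w => a' b'; rewrite /expC /= expRD cosD sinD; simpc.
by congr (_ +i* _); ring.
Qed.

Lemma expC0 : expC 0 = 1 :> R[i].
Proof. by rewrite /expC /= expR0 cos0 sin0 mulr1 mulr0. Qed.

Lemma expCN z : expC (- z) * expC z = 1 :> R[i].
Proof. by rewrite -expCD addNr expC0. Qed.

Lemma expC_neq0 z : expC z != 0.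
Proof.
by apply/negP => /eqP e; have := expCN z; rewrite e mulr0 => /esym/eqP; rewrite oner_eq0.
Qed.

Lemma cpowD (x : R) z w : cpow x (z + w) = cpow x z * cpow x w.
Proof. by rewrite /cpow mulrDl expCD. Qed.

Lemma cpowM (x y : R) z : 0 < x -> 0 < y -> cpow (x * y) z = cpow x z * cpow y z.
Proof. by move=> x0 y0; rewrite /cpow lnM ?posrE// rmorphD mulrDr expCD. Qed.

Lemma cpow_neq0 (x : R) z : cpow x z != 0.
Proof. exact: expC_neq0. Qed.

Lemma cpowV (x : R) z : 0 < x -> cpow x^-1 z = (cpow x z)^-1.
Proof.
move=> x0; apply: (mulIf (cpow_neq0 x z)); rewrite mulVf ?cpow_neq0// -cpowM ?invr_gt0//.
by rewrite mulVf ?gt_eqF// /cpow ln1 mulr0 expC0.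
Qed.

Lemma cpow_nat (x : R) n : 0 < x -> cpow x n%:R = (x ^+ n)%:C.
Proof.
move=> x0; elim: n => [|n ih]; first by rewrite /cpow mul0r expC0.
rewrite -addn1 natrD cpowD ih exprD rmorphM; congr (_ * _).
by rewrite /cpow mul1r /expC /= cos0 sin0 mulr1 mulr0 lnK.
Qed.

Definition cvgC u l := complex.Re (u n) @[n --> \oo] --> complex.Re l /\
  complex.Im (u n) @[n --> \oo] --> complex.Im l.

Lemma limC_cvgC u l : cvgC u l -> limC u = l.
Proof.
move=> [h1 h2]; rewrite /limC (cvg_lim _ h1)// (cvg_lim _ h2)//.
by case: l h1 h2.
Qed.

Lemma eq_cvgC u v l : u =1 v -> cvgC u l -> cvgC v l.
Proof. by move=> /funext ->. Qed.

Lemma cvgC_mul u v k l : cvgC u k -> cvgC v l -> cvgC (fun n => u n * v n) (k * l).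
Proof.
move=> [h1 h2] [g1 g2].
have ReM z w : complex.Re (z * w) = complex.Re z * complex.Re w - complex.Im z * complex.Im w.
  by case: z => ? ?; case: w.
have ImM z w : complex.Im (z * w) = complex.Re z * complex.Im w + complex.Im z * complex.Re w.
  by case: z => ? ?; case: w.
split.
  by under eq_fun do rewrite ReM; rewrite ReM; apply: cvgB; exact: cvgM.
by under eq_fun do rewrite ImM; rewrite ImM; apply: cvgD; exact: cvgM.
Qed.

Lemma cvgC_inv u l : l != 0 -> cvgC u l -> cvgC (fun n => (u n)^-1) l^-1.
Proof.
move=> l0 [h1 h2].
have ReV z : complex.Re z^-1 = complex.Re z / (complex.Re z ^+ 2 + complex.Im z ^+ 2).
  by case: z.
have ImV z : complex.Im z^-1 = - (complex.Im z / (complex.Re z ^+ 2 + complex.Im z ^+ 2)).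
  by case: z.
have n0 : complex.Re l ^+ 2 + complex.Im l ^+ 2 != 0.
  case: l l0 {h1 h2} => a b; rewrite eq_complex /= => h.
  by rewrite paddr_eq0 ?sqr_ge0// !sqrf_eq0.
have hs : (complex.Re (u n) ^+ 2 + complex.Im (u n) ^+ 2) @[n --> \oo] -->
    complex.Re l ^+ 2 + complex.Im l ^+ 2.
  by apply: cvgD; rewrite expr2; under eq_fun do rewrite expr2; exact: cvgM.
have hi : (complex.Re (u n) ^+ 2 + complex.Im (u n) ^+ 2)^-1 @[n --> \oo] -->
    (complex.Re l ^+ 2 + complex.Im l ^+ 2)^-1 by exact: cvgV.
have c1 := cvgM h1 hi; have c2 := cvgN (cvgM h2 hi).
split; rewrite ?ReV ?ImV.
  by under eq_cvg do rewrite ReV; exact: c1.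
by under eq_cvg do rewrite ImV; exact: c2.
Qed.

Lemma cvgC_expC (s : nat -> R) (g : R) w : s n @[n --> \oo] --> g ->
  cvgC (fun n => expC ((s n)%:C * w)) (expC (g%:C * w)).
Proof.
move=> h; have hm (b : R) : s n * b @[n --> \oo] --> g * b by apply: cvgM h _; exact: cvg_cst.
case: w => a b; rewrite /cvgC /expC /=.
under eq_fun do rewrite !mul0r subr0 addr0.
under [in X in _ /\ X]eq_fun do rewrite !mul0r subr0 addr0.
rewrite !mul0r subr0 addr0.
have he : expR (s n * a) @[n --> \oo] --> expR (g * a).
  by apply: cvg_comp (hm a) _; exact: continuous_expR.
split; apply: cvgM he _.
  by apply: cvg_comp (hm b) _; exact: continuous_cos.
by apply: cvg_comp (hm b) _; exact: continuous_sin.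
Qed.

End complex_limits.

Section power_differences.
Context {R : realType}.
Implicit Types (a b N l : R).

Let oneBcos_le_abs (y : R) : 1 - cos y <= 2 * `|y|.
Proof.
have h1 := oneBcos_le y; have h2 := cos_geN1 y; have := normr_ge0 y => y0.
move: h1; rewrite -real_normK ?num_real// => h1.
by have [|] := leP `|y| 1 => h; nra.
Qed.

(** With x = e^l, both parts of x^(a+ib) - 1 are controlled by |x^N - 1|. For l >= 0 the oscillation
    costs at most a factor e^(2|b|l), absorbed by N >= a + 2|b|. For l < 0, -a l e^(al) <= 1 -
    e^(al), which is the origin of the constant 2|b|/a. *)
Lemma pow_diff_bound a b N l : 0 < a -> a + 2 * `|b| <= N ->
  `|expR (a * l) * cos (b * l) - 1| <= (1 + 2 * `|b| / a) * `|expR (N * l) - 1| /\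
  `|expR (a * l) * sin (b * l)| <= (1 + 2 * `|b| / a) * `|expR (N * l) - 1|.
Proof.
move=> a0 aN; have b0 := normr_ge0 b.
have e0 := expR_ge0 (a * l).
have C1 : 0 <= 2 * `|b| / a by rewrite divr_ge0 ?mulr_ge0// ltW.
have K : `|expR (a * l) - 1| + expR (a * l) * (2 * (`|b| * `|l|)) <= (1 + 2 * `|b| / a) * `|expR (N * l) - 1|.
  have [l0|l0] := leP 0 l.
    rewrite (ger0_norm l0).
    have h1 : 1 <= expR (a * l) by rewrite -[leLHS]expR0 ler_expR mulr_ge0// ltW.
    have h2 : expR (a * l) * expR (2 * `|b| * l) <= expR (N * l) by rewrite -expRD ler_expR; nra.
    have h3 := expR_ge1Dx (2 * `|b| * l).
    have h4 : 1 <= expR (N * l) by rewrite -[leLHS]expR0 ler_expR mulr_ge0//; lra.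
    have -> : `|expR (a * l) - 1| = expR (a * l) - 1 by rewrite ger0_norm// subr_ge0.
    have -> : `|expR (N * l) - 1| = expR (N * l) - 1 by rewrite ger0_norm// subr_ge0.
    apply: (@le_trans _ _ (expR (N * l) - 1)); first by have := ler_wpM2l e0 h3; nra.
    by rewrite ler_peMl ?subr_ge0//; lra.
  rewrite (ltr0_norm l0).
  have h1 : expR (a * l) <= 1 by rewrite -[leRHS]expR0 ler_expR; nra.
  have h2 : expR (N * l) <= expR (a * l) by rewrite ler_expR; nra.
  have h3 := expR_ge1Dx (- (a * l)).
  have h4 : expR (a * l) * expR (- (a * l)) = 1 by rewrite -expRD subrr expR0.
  have -> : `|expR (a * l) - 1| = 1 - expR (a * l) by rewrite ler0_norm ?subr_le0// opprB.
  have -> : `|expR (N * l) - 1| = 1 - expR (N * l) by rewrite ler0_norm ?subr_le0 ?(le_trans h2)// opprB.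
  have h5 : expR (a * l) * (- (a * l)) <= 1 - expR (a * l) by nra.
  have -> : expR (a * l) * (2 * (`|b| * - l)) = 2 * `|b| / a * (expR (a * l) * (- (a * l))).
    by field; rewrite gt_eqF.
  have h6 : expR (a * l) * (- (a * l)) <= 1 - expR (N * l) by lra.
  by have := ler_wpM2l C1 h6; move: (2 * `|b| / a) C1 => k C1; nra.
have bl : `|b * l| = `|b| * `|l| by rewrite normrM.
split; apply: le_trans K.
  have -> : expR (a * l) * cos (b * l) - 1 = (expR (a * l) - 1) - expR (a * l) * (1 - cos (b * l)) by ring.
  rewrite (le_trans (ler_normB _ _))// lerD2l ger0_norm ?mulr_ge0 ?subr_ge0 ?cos_le1//.
  by rewrite ler_wpM2l// -bl.
rewrite normrM ger0_norm// -[leLHS]add0r lerD// ler_wpM2l//.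
rewrite (le_trans (sin_norm_le _))// bl.
by have : 0 <= `|b| * `|l| by []; lra.
Qed.

End power_differences.

Section gamma_constant.
Context {R : realType} (c : triplet R) (adm : admissible c).

Let p0 k : (0 < k)%N -> 0 < phiR c k%:R.
Proof. by move=> k0; apply: phiR_gt0 => //; rewrite ltr0n. Qed.

Let ln_le_sub1 (x : R) : 0 < x -> ln x <= x - 1.
Proof. by move=> x0; have := expR_ge1Dx (ln x); rewrite lnK ?posrE//; lra. Qed.

(** Concavity and ln x <= x - 1 give phi'(k)/phi(k) <= 1 - phi(k-1)/phi(k) <= ln(phi(k)/phi(k-1)),
    so the sequence decreases. Likewise phi'(k)/phi(k) >= phi(k+1)/phi(k) - 1 >=
    ln(phi(k+1)/phi(k)), so it stays above -ln phi(1). *)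
Lemma gamma_phi_cvg : \sum_(1 <= k < n.+1) dlog_phi c k - ln (phiR c n%:R) @[n --> \oo] --> gamma_phi c.
Proof.
pose s n := \sum_(1 <= k < n.+1) dlog_phi c k - ln (phiR c n%:R).
(* Monotonicity starts at index 1, since phi(0) may be 0. *)
suff h : cvgn (fun n => s n.+1).
  move: h => /cvg_ex[l hl]; have h2 : s n @[n --> \oo] --> l.
    by move: hl; rewrite (cvg_shiftS s).
  by rewrite /gamma_phi (cvg_lim _ h2).
apply: nonincreasing_is_cvgn.
  apply/nonincreasing_seqP => n.
  rewrite /s big_nat_recr//=.
  have hd := phiR_derive1_le adm (u := n.+2%:R) _; rewrite ltr1n in hd.
  have {}hd := hd isT; rewrite -[X in X - 1]natr1 addrK in hd.
  have a0 := p0 (ltn0Sn n); have b0 := p0 (ltn0Sn n.+1).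
  have : dlog_phi c n.+2 <= 1 - phiR c n.+1%:R / phiR c n.+2%:R.
    rewrite /dlog_phi ler_pdivrMr// mulrBl mul1r divfK ?gt_eqF//.
  have r0 : 0 < phiR c n.+1%:R / phiR c n.+2%:R by rewrite divr_gt0.
  have := ln_le_sub1 r0; rewrite ln_div ?posrE//; lra.
exists (- ln (phiR c 1)) => _ [n _ <-].
have lower m : ln (phiR c m.+1%:R) - ln (phiR c 1) <= \sum_(1 <= k < m.+1) dlog_phi c k.
  elim: m => [|m ih]; first by rewrite big_geq// subrr.
  rewrite big_nat_recr//=.
  have a0 := p0 (ltn0Sn m); have b0 := p0 (ltn0Sn m.+1).
  have hd := phiR_derive1_ge adm (u := m.+1%:R) _; rewrite ler1n in hd.
  have {}hd := hd isT; rewrite natr1 in hd.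
  have : phiR c m.+2%:R / phiR c m.+1%:R - 1 <= dlog_phi c m.+1.
    rewrite /dlog_phi ler_pdivlMr// mulrBl mul1r divfK ?gt_eqF//.
  have r0 : 0 < phiR c m.+2%:R / phiR c m.+1%:R by rewrite divr_gt0.
  have := ln_le_sub1 r0; rewrite ln_div ?posrE//; lra.
have := lower n.+1; rewrite /s.
have : ln (phiR c n.+1%:R) <= ln (phiR c n.+2%:R).
  by rewrite ler_ln ?posrE ?p0//; apply: phiR_homo; rewrite ?ltr0n// ler_nat.
lra.
Qed.

(** The ratio lies between 1, as phi is nondecreasing, and 1 + j/(n + 1), as phi(u)/u is
    nonincreasing. *)
Lemma phiR_ratio_cvg j : phiR c (n.+1 + j)%:R / phiR c n.+1%:R @[n --> \oo] --> (1 : R).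
Proof.
apply: (@squeeze_cvgn _ (fun=> 1) _ (fun n => 1 + j%:R / n.+1%:R)).
- move=> n; have a0 := p0 (ltn0Sn n).
  have n0 : 0 < n.+1%:R :> R by rewrite ltr0n.
  have nj : n.+1%:R <= (n.+1 + j)%:R :> R by rewrite ler_nat leq_addr.
  rewrite ler_pdivlMr// mul1r (phiR_homo adm n0 nj)/= ler_pdivrMr//.
  have := phiR_div_homo adm n0 nj; rewrite ler_pdivrMr ?(lt_le_trans n0)//.
  by move=> /le_trans; apply; rewrite natrD; rewrite le_eqVlt; apply/orP; left; apply/eqP; field; rewrite gt_eqF.
- exact: cvg_cst.
- rewrite -[X in _ --> X]addr0; apply: cvgD; first exact: cvg_cst.
  rewrite -[X in _ --> X](mulr0 (j%:R : R)); apply: cvgM; first exact: cvg_cst.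
  exact: cvg_harmonic.
Qed.

End gamma_constant.

(** * Asymptotics of the Mellin transform along the integers *)

Section mellin_asymptotics.
Context {R : realType} (c : triplet R) (adm : admissible c).
Context (mu : probability (measurableTypeR R) R).
Local Notation D := (`]0%R, +oo[%classic : set (measurableTypeR R)).
Hypothesis mu_pos : mu D = 1%E.
Hypothesis mu_mom : forall n,
  (\int[mu]_x (`|x| ^+ n)%:E = (n`!%:R / \prod_(1 <= i < n.+1) phiR c i%:R)%:E)%E.
Local Open Scope complex_scope.

Let p0 k : (0 < k)%N -> 0 < phiR c k%:R.
Proof. by move=> k0; apply: phiR_gt0 => //; rewrite ltr0n. Qed.

Let prod_gt0 n : 0 < \prod_(1 <= i < n.+1) phiR c i%:R :> R.
Proof. by rewrite big_nat prodr_gt0// => i /andP[i0 _]; exact: p0. Qed.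

Let M n := \int[mu]_x (`|x| ^+ n).

Let ME n : M n = n`!%:R / \prod_(1 <= i < n.+1) phiR c i%:R.
Proof. exact: abs_moment. Qed.

Let M_gt0 n : 0 < M n.
Proof. by rewrite ME divr_gt0// ltr0n fact_gt0. Qed.

Let MS n : M n.+1 = M n * (n.+1%:R / phiR c n.+1%:R).
Proof.
rewrite !ME factS natrM big_nat_recr//=; have := prod_gt0 n.
set Q := \prod_(_ <= _ < _) _ => Q0; have := p0 (ltn0Sn n); move: (phiR c _) => p pp.
by field; rewrite !gt_eqF.
Qed.

Let abs_int n : mu.-integrable setT (EFin \o (fun x : R => `|x| ^+ n)).
Proof.
apply/integrableP; split.
  by apply/measurable_EFinP; apply: measurable_funX; exact: normr_measurable.
by under eq_integral do rewrite gee0_abs ?lee_fin ?exprn_ge0//; rewrite mu_mom ltry.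
Qed.

Let tau n : R := phiR c n.+1%:R / n.+1%:R.

Let tau_gt0 n : 0 < tau n.
Proof. by rewrite divr_gt0 ?p0// ltr0n. Qed.

(** The j-th moment of tau |x| under the law proportional to |x|^(n+1) mu(dx). *)
Let Rj j n := M (n.+1 + j) * tau n ^+ j / M n.+1.

Let Rj_cvg j : Rj j n @[n --> \oo] --> (1 : R).
Proof.
elim: j => [|j ih].
  rewrite (_ : Rj 0 = fun=> 1); first exact: cvg_cst.
  by apply/funext => n; rewrite /Rj addn0 expr0 mulr1 divff// gt_eqF.
have h1 := phiR_ratio_cvg adm j.+1.
have h2 : (n.+1 + j.+1)%:R / n.+1%:R @[n --> \oo] --> (1 : R).
  rewrite -[X in _ --> X]addr0 -[X in _ --> _ + X](mulr0 (j.+1%:R : R)).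
  rewrite (_ : (fun n => _) = (fun n => 1 + j.+1%:R * harmonic n)).
    by apply: cvgD; [exact: cvg_cst|apply: cvgM; [exact: cvg_cst|exact: cvg_harmonic]].
  by apply/funext => n; rewrite natrD mulrDl divff// pnatr_eq0.
have h3 : (phiR c (n.+1 + j.+1)%:R / phiR c n.+1%:R)^-1 @[n --> \oo] --> (1 : R).
  by rewrite -[X in _ --> X]invr1; apply: cvgV => //; exact: oner_neq0.
suff H : Rj j.+1 n @[n --> \oo] --> (1 * 1 * 1 : R) by rewrite !mulr1 in H.
rewrite (_ : Rj j.+1 = fun n => Rj j n * ((n.+1 + j.+1)%:R / n.+1%:R) *
   (phiR c (n.+1 + j.+1)%:R / phiR c n.+1%:R)^-1).
  by apply: cvgM => //; exact: cvgM.
apply/funext => n; rewrite /Rj addnS MS exprS /tau.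
have := p0 (ltn0Sn n); have := p0 (ltn0Sn (n.+1 + j)%N).
move: (phiR c (n.+1 + j).+1%:R) (phiR c n.+1%:R) => p q pp qq.
move: (M_gt0 n.+1); move: (M n.+1) (M _) => m1 m2 m10.
have n0 : n.+1%:R != 0 :> R by rewrite pnatr_eq0.
move: ((n.+1 + j).+1%:R : R) (n.+1%:R : R) n0 ((q / _) ^+ j) => u v v0 w.
by field; rewrite v0 !gt_eqF.
Qed.

Let dev N n (x : R) := (`|x| * tau n) ^+ N - 1.

Let devE N n x : `|x| ^+ n.+1 * dev N n x ^+ 2 =
  tau n ^+ (N + N) * `|x| ^+ (n.+1 + (N + N)) + (- 2 * tau n ^+ N * `|x| ^+ (n.+1 + N) + `|x| ^+ n.+1).
Proof. by rewrite /dev !exprMn !exprD; ring. Qed.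

Let S N n := \int[mu]_x (`|x| ^+ n.+1 * dev N n x ^+ 2) / M n.+1.

Let dev2_int N n : mu.-integrable setT (EFin \o (fun x : R => `|x| ^+ n.+1 * dev N n x ^+ 2)).
Proof.
under eq_fun do rewrite devE.
apply: integrable_add => //; first exact: integrable_scale.
by apply: integrable_add => //; exact: integrable_scale.
Qed.

(** The second moment of (tau |x|)^N - 1 is R_(2N) - 2 R_N + 1, which tends to 1 - 2 + 1. *)
Let S_cvg N : S N n @[n --> \oo] --> (0 : R).
Proof.
rewrite (_ : S N = fun n => Rj (N + N) n + (- 2 * Rj N n + 1)).
  have -> : (0 : R) = 1 + (- 2 * 1 + 1) by ring.
  exact: (cvgD (Rj_cvg _) (cvgD (cvgM (cvg_cst _) (Rj_cvg _)) (cvg_cst _))).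
apply/funext => n; rewrite /S.
under eq_Rintegral do rewrite devE.
have i1 := integrable_scale measurableT (tau n ^+ (N + N)) (abs_int (n.+1 + (N + N))).
have i2 := integrable_scale measurableT (- 2 * tau n ^+ N) (abs_int (n.+1 + N)).
rewrite RintegralD//; last exact: integrable_add.
rewrite RintegralD// !RintegralZl// /Rj -/(M _) -/(M (n.+1 + N)) -/(M n.+1).
have := M_gt0 n.+1; move: (M _) (M (n.+1 + N)) (M n.+1) => m1 m2 m3 m30.
by field; rewrite gt_eqF.
Qed.

Let dev_int N n : mu.-integrable setT (EFin \o (fun x : R => `|x| ^+ n.+1 * `|dev N n x|)).
Proof.
have mdev : measurable_fun setT (dev N n : measurableTypeR R -> R).
  apply: measurable_funB => //; apply: measurable_funX; exact: measurable_funM.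
apply: (integrable_dominated measurableT _ (integrable_add measurableT (dev2_int N n) (abs_int n.+1))).
  apply: measurable_funM; last exact: measurableT_comp.
  by apply: measurable_funX; exact: normr_measurable.
move=> x _; rewrite ger0_norm ?mulr_ge0 ?exprn_ge0//.
rewrite -[X in _ <= _ + X]mulr1 -mulrDr ler_wpM2l ?exprn_ge0//.
have := sqr_ge0 (`|dev N n x| - 1); have := real_normK (num_real (dev N n x)) => <-.
by have := normr_ge0 (dev N n x); nra.
Qed.

Let Dv N n := \int[mu]_x (`|x| ^+ n.+1 * `|dev N n x|) / M n.+1.

Let Dv_ge0 N n : 0 <= Dv N n.
Proof.
rewrite divr_ge0 ?(ltW (M_gt0 _))//; apply: Rintegral_ge0 => x _.
by rewrite mulr_ge0 ?exprn_ge0.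
Qed.

(** Integrate t <= t^2/(2d) + d/2. Once S < e^2, the choice d = e gives Dv < e, as the
    Cauchy-Schwarz inequality would. *)
Let Dv_le N n (d : R) : 0 < d -> Dv N n <= (2 * d)^-1 * S N n + d / 2.
Proof.
move=> d0; rewrite /Dv ler_pdivrMr// mulrDl /S mulrA divfK ?gt_eqF//.
have i1 := integrable_scale measurableT (2 * d)^-1 (dev2_int N n).
have i2 := integrable_scale measurableT (d / 2) (abs_int n.+1).
rewrite -RintegralZl// /M -[X in _ <= _ + X]RintegralZl// -RintegralD//.
apply: le_Rintegral => //; first exact: integrable_add.
move=> x _; rewrite mulrCA [X in _ <= _ + X]mulrC -mulrDr ler_wpM2l ?exprn_ge0//.
rewrite -(real_normK (num_real (dev N n x))).
move: `|dev N n x| => t; have := sqr_ge0 (t - d) => h.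
have -> : (2 * d)^-1 * t ^+ 2 + d / 2 = t + (2 * d)^-1 * (t - d) ^+ 2.
  by field; rewrite gt_eqF.
by rewrite lerDl mulr_ge0// invr_ge0 mulr_ge0// ltW.
Qed.

Let Dv_cvg N : Dv N n @[n --> \oo] --> (0 : R).
Proof.
apply/cvgrPdist_lt => e e0.
have e20 : 0 < e ^+ 2 by rewrite exprn_gt0.
have /cvgrPdist_lt/(_ _ e20) h := @S_cvg N.
near=> n; rewrite sub0r normrN ger0_norm//.
apply: (le_lt_trans (Dv_le N n e0)).
have : `|0 - S N n| < e ^+ 2 by near: n.
rewrite sub0r normrN => /(le_lt_trans (ler_norm _)) Se.
have : (2 * e)^-1 * S N n < (2 * e)^-1 * e ^+ 2.
  by rewrite ltr_pM2l// invr_gt0 mulr_gt0.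
have -> : (2 * e)^-1 * e ^+ 2 = e / 2 by field; rewrite gt_eqF.
by lra.
Unshelve. all: by end_near.
Qed.

Lemma integralC_scale (f : R -> R[i]) (k : R[i]) : integrableC mu setT f ->
  k * integralC mu setT f = integralC mu setT (fun x => k * f x).
Proof.
case: k => a b [i1 i2]; rewrite /integralC.
have ReM x : complex.Re ((a +i* b) * f x) = a * complex.Re (f x) - b * complex.Im (f x) by case: (f x).
have ImM x : complex.Im ((a +i* b) * f x) = a * complex.Im (f x) + b * complex.Re (f x) by case: (f x).
under [in RHS]eq_Rintegral do rewrite ReM.
under [X in _ = _ +i* X]eq_Rintegral do rewrite ImM.
rewrite RintegralB// ?RintegralD// ?RintegralZl//; try exact: integrable_scale.
Qed.

Let cpow_parts (x : R) a b : cpow x (a +i* b) =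
  (expR (a * ln x) * cos (b * ln x)) +i* (expR (a * ln x) * sin (b * ln x)).
Proof. by rewrite /cpow /expC /= !mulr0 subr0 add0r. Qed.

Let meas_parts (tr : R -> R) a b t : measurable_fun setT (tr : measurableTypeR R -> R) ->
  measurable_fun setT (fun x : measurableTypeR R => expR (a * ln (`|x| * t)) * tr (b * ln (`|x| * t))).
Proof.
move=> mtr.
have ml : measurable_fun setT (fun x : measurableTypeR R => ln (`|x| * t)).
  apply: measurableT_comp => //; apply: measurable_funM => //.
apply: measurable_funM; first by apply: measurableT_comp => //; exact: measurable_funM.
by apply: (measurableT_comp mtr); exact: measurable_funM.
Qed.

Let natC n : (n%:R : R[i]) = (n%:R)%:C.
Proof. by rewrite rmorph_nat. Qed.

(* Under the law proportional to |x|^(n+1) mu(dx), the variable |x| phi(n+1)/(n+1) tends to 1. *)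
Lemma mellin_asymptotic (w : R[i]) : 0 < complex.Re w ->
  cvgC (fun n => mellin mu (w + n.+1%:R) * cpow (phiR c n.+1%:R / n.+1%:R) w / (\int[mu]_x (`|x| ^+ n.+1))%:C) 1.
Proof.
case: w => a b /= a0.
(* An integer exponent, so that only integer moments enter the bound. *)
have [N aN] : exists N : nat, a + 2 * `|b| <= N%:R.
  by exists (Num.truncn `|a + 2 * `|b| |).+1; rewrite (le_trans (ler_norm _))// ltW// truncnS_gt.
pose C := 1 + 2 * `|b| / a.
have C0 : 0 <= C by rewrite addr_ge0// divr_ge0 ?mulr_ge0// ltW.
have wn n : -1 < complex.Re ((a +i* b) + n.+1%:R).
  by rewrite natC /=; have : 0 <= n.+1%:R :> R by []; lra.
pose L n (x : R) := ln (`|x| * tau n).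
have bnd n (x : R) : x != 0 -> `|expR (a * L n x) * cos (b * L n x) - 1| <= C * `|dev N n x| /\
    `|expR (a * L n x) * sin (b * L n x)| <= C * `|dev N n x|.
  move=> x0; have := pow_diff_bound (L n x) a0 aN.
  by rewrite /L expRM_natl lnK// posrE mulr_gt0// normr_gt0.
(* [pow_diff_bound] speaks of positive x = e^l. At x = 0 the weight |x|^(n+1) vanishes, so the value
   may be set to 0. *)
pose dRe n (x : R) := `|x| ^+ n.+1 * (if x == 0 then 0 else expR (a * L n x) * cos (b * L n x) - 1).
pose dIm n (x : R) := `|x| ^+ n.+1 * (if x == 0 then 0 else expR (a * L n x) * sin (b * L n x)).
have mabs n : measurable_fun setT (fun x : measurableTypeR R => `|x| ^+ n).
  by apply: measurable_funX; exact: normr_measurable.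
have mRe n : measurable_fun setT (fun x : measurableTypeR R => expR (a * L n x) * cos (b * L n x)).
  by apply: meas_parts; apply: continuous_measurable_fun; exact: continuous_cos.
have mIm n : measurable_fun setT (fun x : measurableTypeR R => expR (a * L n x) * sin (b * L n x)).
  by apply: meas_parts; apply: continuous_measurable_fun; exact: continuous_sin.
have dReE n x : dRe n x = `|x| ^+ n.+1 * (expR (a * L n x) * cos (b * L n x) - 1).
  by rewrite /dRe; case: eqP => // ->; rewrite normr0 expr0n !mul0r.
have dImE n x : dIm n x = `|x| ^+ n.+1 * (expR (a * L n x) * sin (b * L n x)).
  by rewrite /dIm; case: eqP => // ->; rewrite normr0 expr0n !mul0r.
have mdRe n : measurable_fun setT (dRe n : measurableTypeR R -> R).
  rewrite (_ : dRe n = (fun x => `|x| ^+ n.+1 * (expR (a * L n x) * cos (b * L n x) - 1))); last exact/funext.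
  by apply: measurable_funM => //; exact: measurable_funB.
have mdIm n : measurable_fun setT (dIm n : measurableTypeR R -> R).
  rewrite (_ : dIm n = (fun x => `|x| ^+ n.+1 * (expR (a * L n x) * sin (b * L n x)))); last exact/funext.
  exact: measurable_funM.
have bRe n x : `|dRe n x| <= C * (`|x| ^+ n.+1 * `|dev N n x|).
  rewrite /dRe normrM (ger0_norm (exprn_ge0 _ (normr_ge0 x))) mulrCA ler_wpM2l ?exprn_ge0//.
  by case: ifPn => [_|/(bnd n)[]//]; rewrite normr0 mulr_ge0.
have bIm n x : `|dIm n x| <= C * (`|x| ^+ n.+1 * `|dev N n x|).
  rewrite /dIm normrM (ger0_norm (exprn_ge0 _ (normr_ge0 x))) mulrCA ler_wpM2l ?exprn_ge0//.
  by case: ifPn => [_|/(bnd n)[]//]; rewrite normr0 mulr_ge0.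
have iD n := integrable_scale measurableT C (dev_int N n).
have iRe n : mu.-integrable setT (EFin \o dRe n) by apply: (integrable_dominated measurableT _ (iD n)).
have iIm n : mu.-integrable setT (EFin \o dIm n) by apply: (integrable_dominated measurableT _ (iD n)).
have small (f : nat -> R -> R) : (forall n, mu.-integrable setT (EFin \o f n)) ->
   (forall n x, `|f n x| <= C * (`|x| ^+ n.+1 * `|dev N n x|)) ->
   (\int[mu]_x f n x) / M n.+1 @[n --> \oo] --> (0 : R).
  move=> fi fb; apply: (@squeeze_cvgn _ (fun n => - (C * Dv N n)) _ (fun n => C * Dv N n)).
  - move=> n; rewrite -ler_norml normrM [`|(M _)^-1|]ger0_norm ?invr_ge0 ?(ltW (M_gt0 _))//.
    rewrite /Dv mulrA ler_wpM2r ?invr_ge0 ?(ltW (M_gt0 _))// -RintegralZl//.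
    apply: (le_trans (le_normr_Rintegral _ _)) => //.
    by apply: le_Rintegral => //; exact: integrable_norm (fi n).
  - by rewrite -[X in _ --> X]oppr0 -[X in _ --> - X](mulr0 C); exact: (cvgN (cvgM (cvg_cst _) (Dv_cvg N))).
  - by rewrite -[X in _ --> X](mulr0 C); exact: (cvgM (cvg_cst _) (Dv_cvg N)).
have parts n (x : R) : 0 < x -> cpow (tau n) (a +i* b) * cpow x ((a +i* b) + n.+1%:R) =
   (`|x| ^+ n.+1 * (expR (a * L n x) * cos (b * L n x))) +i* (`|x| ^+ n.+1 * (expR (a * L n x) * sin (b * L n x))).
  move=> x0; rewrite cpowD mulrA -cpowM// cpow_nat// [tau n * x]mulrC cpow_parts /L gtr0_norm//.
  by simpc; congr (_ +i* _); ring.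
have GE n : mellin mu ((a +i* b) + n.+1%:R) * cpow (tau n) (a +i* b) =
    (\int[mu]_x (dRe n x) + M n.+1) +i* (\int[mu]_x (dIm n x)).
  have ic := mellin_integrable adm mu_pos mu_mom (wn n).
  rewrite mulrC /mellin integralC_scale// /integralC.
  have [k1 k2] : integrableC mu setT (fun x => cpow (tau n) (a +i* b) * cpow x ((a +i* b) + n.+1%:R)).
    move: ic => [j1 j2]; case: (cpow (tau n) _) => s t.
    have ReM x z : complex.Re ((s +i* t) * cpow x z) = s * complex.Re (cpow x z) + - t * complex.Im (cpow x z) by rewrite mulNr.
    have ImM x z : complex.Im ((s +i* t) * cpow x z) = s * complex.Im (cpow x z) + t * complex.Re (cpow x z) by [].
    split; [under eq_fun do rewrite ReM|under eq_fun do rewrite ImM];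
      by apply: integrable_add => //; exact: integrable_scale.
  congr (_ +i* _).
  - rewrite -RintegralD//; apply: (positive_ext mu_pos); first exact/measurable_EFinP/measurable_int/k1.
      exact: measurable_funD.
    by move=> x x0; rewrite parts//= dReE; ring.
  - apply: (positive_ext mu_pos) => //; first exact/measurable_EFinP/measurable_int/k2.
    by move=> x x0; rewrite parts//= dImE.
have MC n (z : R[i]) : z / (M n.+1)%:C = (complex.Re z / M n.+1) +i* (complex.Im z / M n.+1).
  by rewrite -fmorphV; case: z => s t; simpc.
have h1 : (\int[mu]_x (dRe n x)) / M n.+1 + 1 @[n --> \oo] --> (1 : R).
  by rewrite -[X in _ --> X]add0r; exact: (cvgD (small _ iRe bRe) (cvg_cst _)).
split.
  under eq_cvg do rewrite GE MC /= mulrDl divff ?(gt_eqF (M_gt0 _))//.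
  exact: h1.
by under eq_cvg do rewrite GE MC /=; exact: small.
Qed.

End mellin_asymptotics.

(** * Product formulas *)

Section mellin_products.
Context {R : realType} (c : triplet R) (adm : admissible c).
Context (mu : probability (measurableTypeR R) R).
Local Notation D := (`]0%R, +oo[%classic : set (measurableTypeR R)).
Hypothesis mu_pos : mu D = 1%E.
Hypothesis mu_mom : forall n,
  (\int[mu]_x (`|x| ^+ n)%:E = (n`!%:R / \prod_(1 <= i < n.+1) phiR c i%:R)%:E)%E.
Local Open Scope complex_scope.
Implicit Types w : R[i].

Let natC n : (n%:R : R[i]) = (n%:R)%:C.
Proof. by rewrite rmorph_nat. Qed.

Let p0 k : (0 < k)%N -> 0 < phiR c k%:R.
Proof. by move=> k0; apply: phiR_gt0 => //; rewrite ltr0n. Qed.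

Let ReD z w : complex.Re (z + w) = complex.Re z + complex.Re w.
Proof. by case: z; case: w. Qed.

Let ReD_nat w n : complex.Re (w + n%:R) = complex.Re w + n%:R.
Proof. by rewrite ReD natC. Qed.

Let ReD_gt0 w n : 0 < complex.Re w -> 0 < complex.Re (w + n%:R).
Proof. by move=> w0; rewrite ReD_nat ltr_wpDr. Qed.

Lemma Re_gt0_neq0 w : 0 < complex.Re w -> w != 0.
Proof. by apply: contraTneq => ->; rewrite ltxx. Qed.

Lemma mellin_shift w n : 0 < complex.Re w ->
  mellin mu w = mellin mu (w + n%:R) * \prod_(1 <= k < n.+1) (phi c (w + k%:R) / (w + k%:R)).
Proof.
move=> w0; elim: n => [|n ih]; first by rewrite big_geq// mulr1 addr0.
rewrite big_nat_recr//= ih.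
have wn : -1 < complex.Re (w + n%:R) by rewrite (lt_trans _ (ReD_gt0 n w0)).
have := mellin_recurrence adm mu_pos mu_mom wn.
rewrite -addrA natr1 => e; have u0 := Re_gt0_neq0 (ReD_gt0 n.+1 w0).
have -> : mellin mu (w + n%:R) = phi c (w + n.+1%:R) * mellin mu (w + n.+1%:R) / (w + n.+1%:R).
  by apply: (mulfI u0); rewrite e [RHS]mulrC divfK.
by ring.
Qed.

Let M n := \int[mu]_x (`|x| ^+ n).

Let M_gt0 n : 0 < M n.
Proof.
rewrite /M (abs_moment mu_mom) divr_gt0// ?ltr0n ?fact_gt0// big_nat prodr_gt0//.
by move=> i /andP[i0 _]; exact: p0.
Qed.

Let C0 (x : R) : 0 < x -> x%:C != 0 :> R[i].
Proof. by move=> x0; rewrite (fmorph_eq0 (real_complex R)) gt_eqF. Qed.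

Let tau n : R := phiR c n.+1%:R / n.+1%:R.

Let tau_gt0 n : 0 < tau n.
Proof. by rewrite divr_gt0 ?p0// ltr0n. Qed.

(** By the recurrence a zero at w would propagate to w + n + 1 for all n, as phi has no zero there,
    against the asymptotics. *)
Lemma mellin_neq0 w : 0 < complex.Re w -> mellin mu w != 0.
Proof.
move=> w0; apply/negP => /eqP e.
have [h _] := mellin_asymptotic adm mu_pos mu_mom w0.
have z n : mellin mu (w + n.+1%:R) = 0.
  have := mellin_shift n.+1 w0; rewrite e => /esym/eqP; rewrite mulf_eq0 => /orP[/eqP//|].
  rewrite big_nat prodf_seq_eq0 => /hasP[k _ /andP[/andP[k1 k2]]].
  have w1 := ReD_gt0 k w0.
  by rewrite mulf_eq0 invr_eq0 (negbTE (phi_neq0 adm w1)) (negbTE (Re_gt0_neq0 w1)).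
have h0 : (fun n => complex.Re (mellin mu (w + n.+1%:R) * cpow (phiR c n.+1%:R / n.+1%:R) w /
    (\int[mu]_x (`|x| ^+ n.+1))%:C)) = fun=> 0.
  by apply/funext => n; rewrite z !mul0r.
move: h; rewrite h0 => h.
have e1 : complex.Re (1 : R[i]) = 0 by rewrite -(cvg_lim (@Rhausdorff R) h) lim_cst.
by move/eqP: e1; rewrite /= oner_eq0.
Qed.

(** Shift w up by n + 1, then compare M(w + n + 1) with the moment M(n + 1), which is the product of
    the k/phi(k). *)
Lemma mellin_product w : 0 < complex.Re w ->
  cvgC (fun n => \prod_(1 <= k < n.+2) (k%:R / phi c k%:R * (phi c (k%:R + w) / (k%:R + w))) *
    cpow (n.+1%:R / phiR c n.+1%:R) w) (mellin mu w).
Proof.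
move=> w0; have hg := mellin_asymptotic adm mu_pos mu_mom w0.
set g := (fun n : nat => _) in hg.
have hm : cvgC (fun=> mellin mu w) (mellin mu w) by split; exact: cvg_cst.
have := cvgC_mul hm (cvgC_inv (oner_neq0 _) hg); rewrite invr1 mulr1.
apply: eq_cvgC => n; rewrite /g -/(tau n) -/(M n.+1).
have tE : n.+1%:R / phiR c n.+1%:R = (tau n)^-1 by rewrite invf_div.
rewrite tE cpowV//.
have mn : mellin mu (w + n.+1%:R) != 0 by apply: mellin_neq0; exact: ReD_gt0.
have cn := cpow_neq0 (tau n) w; have Mn := C0 (M_gt0 n.+1).
have ME : (M n.+1)%:C = \prod_(1 <= k < n.+2) (k%:R / phi c k%:R).
  rewrite /M (abs_moment mu_mom); elim: (n.+1) => [|m ih].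
    by rewrite !big_geq// fact0 divr1.
  rewrite big_nat_recr//= [in RHS]big_nat_recr//= -ih factS natrM.
  have -> : phi c (m.+1%:R : R[i]) = (phiR c m.+1%:R)%:C by rewrite natC phi_phiR// pnatr_eq0.
  rewrite (natC m.+1) -(fmorphV (real_complex R)) -!(rmorphM (real_complex R)); apply: (congr1 (real_complex R)).
  have Q0 : \prod_(1 <= i < m.+1) phiR c i%:R != 0 :> R.
    by rewrite gt_eqF// big_nat prodr_gt0// => i /andP[i0 _]; exact: p0.
  have q0 : phiR c m.+1%:R != 0 by rewrite gt_eqF// p0.
  move: (\prod_(_ <= _ < _) _) (phiR c _) Q0 q0 => Q q Q0 q0.
  by field; rewrite q0 Q0.
rewrite {1}(mellin_shift n.+1 w0) [in RHS]big_split/= -ME.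
have -> : \prod_(1 <= i < n.+2) (phi c (i%:R + w) / (i%:R + w)) =
    \prod_(1 <= k < n.+2) (phi c (w + k%:R) / (w + k%:R)).
  by apply: eq_bigr => k _; rewrite addrC.
move: (mellin mu _) mn (cpow _ _) cn (M n.+1)%:C Mn (\prod_(_ <= _ < _) _) => m m0 t t0 N N0 P.
by field; rewrite m0 t0 N0.
Qed.

Lemma mellin_nat n : mellin mu n%:R = (\int[mu]_x (`|x| ^+ n))%:C.
Proof.
rewrite /mellin /integralC.
have n1 : -1 < complex.Re (n%:R : R[i]) by rewrite natC/= (lt_le_trans (ltrN10 R)).
have [i1 i2] := mellin_integrable adm mu_pos mu_mom n1.
congr (_ +i* _).
  apply: (positive_ext mu_pos); first exact/measurable_EFinP/measurable_int/i1.
    by apply: measurable_funX; exact: normr_measurable.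
  by move=> x x0; rewrite cpow_nat//= gtr0_norm.
rewrite -[RHS](_ : \int[mu]_x (cst 0 x) = 0); last by rewrite Rintegral_cst// mul0r.
apply: (positive_ext mu_pos) => //; first exact/measurable_EFinP/measurable_int/i2.
by move=> x x0; rewrite cpow_nat.
Qed.

End mellin_products.

Section weierstrass_product.
Context {R : realType} (c : triplet R) (adm : admissible c).
Context (mu : probability (measurableTypeR R) R).
Local Notation D := (`]0%R, +oo[%classic : set (measurableTypeR R)).
Hypothesis mu_pos : mu D = 1%E.
Hypothesis mu_mom : forall n,
  (\int[mu]_x (`|x| ^+ n)%:E = (n`!%:R / \prod_(1 <= i < n.+1) phiR c i%:R)%:E)%E.
Local Open Scope complex_scope.
Local Notation eps := (epsilon_law R).
Implicit Types w : R[i].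

Let p0 k : (0 < k)%N -> 0 < phiR c k%:R.
Proof. by move=> k0; apply: phiR_gt0 => //; rewrite ltr0n. Qed.

Let natC n : (n%:R : R[i]) = (n%:R)%:C.
Proof. by rewrite rmorph_nat. Qed.

Let eps_mom n : (\int[eps]_x (`|x| ^+ n)%:E = (n`!%:R / \prod_(1 <= i < n.+1) phiR (@gamma_triplet R) i%:R)%:E)%E.
Proof. by rewrite gamma_prod divr1 epsilon_moment. Qed.

Let ReD_gt0 w n : 0 < complex.Re w -> 0 < complex.Re (n%:R + w).
Proof. by case: w => a b; rewrite natC /= => a0; rewrite ltr_wpDl. Qed.

(** Divide the product for phi = 1 by the one for [mu]: the factors k/(k + w) and the powers of n +
    1 cancel. *)
Lemma phi_product w : 0 < complex.Re w ->
  cvgC (fun n => \prod_(1 <= k < n.+2) (phi c k%:R / phi c (k%:R + w)) * cpow (phiR c n.+1%:R) w)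
    (mellin eps w / mellin mu w).
Proof.
move=> w0; have h1 := mellin_product adm mu_pos mu_mom w0.
have h2 := mellin_product (@gamma_admissible R) (@epsilon_pos R) eps_mom w0.
have m0 := mellin_neq0 adm mu_pos mu_mom w0.
have := cvgC_mul h2 (cvgC_inv m0 h1); apply: eq_cvgC => n.
have n0 : 0 < n.+1%:R :> R by rewrite ltr0n.
have q0 := p0 (ltn0Sn n).
rewrite gamma_phiR_eq1 ?gt_eqF// divr1 cpowM ?invr_gt0// cpowV// 2!invfM invrK.
have c1 := cpow_neq0 (n.+1%:R : R) w.
rewrite mulrACA [cpow n.+1%:R w * _]mulrA divff// mul1r; congr (_ * _).
rewrite -prodfV -big_split/= !big_nat; apply: eq_bigr => k /andP[k1 _].
have k0 : (k%:R : R[i]) != 0 by rewrite pnatr_eq0 -lt0n.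
have kw0 := Re_gt0_neq0 (ReD_gt0 k w0).
rewrite !gamma_phi_eq1//.
have pk : phi c k%:R != 0 by apply: phi_neq0 => //; rewrite natC/= ltr0n.
have pkw : phi c (k%:R + w) != 0 by apply: phi_neq0 => //; exact: ReD_gt0.
by field; rewrite kw0 pk pkw.
Qed.

(** The power phi(n + 1)^w of [phi_product] is e^(w ln phi(n + 1)), while the exponential factors of
    [W_phi] multiply to e^(w sum phi'(k)/phi(k)); the quotient tends to e^(gamma_phi w), which
    cancels the prefactor. The recurrences for [mu] and for Gamma then move the argument from w to w
    - 1. *)
Lemma W_phi_mellin w : 0 < complex.Re w ->
  GammaC w != 0 /\ W_phi c w = GammaC w / mellin mu (w - 1).
Proof.
move=> w0; have wn0 := Re_gt0_neq0 w0.
have w1 : -1 < complex.Re (w - 1) by case: w w0 {wn0} => a b /= a0; lra.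
have m0 := mellin_neq0 adm mu_pos mu_mom w0.
have e0 := mellin_neq0 (@gamma_admissible R) (@epsilon_pos R) eps_mom w0.
have pw := phi_neq0 adm w0.
have r1 := mellin_recurrence adm mu_pos mu_mom w1.
have r2 := mellin_recurrence (@gamma_admissible R) (@epsilon_pos R) eps_mom w1.
rewrite subrK in r1; rewrite subrK gamma_phi_eq1// mul1r (mellin_epsilon w1) subrK in r2.
have G0 : GammaC w != 0 by apply: contraNneq e0 => g0; rewrite -r2 g0 mulr0.
split => //.
have m1 : mellin mu (w - 1) != 0.
  by apply: contraNneq m0 => g0; move: r1; rewrite g0 mulr0 => /esym/eqP; rewrite mulf_eq0 (negbTE pw).
pose s n := \sum_(1 <= k < n.+2) dlog_phi c k - ln (phiR c n.+1%:R).
have hs : s n @[n --> \oo] --> gamma_phi c.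
  by have := gamma_phi_cvg adm; rewrite -(cvg_shiftS (fun n => \sum_(1 <= k < n.+1) dlog_phi c k - ln (phiR c n%:R))).
have l1 := cvgC_mul (phi_product w0) (cvgC_expC w hs).
pose u n := \prod_(1 <= k < n.+1) (phi c k%:R / phi c (k%:R + w) * expC ((dlog_phi c k)%:C * w)).
have uE n : \prod_(1 <= k < n.+2) (phi c k%:R / phi c (k%:R + w)) * cpow (phiR c n.+1%:R) w *
    expC ((s n)%:C * w) = u n.+1.
  rewrite /u [in RHS]big_split/= -mulrA; congr (_ * _).
  have -> : \prod_(1 <= k < n.+2) expC ((dlog_phi c k)%:C * w) = expC ((\sum_(1 <= k < n.+2) dlog_phi c k)%:C * w).
    elim: (n.+1) => [|m ih]; first by rewrite !big_geq// mul0r expC0.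
    by rewrite big_nat_recr//= [in RHS]big_nat_recr//= ih rmorphD mulrDl expCD.
  rewrite /cpow -expCD /s; congr expC; rewrite rmorphB; ring.
have lim : cvgC u (mellin eps w / mellin mu w * expC ((gamma_phi c)%:C * w)).
  have [k1 k2] := eq_cvgC uE l1; split; [move: k1|move: k2].
    by rewrite (cvg_shiftS (fun n => complex.Re (u n))).
  by rewrite (cvg_shiftS (fun n => complex.Im (u n))).
rewrite /W_phi (limC_cvgC lim) -r2.
have := expCN ((gamma_phi c)%:C * w); move: (expC (- ((gamma_phi c)%:C * w))) (expC ((gamma_phi c)%:C * w)) => x y xy.
have -> : mellin mu w = w * mellin mu (w - 1) / phi c w by rewrite r1 mulrC mulKf.
have -> : x / phi c w * (w * GammaC w / (w * mellin mu (w - 1) / phi c w) * y) =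
   (x * y) * (GammaC w / mellin mu (w - 1)).
  move: (mellin mu _) m1 (phi c w) pw (GammaC w) => a a0 b b0 g.
  by field; rewrite b0 a0 wn0.
by rewrite xy mul1r.
Qed.

Lemma W_phi_nat n : W_phi c n.+1%:R = (\prod_(1 <= i < n.+1) phiR c i%:R)%:C.
Proof.
have n0 : 0 < complex.Re (n.+1%:R : R[i]) by rewrite natC/= ltr0n.
have [_ ->] := W_phi_mellin n0.
rewrite -natr1 addrK (mellin_nat adm mu_pos mu_mom) (abs_moment mu_mom).
have n1 : -1 < complex.Re (n%:R : R[i]) by rewrite natC/= (lt_le_trans (ltrN10 R)).
rewrite -(mellin_epsilon n1) (mellin_nat (@gamma_admissible R) (@epsilon_pos R) eps_mom).
rewrite (abs_moment eps_mom) gamma_prod divr1 -fmorphV -rmorphM; apply: (congr1 (real_complex R)).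
have Q0 : \prod_(1 <= i < n.+1) phiR c i%:R != 0 :> R.
  by rewrite gt_eqF// big_nat prodr_gt0// => i /andP[i0 _]; exact: p0.
by move: (\prod_(_ <= _ < _) _) Q0 => Q Q0; field; rewrite Q0 pnatr_eq0 -lt0n fact_gt0.
Qed.

End weierstrass_product.

Lemma is_derive_quadratic (R : realType) (f : R -> R) (x d K e : R) : 0 < e ->
  (forall h, `|h| < e -> `|f (x + h) - f x - h * d| <= K * h ^+ 2) -> is_derive x 1 f d.
Proof.
move=> e0 hq; have K0 : 0 <= `|K| + 1 by rewrite addr_ge0.
have cv : h^-1 *: (f (h *: 1 + x) - f x) @[h --> 0^'] --> d.
  apply/cvgrPdist_le => r r0.
  have r1 : 0 < r / (`|K| + 1) by rewrite divr_gt0// ltr_wpDl.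
  near=> h.
  have h0 : h != 0 by near: h; exact: nbhs_dnbhs_neq.
  have he : `|h| < e by near: h; apply: dnbhs0_lt.
  have hr : `|h| <= r / (`|K| + 1) by near: h; apply: dnbhs0_le.
  rewrite -normrN opprB /GRing.scale/= mulr1 [h + x]addrC.
  have -> : h^-1 * (f (x + h) - f x) - d = h^-1 * (f (x + h) - f x - h * d).
    by rewrite [in RHS]mulrBr mulKf.
  rewrite normrM normfV ler_pdivrMl ?normr_gt0//.
  apply: (le_trans (hq h he)); rewrite -real_normK ?num_real// expr2 mulrA mulrC.
  rewrite ler_wpM2l//; apply: (@le_trans _ _ ((`|K| + 1) * (r / (`|K| + 1)))).
    apply: (@le_trans _ _ ((`|K| + 1) * `|h|)); last by rewrite ler_wpM2l.
    by rewrite ler_wpM2r// (le_trans (ler_norm _))// lerDl.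
  by rewrite mulrC divfK// gt_eqF// ltr_wpDl.
split; first by apply/cvg_ex; exists d; exact: cv.
exact: cvg_lim cv.
Unshelve. all: by end_near.
Qed.

(** * The semigroup on Laplace transforms *)

Section exponential_remainders.
Context {R : realType}.
Implicit Types (a b k l v t : R).

(** The remainder is e^(-a) [expc2 1 (b - a)], nonnegative by convexity. The maximum covers both
    orders of a and b. *)
Lemma expRN_quadratic a b : 
  0 <= expR (- b) - expR (- a) + (b - a) * expR (- a) <= (b - a) ^+ 2 * Num.max (expR (- a)) (expR (- b)).
Proof.
have -> : expR (- b) - expR (- a) + (b - a) * expR (- a) = expR (- a) * expc2 1 (b - a).
  have -> : expR (- b) = expR (- a) * expR (- (1 * (b - a))) by rewrite -expRD; congr expR; ring.
  by rewrite /expc2; ring.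
rewrite mulr_ge0 ?expR_ge0 ?expc2_ge0//=.
have [ab|ba] := leP a b.
  rewrite mulrC; apply: ler_pM; rewrite ?expc2_ge0 ?expR_ge0//; last by rewrite le_max lexx.
  by have := @expc2_le_sqr R 1 (b - a) ler01; rewrite mul1r; apply; rewrite subr_ge0.
apply: (@le_trans _ _ ((b - a) ^+ 2 * expR (- b))); last first.
  by rewrite ler_wpM2l ?sqr_ge0// le_max lexx orbT.
have -> : expR (- b) = expR (- a) * expR (a - b) by rewrite -expRD; congr expR; ring.
rewrite mulrCA ler_wpM2l ?expR_ge0// /expc2 mul1r opprB.
have h1 := expR_ge1Dx (- (a - b)).
have h2 : expR (a - b) * expR (- (a - b)) = 1 by rewrite -expRD subrr expR0.
have h3 := expR_gt0 (a - b).
have t0 : 0 < a - b by lra.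
have : 1 - (a - b) ^+ 2 <= (1 + (a - b)) * expR (- (a - b)) by nra.
move: h2 h3; move: (expR (- (a - b))) (expR (a - b)) => y x xy x0 h.
have : x * (1 - (a - b) ^+ 2) <= x * ((1 + (a - b)) * y) by rewrite ler_pM2l.
have -> : x * ((1 + (a - b)) * y) = (1 + (a - b)) * (x * y) by ring.
by rewrite xy; nra.
Qed.

Lemma pow_expRN_le k n v : 0 < k -> 0 <= v -> v ^+ n * expR (- (k * v)) <= n`!%:R / k ^+ n.
Proof.
move=> k0 v0; have /(ler_wpM2r (expR_ge0 (- (k * v)))) := expr_le_expRM n k0 v0.
by rewrite -[leRHS]mulrA -expRD subrr expR0 mulr1.
Qed.

(** A second-order expansion in the rate, uniform in v >= 0. The constant is 2!/(l/2)^2, the bound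
    of v^2 e^(-lv/2). *)
Lemma expRN_param l k v : 0 < l -> l / 2 <= k -> 0 <= v ->
  `|expR (- (k * v)) - expR (- (l * v)) + (k - l) * (v * expR (- (l * v)))| <= 8 / l ^+ 2 * (k - l) ^+ 2.
Proof.
move=> l0 kl v0; have /andP[h1 h2] := expRN_quadratic (l * v) (k * v).
have E : (k * v - l * v) * expR (- (l * v)) = (k - l) * (v * expR (- (l * v))) by ring.
rewrite E in h1 h2; rewrite ger0_norm// (le_trans h2)//.
have l2 : 0 < l / 2 by lra.
have m : Num.max (expR (- (l * v))) (expR (- (k * v))) <= expR (- (l / 2 * v)).
  by rewrite ge_max !ler_expR; apply/andP; split; nra.
have -> : (k * v - l * v) ^+ 2 = (k - l) ^+ 2 * v ^+ 2 by ring.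
rewrite -mulrA mulrC ler_wpM2r ?sqr_ge0//.
apply: (@le_trans _ _ (v ^+ 2 * expR (- (l / 2 * v)))); first by rewrite ler_wpM2l ?sqr_ge0.
apply: (le_trans (pow_expRN_le 2 l2 v0)).
by rewrite le_eqVlt; apply/orP; left; apply/eqP; rewrite !factS fact0; field; rewrite gt_eqF.
Qed.

End exponential_remainders.

Section laplace_transform.
Context {R : realType} (c : triplet R) (adm : admissible c).
Context (mu : probability (measurableTypeR R) R).
Local Notation leb := (@lebesgue_measure R).
Local Notation D := (`]0%R, +oo[%classic : set (measurableTypeR R)).
Hypothesis mu_pos : mu D = 1%E.
Hypothesis mu_mom : forall n,
  (\int[mu]_x (`|x| ^+ n)%:E = (n`!%:R / \prod_(1 <= i < n.+1) phiR c i%:R)%:E)%E.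
Implicit Types (k l s t x y : R) (n : nat).

(** (-1)^n times the n-th derivative of the Laplace transform of [mu]. For x >= 0, J_0(l x) is the
    image of e^(-l .) under the mixture operator. *)
Definition laplace n t : R := \int[mu]_y (`|y| ^+ n * expR (- (t * `|y|))).
Local Notation J := laplace.

Let abs_int n : mu.-integrable setT (EFin \o (fun x : R => `|x| ^+ n)).
Proof.
apply/integrableP; split.
  by apply/measurable_EFinP; apply: measurable_funX; exact: normr_measurable.
by under eq_integral do rewrite gee0_abs ?lee_fin ?exprn_ge0//; rewrite mu_mom ltry.
Qed.

Let mabs n : measurable_fun setT (fun x : measurableTypeR R => `|x| ^+ n).
Proof. by apply: measurable_funX; exact: normr_measurable. Qed.

Let mexpabs t : measurable_fun setT (fun x : measurableTypeR R => expR (- (t * `|x|))).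
Proof.
apply: (measurableT_comp (measurable_expRN t)); exact: normr_measurable.
Qed.

Lemma laplace_integrable n t : 0 <= t ->
  mu.-integrable setT (EFin \o (fun y : R => `|y| ^+ n * expR (- (t * `|y|)))).
Proof.
move=> t0; apply: (integrable_dominated measurableT _ (abs_int n)); first exact: measurable_funM.
move=> y _; rewrite ger0_norm ?mulr_ge0 ?exprn_ge0 ?expR_ge0//.
by rewrite ler_piMr ?exprn_ge0// -[leRHS]expR0 ler_expR oppr_le0 mulr_ge0.
Qed.

Lemma laplace_ge0 n t : 0 <= J n t.
Proof. by apply: Rintegral_ge0 => y _; rewrite mulr_ge0 ?exprn_ge0 ?expR_ge0. Qed.

Lemma laplace0 : J 0 0 = 1.
Proof.
rewrite /J (_ : (fun y => _) = cst 1); last by apply/funext => y; rewrite mul0r oppr0 expR0 mulr1.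
by rewrite Rintegral_cst// mul1r; have := @probability_setT _ _ _ mu => /= ->.
Qed.

Lemma laplace_le n t : 0 <= t -> J n t <= J n 0.
Proof.
move=> t0; apply: le_Rintegral => //; [exact: laplace_integrable|exact: laplace_integrable|].
move=> y _; rewrite ler_wpM2l ?exprn_ge0// ler_expR mul0r oppr0 oppr_le0 mulr_ge0//.
Qed.

Lemma laplace_quadratic n s t : 0 <= s -> 0 <= t ->
  `|J n t - J n s + (t - s) * J n.+1 s| <= J n.+2 0 * (t - s) ^+ 2.
Proof.
move=> s0 t0; have i1 := laplace_integrable n t0; have i2 := laplace_integrable n s0.
have i3 := integrable_scale measurableT (t - s) (laplace_integrable n.+1 s0).
have i4 := integrable_scale measurableT ((t - s) ^+ 2) (laplace_integrable n.+2 (lexx 0)).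
have i12 := integrable_add measurableT i1 (integrable_scale measurableT (- 1) i2).
have E : J n t - J n s + (t - s) * J n.+1 s = \int[mu]_y
   ((`|y| ^+ n * expR (- (t * `|y|)) + - 1 * (`|y| ^+ n * expR (- (s * `|y|)))) +
    (t - s) * (`|y| ^+ n.+1 * expR (- (s * `|y|)))).
  rewrite (RintegralD measurableT i12 i3) (RintegralD measurableT i1 (integrable_scale measurableT (- 1) i2)).
  by rewrite !RintegralZl ?mulN1r//; exact: laplace_integrable.
rewrite E mulrC -RintegralZl//; last exact: laplace_integrable.
have i := integrable_add measurableT i12 i3.
apply: (le_trans (le_normr_Rintegral _ i)) => //.
apply: le_Rintegral => //; first exact: integrable_norm i.
move=> y _; have /andP[h1 h2] := expRN_quadratic (s * `|y|) (t * `|y|).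
rewrite (_ : _ + _ = `|y| ^+ n * (expR (- (t * `|y|)) - expR (- (s * `|y|)) + (t * `|y| - s * `|y|) * expR (- (s * `|y|)))); last by rewrite exprS; ring.
rewrite ger0_norm ?mulr_ge0 ?exprn_ge0// (le_trans (ler_wpM2l (exprn_ge0 _ (normr_ge0 _)) h2))//.
rewrite mul0r oppr0 expR0 mulr1 (_ : (t * `|y| - s * `|y|) ^+ 2 = (t - s) ^+ 2 * `|y| ^+ 2); last by ring.
have m1 : Num.max (expR (- (s * `|y|))) (expR (- (t * `|y|))) <= 1.
  by rewrite ge_max; apply/andP; split; rewrite -[leRHS]expR0 ler_expR oppr_le0 mulr_ge0.
move: (Num.max _ _) m1 => m m1.
have -> : `|y| ^+ n * ((t - s) ^+ 2 * `|y| ^+ 2 * m) = (t - s) ^+ 2 * `|y| ^+ n.+2 * m.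
  by rewrite !exprS; ring.
by rewrite ler_piMr// mulr_ge0 ?sqr_ge0 ?exprn_ge0.
Qed.

Lemma is_derive_laplace n t : 0 < t -> is_derive t 1 (J n) (- J n.+1 t).
Proof.
move=> t0; apply: (is_derive_quadratic (K := J n.+2 0) t0) => h ht.
have t1 : 0 <= t + h by move: ht; rewrite ltr_norml; lra.
have := laplace_quadratic n (ltW t0) t1.
by rewrite [t + h - t]addrAC subrr add0r mulrN opprK.
Qed.

Lemma laplace_continuous n t : 0 <= t -> forall e, 0 < e -> exists2 d, 0 < d &
  forall s, 0 <= s -> `|s - t| < d -> `|J n s - J n t| <= e.
Proof.
move=> t0 e e0; pose K := J n.+1 0 + J n.+2 0 + 1.
have K0 : 0 < K by have := laplace_ge0 n.+1 0; have := laplace_ge0 n.+2 0; rewrite /K; lra.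
exists (Num.min 1 (e / K)); first by rewrite lt_min ltr01 divr_gt0.
move=> s s0; rewrite lt_min => /andP[h1 h2].
have h := laplace_quadratic n t0 s0.
have j := laplace_le n.+1 t0; have j0 := laplace_ge0 n.+1 t; have j2 := laplace_ge0 n.+2 0.
have : `|J n s - J n t| <= J n.+1 0 * `|s - t| + J n.+2 0 * `|s - t| ^+ 2.
  have -> : J n s - J n t = (J n s - J n t + (s - t) * J n.+1 t) - (s - t) * J n.+1 t by ring.
  rewrite (le_trans (ler_normB _ _))// addrC lerD//; last by rewrite real_normK ?num_real.
  by rewrite normrM mulrC (ger0_norm j0) ler_wpM2r.
move=> /le_trans; apply.
apply: (@le_trans _ _ (K * `|s - t|)).
  have d0 := normr_ge0 (s - t).
  have j3 : 0 <= J n.+2 0 * (`|s - t| * (1 - `|s - t|)) by rewrite !mulr_ge0// subr_ge0 ltW.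
  have : J n.+1 0 * `|s - t| + J n.+2 0 * `|s - t| ^+ 2 =
    K * `|s - t| - `|s - t| - J n.+2 0 * (`|s - t| * (1 - `|s - t|)) by rewrite /K; ring.
  lra.
by rewrite -ler_pdivlMl// mulrC ltW.
Qed.

Definition inv_sqrt t : R := expR (- 2^-1 * ln t).

(* [v^n e^(-v) v^(1/2) <= v^n (1 + v) e^(-v)], and [E X^(-1/2)] is finite *)
Lemma laplace_decay n : exists2 B, 0 <= B & forall t, 0 < t -> t ^+ n * J n t <= B * inv_sqrt t.
Proof.
have iE : mu.-integrable setT (EFin \o inv_sqrt).
  by apply: (pow_integrable adm mu_pos mu_mom); rewrite ltrN2 invf_lt1 ?ltr1n.
pose C : R := n`!%:R + n.+1`!%:R.
have C0 : 0 <= C by rewrite addr_ge0.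
exists (C * \int[mu]_y inv_sqrt y).
  by rewrite mulr_ge0//; apply: Rintegral_ge0 => y _; exact: expR_ge0.
move=> t t0.
have i1 := laplace_integrable n (ltW t0).
pose f (y : R) := t ^+ n * (`|y| ^+ n * expR (- (t * `|y|))).
have fi : mu.-integrable setT (EFin \o f) by exact: integrable_scale.
pose Dpos := D.
have mD : measurable Dpos by exact: measurable_itv.
have -> : t ^+ n * J n t = \int[mu]_y (f y * \1_Dpos y).
  rewrite -RintegralZl//; apply: (positive_ext mu_pos).
  - by apply: measurable_funM => //; exact: measurable_funM.
  - by apply: measurable_funM; [exact/measurable_EFinP/measurable_int/fi|exact: measurable_indic].
  - by move=> x x0; rewrite indicE mem_set ?mulr1//; exact/pos_half_lineP.
rewrite mulrAC -RintegralZl//; apply: le_Rintegral => //.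
- apply: (integrable_dominated measurableT _ (integrable_norm fi)).
    by apply: measurable_funM; [exact/measurable_EFinP/measurable_int/fi|exact: measurable_indic].
  move=> y _; rewrite normrM ler_piMr//= indicE; case: (_ \in _); rewrite /= ?normr1 ?normr0//.
- exact: integrable_scale.
move=> y _; rewrite indicE; have [|_] := boolP (y \in Dpos); last first.
  by rewrite mulr0 !mulr_ge0 ?expR_ge0.
rewrite inE => /pos_half_lineP y0; rewrite mulr1 /f gtr0_norm// mulrA -exprMn.
have v0 : 0 < t * y by rewrite mulr_gt0.
have : (t * y) ^+ n * expR (- (t * y)) <= C * inv_sqrt (t * y).
  have e0 : 0 < inv_sqrt (t * y) by exact: expR_gt0.
  rewrite -ler_pdivrMr// /inv_sqrt -expRN mulNr opprK.
  have s1 : expR (2^-1 * ln (t * y)) <= 1 + t * y.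
    have h : expR (2^-1 * ln (t * y)) ^+ 2 = t * y.
      by rewrite -expRM_natl mulrA divff// mul1r lnK.
    have := expR_gt0 (2^-1 * ln (t * y)); move: (expR _) h => z <- z0.
    by have := sqr_ge0 (z - 2^-1); nra.
  apply: (le_trans (ler_wpM2l (mulr_ge0 (exprn_ge0 _ (ltW v0)) (expR_ge0 _)) s1)).
  have p1 := @pow_expRN_le R 1 n _ ltr01 (ltW v0); have p2 := @pow_expRN_le R 1 n.+1 _ ltr01 (ltW v0).
  rewrite !expr1n !divr1 !mul1r in p1 p2.
  rewrite /C mulrDr mulr1 lerD// mulrAC -exprSr//.
move=> /le_trans; apply; rewrite /inv_sqrt lnM ?posrE// mulrDr expRD.
by rewrite -!mulrA [X in _ <= _ * X]mulrC; apply/ler_wpM2l => //; rewrite mulrC.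
Qed.

End laplace_transform.

(** * Continuous functions vanishing at infinity *)

Section C0_functions.
Context {R : realType}.
Implicit Types (f g : R -> R) (a e x y : R).

Lemma C0_intro f : (forall x, 0 <= x -> forall e, 0 < e -> exists2 d, 0 < d &
    forall y, 0 <= y -> `|y - x| < d -> `|f y - f x| <= e) ->
  (forall e, 0 < e -> exists M, forall x, M <= x -> `|f x| <= e) -> C0 f.
Proof.
move=> cf lf; split.
  apply/subspace_continuousP => x; rewrite /= in_itv/= andbT => x0.
  apply/cvgrPdist_le => e e0; have [d d0 h] := cf x x0 e e0.
  rewrite near_withinE; near=> y; rewrite /= in_itv/= andbT => y0.
  rewrite distrC; apply: h => //; rewrite distrC; near: y; exact: nbhs_ball_norm.
apply/cvgrPdist_le => e e0; have [M h] := lf e e0.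
near=> x; rewrite sub0r normrN; apply: h; near: x; apply: nbhs_pinfty_ge; exact: num_real.
Unshelve. all: by end_near.
Qed.

Lemma C0_lin a f g : C0 f -> C0 g -> C0 (fun x => a * f x + g x).
Proof.
move=> [cf lf] [cg lg]; split.
  by move=> x; apply: cvgD (cg x); apply: cvgM (cf x); exact: cvg_cst.
rewrite -[X in _ --> X]addr0 -[X in _ --> X + _](mulr0 a).
by apply: cvgD => //; apply: cvgM => //; exact: cvg_cst.
Qed.

Lemma C0_0 : C0 (fun=> 0 : R).
Proof. by split; [move=> x; exact: cvg_cst|exact: cvg_cst]. Qed.

Lemma C0_max0 f : C0 f -> C0 (fun x => Num.max (f x) 0).
Proof.
move=> hf; have hn : C0 (fun x => `|f x|).
  have [cf lf] := hf; split; first by move=> x; apply: cvg_norm; exact: cf.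
  by rewrite -[X in _ --> X](normr0 R); exact: cvg_norm.
have hs := C0_lin 1 hf hn; have := C0_lin 2^-1 hs C0_0; congr C0; apply/funext => x.
have [x0|x0] := leP 0 (f x); [rewrite (ger0_norm x0)|rewrite (ltr0_norm x0)]; rewrite ?max_l// ?max_r ?(ltW x0)//; lra.
Qed.

Lemma C0_bounded f : C0 f -> exists M, forall x, 0 <= x -> `|f x| <= M.
Proof.
move=> [cf lf].
have : \forall x \near +oo, `|0 - f x| < 1.
  by move/cvgrPdist_lt : lf => /(_ 1 ltr01).
move=> [M [_ hM]].
pose N := `|M| + 1; have N0 : 0 <= N by rewrite addr_ge0.
have cN : {within `[0, N], continuous (fun x => `|f x|)}.
  have sub : `[0, N] `<=` `[0, +oo[ by move=> z; rewrite /= !in_itv/= andbT => /andP[].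
  have cf' : {within `[0, N], continuous f} by exact: continuous_subspaceW sub cf.
  by move=> x; apply: cvg_norm; exact: cf'.
have [b _ hb] := EVT_max N0 cN.
exists (Num.max `|f b| 1) => x x0; rewrite le_max.
have [xN|Nx] := leP x N; first by rewrite hb// in_itv/= x0.
rewrite orbC; have := hM x; rewrite sub0r normrN => h; rewrite ltW//; apply: h.
by rewrite (le_lt_trans (ler_norm M))// (le_lt_trans _ Nx)// /N lerDl.
Qed.

Lemma C0norm_ge f : C0 f -> forall x, 0 <= x -> `|f x| <= C0norm f.
Proof.
move=> /C0_bounded[M hM] x x0; apply: ub_le_sup.
  by exists M => _ [y + <-]; rewrite /= in_itv/= andbT; exact: hM.
by exists x => //; rewrite /= in_itv/= andbT.
Qed.

Lemma C0norm_le f M : (forall x, 0 <= x -> `|f x| <= M) -> C0norm f <= M.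
Proof.
move=> h; apply: ge_sup; first by exists `|f 0|, 0 => //; rewrite /= in_itv/= lexx.
by move=> _ [y + <-]; rewrite /= in_itv/= andbT; exact: h.
Qed.

End C0_functions.

(** * The generator on Laplace transforms *)

Section laplace_functions.
Context {R : realType} (c : triplet R) (adm : admissible c).
Context (mu : probability (measurableTypeR R) R).
Local Notation leb := (@lebesgue_measure R).
Local Notation D := (`]0%R, +oo[%classic : set (measurableTypeR R)).
Hypothesis mu_pos : mu D = 1%E.
Hypothesis mu_mom : forall n,
  (\int[mu]_x (`|x| ^+ n)%:E = (n`!%:R / \prod_(1 <= i < n.+1) phiR c i%:R)%:E)%E.
Implicit Types (k l s t x y u : R) (n : nat).
Local Notation J := (laplace mu).

Lemma inv_sqrt_small e : 0 < e -> exists2 M, 0 < M & forall t, M <= t -> inv_sqrt t <= e.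
Proof.
move=> e0; exists (expR (- 2 * ln e)); first exact: expR_gt0.
move=> t ht; rewrite /inv_sqrt -[leRHS](lnK (x := e)) ?posrE// ler_expR.
have t0 := lt_le_trans (expR_gt0 _) ht.
have : - 2 * ln e <= ln t by rewrite -[leLHS]expRK ler_ln// posrE// expR_gt0.
by lra.
Qed.

Lemma laplace_small n e : 0 < e -> exists2 M, 0 < M & forall t, M <= t -> t ^+ n * J n t <= e.
Proof.
move=> e0; have [B B0 hB] := laplace_decay adm mu_pos mu_mom n.
have e1 : 0 < e / (B + 1) by rewrite divr_gt0// ltr_wpDl.
have [M M0 hM] := inv_sqrt_small e1; exists M => // t ht.
apply: (le_trans (hB t (lt_le_trans M0 ht))).
apply: (@le_trans _ _ (B * (e / (B + 1)))); first by rewrite ler_wpM2l ?hM.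
by rewrite mulrCA ler_piMr ?(ltW e0)// ler_pdivrMr ?mul1r ?lerDl// ltr_wpDl.
Qed.

Lemma laplace_C0 n l : 0 < l -> C0 (fun x => (l * x) ^+ n * J n (l * x)).
Proof.
move=> l0; apply: C0_intro; last first.
  move=> e e0; have [M M0 hM] := laplace_small n e0.
  exists (M / l) => x; rewrite ler_pdivrMr// mulrC => hx.
  have lx : 0 <= l * x by rewrite (le_trans (ltW M0)).
  by rewrite ger0_norm ?mulr_ge0 ?exprn_ge0 ?laplace_ge0// hM.
move=> x x0 e e0; have t0 : 0 <= l * x by rewrite mulr_ge0// ltW.
have [b b0 hb] : exists2 b, 0 < b & forall s, 0 <= s -> `|s - l * x| < b -> `|s ^+ n * J n s - (l * x) ^+ n * J n (l * x)| <= e.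
  pose t := l * x; rewrite -/t in t0 *.
  pose K1 := `|t ^+ n| + 1; pose K2 := J n 0 + 1.
  have K10 : 0 < K1 by rewrite ltr_wpDl. 
  have K20 : 0 < K2 by rewrite ltr_wpDl// laplace_ge0.
  have e1 : 0 < e / 2 / K1 by rewrite !divr_gt0.
  have [d1 d10 h1] := laplace_continuous mu_mom n t0 e1.
  have : \forall s \near t, `|s ^+ n - t ^+ n| < e / 2 / K2.
    have cX : {for t, continuous (fun s : R => s ^+ n)} by exact: exprn_continuous.
    have /cvgrPdist_lt/(_ (e / 2 / K2)) := cX; rewrite !divr_gt0// => /(_ isT).
    by apply: filterS => s; rewrite distrC.
  move=> [d2 /= d20 h2].
  exists (Num.min d1 d2); first by rewrite lt_min d10.
  move=> s s0; rewrite lt_min => /andP[sd1 sd2].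
  have g1 := h1 s s0 sd1; have g2 := h2 s; rewrite /ball/= distrC in g2; have {}g2 := ltW (g2 sd2).
  have -> : s ^+ n * J n s - t ^+ n * J n t = (s ^+ n - t ^+ n) * J n s + t ^+ n * (J n s - J n t) by ring.
  rewrite (le_trans (ler_normD _ _))// !normrM [leRHS]splitr lerD//.
    apply: (@le_trans _ _ (e / 2 / K2 * K2)); last by rewrite divfK// gt_eqF.
    apply: ler_pM => //; rewrite ger0_norm ?laplace_ge0//.
    by rewrite (le_trans (laplace_le mu_mom n s0))// lerDl.
  apply: (@le_trans _ _ (K1 * (e / 2 / K1))); last by rewrite mulrC divfK// gt_eqF.
  by apply: ler_pM => //; rewrite lerDl.
exists (b / l); first by rewrite divr_gt0.
move=> y y0 hy; apply: hb; first by rewrite mulr_ge0// ltW.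
by rewrite -mulrBr normrM (gtr0_norm l0) mulrC -ltr_pdivlMr.
Qed.

(** In the variable u = ln x these functions are closed under differentiation, T_n' = n T_n -
    T_(n+1), so that [C2_log] reduces to limits at both ends. *)
Let T l n u : R := (l * expR u) ^+ n * J n (l * expR u).

Let dexprn n x : is_derive x 1 (fun y : R => y ^+ n.+1) (n.+1%:R * x ^+ n).
Proof.
elim: n => [|n im]; first by under eq_fun do rewrite expr1; apply: is_derive_eq (is_derive_var x) _; rewrite expr0 mulr1.
under eq_fun do rewrite exprS.
by deriv; rewrite !exprS -[in RHS]addn1 natrD; ring.
Qed.

Let dT l n u : 0 < l -> is_derive u 1 (T l n) (n%:R * T l n u - T l n.+1 u).
Proof.
move=> l0; have lu0 : 0 < l * expR u by rewrite mulr_gt0// expR_gt0.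
have dl : is_derive u 1 (fun u => l * expR u) (l * expR u) by deriv; ring.
have dJ := is_derive_chain dl (is_derive_laplace mu_mom n lu0).
rewrite /T; case: n dJ => [|n] dJ.
  by under eq_fun do rewrite expr0; deriv; rewrite expr0 expr1; ring.
have dX := is_derive_chain dl (dexprn n (l * expR u)).
by deriv; rewrite !exprS; ring.
Qed.

Let T_pinfty l n : 0 < l -> T l n u @[u --> +oo] --> (0 : R).
Proof.
move=> l0; apply/cvgrPdist_le => e e0; have [M M0 hM] := laplace_small n e0.
near=> u; rewrite sub0r normrN ger0_norm.
  apply: hM; rewrite -ler_pdivrMl// -[leLHS](lnK (x := l^-1 * M)) ?posrE ?mulr_gt0 ?invr_gt0//.
  by rewrite ler_expR; near: u; apply: nbhs_pinfty_ge; exact: num_real.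
by rewrite mulr_ge0 ?laplace_ge0// exprn_ge0// mulr_ge0 ?expR_ge0// ltW.
Unshelve. all: by end_near.
Qed.

Let T_ninfty l n : 0 < l -> T l n u @[u --> -oo] --> ((n == 0%N)%:R : R).
Proof.
move=> l0; apply/cvgrPdist_le => e e0.
have [d d0 hd] : exists2 d, 0 < d & forall t, 0 <= t -> t < d -> `|t ^+ n * J n t - (n == 0%N)%:R| <= e.
  case: n => [|n].
    have [d d0 h] := laplace_continuous mu_mom 0 (lexx 0) e0.
    exists d => // t t0 td; rewrite expr0 mul1r -(laplace0 mu); apply: h => //.
    by rewrite subr0 ger0_norm.
  pose K := J n.+1 0 + 1; have K0 : 0 < K by rewrite ltr_wpDl// laplace_ge0.
  exists (Num.min 1 (e / K)); first by rewrite lt_min ltr01 divr_gt0.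
  move=> t t0; rewrite lt_min => /andP[t1 t2]; rewrite subr0 ger0_norm ?mulr_ge0 ?exprn_ge0 ?laplace_ge0//.
  apply: (@le_trans _ _ (e / K * K)); last by rewrite divfK// gt_eqF.
  apply: ler_pM; rewrite ?exprn_ge0 ?laplace_ge0//.
    by rewrite exprS (le_trans _ (ltW t2))// ler_piMr// exprn_ile1// ltW.
  by rewrite (le_trans (laplace_le mu_mom n.+1 t0))// lerDl.
near=> u; rewrite distrC; apply: hd.
  by rewrite mulr_ge0 ?expR_ge0// ltW.
rewrite -ltr_pdivlMl// -[ltRHS](lnK (x := l^-1 * d)) ?posrE ?mulr_gt0 ?invr_gt0//.
by rewrite ltr_expR; near: u; apply: nbhs_ninfty_lt; exact: num_real.
Unshelve. all: by end_near.
Qed.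

Lemma laplace_C2_log l : 0 < l -> C2_log (fun x => J 0 (l * x)).
Proof.
move=> l0.
have E0 : (fun x => J 0 (l * x)) \o expR = T l 0.
  by apply/funext => u; rewrite /T expr0 mul1r.
have E1 : derive1n 1 (T l 0) = (fun u => - T l 1 u).
  by apply/funext => u; rewrite /derive1n/= derive1E; have [_ ->] := dT 0 u l0; rewrite mul0r sub0r.
have d2 u : is_derive u 1 (fun u => - T l 1 u) (T l 2 u - T l 1 u).
  by have := dT 1 u l0 => ?; deriv; ring.
have E2 : derive1n 2 (T l 0) = (fun u => T l 2 u - T l 1 u).
  rewrite -[derive1n 2 _]/(derive1 (derive1n 1 (T l 0))) E1.
  by apply/funext => u; rewrite derive1E; have [_ ->] := d2 u.
have cT n : continuous (T l n) by move=> u; exact: is_derive_continuous (dT n u l0).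
rewrite /C2_log E0; split.
- move=> [|[|//]] u _; first by have [] := dT 0 u l0.
  by rewrite E1; have [] := d2 u.
- by rewrite E2 => u; apply: cvgB; exact: cT.
- move=> [|[|[|//]]] _; split; apply/cvg_ex.
  + by exists 0; exact: T_pinfty.
  + by exists 1; exact: (@T_ninfty l 0).
  + by exists (- 0); rewrite E1; apply: cvgN; exact: T_pinfty.
  + by exists (- 0); rewrite E1; apply: cvgN; exact: (@T_ninfty l 1).
  + by exists (0 - 0); rewrite E2; apply: cvgB; exact: T_pinfty.
  + by exists (0 - 0); rewrite E2; apply: cvgB; [exact: (@T_ninfty l 2)|exact: (@T_ninfty l 1)].
Qed.

(** With t = l x and H(y) = J_0(t e^(-y)), the Levy part is 1/x times the integral of H(y) - H(0) -
    y H'(0). [kap_transform] turns it into an integral of kap H'', which the moment identity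
    evaluates. The result has the shape of the classical generator on e^(-lx), namely (l + 1) l x
    e^(-lx) - l e^(-lx). *)
Lemma laplace_generator l x : 0 < l -> 0 < x ->
  laguerre_generator c (fun x => J 0 (l * x)) x =
  (l + 1) * (l * x * J 1 (l * x)) - l * J 0 (l * x).
Proof.
move=> l0 x0; pose f x := J 0 (l * x); rewrite -/f.
have dlin y : is_derive y 1 (fun y => l * y) l by deriv; ring.
have df y : 0 < y -> is_derive y 1 f (- (l * J 1 (l * y))).
  move=> y0; have ly : 0 < l * y by rewrite mulr_gt0.
  by apply: is_derive_eq (is_derive_chain (dlin y) (is_derive_laplace mu_mom 0 ly)) _; ring.
have f1 y : 0 < y -> derive1 f y = - (l * J 1 (l * y)).
  by move=> y0; rewrite derive1E; have [_ ->] := df y y0.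
have f2 : derive1n 2 f x = l ^+ 2 * J 2 (l * x).
  have lx : 0 < l * x by rewrite mulr_gt0.
  have d1 : is_derive x 1 (fun y => - (l * J 1 (l * y))) (l ^+ 2 * J 2 (l * x)).
    by have := is_derive_chain (dlin x) (is_derive_laplace mu_mom 1 lx) => ?; deriv; ring.
  rewrite -[derive1n 2 _]/(derive1 (derive1 f)) derive1E.
  suff : is_derive x 1 (derive1 f) (l ^+ 2 * J 2 (l * x)) by case=> _ ->.
  apply: near_eq_is_derive d1 => //.
  near=> y; rewrite f1//; near: y; exact: lt_nbhsr.
rewrite /laguerre_generator f2 f1//; have [t tE] : exists t, t = l * x by exists (l * x).
have t0 : 0 < t by rewrite tE mulr_gt0.
pose H y := J 0 (t * expR (- y)); pose h y := t * expR (- y) * J 1 (t * expR (- y)).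
pose q y := (t * expR (- y)) ^+ 2 * J 2 (t * expR (- y)) - h y.
have ty y : 0 < t * expR (- y) by rewrite mulr_gt0// expR_gt0.
have dt y : is_derive y 1 (fun y => t * expR (- y)) (- (t * expR (- y))) by deriv; ring.
have dJ n y := is_derive_chain (dt y) (is_derive_laplace mu_mom n (ty y)).
have dH y : is_derive y 1 H (h y) by apply: is_derive_eq (dJ 0%N y) _; rewrite /h; ring.
have dh y : is_derive y 1 h (q y).
  by rewrite /h /q /h; have := dJ 1%N y => ?; deriv; ring.
have cq : continuous q.
  move=> y; apply: (@is_derive_continuous _ _ _ (- 2 * ((t * expR (- y)) ^+ 2 * J 2 (t * expR (- y))) + (t * expR (- y)) ^+ 3 * J 3 (t * expR (- y)) - q y)).
  by rewrite /q; under eq_fun do rewrite expr2; have := dJ 2%N y => ?; deriv; rewrite /q /h !exprS; ring.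
have qE y : q y = expR (- y) * \int[mu]_z (Num.max z 0 * (t * (t * `|expR (- y) * z| - 1) * expR (- (t * `|expR (- y) * z|)))).
  have i1 := laplace_integrable mu_mom 1 (ltW (ty y)).
  have i2 := laplace_integrable mu_mom 2 (ltW (ty y)).
  have -> : \int[mu]_z (Num.max z 0 * (t * (t * `|expR (- y) * z| - 1) * expR (- (t * `|expR (- y) * z|)))) =
    \int[mu]_z (t * (t * expR (- y)) * (`|z| ^+ 2 * expR (- (t * expR (- y) * `|z|))) + - t * (`|z| ^+ 1 * expR (- (t * expR (- y) * `|z|)))).
    have mn : measurable_fun setT (fun z : measurableTypeR R => `|expR (- y) * z|).
      by apply: measurableT_comp => //; exact: measurable_funM.
    apply: (positive_ext mu_pos).
    - apply: measurable_funM; first exact: measurable_maxr.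
      apply: measurable_funM; last exact: (measurableT_comp (measurable_expRN t)).
      by apply: measurable_funM => //; apply: measurable_funB => //; exact: measurable_funM.
    - apply: measurable_funD; apply: measurable_funM => //; exact/measurable_EFinP/measurable_int/i2 || exact/measurable_EFinP/measurable_int/i1.
    - move=> z z0; rewrite max_l ?ltW// normrM (gtr0_norm (expR_gt0 _)) gtr0_norm// !(mulrA t).
      by ring.
  rewrite RintegralD//; try exact: integrable_scale.
  by rewrite !RintegralZl// /q /h /laplace; ring.
have qb y : 0 < y -> `|q y| <= (t ^+ 2 * J 2 0 + t * J 1 0) * expR (- (1 * y)).
  move=> y0; rewrite mul1r /q (le_trans (ler_normB _ _))//.
  have e0 := expR_gt0 (- y); have e1 : expR (- y) <= 1 by rewrite -[leRHS]expR0 ler_expR oppr_le0 ltW.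
  have j2 := laplace_le mu_mom 2 (ltW (ty y)); have j1 := laplace_le mu_mom 1 (ltW (ty y)).
  have j20 := laplace_ge0 mu 2 (t * expR (- y)); have j10 := laplace_ge0 mu 1 (t * expR (- y)).
  have n1 : `|(t * expR (- y)) ^+ 2 * J 2 (t * expR (- y))| = (t * expR (- y)) ^+ 2 * J 2 (t * expR (- y)).
    by rewrite ger0_norm// mulr_ge0// sqr_ge0.
  have n2 : `|h y| = t * expR (- y) * J 1 (t * expR (- y)).
    by rewrite /h ger0_norm// mulr_ge0// ltW.
  rewrite n1 n2 mulrDl; apply: lerD.
    have -> : (t * expR (- y)) ^+ 2 * J 2 (t * expR (- y)) = t ^+ 2 * (expR (- y) ^+ 2 * J 2 (t * expR (- y))) by ring.
    have -> : t ^+ 2 * J 2 0 * expR (- y) = t ^+ 2 * (expR (- y) * J 2 0) by ring.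
    apply: ler_wpM2l; first exact: sqr_ge0.
    apply: ler_pM => //.
    by rewrite expr2 ler_piMr// ltW.
  have -> : t * expR (- y) * J 1 (t * expR (- y)) = t * (expR (- y) * J 1 (t * expR (- y))) by ring.
  have -> : t * J 1 0 * expR (- y) = t * (expR (- y) * J 1 0) by ring.
  by apply: ler_wpM2l; [exact: ltW|apply: ler_wpM2l; [exact: ltW|]].
have h0 : h n%:R @[n --> \oo] --> 0.
  have e0 : (expR (- (n%:R : R))) @[n --> \oo] --> (0 : R).
    rewrite (_ : (fun n => _) = (fun n => expR (- 1) ^+ n)).
      by apply: cvg_expr; rewrite ger0_norm ?expR_ge0// -[ltRHS]expR0 ltr_expR oppr_lt0.
    by apply/funext => m; rewrite -expRM_natl mulrN1.
  apply: (@squeeze_cvgn _ (fun=> 0) _ (fun n => t * J 1 0 * expR (- n%:R))).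
  - move=> n; rewrite /h mulr_ge0 ?laplace_ge0 ?(ltW (ty _))//=.
    have -> : t * expR (- n%:R) * J 1 (t * expR (- n%:R)) = t * (expR (- n%:R) * J 1 (t * expR (- n%:R))) by ring.
    have -> : t * J 1 0 * expR (- n%:R) = t * (expR (- n%:R) * J 1 0) by ring.
    apply: ler_wpM2l; [exact: ltW|apply: ler_wpM2l; [exact: expR_ge0|]].
    by apply: (laplace_le mu_mom); exact: ltW.
  - exact: cvg_cst.
  - by rewrite -[X in _ --> X](mulr0 (t * J 1 0)); apply: cvgM => //; exact: cvg_cst.
have [_ KT] := kap_transform adm ltr01 dH dh cq qb h0.
(* Chosen so that H''(y) = e^(-y) E[X g(e^(-y) X)], the inner integral of the moment identity. *)
pose g (z : R) := t * (t * `|z| - 1) * expR (- (t * `|z|)).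
have gb : bounded_borel g.
  split.
    apply: measurable_funM; last by apply: (measurableT_comp (measurable_expRN t)); exact: normr_measurable.
    by apply: measurable_funM => //; apply: measurable_funB => //; apply: measurable_funM => //; exact: normr_measurable.
  exists (2 * t) => z; rewrite /g.
  have z0 : 0 <= t * `|z| by rewrite mulr_ge0// ltW.
  have := @pow_expRN_le R 1 1 _ ltr01 z0; rewrite !expr1 divr1 mul1r (_ : 1`!%:R = 1 :> R)// => z1.
  have e1 : expR (- (t * `|z|)) <= 1 by rewrite -[leRHS]expR0 ler_expR oppr_le0.
  have e0 := expR_gt0 (- (t * `|z|)).
  rewrite -mulrA normrM (gtr0_norm t0) mulrC ler_wpM2r ?(ltW t0)// ler_norml mulrBl mul1r.
  have ve0 : 0 <= t * `|z| * expR (- (t * `|z|)) by rewrite mulr_ge0// ltW.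
  by apply/andP; split; lra.
have := moment_identity adm mu_pos mu_mom gb.
have -> : \int[leb]_(y in D) (kap c y * (expR (- y) * \int[mu]_x0 (Num.max x0 0 * g (expR (- y) * x0)))) =
   \int[leb]_(y in D) (kap c y * q y).
  by apply: eq_Rintegral => y _; rewrite qE.
have i0 := laplace_integrable mu_mom 0 (ltW t0).
have i1 := laplace_integrable mu_mom 1 (ltW t0).
have i2 := laplace_integrable mu_mom 2 (ltW t0).
have gE : \int[mu]_z g z = t ^+ 2 * J 1 t - t * J 0 t.
  have i00 : mu.-integrable setT (EFin \o (fun z : R => expR (- (t * `|z|)))).
    by move: i0; congr (integrable _ _ (EFin \o _)); apply/funext => z; rewrite expr0 mul1r.
  have k1 := integrable_scale measurableT (t ^+ 2) i1.
  have k0 := integrable_scale measurableT (- t) i00.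
  transitivity (\int[mu]_z (t ^+ 2 * (`|z| ^+ 1 * expR (- (t * `|z|))) + - t * expR (- (t * `|z|)))).
    by apply: eq_Rintegral => z _; rewrite /g expr1; ring.
  rewrite (RintegralD measurableT k1 k0).
  have -> : J 0 t = \int[mu]_z expR (- (t * `|z|)) by apply: eq_Rintegral => z _; rewrite expr0 mul1r.
  by rewrite !RintegralZl//; rewrite mulNr.
rewrite gE.
have -> : \int[mu]_x0 (Num.max x0 0 * g x0) = t ^+ 2 * J 2 t - t * J 1 t.
  have e0 := qE 0; rewrite /q /h oppr0 expR0 mulr1 mul1r in e0.
  by rewrite e0; apply: eq_Rintegral => z _; rewrite mul1r.
rewrite KT /H /h oppr0 expR0 mulr1.
have -> : \int[levy c]_(y in D) ((f (expR (- y) * x) - f x + y * x * - (l * J 1 (l * x))) / x) =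
  x^-1 * \int[levy c]_(r in D) (J 0 (t * expR (- r)) - J 0 t - r * (t * J 1 t)).
  have [i _ _] := hinge_transform adm ltr01 dH dh cq qb.
  rewrite /H /h oppr0 expR0 mulr1 in i.
  transitivity (\int[levy c]_(r in D) (x^-1 * (J 0 (t * expR (- r)) - J 0 t - r * (t * J 1 t)))); last first.
    by apply: RintegralZl => //; exact: measurable_itv.
  apply: eq_Rintegral => y _; rewrite /f.
  have -> : l * (expR (- y) * x) = t * expR (- y) by rewrite tE; ring.
  have -> : y * x * - (l * J 1 (l * x)) = - (y * (t * J 1 t)) by rewrite -tE; move: (J 1 t) => j; rewrite tE; ring.
  by rewrite -tE; ring.
set L := \int[levy c]_(r in D) _ => E.
have {}E : L = t ^+ 2 * J 1 t - t * J 0 t - sigma c ^+ 2 * (t ^+ 2 * J 2 t - t * J 1 t) + drift c * (t * J 1 t).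
  by rewrite E; ring.
rewrite E -!tE; have -> : l = t / x by rewrite tE mulfK// gt_eqF.
move: (J 0 t) (J 1 t) (J 2 t) => j0 j1 j2.
by field; rewrite gt_eqF.
Unshelve. all: by end_near.
Qed.

End laplace_functions.

(** * Feller semigroups along differentiable curves *)

Section little_o.
Context {R : realType}.
Implicit Types (f : R -> R) (x d e h : R).

Lemma is_derive_of_littleo f x d : (forall e, 0 < e -> exists2 r, 0 < r &
    forall h, `|h| < r -> `|f (x + h) - f x - h * d| <= e * `|h|) -> is_derive x 1 f d.
Proof.
move=> hq.
have cv : h^-1 *: (f (h *: 1 + x) - f x) @[h --> 0^'] --> d.
  apply/cvgrPdist_le => e e0; have [r r0 hr] := hq e e0.
  near=> h.
  have h0 : h != 0 by near: h; exact: nbhs_dnbhs_neq.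
  have he : `|h| < r by near: h; apply: dnbhs0_lt.
  rewrite -normrN opprB /GRing.scale/= mulr1 [h + x]addrC.
  have -> : h^-1 * (f (x + h) - f x) - d = h^-1 * (f (x + h) - f x - h * d).
    by rewrite [in RHS]mulrBr mulKf.
  by rewrite normrM normfV ler_pdivrMl ?normr_gt0// [leRHS]mulrC; exact: hr.
split; first by apply/cvg_ex; exists d; exact: cv.
exact: cvg_lim cv.
Unshelve. all: by end_near.
Qed.

Lemma littleo_of_is_derive f x d : is_derive x 1 f d -> forall e, 0 < e -> exists2 r, 0 < r &
  forall h, `|h| < r -> `|f (x + h) - f x - h * d| <= e * `|h|.
Proof.
move=> [df <-] e e0.
have /cvgrPdist_le/(_ e e0) := df.
move=> [r /= r0 hr]; exists r => // h hh.
have [->|h0] := eqVneq h 0; first by rewrite addr0 subrr mul0r subrr normr0 mulr0.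
have := hr h; rewrite /ball/= sub0r normrN => /(_ hh h0).
rewrite -normrN opprB /GRing.scale/= mulr1 [h + x]addrC -/(derive f x 1) => k.
have -> : f (x + h) - f x - h * derive f x 1 = h * (h^-1 * (f (x + h) - f x) - derive f x 1).
  by rewrite mulrBr mulVKf.
by rewrite normrM mulrC ler_wpM2r.
Qed.

Lemma is_derive_inv f x d : f x != 0 -> is_derive x 1 f d ->
  is_derive x 1 (fun y => (f y)^-1) (- (d / f x ^+ 2)).
Proof.
move=> f0 [dv dE]; split; first exact: derivableV.
by rewrite deriveV// dE /GRing.scale/= mulNr mulrC.
Qed.

End little_o.

Section feller_semigroups.
Context {R : realType} (P : R -> (R -> R) -> R -> R).
Hypothesis fellerP : feller_semigroup P.
Implicit Types (f g : R -> R) (a t s x h e : R).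

Let C0P t f : 0 <= t -> C0 f -> C0 (P t f).
Proof. by move=> t0; have [/(_ t t0)[h _ _] _ _ _ _] := fellerP; exact: h. Qed.

Lemma feller_lin t a f g x : 0 <= t -> C0 f -> C0 g -> 0 <= x ->
  P t (fun y => a * f y + g y) x = a * P t f x + P t g x.
Proof. by move=> t0 hf hg x0; have [/(_ t t0)[_ h _] _ _ _ _] := fellerP; exact: h. Qed.

Lemma feller_0 t x : 0 <= t -> 0 <= x -> P t (fun=> 0) x = 0.
Proof.
move=> t0 x0; have := feller_lin 1 t0 C0_0 C0_0 x0.
have -> : (fun y : R => 1 * 0 + 0) = (fun=> 0 : R) by apply/funext => y; rewrite mulr0 addr0.
by rewrite mul1r => /eqP; rewrite -subr_eq subrr eq_sym => /eqP.
Qed.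

Lemma feller_scale t a f x : 0 <= t -> C0 f -> 0 <= x ->
  P t (fun y => a * f y) x = a * P t f x.
Proof.
move=> t0 hf x0; have := feller_lin a t0 hf C0_0 x0; rewrite feller_0// addr0 => <-.
by congr (P t _ x); apply/funext => y; rewrite addr0.
Qed.

Lemma C0_scale a f : C0 f -> C0 (fun x => a * f x).
Proof. by move=> hf; have := C0_lin a hf C0_0; congr C0; apply/funext => y; rewrite addr0. Qed.

(** f/M is the difference of its positive and negative parts; both take values in [0, 1], and P_t
    keeps them there. *)
Let bound_pos t f M : 0 <= t -> C0 f -> 0 < M -> (forall x, 0 <= x -> `|f x| <= M) ->
  forall x, 0 <= x -> `|P t f x| <= M.
Proof.
move=> t0 hf M0 fM x x0.
have [_ pos _ _ _] := fellerP.
pose fp y := Num.max (M^-1 * f y) 0; pose fn y := Num.max (- M^-1 * f y) 0.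
have hp : C0 fp by apply: C0_max0; exact: C0_scale.
have hn : C0 fn by apply: C0_max0; exact: C0_scale.
have b a y : `|a| <= M^-1 -> 0 <= y -> 0 <= Num.max (a * f y) 0 <= 1.
  move=> aM y0; rewrite le_max lexx orbT /= ge_max ler01 andbT.
  have Mn : M != 0 by rewrite gt_eqF.
  rewrite (le_trans (ler_norm _))// normrM -(mulVf Mn).
  by apply: ler_pM => //; exact: fM.
have Mi : 0 < M^-1 by rewrite invr_gt0.
have aM : `|M^-1| <= M^-1 by rewrite gtr0_norm.
have aN : `|- M^-1| <= M^-1 by rewrite normrN.
have /andP[p1 p2] := pos t fp t0 hp (fun y => @b M^-1 y aM) x x0.
have /andP[n1 n2] := pos t fn t0 hn (fun y => @b (- M^-1) y aN) x x0.
have fE : f = (fun y => M * fp y + (- M * fn y)).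
  apply/funext => y; rewrite /fp /fn mulNr -mulrBr (mulNr M^-1).
  have mx (z : R) : Num.max z 0 - Num.max (- z) 0 = z.
    by rewrite /Num.max; case: ifPn; case: ifPn; rewrite -?leNgt; lra.
  by rewrite mx mulVKf// gt_eqF.
rewrite fE feller_lin//; last exact: C0_scale.
rewrite feller_scale// ler_norml; apply/andP; split; nra.
Qed.

Lemma feller_bound t f M : 0 <= t -> C0 f -> (forall x, 0 <= x -> `|f x| <= M) ->
  forall x, 0 <= x -> `|P t f x| <= M.
Proof.
move=> t0 hf fM x x0; apply/ler_addgt0Pr => e e0.
have M0 : 0 <= M by rewrite (le_trans _ (fM 0 (lexx 0))).
apply: (bound_pos t0 hf) => //; first lra.
by move=> y /fM h; lra.
Qed.

Lemma feller_dist t f g M : 0 <= t -> C0 f -> C0 g -> (forall x, 0 <= x -> `|f x - g x| <= M) ->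
  forall x, 0 <= x -> `|P t f x - P t g x| <= M.
Proof.
move=> t0 hf hg fM x x0.
have -> : P t f x - P t g x = P t (fun y => - 1 * g y + f y) x by rewrite feller_lin// mulN1r addrC.
apply: feller_bound => //; first exact: C0_lin.
by move=> y y0; rewrite mulN1r addrC; exact: fM.
Qed.

(** The contraction bound only looks at [0, +oo[, so the values of f on the negative half-line do
    not affect P_t f there. *)
Lemma feller_ext t f g : 0 <= t -> C0 f -> C0 g -> (forall x, 0 <= x -> f x = g x) ->
  forall x, 0 <= x -> P t f x = P t g x.
Proof.
move=> t0 hf hg fg x x0; apply/eqP; rewrite -subr_eq0 -normr_le0.
by apply: (feller_dist t0 hf hg) => // y y0; rewrite fg// subrr normr0.
Qed.

(** g is the right derivative at 0 of h -> P_h f, uniformly on [0, +oo[. *)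
Definition sup_derivative f g := forall e, 0 < e -> exists2 d, 0 < d &
  forall h, 0 < h -> h < d -> forall x, 0 <= x -> `|P h f x - f x - h * g x| <= e * h.

Lemma generator_maps_derivative f g : generator_maps P f g -> sup_derivative f g.
Proof.
move=> [hf hg lim] e e0; have /cvgrPdist_le/(_ e e0) := lim.
move=> [d /= d0 hd]; exists d => // h h0 hh x x0.
have := hd h; rewrite /ball/= sub0r normrN (gtr0_norm h0) => /(_ hh h0).
rewrite sub0r normrN => /(le_trans (ler_norm _)) k.
have hk : C0 (fun x => h^-1 * (P h f x - f x) - g x).
  have := C0_lin h^-1 (C0_lin (- 1) hf (C0P (ltW h0) hf)) (C0_scale (- 1) hg).
  by congr C0; apply/funext => y; ring.
have -> : P h f x - f x - h * g x = h * (h^-1 * (P h f x - f x) - g x).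
  by rewrite mulrBr mulVKf// gt_eqF.
rewrite normrM (gtr0_norm h0) mulrC ler_wpM2r ?(ltW h0)//.
exact: (le_trans (C0norm_ge hk x0) k).
Qed.

Lemma sup_derivative_scale a f g : C0 f -> sup_derivative f g ->
  sup_derivative (fun x => a * f x) (fun x => a * g x).
Proof.
move=> hf hd e e0; have a0 : 0 < `|a| + 1 by rewrite ltr_wpDl.
have [d d0 h1] := hd (e / (`|a| + 1)) (divr_gt0 e0 a0).
exists d => // h h0 hh x x0; rewrite feller_scale ?(ltW h0)//.
have -> : a * P h f x - a * f x - h * (a * g x) = a * (P h f x - f x - h * g x) by ring.
rewrite normrM; apply: (@le_trans _ _ ((`|a| + 1) * (e / (`|a| + 1) * h))).
  by apply: ler_pM => //; [rewrite lerDl|exact: h1].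
by rewrite mulrA [_ * (e / _)]mulrC divfK// gt_eqF.
Qed.

Lemma feller_continuous f e : C0 f -> 0 < e -> exists2 d, 0 < d &
  forall h, 0 < h -> h < d -> forall x, 0 <= x -> `|P h f x - f x| <= e.
Proof.
move=> hf e0; have [_ _ _ _ sc] := fellerP.
have /cvgrPdist_le/(_ e e0) := sc f hf.
move=> [d /= d0 hd]; exists d => // h h0 hh x x0.
have := hd h; rewrite /ball/= sub0r normrN (gtr0_norm h0) => /(_ hh h0).
rewrite sub0r normrN => /(le_trans (ler_norm _)) k.
have hk : C0 (P h f - f)%R.
  by have := C0_lin (- 1) hf (C0P (ltW h0) hf); congr C0; apply/funext => y; rewrite mulN1r addrC.
exact: (le_trans (C0norm_ge hk x0) k).
Qed.

(* [s |-> P_(t-s) (u s) (x)] has derivative zero. *)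
Lemma feller_evolution t (u g : R -> R -> R) : 0 <= t ->
  (forall s, 0 <= s -> C0 (u s)) -> (forall s, 0 <= s -> C0 (g s)) ->
  (forall s, 0 <= s -> sup_derivative (u s) (g s)) ->
  (forall s, 0 <= s -> forall e, 0 < e -> exists2 d, 0 < d &
    forall h, `|h| < d -> 0 <= s + h -> forall x, 0 <= x ->
      `|u (s + h) x - u s x - h * g s x| <= e * `|h|) ->
  forall x, 0 <= x -> P t (u 0) x = u t x.
Proof.
move=> t0 hu hg hd hr x x0; have [_ _ P0 Ps _] := fellerP.
pose F s := P (t - s) (u s) x.
have right s e : 0 <= s -> 0 < e -> exists2 d, 0 < d & forall h, 0 < h -> h < d -> s + h <= t ->
    `|F (s + h) - F s| <= e * h.
  move=> s0 e0; have e2 : 0 < e / 2 by lra.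
  have [d1 d10 h1] := hd s s0 _ e2; have [d2 d20 h2] := hr s s0 _ e2.
  exists (Num.min d1 d2); first by rewrite lt_min d10.
  move=> h h0; rewrite lt_min => /andP[hd1 hd2] sht.
  have sh0 : 0 <= s + h by lra.
  have r0 : 0 <= t - (s + h) by rewrite subr_ge0.
  have -> : F s = P (t - (s + h)) (P h (u s)) x.
    rewrite /F -Ps ?(ltW h0)//; last exact: hu.
    by congr (P _ _ x); lra.
  apply: feller_dist => //; [exact: hu|by apply: C0P; [exact: ltW|exact: hu]|].
  move=> y y0; have k1 := h1 h h0 hd1 y y0; have := h2 h; rewrite (gtr0_norm h0) => /(_ hd2 sh0 y y0) k2.
  have -> : u (s + h) y - P h (u s) y = (u (s + h) y - u s y - h * g s y) - (P h (u s) y - u s y - h * g s y) by ring.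
  by rewrite (le_trans (ler_normB _ _))//; lra.
(* Here P_h acts on u(s - h), so P_h g(s) has to be compared with g(s): strong continuity supplies
   the third error term. *)
have left s e : 0 <= s -> s <= t -> 0 < e -> exists2 d, 0 < d & forall h, 0 < h -> h < d -> 0 <= s - h ->
    `|F (s - h) - F s| <= e * h.
  move=> s0 st e0; have e3 : 0 < e / 3 by lra.
  have [d1 d10 h1] := hd s s0 _ e3; have [d2 d20 h2] := hr s s0 _ e3.
  have [d3 d30 h3] := feller_continuous (hg s s0) e3.
  exists (Num.min d1 (Num.min d2 d3)); first by rewrite !lt_min d10 d20.
  move=> h h0; rewrite !lt_min => /and3P[hd1 hd2 hd3] sh0.
  have h0' := ltW h0.
  have r0 : 0 <= t - s by rewrite subr_ge0.
  have -> : F (s - h) = P (t - s) (P h (u (s - h))) x.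
    rewrite /F -Ps//; last exact: hu.
    by congr (P _ _ x); lra.
  apply: feller_dist => //; [by apply: C0P => //; exact: hu|exact: hu|].
  move=> y y0; have k1 := h1 h h0 hd1 y y0.
  have k2 z : 0 <= z -> `|u (s - h) z - u s z + h * g s z| <= e / 3 * h.
    move=> z0; have := h2 (- h); rewrite normrN (gtr0_norm h0) => /(_ hd2 sh0 z z0).
    by rewrite mulNr opprK.
  have k3 := h3 h h0 hd3 y y0.
  have Cr : C0 (fun z => h * g s z + (- 1 * u s z + u (s - h) z)).
    by apply: C0_lin; [exact: hg|apply: C0_lin; exact: hu].
  have k4 : `|P h (fun z => h * g s z + (- 1 * u s z + u (s - h) z)) y| <= e / 3 * h.
    apply: feller_bound => // z z0; have := k2 z z0.
    by congr (`|_| <= _); ring.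
  have hus : C0 (u s) by exact: hu.
  have hush : C0 (u (s - h)) by exact: hu.
  have hgs : C0 (g s) by exact: hg.
  rewrite feller_lin ?feller_lin// in k4; last exact: C0_lin.
  have -> : P h (u (s - h)) y - u s y = (h * P h (g s) y + (- 1 * P h (u s) y + P h (u (s - h)) y)) +
     ((P h (u s) y - u s y - h * g s y) - h * (P h (g s) y - g s y)) by ring.
  rewrite (le_trans (ler_normD _ _))//.
  have k5 : `|h * (P h (g s) y - g s y)| <= h * (e / 3) by rewrite normrM (gtr0_norm h0) ler_wpM2l.
  have := ler_normB (P h (u s) y - u s y - h * g s y) (h * (P h (g s) y - g s y)).
  lra.
(* Clamping s to [0, t] extends the curve to the line. Since [cl] is 1-Lipschitz, the one-sided
   estimates give derivative 0 everywhere, end points included. *)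
pose cl s := Num.max 0 (Num.min s t).
have cl0 s : 0 <= cl s by rewrite /cl le_max lexx.
have clt s : cl s <= t by rewrite /cl ge_max t0 ge_min lexx orbT.
have cl_lip s h : `|cl (s + h) - cl s| <= `|h|.
  rewrite /cl; have [h0|h0] := leP 0 h; [rewrite ger0_norm ?(ger0_norm h0)|rewrite ler0_norm ?(ltr0_norm h0)];
  rewrite ?subr_ge0 ?subr_le0;
  have [a|a] := leP (s + h) t; have [b|b] := leP s t; rewrite ?(max_r t0);
  try (have [k|k] := leP 0 (s + h)); try (have [k'|k'] := leP 0 s); lra.
have dF s : is_derive s 1 (fun s => F (cl s)) 0.
  apply: is_derive_of_littleo => e e0.
  have [d1 d10 h1] := right (cl s) e (cl0 s) e0.
  have [d2 d20 h2] := left (cl s) e (cl0 s) (clt s) e0.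
  exists (Num.min d1 d2); first by rewrite lt_min d10.
  move=> h; rewrite lt_min => /andP[hd1 hd2]; rewrite mulr0 subr0.
  have lip := cl_lip s h; set k := cl (s + h) - cl s in lip.
  have clE : cl (s + h) = cl s + k by rewrite /k addrCA subrr addr0.
  apply: (@le_trans _ _ (e * `|k|)); last by rewrite ler_wpM2l// ltW.
  rewrite clE; have [k0|k0|k0] := ltrgt0P k.
  - by apply: h1 => //; [rewrite (gtr0_norm k0) in lip; lra|rewrite -clE].
  - have {}k0 : 0 < - k by rewrite oppr_gt0.
    have := h2 (- k) k0; rewrite opprK; apply; last by rewrite -clE.
    by rewrite ltr0_norm in lip; lra.
  - by rewrite k0 addr0 subrr normr0 mulr0.
have := is_derive_0_is_cst 0 t dF.
rewrite /F /cl (min_l t0) minxx maxxx (max_r t0) subr0 subrr => ->.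
by rewrite P0//; exact: hu.
Qed.

End feller_semigroups.

(** * The evolution of the Laplace parameter *)

Section laplace_evolution.
Context {R : realType} (c : triplet R) (adm : admissible c).
Context (mu : probability (measurableTypeR R) R).
Local Notation D := (`]0%R, +oo[%classic : set (measurableTypeR R)).
Hypothesis mu_pos : mu D = 1%E.
Hypothesis mu_mom : forall n,
  (\int[mu]_x (`|x| ^+ n)%:E = (n`!%:R / \prod_(1 <= i < n.+1) phiR c i%:R)%:E)%E.
Context (P : R -> (R -> R) -> R -> R) (hP : generalized_laguerre c P).
Implicit Types (k l s t x h e : R).
Local Notation J := (laplace mu).

Lemma laplace_param l k x : 0 < l -> l / 2 <= k -> 0 <= x ->
  `|J 0 (k * x) - J 0 (l * x) + (k - l) * (x * J 1 (l * x))| <= 8 / l ^+ 2 * (k - l) ^+ 2.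
Proof.
move=> l0 lk x0; have k0 : 0 <= k by lra.
have i1 := laplace_integrable mu_mom 0 (mulr_ge0 k0 x0).
have i2 := laplace_integrable mu_mom 0 (mulr_ge0 (ltW l0) x0).
have i3 := laplace_integrable mu_mom 1 (mulr_ge0 (ltW l0) x0).
have j2 := integrable_scale measurableT (- 1) i2.
have j3 := integrable_scale measurableT ((k - l) * x) i3.
have i12 := integrable_add measurableT i1 j2.
have i := integrable_add measurableT i12 j3.
have -> : J 0 (k * x) - J 0 (l * x) + (k - l) * (x * J 1 (l * x)) = \int[mu]_y
   ((`|y| ^+ 0 * expR (- (k * x * `|y|)) + - 1 * (`|y| ^+ 0 * expR (- (l * x * `|y|)))) +
    (k - l) * x * (`|y| ^+ 1 * expR (- (l * x * `|y|)))).
  rewrite (RintegralD measurableT i12 j3) (RintegralD measurableT i1 j2).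
  have -> : \int[mu]_y (- 1 * (`|y| ^+ 0 * expR (- (l * x * `|y|)))) = - 1 * J 0 (l * x) by exact: RintegralZl.
  have -> : \int[mu]_y ((k - l) * x * (`|y| ^+ 1 * expR (- (l * x * `|y|)))) = (k - l) * x * J 1 (l * x) by exact: RintegralZl.
  by rewrite mulN1r mulrA.
apply: (le_trans (le_normr_Rintegral _ i)) => //.
have -> : 8 / l ^+ 2 * (k - l) ^+ 2 = \int[mu]_(y in setT) (8 / l ^+ 2 * (k - l) ^+ 2).
  by rewrite Rintegral_cst// [X in fine X](_ : _ = 1%E) ?mulr1//; exact: probability_setT.
apply: le_Rintegral => //; first exact: integrable_norm i.
  exact: finite_measure_integrable_cst.
move=> y _; have := expRN_param l0 lk (mulr_ge0 x0 (normr_ge0 y)).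
by congr (`|_| <= _); rewrite expr0 expr1 !mulrA; ring.
Qed.

Lemma laplace_first_le l x : 0 < l -> 0 <= x -> x * J 1 (l * x) <= l^-1.
Proof.
move=> l0 x0; have i := laplace_integrable mu_mom 1 (mulr_ge0 (ltW l0) x0).
have -> : x * J 1 (l * x) = \int[mu]_y (x * (`|y| ^+ 1 * expR (- (l * x * `|y|)))) by apply/esym; exact: RintegralZl.
have -> : l^-1 = \int[mu]_(y in setT) l^-1.
  by rewrite Rintegral_cst// [X in fine X](_ : _ = 1%E) ?mulr1//; exact: probability_setT.
apply: le_Rintegral => //; [exact: integrable_scale|exact: finite_measure_integrable_cst|].
move=> y _; have := pow_expRN_le 1 l0 (mulr_ge0 x0 (normr_ge0 y)).
by rewrite !expr1 (_ : 1`!%:R = 1 :> R)// div1r !mulrA.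
Qed.

(** With a the inverse of this and L the rate below, a' = -L a, L' = -(L + L^2), a(0) = 1 and L(0) =
    l. These equations make a(t) J_0(L(t) x) follow the generator, which maps J_0(l x) to (l + 1) l
    x J_1(l x) - l J_0(l x). *)
Definition evolution_den l t : R := 1 + l * (1 - expR (- t)).
Definition evolution_rate l t : R := l * expR (- t) / evolution_den l t.

Lemma evolution_den_gt0 l t : 0 < l -> 0 <= t -> 0 < evolution_den l t.
Proof.
move=> l0 t0; rewrite /evolution_den ltr_wpDr// mulr_ge0 ?(ltW l0)// subr_ge0.
by rewrite -[leRHS]expR0 ler_expR oppr_le0.
Qed.

Lemma evolution_rate_gt0 l t : 0 < l -> 0 <= t -> 0 < evolution_rate l t.
Proof. by move=> l0 t0; rewrite divr_gt0 ?evolution_den_gt0// mulr_gt0// expR_gt0. Qed.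

(** The curve a(s) J_0(L(s) x) starts at J_0(l x) and moves by the generator, so [feller_evolution]
    integrates it. The work lies in differentiating in s uniformly in x >= 0. *)
Theorem laplace_evolution l t x : 0 < l -> 0 <= t -> 0 <= x ->
  P t (fun y => J 0 (l * y)) x = J 0 (evolution_rate l t * x) / evolution_den l t.
Proof.
move=> l0 t0 x0; have [fP gP] := hP.
pose a s := (evolution_den l s)^-1; pose L s := evolution_rate l s.
pose gen k y := (k + 1) * (k * y * J 1 (k * y)) - k * J 0 (k * y).
pose u s y := a s * J 0 (L s * y); pose g s y := a s * gen (L s) y.
have L0 s : 0 <= s -> 0 < L s by exact: evolution_rate_gt0.
have a0 s : 0 <= s -> 0 < a s by move=> s0; rewrite invr_gt0; exact: evolution_den_gt0.
have CJ k : 0 < k -> C0 (fun y => J 0 (k * y)).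
  by move=> k0; have := laplace_C0 adm mu_pos mu_mom 0 k0; congr C0; apply/funext => y; rewrite expr0 mul1r.
have Cg k : 0 < k -> C0 (gen k).
  move=> k0; have := C0_lin (k + 1) (laplace_C0 adm mu_pos mu_mom 1 k0) (C0_scale (- k) (CJ k k0)).
  by congr C0; apply/funext => y; rewrite /gen expr1 mulNr.
suff -> : (fun y => J 0 (l * y)) = u 0.
  rewrite (feller_evolution (u := u) (g := g) fP t0) ?/u//; first by rewrite mulrC.
  - by move=> s s0; apply: C0_scale; apply: CJ; exact: L0.
  - by move=> s s0; apply: C0_scale; apply: Cg; exact: L0.
  - move=> s s0; apply: sup_derivative_scale => //; first by apply: CJ; exact: L0.
    apply: generator_maps_derivative => //; apply: gP; [exact/CJ/L0| |exact/Cg/L0|].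
      by apply: (laplace_C2_log adm mu_pos mu_mom); exact: L0.
    by move=> y y0; rewrite (laplace_generator adm mu_pos mu_mom)//; exact: L0.
  - move=> s s0 e e0.
    have dn : evolution_den l s != 0 by rewrite gt_eqF// evolution_den_gt0.
    have dden : is_derive s 1 (evolution_den l) (l * expR (- s)) by rewrite /evolution_den; deriv; ring.
    have da : is_derive s 1 a (- (L s * a s)).
      by apply: is_derive_eq (is_derive_inv dn dden) _; rewrite /L /evolution_rate /a; field.
    have dL : is_derive s 1 L (- (L s + L s ^+ 2)).
      rewrite (_ : L = (fun s => l * expR (- s) * a s)); last by apply/funext.
      by deriv; rewrite /L /evolution_rate /a; field.
    pose K := 8 / L s ^+ 2.
    have d1 : is_derive s 1 (fun r => K * (a r * (L r - L s) ^+ 2)) 0.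
      by under eq_fun do rewrite expr2; deriv; ring.
    have d3 : is_derive s 1 (fun r => a r * (L r - L s)) (a s * - (L s + L s ^+ 2)) by deriv; ring.
    have e3 : 0 < e / 3 by lra.
    have e3' : 0 < L s * (e / 3) by rewrite mulr_gt0// L0.
    have [r1 r10 h1] := littleo_of_is_derive d1 e3.
    have [r2 r20 h2] := littleo_of_is_derive da e3.
    have [r3 r30 h3] := littleo_of_is_derive d3 e3'.
    have cL : {for s, continuous L} by exact: is_derive_continuous dL.
    have l2 : 0 < L s / 2 by rewrite divr_gt0// L0.
    have /cvgrPdist_lt/(_ _ l2) [r4 /= r40 h4] := cL.
    exists (Num.min (Num.min r1 r2) (Num.min r3 r4)); first by rewrite !lt_min r10 r20 r30.
    move=> h; rewrite !lt_min => /andP[/andP[hr1 hr2] /andP[hr3 hr4]] sh0 y y0.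
    have k1 := h1 h hr1; have k2 := h2 h hr2; have k3 := h3 h hr3.
    have k4 := h4 (s + h); rewrite /ball/= opprD addNKr normrN in k4; have {}k4 := k4 hr4.
    have Lh : L s / 2 <= L (s + h) by move: k4; rewrite ltr_norml; lra.
    have := laplace_param (L0 s s0) Lh y0; have Ly := laplace_first_le (L0 s s0) y0.
    have J0le : J 0 (L s * y) <= 1.
      by rewrite -(laplace0 mu) (laplace_le mu_mom)// mulr_ge0// ltW// L0.
    have J00 := laplace_ge0 mu 0 (L s * y); have J10 := laplace_ge0 mu 1 (L s * y).
    have yJ0 : 0 <= y * J 1 (L s * y) by rewrite mulr_ge0.
    move: Ly yJ0; rewrite -/K /g /gen /u.
    have -> : L s * y * J 1 (L s * y) = L s * (y * J 1 (L s * y)) by ring.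
    move: (y * J 1 (L s * y)) (J 0 (L s * y)) J00 J0le (J 0 (L (s + h) * y)) => A1 A0 A00 A01 B A1l A10 kB.
    have as0 := a0 (s + h) sh0; have Ls0 := L0 s s0.
    (* Three errors: the second-order remainder in the rate, the increment of a against J_0 <= 1,
       and the increment of a (L - L(s)) against x J_1(L(s) x) <= 1/L(s). *)
    have -> : a (s + h) * B - a s * A0 - h * (a s * ((L s + 1) * (L s * A1) - L s * A0)) =
      a (s + h) * (B - A0 + (L (s + h) - L s) * A1) + (a (s + h) - a s - h * - (L s * a s)) * A0
      - (a (s + h) * (L (s + h) - L s) - a s * (L s - L s) - h * (a s * - (L s + L s ^+ 2))) * A1 by ring.
    have t1 : `|a (s + h) * (B - A0 + (L (s + h) - L s) * A1)| <= e / 3 * `|h|.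
      rewrite normrM (gtr0_norm as0); apply: (le_trans (ler_wpM2l (ltW as0) kB)).
      move: k1; rewrite subrr expr0n !mulr0 !subr0 => /(le_trans (ler_norm _)).
      by congr (_ <= _); ring.
    have t2 : `|(a (s + h) - a s - h * - (L s * a s)) * A0| <= e / 3 * `|h|.
      by rewrite normrM (ger0_norm A00) (le_trans _ k2)// ler_piMr.
    have t3 : `|(a (s + h) * (L (s + h) - L s) - a s * (L s - L s) - h * (a s * - (L s + L s ^+ 2))) * A1| <= e / 3 * `|h|.
      rewrite normrM (ger0_norm A10); apply: (@le_trans _ _ (L s * (e / 3) * `|h| * (L s)^-1)).
        by apply: ler_pM.
      by rewrite le_eqVlt; apply/orP; left; apply/eqP; field; rewrite gt_eqF.
    rewrite (le_trans (ler_normB _ _))// (le_trans (lerD (ler_normD _ _) (lexx _)))//.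
    lra.
apply/funext => y; rewrite /u /a /L /evolution_rate /evolution_den oppr0 expR0 subrr mulr0 addr0 mulr1 invr1 mul1r ?divr1 ?mulr1//.
Qed.

End laplace_evolution.

(** * Intertwining *)

Section mixtures.
Context {R : realType} (mu : probability (measurableTypeR R) R).
Implicit Types (f g : R -> R) (x y : R).

Definition mixture f x : R := \int[mu]_y f (x * y).

Let mmul : measurable_fun setT (fun z : measurableTypeR R * measurableTypeR R => z.1 * z.2).
Proof. exact: measurable_funM. Qed.

Lemma measurable_mul_slice f x : measurable_fun setT (f : measurableTypeR R -> R) ->
  measurable_fun setT (fun y : measurableTypeR R => f (x * y)).
Proof. by move=> mf; apply: (measurableT_comp mf); exact: measurable_funM. Qed.

Lemma measurable_mixture f : measurable_fun setT (f : measurableTypeR R -> R) ->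
  measurable_fun setT (mixture f : measurableTypeR R -> R).
Proof.
move=> mf; apply: measurableT_comp => //.
have mF : measurable_fun setT (fun z : measurableTypeR R * measurableTypeR R => (f (z.1 * z.2))%:E).
  by apply/measurable_EFinP; exact: (measurableT_comp mf mmul).
rewrite (_ : (fun x => _) = (fun x => \int[mu]_y ((fun z : measurableTypeR R * measurableTypeR R => (f (z.1 * z.2))%:E)^\+ (x, y)) -
   \int[mu]_y ((fun z : measurableTypeR R * measurableTypeR R => (f (z.1 * z.2))%:E)^\- (x, y)))%E).
  apply: emeasurable_funB.
    exact: (measurable_fun_fubini_tonelli_F _ (measurable_funepos mF) (fun z => funepos_ge0 _ z)).
  exact: (measurable_fun_fubini_tonelli_F _ (measurable_funeneg mF) (fun z => funeneg_ge0 _ z)).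
apply/funext => x; rewrite integralE; congr (_ - _)%E; apply: eq_integral => y _.
  by rewrite !funeposE.
by rewrite !funenegE.
Qed.

Lemma bounded_integrable f M : measurable_fun setT (f : measurableTypeR R -> R) ->
  (forall x, `|f x| <= M) -> mu.-integrable setT (EFin \o f).
Proof.
move=> mf fM; apply: (integrable_dominated measurableT mf (finite_measure_integrable_cst mu M measurableT)).
by move=> x _; exact: fM.
Qed.

Lemma Rintegral_prob_cst (k : R) : \int[mu]_(y in setT) k = k.
Proof. by rewrite Rintegral_cst// [X in fine X](_ : _ = 1%E) ?mulr1//; exact: probability_setT. Qed.

Lemma Rintegral_le_bound f M : measurable_fun setT (f : measurableTypeR R -> R) ->
  (forall x, `|f x| <= M) -> `|\int[mu]_x f x| <= M.
Proof.
move=> mf fM; have i := bounded_integrable mf fM.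
apply: (le_trans (le_normr_Rintegral _ i)) => //.
rewrite -[leRHS]Rintegral_prob_cst; apply: le_Rintegral => //; first exact: integrable_norm i.
exact: finite_measure_integrable_cst.
Qed.

(** [C0] says nothing about negative arguments; the even extension is a representative that is
    continuous, hence Borel, on the whole line. *)
Lemma C0_even_continuous f : C0 f -> continuous (fun x : R => f `|x|).
Proof.
move=> [/subspace_continuousP cf _] x.
have x0 : (`[0, +oo[%classic : set R) `|x| by rewrite /= in_itv/= andbT.
apply/cvgrPdist_lt => e e0.
have /cvgrPdist_lt/(_ e e0) := cf _ x0; rewrite near_withinE => h.
have cn : {for x, continuous (fun y : R => `|y|)} by exact: norm_continuous.
have h2 : \forall y \near x, (`[0, +oo[%classic : set R) `|y| -> `|f `|x| - f `|y| | < e by exact: (cn _ h).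
by apply: filterS h2 => y; apply; rewrite /= in_itv/= andbT.
Qed.

Lemma measurable_C0_even f : C0 f -> measurable_fun setT (fun x : measurableTypeR R => f `|x|).
Proof. by move=> /C0_even_continuous; exact: continuous_measurable_fun. Qed.

Lemma C0_even_bound f M : (forall x, 0 <= x -> `|f x| <= M) -> forall x, `|f `|x| | <= M.
Proof. by move=> h x; exact: h. Qed.

Lemma C0_ext f g : C0 f -> (forall x, 0 <= x -> f x = g x) -> C0 g.
Proof.
move=> [cf lf] fg; split.
  by apply: subspace_eq_continuous cf => x; rewrite inE/= in_itv/= andbT => /fg.
apply: cvg_trans lf; apply: near_eq_cvg; near=> x; apply: fg.
by near: x; apply: nbhs_pinfty_ge; exact: num_real.
Unshelve. all: by end_near.
Qed.

End mixtures.

(** * Mixtures of functions vanishing at infinity *)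

Section mixture_C0.
Context {R : realType} (mu : probability (measurableTypeR R) R).
Local Notation D := (`]0%R, +oo[%classic : set (measurableTypeR R)).
Hypothesis mu_pos : mu D = 1%E.
Hypothesis mu_inv_sqrt : mu.-integrable setT (EFin \o inv_sqrt).
Implicit Types (f : R -> R) (x y : R).

(** Continuity is dominated convergence. At infinity, f(xX) can only be large where xX < K, and
    there (K/(xX))^(1/2) >= 1; so |f(xX)| <= e/2 + M (K/(xX))^(1/2), and E X^(-1/2) is finite. *)
Lemma mixture_C0 f : C0 f -> C0 (mixture mu (fun x => f `|x|)).
Proof.
move=> hf; have cf := C0_even_continuous hf; have mf := measurable_C0_even hf.
have [M fM] := C0_bounded hf; have fM' := C0_even_bound fM.
have M0 : 0 <= M by rewrite (le_trans _ (fM 0 (lexx 0))).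
apply: C0_intro.
  move=> x x0 e e0.
  have cm : {for x, continuous (mixture mu (fun x => f `|x|))}.
    have := @continuity_under_integral R _ _ mu (fun x y => f `|x * y|) setT measurableT (x - 1) (x + 1) _ _ (fun=> M) _ _.
    have xI : x \in (`]x - 1, x + 1[%classic : set R) by rewrite inE/= in_itv/=; apply/andP; split; lra.
    apply; [| | | |exact: xI].
    - by move=> z _; apply: (bounded_integrable mu (measurable_mul_slice z mf) (M := M)) => y; exact: fM'.
    - apply: aeW => y _ z _.
      have cz : {for z, continuous (fun w : R => w * y)} by apply: cvgM; [exact: cvg_id|exact: cvg_cst].
      exact: (continuous_comp cz (cf (z * y))).
    - exact: finite_measure_integrable_cst.
    - by move=> z _; apply: aeW => y _; exact: fM'.
  have /cvgrPdist_le/(_ e e0) := cm.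
  move=> [d /= d0 h]; exists d => // y y0 yd.
  by rewrite distrC; apply: h; rewrite /ball/= distrC.
move=> e e0; have e2 : 0 < e / 2 by lra.
have [_ lf] := hf; have /cvgrPdist_le/(_ _ e2) [N [_ hN]] := lf.
pose K := `|N| + 1; have K0 : 0 < K by rewrite ltr_wpDl.
have fK z : K <= z -> `|f z| <= e / 2.
  move=> Kz; have := hN z; rewrite sub0r normrN; apply.
  by rewrite (le_lt_trans (ler_norm N))// (lt_le_trans _ Kz)// /K ltrDl.
pose B := \int[mu]_y inv_sqrt y; have B0 : 0 <= B by apply: Rintegral_ge0 => y _; exact: expR_ge0.
have Q0 : 0 < inv_sqrt K * (e / 2) / (M * B + 1).
  by rewrite !divr_gt0 ?mulr_gt0 ?expR_gt0// ltr_wpDl// mulr_ge0.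
have [L L0 hL] := inv_sqrt_small Q0.
exists L => x Lx; have x0 := lt_le_trans L0 Lx.
have key y : 0 < y -> `|f `|x * y| | <= e / 2 + M * (inv_sqrt x * inv_sqrt y / inv_sqrt K).
  move=> y0; have xy0 : 0 < x * y by rewrite mulr_gt0.
  rewrite (gtr0_norm xy0); have [h|h] := leP K (x * y).
    by rewrite (le_trans (fK _ h))// lerDl mulr_ge0// divr_ge0 ?mulr_ge0 ?expR_ge0.
  rewrite (le_trans (fM _ (ltW xy0)))// -[leLHS]add0r lerD ?(ltW e2)// ler_peMr//.
  rewrite /inv_sqrt -expRD -mulrDr -lnM ?posrE// ler_pdivlMr ?expR_gt0// mul1r ler_expR.
  have : ln (x * y) <= ln K by rewrite ler_ln// ltW.
  lra.
have mfx := measurable_mul_slice x mf.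
have ib := bounded_integrable mu mfx (fun y => fM' (x * y)).
pose G y := (M * (inv_sqrt x / inv_sqrt K)) * inv_sqrt y + e / 2.
have iG1 := integrable_scale measurableT (M * (inv_sqrt x / inv_sqrt K)) mu_inv_sqrt.
have iG2 : mu.-integrable setT (EFin \o (fun=> e / 2)) by exact: finite_measure_integrable_cst.
have iG := integrable_add measurableT iG1 iG2.
rewrite /mixture; apply: (le_trans (le_normr_Rintegral _ ib)) => //.
(* The bound [key] holds for y > 0 only; the minimum makes it valid everywhere without changing the
   integral. *)
have -> : \int[mu]_y `|f `|x * y| | = \int[mu]_y Num.min `|f `|x * y| | (G y).
  apply: (positive_ext mu_pos); first exact: measurableT_comp.
    apply: measurable_minr; first exact: measurableT_comp.
    by apply/measurable_EFinP; exact: measurable_int iG.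
  by move=> y y0; rewrite min_l// (le_trans (key y y0))// /G addrC lerD2r le_eqVlt; apply/orP; left; apply/eqP; ring.
apply: (@le_trans _ _ (\int[mu]_y G y)).
  apply: le_Rintegral => //.
    apply: (integrable_dominated measurableT _ (integrable_norm ib)).
      apply: measurable_minr; first exact: measurableT_comp.
      by apply/measurable_EFinP; exact: measurable_int iG.
    move=> y _; rewrite ger0_norm ?ge_min ?lexx//.
    by rewrite le_min normr_ge0/= addr_ge0 ?(ltW e2)// !mulr_ge0 ?invr_ge0 ?expR_ge0.
  by move=> y _; rewrite ge_min lexx orbT.
rewrite (RintegralD measurableT iG1 iG2) Rintegral_prob_cst RintegralZl// -/B.
suff : M * (inv_sqrt x / inv_sqrt K) * B <= e / 2 by lra.
have := hL x Lx; rewrite ler_pdivlMr; last by rewrite ltr_wpDl// mulr_ge0.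
move=> h; have sK : 0 < inv_sqrt K by exact: expR_gt0.
rewrite (_ : _ * B = inv_sqrt x * (M * B) / inv_sqrt K); last by ring.
rewrite ler_pdivrMr// mulrC (mulrC (e / 2)); apply: le_trans h.
by rewrite mulrC ler_wpM2l ?expR_ge0// lerDl.
Qed.

End mixture_C0.

(** * The classical semigroup as the case phi(u) = u *)

Section classical_laguerre.
Context {R : realType}.
Local Notation D := (`]0%R, +oo[%classic : set (measurableTypeR R)).

Lemma classical_admissible : admissible (@classical_triplet R).
Proof.
split => //=.
- exists (fun=> `]0%R, +oo[%classic); first by rewrite bigcup_const//; exists 0%N.
  by move=> n; split; [exact: measurable_itv|rewrite /mzero ltry].
- by rewrite integral_measure_zero.
- by move=> [/eqP]; rewrite oner_eq0.
Qed.

Lemma classical_phiR (u : R) : u != 0 -> phiR (@classical_triplet R) u = u.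
Proof.
move=> u0; rewrite phiRE// /psiR/= /Rintegral integral_measure_zero/= mul0r !addr0 expr1n mul1r.
by rewrite expr2 mulfK.
Qed.

Let delta : probability (measurableTypeR R) R := dirac (1 : measurableTypeR R).

Let Rint_delta (f : R -> R) : measurable_fun setT (f : measurableTypeR R -> R) -> \int[delta]_x f x = f 1.
Proof.
move=> mf; rewrite /Rintegral integral_dirac//; last exact/measurable_EFinP.
by rewrite diracT mul1e.
Qed.

(** The moments n!/(1 2 ... n) = 1 are those of the unit mass at 1, for which J_0(s) = e^(-s);
    [laplace_evolution] then applies to Q. *)
Lemma classical_evolution (Q : R -> (R -> R) -> R -> R) (l t x : R) :
  generalized_laguerre (@classical_triplet R) Q -> 0 < l -> 0 <= t -> 0 <= x ->
  Q t (fun y => expR (- (l * y))) x = expR (- (evolution_rate l t * x)) / evolution_den l t.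
Proof.
move=> hQ l0 t0 x0.
have dpos : delta D = 1%E by rewrite /delta/= diracE mem_set//= in_itv/= ltr01.
have mabs n : measurable_fun setT (fun x : measurableTypeR R => `|x| ^+ n).
  by apply: measurable_funX; exact: normr_measurable.
have dmom n : (\int[delta]_x (`|x| ^+ n)%:E = (n`!%:R / \prod_(1 <= i < n.+1) phiR (@classical_triplet R) i%:R)%:E)%E.
  rewrite integral_dirac//; last exact/measurable_EFinP.
  rewrite diracT mul1e normr1 expr1n; congr EFin.
  have -> : \prod_(1 <= i < n.+1) phiR (@classical_triplet R) i%:R = n`!%:R.
    rewrite fact_prod natr_prod !big_nat; apply: eq_bigr => i /andP[i1 _].
    by rewrite classical_phiR// pnatr_eq0 -lt0n.
  by rewrite divff// pnatr_eq0 -lt0n fact_gt0.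
have JE s : laplace delta 0 s = expR (- s).
  rewrite /laplace Rint_delta; first by rewrite normr1 mulr1 expr0 mul1r.
  apply: measurable_funM => //.
  by apply: (measurableT_comp (measurable_expRN s)); exact: normr_measurable.
have := laplace_evolution classical_admissible dpos dmom hQ l0 t0 x0.
by rewrite JE; congr (Q t _ x = _); apply/funext => y; rewrite JE.
Qed.

End classical_laguerre.

(** Gives the product of [nu] and [mu] the structure of a probability, so that its image under
    multiplication can be formed. *)
Lemma measure_of_mass_one d (T : measurableType d) (R : realType) (m : {measure set T -> \bar R}) :
  m setT = 1%E -> exists p : probability T R, forall A, p A = m A.
Proof.
move=> m1; pose r : {measure set T -> \bar R} := mrestr m (@measurableT _ T).
have r1 : r setT = 1%E by rewrite /r/= /mrestr setIT.
pose H := Measure_isProbability.Build _ _ _ r r1.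
pose p := HB.pack_for (Probability.type T R) (Measure.sort r) H.
by exists p => A; rewrite /p/= /mrestr setIT.
Qed.

Lemma ae_mono (R : realType) (mu : probability (measurableTypeR R) R) (P Q : R -> Prop) :
  (forall x, P x -> Q x) -> {ae mu, forall x, P x} -> {ae mu, forall x, Q x}.
Proof. by move=> PQ; apply: (@filterS _ _ (ae_filter_ringOfSetsType mu)). Qed.

Lemma ae_mono2 (R : realType) (mu : probability (measurableTypeR R) R) (P1 P2 Q : R -> Prop) :
  (forall x, P1 x -> P2 x -> Q x) ->
  {ae mu, forall x, P1 x} -> {ae mu, forall x, P2 x} -> {ae mu, forall x, Q x}.
Proof. by move=> PQ; apply: (@filterS2 _ _ (ae_filter_ringOfSetsType mu)). Qed.

(** * Factorization of the exponential law and the bound in L2 *)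

Section factorization.
Context {R : realType} (nu mu : probability (measurableTypeR R) R).
Local Notation D := (`]0%R, +oo[%classic : set (measurableTypeR R)).
Local Notation eps := (epsilon_law R).
Hypotheses (nu_pos : nu D = 1%E) (mu_pos : mu D = 1%E).
Variables (m1 m2 : nat -> R).
Hypothesis nu_mom : forall n, (\int[nu]_x (`|x| ^+ n)%:E = (m1 n)%:E)%E.
Hypothesis mu_mom : forall n, (\int[mu]_x (`|x| ^+ n)%:E = (m2 n)%:E)%E.
Hypothesis m12 : forall n, m1 n * m2 n = n`!%:R.

Let mX n : measurable_fun setT (fun x : measurableTypeR R => x ^+ n).
Proof. exact: measurable_funX. Qed.

Let mabs n : measurable_fun setT (fun x : measurableTypeR R => `|x| ^+ n).
Proof. by apply: measurable_funX; exact: normr_measurable. Qed.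

Let monomial (p : probability (measurableTypeR R) R) (m : nat -> R) n : p D = 1%E ->
  (forall n, (\int[p]_x (`|x| ^+ n)%:E = (m n)%:E)%E) ->
  p.-integrable setT (EFin \o (fun x : R => x ^+ n)) /\ \int[p]_x (x ^+ n) = m n.
Proof.
move=> pD pm; split.
  apply/integrableP; split; first exact/measurable_EFinP.
  apply: (@le_lt_trans _ _ (\int[p]_x (`|x| ^+ n)%:E)%E); last by rewrite pm ltry.
  rewrite le_eqVlt; apply/orP; left; apply/eqP.
  by apply: eq_integral => x _; rewrite /= normrX.
rewrite (positive_ext pD (mX n) (mabs n)); first by rewrite /Rintegral pm.
by move=> x x0; rewrite gtr0_norm.
Qed.

(** Both the image of the product law under multiplication and the exponential law have absolute
    moments n!, hence exponential moments of any rate below 1; the rate 1/2 is used in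
    [moments_determine]. *)
Lemma epsilon_factorization (f : R -> R) : measurable_fun setT (f : measurableTypeR R -> R) ->
  (forall x, 0 <= f x) ->
  (\int[eps]_x (f x)%:E = \int[nu]_x \int[mu]_y (f (x * y))%:E)%E.
Proof.
move=> mf f0.
have mmul : measurable_fun setT (fun z : measurableTypeR R * measurableTypeR R => (z.1 * z.2 : measurableTypeR R)).
  exact: measurable_funM.
have P1 : (nu \x mu)%E setT = 1%E.
  rewrite -setXTT product_measure1E//.
  have := @probability_setT _ _ _ nu; have := @probability_setT _ _ _ mu => /= -> ->.
  by rewrite mul1e.
have [p pE] := measure_of_mass_one P1.
have pI (g : R -> R) : measurable_fun setT (g : measurableTypeR R -> R) -> (forall x, 0 <= g x) ->
    (\int[p]_z (g (z.1 * z.2))%:E = \int[nu]_x \int[mu]_y (g (x * y))%:E)%E.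
  move=> mg g0; transitivity (\int[(nu \x mu)%E]_z (g (z.1 * z.2))%:E)%E.
    by apply: eq_measure_integral => A _ _; exact: pE.
  rewrite (fubini_tonelli1 (fun z : measurableTypeR R * measurableTypeR R => (g (z.1 * z.2))%:E))//; last by move=> z; rewrite lee_fin.
  by apply/measurable_EFinP; exact: (measurableT_comp mg mmul).
have [k kE] := image_law p mmul.
have kI (g : R -> R) : measurable_fun setT (g : measurableTypeR R -> R) -> (forall x, 0 <= g x) ->
    (\int[k]_x (g x)%:E = \int[nu]_x \int[mu]_y (g (x * y))%:E)%E.
  move=> mg g0; rewrite -pI//.
  rewrite (ge0_integral_image_law mmul kE (g := fun x => (g x)%:E))//; exact/measurable_EFinP.
have kmom n : \int[k]_x (x ^+ n) = n`!%:R.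
  have [i1 e1] := monomial n nu_pos nu_mom; have [i2 e2] := monomial n mu_pos mu_mom.
  rewrite (Rintegral_image_law mmul kE (mX n)).
  transitivity (\int[(nu \x mu)%E]_z (z.1 * z.2) ^+ n).
    by rewrite /Rintegral; congr fine; apply: eq_measure_integral => A _ _; exact: pE.
  have [_ e] := product_integral i1 i2.
  by rewrite -m12 -e1 -e2 -e; apply: eq_Rintegral => z _; rewrite exprMn.
have inner (g : R -> R) (x : R) (r : R) : mu.-integrable setT (EFin \o g) -> (\int[mu]_y (r * g y)%:E = (r * \int[mu]_y g y)%:E)%E.
  move=> ig; rewrite -RintegralZl// /Rintegral fineK//.
  by apply: integrable_fin_num => //; exact: integrable_scale.
have kabs n : (\int[k]_x (`|x| ^+ n)%:E = (n`!%:R)%:E)%E.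
  rewrite kI//.
  have ia : mu.-integrable setT (EFin \o (fun y : R => `|y| ^+ n)).
    have [i2 _] := monomial n mu_pos mu_mom; have := integrable_norm i2.
    by congr (integrable _ _ (EFin \o _)); apply/funext => y; rewrite /= normrX.
  transitivity (\int[nu]_x ((m2 n)%:E * (`|x| ^+ n)%:E)%E)%E.
    apply: eq_integral => x _; rewrite -EFinM mulrC.
    rewrite -[m2 n]/(fine (m2 n)%:E) -mu_mom -/(Rintegral mu setT (fun y => `|y| ^+ n)) -inner//.
    by apply: eq_integral => y _; rewrite normrM exprMn.
  have m20 : 0 <= m2 n.
    by rewrite -lee_fin -mu_mom; apply: integral_ge0 => y _; rewrite lee_fin exprn_ge0.
  rewrite ge0_integralZl//; first by rewrite nu_mom -EFinM mulrC m12.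
  exact/measurable_EFinP.
have h2 : 0 <= 2^-1 :> R by rewrite invr_ge0.
have exp1 (q : probability (measurableTypeR R) R) : (forall n, (\int[q]_x (`|x| ^+ n)%:E = (n`!%:R)%:E)%E) ->
    q.-integrable setT (fun x => (expR (2^-1 * `|x|))%:E).
  move=> qm; apply: (exp_moment (K := 1) (C := 1)) => //; first by rewrite mulr1; lra.
  move=> n en; rewrite expr1n mulr1 mul1r -qm le_eqVlt; apply/orP; left; apply/eqP.
  by apply: eq_integral => x _; rewrite -normrX ger0_norm// exprn_even_ge0.
have keps : forall A, measurable A -> k A = eps A.
  apply: (@moments_determine _ k eps 2^-1); first by rewrite invr_gt0.
  - exact: exp1.
  - by apply: exp1 => n; exact: epsilon_moment.
  - move=> n; rewrite kmom; have [_ ->] := monomial n (@epsilon_pos R) (@epsilon_moment R).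
    by [].
by rewrite -kI//; apply: eq_measure_integral => A mA _; apply/esym; exact: keps.
Qed.

End factorization.

Section L2_mixture.
Context {R : realType} (nu mu : probability (measurableTypeR R) R).
Local Notation D := (`]0%R, +oo[%classic : set (measurableTypeR R)).
Local Notation eps := (epsilon_law R).
Local Notation I := (mixture mu).
Hypothesis factor : forall f : R -> R, measurable_fun setT (f : measurableTypeR R -> R) ->
  (forall x, 0 <= f x) -> (\int[eps]_x (f x)%:E = \int[nu]_x \int[mu]_y (f (x * y))%:E)%E.
Implicit Types (f g : R -> R) (x y a : R).

Let mslice f x : measurable_fun setT (f : measurableTypeR R -> R) ->
  measurable_fun setT (fun y : measurableTypeR R => f (x * y)).
Proof. exact: measurable_mul_slice. Qed.

Let integrable_of_sqr (h : R -> R) : measurable_fun setT (h : measurableTypeR R -> R) ->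
  mu.-integrable setT (EFin \o (fun y => h y ^+ 2)) -> mu.-integrable setT (EFin \o h).
Proof.
move=> mh i; have i1 : mu.-integrable setT (EFin \o (fun=> 1 : R)) by exact: finite_measure_integrable_cst.
apply: (integrable_dominated measurableT mh (integrable_add measurableT i i1)) => y _.
by have := sqr_ge0 (`|h y| - 1); rewrite -(real_normK (num_real (h y))); have := normr_ge0 (h y); nra.
Qed.

(** Expand E (f(xX) - m)^2 >= 0 with m the mixture at x. The case of an infinite right side is
    immediate; otherwise f(xX) is integrable. *)
Lemma mixture_sqr_le f x : measurable_fun setT (f : measurableTypeR R -> R) ->
  ((I f x ^+ 2)%:E <= \int[mu]_y (f (x * y) ^+ 2)%:E)%E.
Proof.
move=> mf; have mfx := mslice x mf.
have m2 : measurable_fun setT (fun y : measurableTypeR R => f (x * y) ^+ 2) by exact: measurable_funX.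
have p0 : (0 <= \int[mu]_y (f (x * y) ^+ 2)%:E)%E by apply: integral_ge0 => y _; rewrite lee_fin sqr_ge0.
have [h|h] := boolP (\int[mu]_y (f (x * y) ^+ 2)%:E < +oo)%E; last first.
  by move: h; rewrite -leNgt leye_eq => /eqP ->; rewrite leey.
have i2 : mu.-integrable setT (EFin \o (fun y => f (x * y) ^+ 2)).
  apply/integrableP; split; first exact/measurable_EFinP.
  by under eq_integral do rewrite gee0_abs ?lee_fin ?sqr_ge0//.
have i1 := integrable_of_sqr mfx i2.
have -> : (\int[mu]_y (f (x * y) ^+ 2)%:E = (\int[mu]_y (f (x * y) ^+ 2))%:E)%E.
  by rewrite /Rintegral fineK// (integrable_fin_num _ i2).
rewrite lee_fin; set m := I f x.
have j1 := integrable_scale measurableT (- (2 * m)) i1.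
have j0 : mu.-integrable setT (EFin \o (fun=> m ^+ 2 : R)) by exact: finite_measure_integrable_cst.
have j01 := integrable_add measurableT j1 j0.
have : 0 <= \int[mu]_y (f (x * y) ^+ 2 + (- (2 * m) * f (x * y) + m ^+ 2)).
  apply: Rintegral_ge0 => y _; have := sqr_ge0 (f (x * y) - m).
  by congr (_ <= _); ring.
rewrite (RintegralD measurableT i2 j01) (RintegralD measurableT j1 j0) Rintegral_prob_cst.
have -> : \int[mu]_y (- (2 * m) * f (x * y)) = - (2 * m) * m by exact: RintegralZl.
by rewrite -subr_ge0; congr (_ <= _); ring.
Qed.

Lemma mixture_sqr_integral f : measurable_fun setT (f : measurableTypeR R -> R) ->
  (\int[nu]_x (I f x ^+ 2)%:E <= \int[eps]_x (f x ^+ 2)%:E)%E.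
Proof.
move=> mf; have mf2 : measurable_fun setT (fun x : measurableTypeR R => f x ^+ 2) by exact: measurable_funX.
rewrite (factor mf2); last by move=> x; exact: sqr_ge0.
apply: ge0_le_integral => //.
- by move=> x _; rewrite lee_fin sqr_ge0.
- by apply/measurable_EFinP; apply: measurable_funX; exact: measurable_mixture.
- apply: (measurable_fun_fubini_tonelli_F (fun z : measurableTypeR R * measurableTypeR R => (f (z.1 * z.2) ^+ 2)%:E)).
    by apply/measurable_EFinP; apply: (measurableT_comp mf2); exact: measurable_funM.
  by move=> z; rewrite lee_fin sqr_ge0.
- by move=> x _; exact: mixture_sqr_le.
Qed.

Lemma mixture_norm_le f : measurable_fun setT f -> (L2norm nu (I f) <= L2norm eps f)%E.
Proof. by move=> mf; rewrite L2norm_le; exact: mixture_sqr_integral. Qed.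

Lemma mixture_L2 f : f \in L2 eps -> I f \in L2 nu.
Proof.
move=> hf; have mf := L2_measurable hf; apply/L2P; split; first exact: measurable_mixture.
have /integrableP[_ h] := L2_sqr_integrable hf.
apply/integrableP; split.
  by apply/measurable_EFinP; apply: measurable_funX; exact: measurable_mixture.
under eq_integral do rewrite gee0_abs ?lee_fin ?sqr_ge0//.
apply: (le_lt_trans (mixture_sqr_integral mf)).
by move: h; under eq_integral do rewrite gee0_abs ?lee_fin ?sqr_ge0//.
Qed.

(** The [nu]-integral of E f(xX)^2 is the squared norm of f under [eps]. So f(xX) is square
    integrable, hence integrable, for almost every x. *)
Lemma mixture_ae_integrable f : f \in L2 eps ->
  {ae nu, forall x, mu.-integrable setT (EFin \o (fun y => f (x * y)))}.
Proof.
move=> hf; have mf := L2_measurable hf.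
have mf2 : measurable_fun setT (fun x : measurableTypeR R => f x ^+ 2) by exact: measurable_funX.
have mF : measurable_fun setT (fun x : measurableTypeR R => \int[mu]_y (f (x * y) ^+ 2)%:E)%E.
  apply: (measurable_fun_fubini_tonelli_F (fun z : measurableTypeR R * measurableTypeR R => (f (z.1 * z.2) ^+ 2)%:E)).
    by apply/measurable_EFinP; apply: (measurableT_comp mf2); exact: measurable_funM.
  by move=> z; rewrite lee_fin sqr_ge0.
have p0 x : (0 <= \int[mu]_y (f (x * y) ^+ 2)%:E)%E by apply: integral_ge0 => y _; rewrite lee_fin sqr_ge0.
have iF : nu.-integrable setT (fun x => \int[mu]_y (f (x * y) ^+ 2)%:E)%E.
  apply/integrableP; split => //; under eq_integral do rewrite gee0_abs//.
  rewrite -(factor mf2); last by move=> x; exact: sqr_ge0.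
  by have /integrableP[_] := L2_sqr_integrable hf; under eq_integral do rewrite gee0_abs ?lee_fin ?sqr_ge0//.
have := integrable_ae measurableT iF; apply: ae_mono => x /(_ Logic.I).
rewrite fin_numElt => /andP[_ h].
apply: integrable_of_sqr; first exact: mslice.
apply/integrableP; split; first by apply/measurable_EFinP; apply: measurable_funX; exact: mslice.
by under eq_integral do rewrite gee0_abs ?lee_fin ?sqr_ge0//.
Qed.

Lemma mixture_lin a f g : f \in L2 eps -> g \in L2 eps ->
  {ae nu, forall x, I (fun y => a * f y + g y) x = a * I f x + I g x}.
Proof.
move=> hf hg; apply: ae_mono2 (mixture_ae_integrable hf) (mixture_ae_integrable hg) => x i1 i2.
have j1 := integrable_scale measurableT a i1.
by rewrite /mixture (RintegralD measurableT j1 i2); congr (_ + _); exact: RintegralZl.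
Qed.

Lemma mixture_ae_eq f g : f \in L2 eps -> g \in L2 eps -> f = g %[ae eps] -> I f = I g %[ae nu].
Proof.
move=> hf hg fg; have mf := L2_measurable hf; have mg := L2_measurable hg.
have hd := L2_lin (-1) hg hf.
have n0 : L2norm nu (I (fun x => - 1 * g x + f x)) = 0%E.
  apply/eqP; rewrite eq_le L2norm_ge0 andbT (le_trans (mixture_norm_le (L2_measurable hd)))//.
  have -> : 0%E = L2norm eps (fun=> 0).
    apply/eqP; rewrite eq_le L2norm_ge0/=.
    have := L2norm_scale eps (lexx 0) mf; rewrite mul0e => <-.
    by rewrite (_ : (fun x => 0 * f x) = (fun=> 0)) ?L2norm_ge0//; apply/funext => x; rewrite mul0r.
  rewrite L2norm_le (ae_eq_integral (fun=> 0%E))//.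
  - by rewrite expr0n; under [X in (_ <= X)%E]eq_integral do rewrite /=.
  - by apply/measurable_EFinP; apply: measurable_funX; exact: L2_measurable hd.
  - by apply: ae_mono fg => x /(_ Logic.I) -> _ /=; rewrite mulN1r addNr expr0n.
have mI : measurable_fun setT (I (fun x => - 1 * g x + f x)).
  exact: measurable_mixture (L2_measurable hd).
have := L2norm_eq0 mI n0; have := mixture_lin (- 1) hg hf.
apply: ae_mono2 => x e1 e2 _; move: e2; rewrite e1 mulN1r => /eqP.
by rewrite addrC subr_eq0 => /eqP.
Qed.

End L2_mixture.

(** * Contractions agreeing on a closed subspace *)

Section L2_tools.
Context {R : realType}.
Implicit Types (mu nu : probability (measurableTypeR R) R) (f g h : R -> R) (e k : R).

Lemma L2norm_sqr_eq mu f g : (forall x, f x ^+ 2 = g x ^+ 2) -> L2norm mu f = L2norm mu g.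
Proof.
move=> fg; have E : (\int[mu]_x (f x ^+ 2)%:E = \int[mu]_x (g x ^+ 2)%:E)%E.
  by apply: eq_integral => x _; rewrite fg.
by apply/eqP; rewrite eq_le !L2norm_le E lexx.
Qed.

Lemma L2norm_ae mu f g : measurable_fun setT f -> measurable_fun setT g -> f = g %[ae mu] ->
  L2norm mu f = L2norm mu g.
Proof.
move=> mf mg fg; have E : (\int[mu]_x (f x ^+ 2)%:E = \int[mu]_x (g x ^+ 2)%:E)%E.
  apply: ae_eq_integral => //.
  - by apply/measurable_EFinP; exact: measurable_funX.
  - by apply/measurable_EFinP; exact: measurable_funX.
  - by apply: ae_mono fg => x /(_ I) ->.
by apply/eqP; rewrite eq_le !L2norm_le E lexx.
Qed.

Lemma L2norm_scale_abs mu k f : measurable_fun setT f ->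
  L2norm mu (fun x => k * f x) = (`|k|%:E * L2norm mu f)%E.
Proof.
move=> mf; rewrite -L2norm_scale//; apply: L2norm_sqr_eq => x.
by rewrite !exprMn real_normK ?num_real.
Qed.

Lemma L2_sub mu f g : f \in L2 mu -> g \in L2 mu -> (fun x => f x - g x) \in L2 mu.
Proof.
move=> hf hg; have := L2_lin (- 1) hg hf.
rewrite (_ : (fun x => - 1 * g x + f x) = (fun x => f x - g x))//.
by apply/funext => x; rewrite mulN1r addrC.
Qed.

Lemma L2norm_small_eq0 mu f : (forall e, 0 < e -> (L2norm mu f < e%:E)%E) -> L2norm mu f = 0%E.
Proof.
move=> h; apply/eqP; rewrite eq_le L2norm_ge0 andbT.
by apply/lee_addgt0Pr => e e0; rewrite add0e ltW// h.
Qed.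

Lemma bounded_L2 mu f (M : R) : measurable_fun setT (f : measurableTypeR R -> R) ->
  (forall x, `|f x| <= M) -> f \in L2 mu.
Proof.
move=> mf fM; apply/L2P; split => //.
apply: (bounded_integrable mu (M := M ^+ 2) (measurable_funX _ mf)) => x.
by rewrite normrX lerXn2r ?nnegrE// (le_trans _ (fM x)).
Qed.

Definition L2_contraction mu nu (S : (R -> R) -> R -> R) :=
  L2_operator mu nu S /\ forall f, f \in L2 mu -> (L2norm nu (S f) <= L2norm mu f)%E.

Variables (mu nu : probability (measurableTypeR R) R) (S T : (R -> R) -> R -> R).
Hypotheses (hS : L2_contraction mu nu S) (hT : L2_contraction mu nu T).

Let V f := f \in L2 mu /\ S f = T f %[ae nu].

Lemma L2_agree_lin k f g : V f -> V g -> V (fun x => k * f x + g x).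
Proof.
move=> [hf ef] [hg eg]; have [[_ _ Sl] _] := hS; have [[_ _ Tl] _] := hT.
split; first exact: L2_lin.
have e1 : {ae nu, forall x, k * S f x + S g x = k * T f x + T g x}.
  by apply: ae_mono2 ef eg => x /(_ I) -> /(_ I) ->.
have e2 : {ae nu, forall x, S (fun y => k * f y + g y) x = k * T f x + T g x}.
  by apply: ae_mono2 e1 (Sl k f g hf hg) => x e /(_ I) ->.
by apply: ae_mono2 e2 (Tl k f g hf hg) => x -> /(_ I) -> _.
Qed.

(** If S and T agree at g, the contraction bounds make S f - T f at most twice as long as f - g. *)
Lemma L2_agree_closed f : f \in L2 mu ->
  (forall e, 0 < e -> exists g, [/\ V g, g \in L2 mu & (L2norm mu (fun x => f x - g x)%R < e%:E)%E]) -> V f.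
Proof.
move=> hf happ; split => //.
have [[SL _ Sl] Sc] := hS; have [[TL _ Tl] Tc] := hT.
have mSf := L2_measurable (SL f hf); have mTf := L2_measurable (TL f hf).
have md : measurable_fun setT (fun x => S f x - T f x) by exact: measurable_funB.
suff n0 : L2norm nu (fun x => S f x - T f x) = 0%E.
  by apply: ae_mono (L2norm_eq0 md n0) => x /eqP; rewrite subr_eq0 => /eqP.
apply: L2norm_small_eq0 => e e0; have e2 : 0 < e / 2 by lra.
have [g [[hg eg] _ fg]] := happ _ e2.
pose h x := f x - g x; have hh : h \in L2 mu by exact: L2_sub.
have fE : f = (fun x => 1 * h x + g x) by apply/funext => x; rewrite /h; ring.
have d1 : {ae nu, forall x, S f x - T g x = S h x}.
  have := Sl 1 h g hh hg; rewrite -fE => s1; apply: ae_mono2 s1 eg => x /(_ I) -> /(_ I) ->.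
  by ring.
have d2 : {ae nu, forall x, T f x - T g x = T h x}.
  by have := Tl 1 h g hh hg; rewrite -fE; apply: ae_mono => x /(_ I) ->; ring.
have d : (fun x => S f x - T f x) = (fun x => S h x + - 1 * T h x) %[ae nu].
  by apply: ae_mono2 d1 d2 => x <- <- _; ring.
have mSh := L2_measurable (SL h hh); have mTh := L2_measurable (TL h hh).
have mT1 : measurable_fun setT (fun x => - 1 * T h x) by exact: measurable_funM.
rewrite (L2norm_ae md _ d); last exact: measurable_funD.
apply: (le_lt_trans (L2norm_add_le nu mSh mT1)).
rewrite L2norm_scale_abs// normrN1 mul1e [X in (_ < X%:E)%E]splitr EFinD.
by apply: lteD; [apply: (le_lt_trans (Sc h hh))|apply: (le_lt_trans (Tc h hh))].
Qed.

End L2_tools.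

(** * Intertwining and density of the range *)

Section intertwining.
Context {R : realType} (c : triplet R) (adm : admissible c).
Context (nu mu : probability (measurableTypeR R) R).
Local Notation D := (`]0%R, +oo[%classic : set (measurableTypeR R)).
Local Notation eps := (epsilon_law R).
Local Notation I := (mixture mu).
Local Notation J := (laplace mu).
Hypotheses (nu_pos : nu D = 1%E) (mu_pos : mu D = 1%E).
Hypothesis mu_mom : forall n,
  (\int[mu]_x (`|x| ^+ n)%:E = (n`!%:R / \prod_(1 <= i < n.+1) phiR c i%:R)%:E)%E.
Hypothesis nu_mom : forall n,
  (\int[nu]_x (`|x| ^+ n)%:E = (\prod_(1 <= i < n.+1) phiR c i%:R)%:E)%E.
Implicit Types (f g : R -> R) (l t x e : R).

Let p0 k : (0 < k)%N -> 0 < phiR c k%:R.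
Proof. by move=> k0; apply: phiR_gt0 => //; rewrite ltr0n. Qed.

Let prod_gt0 n : 0 < \prod_(1 <= i < n.+1) phiR c i%:R :> R.
Proof. by rewrite big_nat prodr_gt0// => i /andP[i0 _]; exact: p0. Qed.

Lemma law_factorization f : measurable_fun setT (f : measurableTypeR R -> R) -> (forall x, 0 <= f x) ->
  (\int[eps]_x (f x)%:E = \int[nu]_x \int[mu]_y (f (x * y))%:E)%E.
Proof.
apply: (epsilon_factorization nu_pos mu_pos nu_mom mu_mom) => n.
by rewrite mulrC divfK// gt_eqF.
Qed.

Let factor := law_factorization.

Lemma mixture_contraction : L2_contraction eps nu I.
Proof.
split; first split.
- exact: mixture_L2 factor.
- exact: mixture_ae_eq factor.
- by move=> a f g hf hg; apply: ae_mono (mixture_lin factor a hf hg) => x -> _.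
- by move=> f hf; apply: (mixture_norm_le factor); exact: L2_measurable hf.
Qed.

Lemma mixture_monomial n x : I (fun y => y ^+ n) x = x ^+ n * (n`!%:R / \prod_(1 <= i < n.+1) phiR c i%:R).
Proof.
rewrite /mixture -(abs_moment mu_mom).
have i : mu.-integrable setT (EFin \o (fun y : R => `|y| ^+ n)).
  apply/integrableP; split.
    by apply/measurable_EFinP; apply: measurable_funX; exact: normr_measurable.
  by under eq_integral do rewrite gee0_abs ?lee_fin ?exprn_ge0//; rewrite mu_mom ltry.
rewrite -RintegralZl//; apply: (positive_ext mu_pos).
- by apply: measurable_funX; exact: measurable_funM.
- by apply: measurable_funM => //; apply: measurable_funX; exact: normr_measurable.
- by move=> y y0; rewrite exprMn gtr0_norm.
Qed.

Let abs_int (p : probability (measurableTypeR R) R) (m : nat -> R) n :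
  (forall n, (\int[p]_x (`|x| ^+ n)%:E = (m n)%:E)%E) -> (fun x : R => x ^+ n) \in L2 p.
Proof.
move=> pm; apply/L2P; split; first exact: measurable_funX.
apply/integrableP; split; first by apply/measurable_EFinP; apply: measurable_funX; exact: measurable_funX.
apply: (@le_lt_trans _ _ (\int[p]_x (`|x| ^+ (n * 2))%:E)%E); last by rewrite pm ltry.
rewrite le_eqVlt; apply/orP; left; apply/eqP.
by apply: eq_integral => x _; rewrite /= !normrX exprM.
Qed.

Lemma monomial_L2_epsilon n : (fun x : R => x ^+ n) \in L2 eps.
Proof. exact: abs_int (@epsilon_moment R). Qed.

Lemma monomial_L2_nu n : (fun x : R => x ^+ n) \in L2 nu.
Proof. exact: abs_int nu_mom. Qed.

Let expf l x : R := expR (- (l * `|x|)).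

Let mexpf l : measurable_fun setT (expf l : measurableTypeR R -> R).
Proof. by apply: (measurableT_comp (measurable_expRN l)); exact: normr_measurable. Qed.

Let expf_L2 l (p : probability (measurableTypeR R) R) : 0 < l -> expf l \in L2 p.
Proof.
move=> l0; apply: (@bounded_L2 _ _ _ 1) => // x; rewrite ger0_norm ?expR_ge0//.
by rewrite -[leRHS]expR0 ler_expR oppr_le0 mulr_ge0// ltW.
Qed.

Let expC0 l : 0 < l -> C0 (fun x : R => expR (- (l * x))).
Proof.
move=> l0; split.
  apply: continuous_subspaceT => x; apply: (@is_derive_continuous _ _ _ (- l * expR (- (l * x)))).
  by deriv; ring.
apply/cvgrPdist_le => e e0; near=> x.
have h : l^-1 * - ln e <= x by near: x; apply: nbhs_pinfty_ge; exact: num_real.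
rewrite sub0r normrN ger0_norm ?expR_ge0//.
by rewrite -[leRHS](lnK (x := e)) ?posrE// ler_expR lerNl -ler_pdivrMl.
Unshelve. all: by end_near.
Qed.

Let mixture_exp l x : I (expf l) x = J 0 (l * `|x|).
Proof.
by apply: eq_Rintegral => y _; rewrite /expf normrM expr0 mul1r mulrA.
Qed.

Context (P P2 Q Q2 : R -> (R -> R) -> R -> R).
Hypotheses (hP : generalized_laguerre c P) (hP2 : L2_contraction_extension nu P P2).
Hypotheses (hQ : generalized_laguerre (@classical_triplet R) Q) (hQ2 : L2_contraction_extension eps Q Q2).

(** Almost everywhere both sides are J_0(L x)/d, with the same rate L and denominator d. The even
    form e^(-l|x|) is bounded and Borel on the line, as the L2 extensions require. *)
Let intertwine_exp l t : 0 < l -> 0 <= t -> P2 t (I (expf l)) = I (Q2 t (expf l)) %[ae nu].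
Proof.
move=> l0 t0; have [fP _] := hP; have [fQ _] := hQ.
have [[QL _ _] _ Qe] := hQ2 t0; have [_ _ Pe] := hP2 t0.
have L0 := evolution_rate_gt0 l0 t0; set L := evolution_rate l t in L0; set d := evolution_den l t.
have CJ : C0 (fun y => J 0 (l * y)).
  by have := laplace_C0 adm mu_pos mu_mom 0 l0; congr C0; apply/funext => y; rewrite expr0 mul1r.
have CI : C0 (I (expf l)).
  by apply: C0_ext CJ _ => x x0; rewrite mixture_exp ger0_norm.
have Ce : C0 (expf l) by apply: C0_ext (expC0 l0) _ => x x0; rewrite /expf ger0_norm.
have q1 : Q2 t (expf l) = (fun x => d^-1 * expf L x) %[ae eps].
  apply: ae_mono2 (Qe _ Ce (mexpf l)) (positive_ae (@epsilon_pos R)) => x /(_ Logic.I) -> x0 _.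
  rewrite (feller_ext fQ t0 Ce (expC0 l0)) ?(ltW x0)//; last by move=> y y0; rewrite /expf ger0_norm.
  by rewrite (classical_evolution hQ l0 t0 (ltW x0)) /expf gtr0_norm// mulrC.
have hL : (fun x => d^-1 * expf L x) \in L2 eps.
  have hz : (fun=> 0 : R) \in L2 eps by apply: (@bounded_L2 _ eps _ 0) => // x; rewrite normr0.
  have := L2_lin d^-1 (expf_L2 eps L0) hz.
  rewrite (_ : (fun x => d^-1 * expf L x + 0) = (fun x => d^-1 * expf L x))//.
  by apply/funext => x; rewrite addr0.
have q2 := mixture_ae_eq factor (QL _ (expf_L2 eps l0)) hL q1.
have q3 x : I (fun x => d^-1 * expf L x) x = d^-1 * J 0 (L * `|x|).
  rewrite -mixture_exp; apply: RintegralZl => //.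
  have M0 : forall y, `|expf L y| <= 1.
    by move=> y; rewrite ger0_norm ?expR_ge0// -[leRHS]expR0 ler_expR oppr_le0 mulr_ge0// ltW.
  exact: (bounded_integrable mu (measurable_mul_slice x (mexpf L)) (fun y => M0 (x * y))).
have r1 : {ae nu, forall x, P2 t (I (expf l)) x = d^-1 * J 0 (L * `|x|)}.
  apply: ae_mono2 (Pe _ CI (measurable_mixture mu (mexpf l))) (positive_ae nu_pos) => x /(_ Logic.I) -> x0.
  rewrite (feller_ext fP t0 CI CJ) ?(ltW x0)//; last by move=> y y0; rewrite mixture_exp ger0_norm.
  by rewrite (laplace_evolution adm mu_pos mu_mom hP l0 t0 (ltW x0)) gtr0_norm// mulrC.
by apply: ae_mono2 r1 q2 => x -> /(_ Logic.I) -> _; rewrite q3.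
Qed.

Let eps_exp : eps.-integrable setT (fun x => (expR (2^-1 * `|x|))%:E).
Proof.
have m n : (\int[eps]_x (`|x| ^+ n)%:E = (n`!%:R / \prod_(1 <= i < n.+1) phiR (@gamma_triplet R) i%:R)%:E)%E.
  by rewrite gamma_prod divr1 epsilon_moment.
have := exp_integrable (@gamma_admissible R) m.
by rewrite gamma_phiR_eq1 ?oner_neq0// div1r.
Qed.

(** Both compositions are contractions from L2 of [eps] to L2 of [nu], so they agree on a closed
    subspace. Containing the exponentials, it contains the monomials by [closed_class_abs_monomial],
    and these suffice by [L2_closed_class_full]. *)
Lemma L2_intertwining f t : 0 <= t -> f \in L2 eps -> P2 t (I f) = I (Q2 t f) %[ae nu].
Proof.
move=> t0; have [[PL Pae Pl] Pc _] := hP2 t0; have [[QL Qae Ql] Qc _] := hQ2 t0.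
have [[IL Iae Il] Ic] := mixture_contraction.
have hS : L2_contraction eps nu (fun f => P2 t (I f)).
  split; first split.
  - by move=> g hg; exact/PL/IL.
  - by move=> g h hg hh gh; apply: Pae; [exact: IL|exact: IL|exact: Iae].
  - move=> a g h hg hh.
    have e1 := Pae _ _ (IL _ (L2_lin a hg hh)) (L2_lin a (IL _ hg) (IL _ hh)) (Il a g h hg hh).
    by apply: ae_mono2 e1 (Pl a _ _ (IL _ hg) (IL _ hh)) => x /(_ Logic.I) -> /(_ Logic.I) -> _.
  - by move=> g hg; apply: (le_trans (Pc _ (IL _ hg))); exact: Ic.
have hT : L2_contraction eps nu (fun f => I (Q2 t f)).
  split; first split.
  - by move=> g hg; exact/IL/QL.
  - by move=> g h hg hh gh; apply: Iae; [exact: QL|exact: QL|exact: Qae].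
  - move=> a g h hg hh.
    have e1 := Iae _ _ (QL _ (L2_lin a hg hh)) (L2_lin a (QL _ hg) (QL _ hh)) (Ql a g h hg hh).
    by apply: ae_mono2 e1 (Il a _ _ (QL _ hg) (QL _ hh)) => x /(_ Logic.I) -> /(_ Logic.I) -> _.
  - by move=> g hg; apply: (le_trans (Ic _ (QL _ hg))); exact: Qc.
pose V f := f \in L2 eps /\ P2 t (I f) = I (Q2 t f) %[ae nu].
have Vl : forall k f g, V f -> V g -> V (fun x => k * f x + g x) by exact: L2_agree_lin hS hT.
have Vc : forall f, f \in L2 eps -> (forall e, 0 < e -> exists g,
    [/\ V g, g \in L2 eps & (L2norm eps (fun x => f x - g x)%R < e%:E)%E]) -> V f.
  exact: L2_agree_closed hS hT.
(* The rate is 1/4 because the square of e^(|x|/4) is e^(|x|/2), integrable under [eps]. *)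
have q0 : 0 < 4^-1 :> R by rewrite invr_gt0.
have clV : closed_class 4^-1 V.
  split => // f_ g C Vf fC fg.
  have hG : (fun x : R => `|C| * expR (4^-1 * `|x|)) \in L2 eps.
    have mG : measurable_fun setT (fun x : measurableTypeR R => `|C| * expR (4^-1 * `|x|)).
      apply: measurable_funM => //; apply: measurableT_comp => //; apply: measurable_funM => //.
    apply/L2P; split => //.
    have := integrable_scale measurableT (`|C| ^+ 2) eps_exp.
    congr (integrable _ _ _); apply/funext => x /=; rewrite exprMn -expRM_natl.
    by congr (_ * expR _)%:E; field.
  have Gb n x : `|f_ n x| <= `|C| * expR (4^-1 * `|x|).
    by apply: (le_trans (fC n x)); rewrite ler_wpM2r ?expR_ge0// ler_norm.
  have [] := @L2_dominated_closed _ eps V Vc f_ g _ Vf (fun n => (Vf n).1) hG Gb fg.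
  by [].
have Ve l : 0 < l -> V (fun x => expR (- (l * `|x|))).
  by move=> l0; split; [exact: expf_L2|exact: intertwine_exp].
have Vabs := closed_class_abs_monomial q0 clV Ve.
(* x^n and |x|^n agree almost everywhere for [eps], and both compositions respect this. *)
have VX n : V (fun x => x ^+ n).
  have hX := monomial_L2_epsilon n; split => //.
  have [ha ea] := Vabs n.
  have aX : (fun x : R => x ^+ n) = (fun x => `|x| ^+ n) %[ae eps].
    by apply: ae_mono (positive_ae (@epsilon_pos R)) => x x0 _; rewrite gtr0_norm.
  have [[_ Sae _] _] := hS; have [[_ Tae _] _] := hT.
  have s1 := Sae _ _ hX ha aX; have t1 := Tae _ _ hX ha aX.
  have s2 : {ae nu, forall x, P2 t (I (fun x => x ^+ n)) x = I (Q2 t (fun x => `|x| ^+ n)) x}.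
    by apply: ae_mono2 s1 ea => x /(_ Logic.I) -> /(_ Logic.I) ->.
  by apply: ae_mono2 s2 t1 => x -> /(_ Logic.I) -> _.
have h0 : 0 < 2^-1 :> R by rewrite invr_gt0.
by move=> hf; have [_] := @L2_closed_class_full _ eps V Vl Vc 2^-1 h0 eps_exp VX f hf.
Qed.

Let prod_le n : \prod_(1 <= i < n.+1) phiR c i%:R <= n`!%:R * phiR c 1 ^+ n.
Proof.
elim: n => [|n ih]; first by rewrite big_geq// fact0 expr0 mulr1.
rewrite big_nat_recr//= factS natrM exprSr.
have h : phiR c n.+1%:R <= n.+1%:R * phiR c 1.
  have := @phiR_div_homo _ _ adm 1 n.+1%:R ltr01; rewrite ler1n => /(_ isT).
  by rewrite divr1 ler_pdivrMr ?ltr0n// mulrC.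
have -> : n.+1%:R * n`!%:R * (phiR c 1 ^+ n * phiR c 1) = (n`!%:R * phiR c 1 ^+ n) * (n.+1%:R * phiR c 1) by ring.
by apply: ler_pM => //; [exact: ltW|exact/ltW/p0].
Qed.

(** The functions approximable by images form a closed subspace, which contains the monomials, as
    these are multiples of their own images. *)
Lemma mixture_dense g e : g \in L2 nu -> 0 < e ->
  exists2 f, f \in L2 eps & (L2norm nu (fun x => (I f x - g x)%R) < e%:E)%E.
Proof.
have f1 : 0 < phiR c 1 by exact: (p0 (ltn0Sn 0)).
have [[IL Iae Il] Ic] := mixture_contraction.
pose V g := g \in L2 nu /\ forall e, 0 < e ->
  exists2 f, f \in L2 eps & (L2norm nu (fun x => (I f x - g x)%R) < e%:E)%E.
have tri (u v w : R -> R) (r s : R) : u \in L2 nu -> v \in L2 nu -> w \in L2 nu ->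
    (L2norm nu (fun x => (u x - v x)%R) < r%:E)%E -> (L2norm nu (fun x => (v x - w x)%R) < s%:E)%E ->
    (L2norm nu (fun x => (u x - w x)%R) < (r + s)%:E)%E.
  move=> hu hv hw h1 h2.
  have -> : (fun x => (u x - w x)%R) = (fun x => (u x - v x) + (v x - w x)) by apply/funext => x; ring.
  apply: (le_lt_trans (L2norm_add_le nu (L2_measurable (L2_sub hu hv)) (L2_measurable (L2_sub hv hw)))).
  by rewrite EFinD; exact: lteD.
have Vl k u v : V u -> V v -> V (fun x => k * u x + v x).
  move=> [hu au] [hv av]; split; first exact: L2_lin.
  move=> r r0; have r2 : 0 < r / 2 by lra.
  have k0 : 0 < `|k| + 1 by rewrite ltr_wpDl.
  have r3 : 0 < r / 2 / (`|k| + 1) by rewrite divr_gt0.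
  have [fu hfu eu] := au _ r3; have [fv hfv ev] := av _ r2.
  exists (fun x => k * fu x + fv x); first exact: L2_lin.
  have du := L2_sub (IL _ hfu) hu; have dv := L2_sub (IL _ hfv) hv.
  have -> : L2norm nu (fun x => (I (fun y => k * fu y + fv y) x - (k * u x + v x))%R) =
     L2norm nu (fun x => (k * (I fu x - u x)%R + (I fv x - v x)%R)%R).
    apply: L2norm_ae.
    - by apply: L2_measurable; apply: L2_sub; [apply: IL; exact: L2_lin|exact: L2_lin].
    - exact: L2_measurable (L2_lin k du dv).
    - by apply: ae_mono (Il k fu fv hfu hfv) => x /(_ Logic.I) -> _; ring.
  have mk : measurable_fun setT (fun x => k * (I fu x - u x)%R).
    by apply: measurable_funM => //; exact: L2_measurable du.
  apply: (le_lt_trans (L2norm_add_le nu mk (L2_measurable dv))).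
  rewrite L2norm_scale_abs; last exact: L2_measurable du.
  rewrite [X in (_ < X%:E)%E]splitr EFinD; apply: lee_ltD => //.
    have : (L2norm nu (fun x => (I fu x - u x)%R) \is a fin_num).
      by rewrite ge0_fin_numE ?L2norm_ge0// (lt_trans eu)// ltry.
    move=> /fineK <-; rewrite -EFinM //.
  have : (L2norm nu (fun x => (I fu x - u x)%R) \is a fin_num).
    by rewrite ge0_fin_numE ?L2norm_ge0// (lt_trans eu)// ltry.
  move=> nf; move: eu; rewrite -(fineK nf) lte_fin => eu; rewrite -EFinM lee_fin.
  apply: (@le_trans _ _ ((`|k| + 1) * (r / 2 / (`|k| + 1)))); last by rewrite mulrC divfK// gt_eqF.
  by apply: ler_pM => //; [rewrite fine_ge0// L2norm_ge0|rewrite lerDl|exact: ltW].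
have Vc u : u \in L2 nu -> (forall r, 0 < r -> exists v,
    [/\ V v, v \in L2 nu & (L2norm nu (fun x => u x - v x)%R < r%:E)%E]) -> V u.
  move=> hu au; split => // r r0; have r2 : 0 < r / 2 by lra.
  have [v [[_ av] hv uv]] := au _ r2; have [f hf fv] := av _ r2.
  exists f => //; rewrite [r]splitr; apply: (tri _ v) => //; first exact: IL.
  by move: uv; rewrite (@L2norm_sqr_eq _ _ _ (fun x => v x - u x))// => x; ring.
have VX n : V (fun x => x ^+ n).
  have hX := monomial_L2_nu n; split => // r r0.
  pose m := n`!%:R / \prod_(1 <= i < n.+1) phiR c i%:R.
  have m0 : m != 0 by rewrite gt_eqF// divr_gt0// ltr0n fact_gt0.
  have hz : (fun=> 0 : R) \in L2 eps by apply: (@bounded_L2 _ eps _ 0) => // x; rewrite normr0.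
  exists (fun x => m^-1 * x ^+ n + 0); first exact: L2_lin (monomial_L2_epsilon n) hz.
  have IX x : I (fun x => m^-1 * x ^+ n + 0) x = x ^+ n.
    have i : mu.-integrable setT (EFin \o (fun y : R => (x * y) ^+ n)).
      have mX : measurable_fun setT (fun y : measurableTypeR R => (x * y) ^+ n).
        by apply: measurable_funX; exact: measurable_funM.
      apply/integrableP; split; first exact/measurable_EFinP.
      apply: (@le_lt_trans _ _ ((`|x| ^+ n)%:E * \int[mu]_y (`|y| ^+ n)%:E)%E).
        have mn : measurable_fun setT (fun y : measurableTypeR R => (`|y| ^+ n)%:E).
          by apply/measurable_EFinP; apply: measurable_funX; exact: normr_measurable.
        rewrite -ge0_integralZl//.
        by rewrite le_eqVlt; apply/orP; left; apply/eqP; apply: eq_integral => y _; rewrite /= normrX normrM exprMn EFinM.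
      by rewrite mu_mom -EFinM ltry.
    transitivity (m^-1 * I (fun y => y ^+ n) x).
      rewrite /mixture -RintegralZl//; apply: eq_Rintegral => y _; rewrite addr0//.
    by rewrite mixture_monomial -/m mulrCA mulVf// mulr1.
  rewrite (_ : (fun x => _) = (fun=> 0)); last by apply/funext => x; rewrite IX subrr.
  rewrite L2norm_lt// (_ : (\int[nu]_x _)%E = 0%E) ?lte_fin ?exprn_gt0//.
  by under eq_integral do rewrite expr0n; exact: integral0.
(* The moments of [nu] are at most n! phi(1)^n, so any rate below 1/phi(1) is allowed. *)
pose a := (2 * phiR c 1)^-1; have a0 : 0 < a by rewrite invr_gt0 mulr_gt0.
have ea : nu.-integrable setT (fun x => (expR (a * `|x|))%:E).
  apply: (@exp_moment _ nu a (phiR c 1) 1); [exact: ltW|exact: ltW| |].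
    by rewrite /a invfM -mulrA mulVf ?gt_eqF//; lra.
  move=> n en; rewrite mul1r (_ : (\int[nu]_x _)%E = (\int[nu]_x (`|x| ^+ n)%:E)%E).
    by rewrite nu_mom lee_fin.
  by apply: eq_integral => x _; rewrite -normrX ger0_norm// exprn_even_ge0.
move=> hg; have [_ h] := @L2_closed_class_full _ nu V Vl Vc a a0 ea VX g hg.
exact: h.
Qed.

End intertwining.

(** * The lower bound *)

Section product_growth.
Context {R : realType} (q : nat -> R) (k s : R).
Hypotheses (q_gt0 : forall i, 0 < q i) (k_gt0 : 0 < k).

Let prod_pos m n : 0 < \prod_(m <= i < n) q i.
Proof. by rewrite big_nat prodr_gt0. Qed.

(** Write p_n for the product of the first n terms. By monotonicity p_(2n) <= p_n q_n^n, so k p_n^2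
    <= p_(2n) gives k p_n <= q_n^n; also p_n >= p_j q_n^(n-j). Hence k p_j <= q_n^j, and n tends to
    infinity. *)
Lemma prod_le_lim_pow (j : nat) : (forall m n, (m <= n)%N -> q n <= q m) ->
  (forall n, k * (\prod_(0 <= i < n) q i) ^+ 2 <= \prod_(0 <= i < n * 2) q i) ->
  q n @[n --> \oo] --> s -> k * \prod_(0 <= i < j) q i <= s ^+ j.
Proof.
move=> qd qk qs.
have cX : q n ^+ j @[n --> \oo] --> s ^+ j.
  elim: j => [|j ih]; first by under eq_cvg do rewrite expr0; rewrite expr0; exact: cvg_cst.
  by under eq_cvg do rewrite exprS; rewrite exprS; exact: cvgM.
apply: (ler_cvg_to (cvg_cst _) cX); near=> n.
have jn : (j <= n)%N by near: n; exists j.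
have X m l a : (m <= l)%N -> (forall i, (m <= i < l)%N -> a <= q i) -> 0 <= a ->
    a ^+ (l - m) <= \prod_(m <= i < l) q i.
  by move=> ml h a0; rewrite -prodr_const_nat !big_nat; apply: ler_prod => i hi; rewrite a0 h.
have Y m l a : (m <= l)%N -> (forall i, (m <= i < l)%N -> q i <= a) ->
    \prod_(m <= i < l) q i <= a ^+ (l - m).
  by move=> ml h; rewrite -prodr_const_nat !big_nat; apply: ler_prod => i hi; rewrite h// ltW.
have x1 := X j n (q n) jn (fun i hi => qd _ _ (ltnW (proj2 (andP hi)))) (ltW (q_gt0 n)).
have nn : (n <= n * 2)%N by rewrite leq_pmulr.
have y1 := Y n (n * 2)%N (q n) nn (fun i hi => qd _ _ (proj1 (andP hi))).
have e1 : \prod_(0 <= i < n * 2) q i = \prod_(0 <= i < n) q i * \prod_(n <= i < n * 2) q i.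
  by rewrite (big_cat_nat (n := n)).
have e2 : \prod_(0 <= i < n) q i = \prod_(0 <= i < j) q i * \prod_(j <= i < n) q i.
  by rewrite (big_cat_nat (n := j)).
have := qk n; rewrite e1 expr2 mulrCA ler_pM2l// e2 mulrA => h.
have E : (n * 2 - n = (n - j) + j)%N by rewrite subnK// muln2 -addnn addnK.
rewrite -(ler_pM2r (exprn_gt0 (n - j) (q_gt0 n))) [leRHS]mulrC -exprD -E.
apply: le_trans y1; apply: le_trans h; rewrite ler_wpM2l// mulr_ge0 ?(ltW k_gt0)// ltW//.
Unshelve. all: by end_near.
Qed.

(** The product is at least s^n (1 + (e/s)(1 + 1/2 + ... + 1/n)); if e were positive, the bound
    s^n/k would make the harmonic series converge. *)
Lemma prod_pow_excess_eq0 (e : R) : 0 < s -> 0 <= e ->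
  (forall i, s + e / i.+1%:R <= q i) ->
  (forall j, k * \prod_(0 <= i < j) q i <= s ^+ j) -> e = 0.
Proof.
move=> s0 e0 qe qk; apply/eqP; rewrite eq_le e0 andbT leNgt; apply/negP => ep.
have d0 : 0 < e / s by rewrite divr_gt0.
have H n : s ^+ n * (1 + e / s * series (@harmonic R) n) <= \prod_(0 <= i < n) q i.
  elim: n => [|n ih]; first by rewrite big_geq// /series/= big_geq// mulr0 addr0 expr0 mulr1.
  have h0 : 0 <= series (@harmonic R) n by rewrite /series/= sumr_ge0// => i _; exact: harmonic_ge0.
  rewrite big_nat_recr//=; apply: le_trans (ler_pM _ _ ih (qe n)).
  - have -> : series (@harmonic R) n.+1 = series (@harmonic R) n + harmonic n by rewrite /series/= big_nat_recr.
    move: h0; set S := series _ n => h0.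
    have -> : s + e / n.+1%:R = s * (1 + e / s * harmonic n).
      by rewrite mulrDr mulr1 mulrA [s * _]mulrC divfK ?gt_eqF.
    rewrite exprSr -!mulrA; apply: ler_wpM2l; first by rewrite exprn_ge0// ltW.
    rewrite [leRHS]mulrCA; apply: ler_wpM2l; first exact: ltW.
    have a0 : 0 <= e / s * S by rewrite mulr_ge0// ltW.
    have b0 : 0 <= e / s * harmonic n by rewrite mulr_ge0 ?harmonic_ge0// ltW.
    by rewrite mulrDr; nra.
  - by rewrite mulr_ge0 ?exprn_ge0 ?(ltW s0)// addr_ge0// mulr_ge0// ltW.
  - by rewrite addr_ge0 ?(ltW s0)// divr_ge0.
apply: (@dvg_harmonic R); apply: nondecreasing_is_cvgn.
  by apply: nondecreasing_series => i _ _; exact: harmonic_ge0.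
exists (k^-1 / (e / s)) => _ [n _ <-].
have h := le_trans (ler_wpM2l (ltW k_gt0) (H n)) (qk n).
have sn := exprn_gt0 n s0.
have h1 : k * (1 + e / s * series (@harmonic R) n) <= 1.
  by rewrite -(ler_pM2l sn) mulr1 mulrCA.
rewrite ler_pdivlMr// -(ler_pM2l k_gt0) mulfV ?gt_eqF//; apply: le_trans h1.
by rewrite mulrDr mulr1 [e / s * _]mulrC lerDr ltW.
Qed.

End product_growth.

(** * The ratio phi(n)/n and quadratic exponents *)

Section exponent_ratio.
Context {R : realType} (c : triplet R) (adm : admissible c).
Local Notation D := (`]0%R, +oo[%classic : set (measurableTypeR R)).

Let mD : measurable D. Proof. exact: measurable_itv. Qed.

(** [expc2 u y / u^2] is nonincreasing in u, so its value at u = 1 dominates; it is also at most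
    y/u, which tends to 0. *)
Lemma cvg_phiR_div : phiR c n.+1%:R / n.+1%:R @[n --> \oo] --> sigma c ^+ 2.
Proof.
have n0 n : 0 < n.+1%:R :> R by rewrite ltr0n.
have ch : n.+1%:R^-1 @[n --> \oo] --> (0 : R) by exact: cvg_harmonic.
have c0 (a : R) : a / n.+1%:R @[n --> \oo] --> (0 : R).
  by rewrite -(mulr0 a); apply: cvgM; [exact: cvg_cst|exact: ch].
have [_ ci] : (levy c).-integrable D (EFin \o (fun=> 0 : R)) /\
    \int[levy c]_(y in D) (expc2 n.+1%:R y / n.+1%:R ^+ 2) @[n --> \oo] --> \int[levy c]_(y in D) (0 : R).
  apply: (@Rintegral_dominated_cvg _ _ _ (levy c) D mD _ _ (expc2 1)).
  - by move=> n; apply: measurable_funTS; apply: measurable_funM => //; exact: measurable_expc2.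
  - exact: expc2_integrable.
  - move=> n y /pos_half_lineP y0; rewrite ger0_norm ?divr_ge0 ?expc2_ge0 ?sqr_ge0//.
    by have := expc2_div2_homo ltr01 (_ : 1 <= n.+1%:R) (ltW y0); rewrite expr1n divr1 ler1n; apply.
  - move=> y /pos_half_lineP y0; apply: (@squeeze_cvgn _ (fun=> 0) _ (fun n => y / n.+1%:R)); [|exact: cvg_cst|exact: c0].
    move=> n; rewrite divr_ge0 ?expc2_ge0 ?sqr_ge0//= ler_pdivrMr ?exprn_gt0//.
    have -> : y / n.+1%:R * n.+1%:R ^+ 2 = n.+1%:R * y by field; rewrite ?natr1 ?nat1r pnatr_eq0.
    by apply: expc2_le_id; exact: ltW.
move: ci; rewrite Rintegral_cst// mul0r => ci.
have H : sigma c ^+ 2 + drift c / n.+1%:R + \int[levy c]_(y in D) (expc2 n.+1%:R y / n.+1%:R ^+ 2) @[n --> \oo] --> sigma c ^+ 2 + 0 + 0.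
  exact: (cvgD (cvgD (cvg_cst _) (c0 _)) ci).
rewrite !addr0 in H; under eq_cvg do rewrite (phiR_div_integral adm (n0 _)).
exact: H.
Qed.

(** phi(u) - sigma^2 u is the drift plus the Levy integral of [expc2 u y / u], hence
    nondecreasing. *)
Lemma phiR_div_ge n : sigma c ^+ 2 + (phiR c 1 - sigma c ^+ 2) / n.+1%:R <= phiR c n.+1%:R / n.+1%:R.
Proof.
have n0 : 0 < n.+1%:R :> R by rewrite ltr0n.
have di u : 0 < u -> (levy c).-integrable D (EFin \o (fun y => expc2 u y / u)).
  move=> u0; have := integrable_scale mD u^-1 (expc2_integrable adm (ltW u0)).
  by congr (integrable _ _ (EFin \o _)); apply/funext => y; rewrite mulrC.
have le : \int[levy c]_(y in D) (expc2 1 y / 1) <= \int[levy c]_(y in D) (expc2 n.+1%:R y / n.+1%:R).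
  apply: le_Rintegral => //; [exact: di|exact: di|].
  by move=> y /pos_half_lineP y0; apply: expc2_div_homo; rewrite ?ler1n// ltW.
rewrite !phiR_integral// mulr1 ler_pdivlMr// mulrDl divfK ?gt_eqF//; lra.
Qed.

Local Open Scope complex_scope.

(** phi(1) is sigma^2 plus the drift plus the integral of [expc2 1]; equality with sigma^2 forces
    both nonnegative terms to vanish, and the Levy measure with the second. *)
Lemma psi_quadratic (z : R[i]) : phiR c 1 = sigma c ^+ 2 -> 0 <= complex.Re z ->
  psi c z = (sigma c ^+ 2)%:C * z ^+ 2.
Proof.
move=> f1; case: z => a b /= a0.
have i1 : \int[levy c]_(y in D) (expc2 1 y / 1) = \int[levy c]_(y in D) expc2 1 y.
  by apply: eq_Rintegral => y _; rewrite divr1.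
have i0 : 0 <= \int[levy c]_(y in D) expc2 1 y by apply: Rintegral_ge0 => y _; exact: expc2_ge0.
have [_ d0 _ _ _] := adm.
move: f1; rewrite phiR_integral// i1 mulr1 => f1.
have dz : drift c = 0 by lra.
have Dz : levy c D = 0%E by apply: (levy_null adm ltr01); lra.
have Z f : (levy c).-integrable D (EFin \o f) -> \int[levy c]_(y in D) f y = 0.
  by move=> fi; rewrite /Rintegral (null_set_integral mD (measurable_int _ fi) Dz).
rewrite psiE dz (Z _ (re_expc2_integrable adm b a0)) (Z _ (im_expc2_integrable adm b a0)).
by rewrite expr2; simpc; congr (_ +i* _); ring.
Qed.

Lemma phiR_quadratic (u : R) : (forall z, 0 <= complex.Re z -> psi c z = (sigma c ^+ 2)%:C * z ^+ 2) ->
  0 < u -> phiR c u = sigma c ^+ 2 * u.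
Proof.
move=> h u0; have := h u%:C (ltW u0); rewrite psi_real -rmorphXn -rmorphM => /complexI E.
by rewrite phiRE ?gt_eqF// E; field; rewrite gt_eqF.
Qed.

End exponent_ratio.

(** * The lower bound and the quadratic case *)

Section lower_bound.
Context {R : realType} (c : triplet R) (adm : admissible c).
Context (nu mu : probability (measurableTypeR R) R).
Local Notation D := (`]0%R, +oo[%classic : set (measurableTypeR R)).
Local Notation eps := (epsilon_law R).
Local Notation I := (mixture mu).
Hypotheses (nu_pos : nu D = 1%E) (mu_pos : mu D = 1%E).
Hypothesis mu_mom : forall n,
  (\int[mu]_x (`|x| ^+ n)%:E = (n`!%:R / \prod_(1 <= i < n.+1) phiR c i%:R)%:E)%E.
Hypothesis nu_mom : forall n,
  (\int[nu]_x (`|x| ^+ n)%:E = (\prod_(1 <= i < n.+1) phiR c i%:R)%:E)%E.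

Let q i : R := phiR c i.+1%:R / i.+1%:R.

Let q0 i : 0 < q i.
Proof. by rewrite divr_gt0 ?ltr0n// phiR_gt0// ltr0n. Qed.

Let prodE n : \prod_(1 <= i < n.+1) phiR c i%:R = n`!%:R * \prod_(0 <= i < n) q i.
Proof.
rewrite big_add1 /=; elim: n => [|n ih]; first by rewrite !big_geq// fact0 mulr1.
rewrite !big_nat_recr//= ih factS natrM /q.
by field; rewrite ?natr1 ?nat1r pnatr_eq0.
Qed.

Let fact_pos n : 0 < n`!%:R :> R. Proof. by rewrite ltr0n fact_gt0. Qed.

Let prod_pos n : 0 < \prod_(0 <= i < n) q i. Proof. by rewrite prodr_gt0. Qed.

Let monomial_norm (p : probability (measurableTypeR R) R) n :
  (\int[p]_x ((x ^+ n) ^+ 2)%:E = \int[p]_x (`|x| ^+ (n * 2))%:E)%E.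
Proof. by apply: eq_integral => x _; rewrite -exprM -normrX ger0_norm// exprM sqr_ge0. Qed.

(* On f = x^n the bound reads C^2 (q_0 .. q_(n-1))^2 <= q_0 .. q_(2n-1), where q_i = phi(i + 1)/(i + 1)
   decreases to sigma^2; but q_i >= sigma^2 + (phi(1) - sigma^2)/(i + 1), and the harmonic series diverges. *)
Lemma lower_bound_quadratic (C : R) : 0 < C ->
  (forall f, f \in L2 eps -> (C%:E * L2norm eps f <= L2norm nu (I f))%E) ->
  0 < sigma c ^+ 2 /\ phiR c 1 = sigma c ^+ 2.
Proof.
move=> C0 h.
have qk n : C ^+ 2 * (\prod_(0 <= i < n) q i) ^+ 2 <= \prod_(0 <= i < n * 2) q i.
  have mX k : measurable_fun setT (fun x : measurableTypeR R => k * x ^+ n) by exact: measurable_funM.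
  have := h _ (monomial_L2_epsilon n).
  rewrite -L2norm_scale ?(ltW C0)//.
  pose m := n`!%:R / \prod_(1 <= i < n.+1) phiR c i%:R.
  have -> : I (fun x => x ^+ n) = (fun x => m * x ^+ n).
    by apply/funext => x; rewrite (mixture_monomial mu_pos mu_mom) mulrC.
  rewrite L2norm_le.
  have E (p : probability (measurableTypeR R) R) (a : R) : (\int[p]_x ((a * x ^+ n) ^+ 2)%:E = (a ^+ 2)%:E * \int[p]_x (`|x| ^+ (n * 2))%:E)%E.
    have m2 : measurable_fun setT (fun x : measurableTypeR R => ((x ^+ n) ^+ 2)%:E).
      by apply/measurable_EFinP; apply: measurable_funX; exact: measurable_funX.
    have p2 x : (0 <= ((x ^+ n) ^+ 2)%:E :> \bar R)%E by rewrite lee_fin sqr_ge0.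
    have a2 : (0 <= (a ^+ 2)%:E :> \bar R)%E by rewrite lee_fin sqr_ge0.
    rewrite -monomial_norm -(ge0_integralZl p measurableT m2 (fun x _ => p2 x) a2).
    by apply: eq_integral => x _; rewrite exprMn EFinM.
  rewrite !E epsilon_moment nu_mom -!EFinM lee_fin prodE /m prodE.
  have P := prod_pos n; have F := fact_pos n; have F2 := fact_pos (n * 2)%N.
  have -> : n`!%:R / (n`!%:R * \prod_(0 <= i < n) q i) = (\prod_(0 <= i < n) q i)^-1.
    by field; rewrite !gt_eqF.
  move: P F2; set p := \prod_(0 <= i < n) q i; set p2 := \prod_(0 <= i < n * 2) q i.
  set F2 := (n * 2)`!%:R => P F2_gt0 le.
  rewrite -(ler_pM2r F2_gt0) mulrAC -ler_pdivlMr ?exprn_gt0//; apply: (le_trans le).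
  by rewrite le_eqVlt; apply/orP; left; apply/eqP; field; rewrite gt_eqF.
have k0 := exprn_gt0 2 C0.
have qd m n : (m <= n)%N -> q n <= q m.
  by move=> mn; apply: phiR_div_homo; rewrite ?ltr0n// ler_nat.
have qs j := @prod_le_lim_pow _ q (C ^+ 2) (sigma c ^+ 2) q0 k0 j qd qk (cvg_phiR_div adm).
have s0 : 0 < sigma c ^+ 2.
  by have := qs 1%N; rewrite big_nat1 expr1; apply: lt_le_trans; rewrite mulr_gt0.
split => //; apply/eqP; rewrite -subr_eq0; apply/eqP.
have q_ge i : sigma c ^+ 2 + (phiR c 1 - sigma c ^+ 2) / i.+1%:R <= q i by exact: phiR_div_ge.
apply: (prod_pow_excess_eq0 k0 s0 _ q_ge qs).
rewrite phiR_integral// mulr1 -addrA addrC addrA subrK.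
rewrite addr_ge0//; last by have [] := adm.
by apply: Rintegral_ge0 => y _; rewrite divr1 expc2_ge0.
Qed.

(** For phi(u) = sigma^2 u the moments of X are the powers of s = 1/sigma^2, so X has variance 0 and
    equals s. The operator is a dilation, and the factorization of [eps] makes it isometric. *)
Lemma quadratic_lower_bound f : 0 < sigma c ^+ 2 ->
  (forall u, 0 < u -> phiR c u = sigma c ^+ 2 * u) ->
  f \in L2 eps -> (L2norm eps f <= L2norm nu (I f))%E.
Proof.
move=> s0 hq hf; have mf := L2_measurable hf; pose s := (sigma c ^+ 2)^-1.
have sp : 0 < s by rewrite invr_gt0.
have qE i : q i = sigma c ^+ 2 by rewrite /q hq ?ltr0n//; field; rewrite ?natr1 ?nat1r pnatr_eq0.
have mom n : (\int[mu]_x (`|x| ^+ n)%:E = (s ^+ n)%:E)%E.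
  rewrite mu_mom prodE; congr (_%:E); under eq_bigr do rewrite qE.
  rewrite prodr_const_nat subn0 /s exprVn; field.
  by rewrite !gt_eqF// exprn_gt0.
have i n : mu.-integrable setT (EFin \o (fun y : R => `|y| ^+ n)).
  apply/integrableP; split.
    by apply/measurable_EFinP; apply: measurable_funX; exact: normr_measurable.
  by under eq_integral do rewrite gee0_abs ?lee_fin ?exprn_ge0//; rewrite mom ltry.
have var : (\int[mu]_y ((`|y| - s) ^+ 2)%:E = 0)%E.
  transitivity (\int[mu]_y ((`|y| ^+ 2)%:E + ((- (2 * s) * `|y| ^+ 1)%:E + (s ^+ 2 * `|y| ^+ 0)%:E)))%E.
    by apply: eq_integral => y _; rewrite -!EFinD; congr (_%:E); ring.
  have j k n := integrable_scale measurableT k (i n).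
  have jj : mu.-integrable setT (fun y : R => ((- (2 * s) * `|y| ^+ 1)%:E + (s ^+ 2 * `|y| ^+ 0)%:E)%E).
    exact: integrableD (j _ _) (j _ _).
  rewrite (integralD measurableT (i 2) jj) (integralD measurableT (j _ 1%N) (j _ 0%N)).
  have Z k n : (\int[mu]_y (k * `|y| ^+ n)%:E = (k * s ^+ n)%:E)%E.
    under eq_integral do rewrite EFinM.
    by rewrite (integralZl measurableT (i n)) mom EFinM.
  rewrite !Z mom -!EFinD; congr (_%:E); ring.
have ys : {ae mu, forall y, y = s}.
  have m1 : measurable_fun setT (fun y : measurableTypeR R => `|y| - s).
    by apply: measurable_funB => //; exact: normr_measurable.
  have n0 : L2norm mu (fun y => `|y| - s) = 0%E.
    apply: L2norm_small_eq0 => e e0; rewrite L2norm_lt// var lte_fin exprn_gt0//.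
  apply: ae_mono2 (L2norm_eq0 m1 n0) (positive_ae mu_pos) => y /eqP.
  by rewrite subr_eq0 => /eqP + y0; rewrite gtr0_norm.
have D1 (g : R -> R) x : measurable_fun setT (g : measurableTypeR R -> R) ->
    (\int[mu]_y (g (x * y))%:E = (g (x * s))%:E)%E.
  move=> mg; transitivity (\int[mu]_y (g (x * s))%:E)%E.
    apply: ae_eq_integral => //.
    - by apply/measurable_EFinP; exact: measurable_mul_slice.
    - by apply: ae_mono ys => y -> _.
  transitivity ((g (x * s))%:E * mu setT)%E; first exact: integral_cst.
  by rewrite [X in (_ * X)%E](_ : _ = 1%E) ?mule1//; exact: probability_setT.
have mf2 : measurable_fun setT (fun x : measurableTypeR R => f x ^+ 2) by exact: measurable_funX.
rewrite L2norm_le (law_factorization adm nu_pos mu_pos mu_mom nu_mom mf2); last by move=> x; exact: sqr_ge0.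
rewrite le_eqVlt; apply/orP; left; apply/eqP; apply: eq_integral => x _.
by rewrite (D1 (fun x => f x ^+ 2))// /mixture /Rintegral (D1 f).
Qed.

End lower_bound.

(** * The operator expressed through the random variable *)

Section multiplicative_operator.
Context {R : realType} d (Omega : measurableType d) (Pr : probability Omega R).
Context (X : Omega -> \bar R) (mu : probability (measurableTypeR R) R).
Local Notation D := (`]0%R, +oo[%classic : set (measurableTypeR R)).
Hypotheses (mX : measurable_fun setT X) (X_ge0 : forall w, (0 <= X w)%E).
Hypothesis muE : forall A, mu A = Pr ((fun w => fine (X w)) @^-1` A).
Hypothesis mu_pos : mu D = 1%E.
Hypothesis mu_inv_sqrt : mu.-integrable setT (EFin \o inv_sqrt).
Local Notation I := (mult_op Pr X).
Implicit Types (f g : R -> R) (x : R).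

Let mfX : measurable_fun setT (fun w => fine (X w) : measurableTypeR R).
Proof. exact: measurableT_comp. Qed.

Lemma mult_op_mixture f : measurable_fun setT (f : measurableTypeR R -> R) -> I f = mixture mu f.
Proof.
move=> mf; apply/funext => x; rewrite /mixture.
by rewrite (Rintegral_image_law mfX muE (measurable_mul_slice x mf)).
Qed.

Lemma mult_op_even f x : C0 f -> 0 <= x -> I f x = mixture mu (fun y => f `|y|) x.
Proof.
move=> hf x0; rewrite -mult_op_mixture; last exact: measurable_C0_even.
by apply: eq_Rintegral => w _; rewrite ger0_norm// mulr_ge0// fine_ge0.
Qed.

Lemma mult_op_C0 : C0_bounded_operator I.
Proof.
have b f : C0 f -> exists M, forall x, `|f `|x| | <= M.
  by move=> /C0_bounded[M hM]; exists M; exact: C0_even_bound.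
split.
- by move=> f hf; apply: C0_ext (mixture_C0 mu_pos mu_inv_sqrt hf) _ => x x0; rewrite mult_op_even.
- move=> a f g hf hg x x0; rewrite !mult_op_even//; last exact: C0_lin.
  have [M fM] := b f hf; have [N gN] := b g hg.
  have i1 := bounded_integrable mu (measurable_mul_slice x (measurable_C0_even hf)) (fun y => fM (x * y)).
  have i2 := bounded_integrable mu (measurable_mul_slice x (measurable_C0_even hg)) (fun y => gN (x * y)).
  have j1 := integrable_scale measurableT a i1.
  by rewrite /mixture (RintegralD measurableT j1 i2); congr (_ + _); exact: RintegralZl.
- exists 1 => f hf; rewrite mul1r; apply: C0norm_le => x x0; rewrite mult_op_even//.
  apply: Rintegral_le_bound; first exact: measurable_mul_slice (measurable_C0_even hf).
  by move=> y; exact: C0norm_ge.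
Qed.

Lemma mult_op_markov : markov_operator I.
Proof.
split.
- move=> f [mf [M fM]]; rewrite mult_op_mixture//; split; first exact: measurable_mixture.
  by exists M => x; apply: Rintegral_le_bound; [exact: measurable_mul_slice|move=> y; exact: fM].
- move=> a f g [mf [M fM]] [mg [N gN]] x x0.
  rewrite !mult_op_mixture//; last by apply: measurable_funD => //; exact: measurable_funM.
  have i1 := bounded_integrable mu (measurable_mul_slice x mf) (fun y => fM (x * y)).
  have i2 := bounded_integrable mu (measurable_mul_slice x mg) (fun y => gN (x * y)).
  have j1 := integrable_scale measurableT a i1.
  by rewrite /mixture (RintegralD measurableT j1 i2); congr (_ + _); exact: RintegralZl.
- move=> f bf f0 x x0; apply: Rintegral_ge0 => w _; apply: f0.
  by rewrite mulr_ge0// fine_ge0.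
- move=> x x0; rewrite mult_op_mixture; last exact: measurable_cst.
  exact: Rintegral_prob_cst.
Qed.

End multiplicative_operator.

Section mellin_transform.
Context {R : realType} (c : triplet R) (adm : admissible c).
Context d (Omega : measurableType d) (Pr : probability Omega R).
Context (X : Omega -> \bar R) (mu : probability (measurableTypeR R) R).
Local Notation D := (`]0%R, +oo[%classic : set (measurableTypeR R)).
Hypothesis mX : measurable_fun setT X.
Hypothesis muE : forall A, mu A = Pr ((fun w => fine (X w)) @^-1` A).
Hypothesis mu_pos : mu D = 1%E.
Hypothesis mu_mom : forall n,
  (\int[mu]_x (`|x| ^+ n)%:E = (n`!%:R / \prod_(1 <= i < n.+1) phiR c i%:R)%:E)%E.
Local Open Scope complex_scope.

Let mfX : measurable_fun setT (fun w => fine (X w) : measurableTypeR R).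
Proof. exact: measurableT_comp. Qed.

Let positive_integrable (f g : R -> R) : measurable_fun setT (g : measurableTypeR R -> R) ->
  (forall y, 0 < y -> f y = g y) -> mu.-integrable setT (EFin \o f) -> mu.-integrable setT (EFin \o g).
Proof.
move=> mg fg i; apply/integrableP; split; first exact/measurable_EFinP.
have /integrableP[mf h] := i; apply: le_lt_trans h; rewrite le_eqVlt; apply/orP; left; apply/eqP.
apply: ae_eq_integral => //.
- by apply: measurableT_comp => //; exact/measurable_EFinP.
- exact: measurableT_comp.
- by apply: ae_mono (positive_ae mu_pos) => y y0 _ /=; rewrite fg.
Qed.

(** x^z factors out of E (xX)^z because X > 0 almost surely, and [W_phi_mellin] at z + 1 identifies
    E X^z. *)
Lemma mult_op_power (z : R[i]) (x : R) : -1 < complex.Re z -> 0 < x ->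
  integrableC Pr setT (fun w => cpow (x * fine (X w)) z) /\
  mult_opC Pr X (cpow ^~ z) x = GammaC (z + 1) / W_phi c (z + 1) * cpow x z.
Proof.
move=> z1 x0; have iz := mellin_integrable adm mu_pos mu_mom z1.
have [i1 i2] := iz.
have mRe : measurable_fun setT (fun y : measurableTypeR R => complex.Re (cpow y z)).
  by apply/measurable_EFinP; exact: measurable_int i1.
have mIm : measurable_fun setT (fun y : measurableTypeR R => complex.Im (cpow y z)).
  by apply/measurable_EFinP; exact: measurable_int i2.
have mRx := measurable_mul_slice x mRe; have mIx := measurable_mul_slice x mIm.
pose a := complex.Re (cpow x z); pose b := complex.Im (cpow x z).
have ReM y : complex.Re (cpow x z * cpow y z) = a * complex.Re (cpow y z) + - b * complex.Im (cpow y z).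
  by rewrite /a /b; case: (cpow x z) (cpow y z) => [? ?] [? ?] /=; rewrite mulNr.
have ImM y : complex.Im (cpow x z * cpow y z) = b * complex.Re (cpow y z) + a * complex.Im (cpow y z).
  by rewrite /a /b; case: (cpow x z) (cpow y z) => [? ?] [? ?] /=; rewrite addrC.
have ReE y : 0 < y -> a * complex.Re (cpow y z) + - b * complex.Im (cpow y z) = complex.Re (cpow (x * y) z).
  by move=> y0; rewrite cpowM// ReM.
have ImE y : 0 < y -> b * complex.Re (cpow y z) + a * complex.Im (cpow y z) = complex.Im (cpow (x * y) z).
  by move=> y0; rewrite cpowM// ImM.
have lin k l : mu.-integrable setT (EFin \o (fun y => k * complex.Re (cpow y z) + l * complex.Im (cpow y z))).
  exact: integrableD (integrable_scale measurableT k i1) (integrable_scale measurableT l i2).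
have jR := positive_integrable mRx ReE (lin a (- b)).
have jI := positive_integrable mIx ImE (lin b a).
split.
  split.
  - exact: (proj1 (integrable_image_law mfX muE mRx) jR).
  - exact: (proj1 (integrable_image_law mfX muE mIx) jI).
have w0 : 0 < complex.Re (z + 1) by move: z1; case: z {iz i1 i2 mRe mIm mRx mIx a b ReM ImM ReE ImE lin jR jI} => p q /=; lra.
have [G0 ->] := W_phi_mellin adm mu_pos mu_mom w0.
rewrite addrK invf_div mulrCA divff// mulr1 mulrC /mellin (integralC_scale _ iz).
rewrite /mult_opC /integralC -(Rintegral_image_law mfX muE mRx) -(Rintegral_image_law mfX muE mIx).
have m k l : measurable_fun setT (fun y : measurableTypeR R => k * complex.Re (cpow y z) + l * complex.Im (cpow y z)).
  by apply: measurable_funD; exact: measurable_funM.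
congr (_ +i* _); apply: (positive_ext mu_pos) => //.
- by under eq_fun do rewrite ReM; exact: m.
- by move=> y y0; rewrite cpowM.
- by under eq_fun do rewrite ImM; exact: m.
- by move=> y y0; rewrite cpowM.
Qed.

End mellin_transform.

(** * Uniqueness of the law of X, moments of the invariant law, conclusion *)

Section main_facts.
Context {R : realType} (c : triplet R) (adm : admissible c).
Local Notation D := (`]0%R, +oo[%classic : set (measurableTypeR R)).

(** Only the moments of the competitor [m] are known, so its exponential integrability is drawn from
    the even ones. *)
Lemma moment_law_unique (mu m : probability (measurableTypeR R) R) : mu D = 1%E ->
  (forall n, (\int[mu]_x (`|x| ^+ n)%:E = (n`!%:R / \prod_(1 <= i < n.+1) phiR c i%:R)%:E)%E) ->
  (forall n, (\int[m]_x (x ^+ n)%:E = (n`!%:R / \prod_(1 <= i < n.+1) phiR c i%:R)%:E)%E) ->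
  forall A, measurable A -> m A = mu A.
Proof.
move=> mu_pos mu_mom m_mom A mA.
have p1 : 0 < phiR c 1 by exact: phiR_gt0.
apply: (@moments_determine _ m mu (phiR c 1 / 2)) => //.
- by rewrite divr_gt0.
- by apply: (exp_integrable_even adm) => n _; exact: m_mom.
- exact: exp_integrable mu_mom.
- move=> n; rewrite [in LHS]/Rintegral m_mom -(abs_moment mu_mom).
  apply: (positive_ext mu_pos); first by apply: measurable_funX; exact: normr_measurable.
    exact: measurable_funX.
  by move=> x x0; rewrite gtr0_norm.
Qed.

(** The density lives on a subset of ]0, +oo[, which therefore has full mass, and [W_phi_nat] turns
    the moments W_phi(n + 1) into products of phi. *)
Lemma invariant_law_facts (P : R -> (R -> R) -> R -> R) (nu mu : probability (measurableTypeR R) R) :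
  mu D = 1%E ->
  (forall n, (\int[mu]_x (`|x| ^+ n)%:E = (n`!%:R / \prod_(1 <= i < n.+1) phiR c i%:R)%:E)%E) ->
  invariant_law c P nu -> nu D = 1%E /\
  forall n, (\int[nu]_x (`|x| ^+ n)%:E = (\prod_(1 <= i < n.+1) phiR c i%:R)%:E)%E.
Proof.
move=> mu_pos mu_mom [[w [_ _ dens]] _ mom].
have mD : measurable D by exact: measurable_itv.
have nu_pos : nu D = 1%E.
  have N0 : nu (~` D) = 0%E.
    rewrite dens; last exact: measurableC.
    rewrite (_ : _ `&` _ = set0) ?integral_set0//; apply/seteqP; split => // x [].
    by move=> /= nD [x0 _]; apply: nD; exact/pos_half_lineP.
  have := @probability_setC _ _ _ nu _ (measurableC mD).
  by rewrite setCK N0 sube0.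
split=> // n; have [i e] := mom n.
have -> : (\int[nu]_x (`|x| ^+ n)%:E = \int[nu]_x (x ^+ n)%:E)%E.
  apply: ae_eq_integral => //.
  - by apply/measurable_EFinP; apply: measurable_funX; exact: normr_measurable.
  - by apply/measurable_EFinP; exact: measurable_funX.
  - by apply: ae_mono (positive_ae nu_pos) => x x0 _; rewrite gtr0_norm.
move: e; rewrite (W_phi_nat adm mu_pos mu_mom) => /complexI e.
rewrite -[LHS]fineK; last exact: integrable_fin_num.
by congr (_%:E); exact: e.
Qed.

End main_facts.

Local Open Scope complex_scope.

Theorem theorem7p1 (R : realType) (c : triplet R) (hc : in_N c)
    (P : R -> (R -> R) -> (R -> R)) (hP : generalized_laguerre c P)
    (nu : probability (measurableTypeR R) R) (hnu : invariant_law c P nu)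
    (P2 : R -> (R -> R) -> (R -> R)) (hP2 : L2_contraction_extension nu P P2)
    (Q : R -> (R -> R) -> (R -> R))
    (hQ : generalized_laguerre classical_triplet Q)
    (Q2 : R -> (R -> R) -> (R -> R))
    (hQ2 : L2_contraction_extension (epsilon_law R) Q Q2)
    (d : measure_display) (Omega : measurableType d) (Pr : probability Omega R)
    (eta : R -> Omega -> \bar R) (heta : killed_subordinator Pr (phiR c) eta) :
  let eps := epsilon_law R in
  let X := exp_functional eta in
  let I := mult_op Pr X in
  (forall t f, 0 <= t -> f \in L2 eps ->
     P2 t (I f) = I (Q2 t f) %[ae nu]) /\
  (* (1) *)
  [/\ forall f, f \in L2 eps ->
        \forall x \ae nu, Pr.-integrable setT (fun w => (f (x * fine (X w)))%:E),
      L2_bounded_operator eps nu I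
    & C0_bounded_operator I] /\
  (* (2) *)
  (forall g (e : R), g \in L2 nu -> 0 < e ->
     exists2 f, f \in L2 eps & (L2norm nu (fun x => (I f x - g x)%R) < e%:E)%E) /\
  ((exists2 C : R, 0 < C & forall f, f \in L2 eps ->
      (C%:E * L2norm eps f <= L2norm nu (I f))%E) <->
   (0 < sigma c ^+ 2 /\
    forall z : R[i], 0 <= complex.Re z -> psi c z = (sigma c ^+ 2)%:C * z ^+ 2)) /\
  (* (3) *)
  markov_operator I /\ moment_determinate Pr X /\
  (forall (z : R[i]) (x : R), -1 < complex.Re z -> 0 < x ->
     integrableC Pr setT (fun w => cpow (x * fine (X w)) z) /\
     mult_opC Pr X (cpow ^~ z) x = GammaC (z + 1) / W_phi c (z + 1) * cpow x z).
Proof.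
move=> eps X I.
have adm := in_N_admissible hc.
have [mX X_ge0 X_mom _] := exp_functional_facts adm heta.
have [mu [muE mu_pos mu_mom]] := exp_functional_law adm heta.
have [nu_pos nu_mom] := invariant_law_facts adm mu_pos mu_mom hnu.
(* Needed for the operator to preserve the limit 0 at infinity. *)
have mu_inv_sqrt : mu.-integrable setT (EFin \o inv_sqrt).
  by apply: (pow_integrable adm mu_pos mu_mom); lra.
have factor := law_factorization adm nu_pos mu_pos mu_mom nu_mom.
have IE (f : R -> R) : f \in L2 eps -> I f = mixture mu f.
  by move=> hf; rewrite /I (mult_op_mixture mX muE (L2_measurable hf)).
have [[ML Mae Ml] Mc] := mixture_contraction adm nu_pos mu_pos mu_mom nu_mom.
split; [|split; [|split; [|split; [|split; [|split]]]]].
- move=> t f t0 hf; rewrite !IE//; first exact: (L2_intertwining adm nu_pos mu_pos mu_mom nu_mom hP hP2 hQ hQ2).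
  by have [[QL _ _] _ _] := hQ2 t t0; exact: QL.
- split.
  + move=> f hf; apply: ae_mono (mixture_ae_integrable factor hf) => x i.
    have mfX : measurable_fun setT (fun w => fine (X w) : measurableTypeR R) by exact: measurableT_comp.
    exact: (proj1 (integrable_image_law mfX muE (measurable_mul_slice x (L2_measurable hf))) i).
  + split; first split.
    * by move=> f hf; rewrite IE//; exact: ML.
    * by move=> f g hf hg fg; rewrite !IE//; exact: Mae.
    * by move=> a f g hf hg; rewrite !IE//; [exact: Ml|exact: L2_lin].
    * by exists 1 => f hf; rewrite mul1e IE//; exact: Mc.
  + exact: (mult_op_C0 mX X_ge0 muE mu_pos mu_inv_sqrt).
- move=> g e hg e0; have [f hf fg] := mixture_dense adm nu_pos mu_pos mu_mom nu_mom hg e0.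
  by exists f => //; rewrite IE.
- split=> [[C C0 h]|[s0 h]].
  + have hm f : f \in L2 eps -> (C%:E * L2norm eps f <= L2norm nu (mixture mu f))%E.
      by move=> hf; rewrite -IE//; exact: h.
    have [s0 f1] := lower_bound_quadratic adm mu_pos mu_mom nu_mom C0 hm.
    by split => // z z0; exact: psi_quadratic.
  (* The constant is 1, the operator being a norm-preserving dilation in the quadratic case. *)
  + exists 1 => // f hf; rewrite mul1e IE//.
    by apply: (quadratic_lower_bound adm nu_pos mu_pos mu_mom nu_mom s0) => // u u0; exact: phiR_quadratic.
- exact: (mult_op_markov mX X_ge0 muE).
- split => //; first by move=> n; rewrite X_mom ltry.
  move=> m hm A mA; rewrite (moment_law_unique adm mu_pos mu_mom _ mA) ?muE// => n.
  by have [_ ->] := hm n; exact: X_mom.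
- by move=> z x z1 x0; exact: (mult_op_power adm mX muE mu_pos mu_mom z1 x0).
Qed.
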